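(* Let $H$ be an $N\times N$ Wigner matrix, let $v\in\mathbb{C}^N$ be a fixed (deterministic) unit vector, let $T\ge 2$ be a fixed constant, and set $G_t := H + it\,vv^*$ and $t^* := t - 1/t$. For any $\varepsilon>0$, with high probability (with respect to the randomness of $H$), for all times $t\in(1+N^{-1/3+\varepsilon},\,T)$ the following holds: one eigenvalue of $G_t$ (the outlier) lies in the disk $D\!\left(it^*, \frac{N^{\varepsilon/4}}{\sqrt{N t^*}}\right)$, while all other eigenvalues $\lambda_j(t)$ of $G_t$ satisfy $\Im\lambda_j(t) < \frac{N^{\varepsilon}}{N (t^* )^2}$.
   Context: $D(w,r)$ denotes the open disk of center $w$ and radius $r$ in $\mathbb{C}$. A Wigner matrix is an $N\times N$ Hermitian random matrix $H=(h_{ij})$ whose entries $h_{ij}$, $i\le j$, are independent; the off-diagonal entries are identically distributed with a continuous distribution on $\mathbb{C}$ and the diagonal entries are identically distributed with a continuous distribution on $\mathbb{R}$; $\mathbb{E}h_{ij}=0$, $\mathbb{E}|h_{ij}|^2=1/N$, and $\mathbb{E}|\sqrt N h_{ij}|^p\le C_p$ for every $p$, with constants $C_p$ independent of $N$. A sequence of events $(A_N)_{N\ge1}$ holds with high probability if for every $D>0$, $\mathbb{P}(A_N^c)<N^{-D}$ for all sufficiently large $N$. *)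

(* Defs.v *)
From HB Require Import structures.
From mathcomp Require Import all_boot all_order all_algebra.
From mathcomp Require Import all_classical all_reals all_analysis.
From mathcomp Require Import complex.
Set Implicit Arguments. Unset Strict Implicit. Unset Printing Implicit Defensive.
Import Order.TTheory GRing.Theory Num.Theory.
Local Open Scope classical_set_scope.
Local Open Scope ring_scope.

Definition cRe {R : realType} (z : R[i]) : R := complex.Re z.
Definition cIm {R : realType} (z : R[i]) : R := complex.Im z.
Definition cconj {R : realType} (z : R[i]) : R[i] := complex.conjc z.
Definition cabs {R : realType} (z : R[i]) : R := Num.sqrt (cRe z ^+ 2 + cIm z ^+ 2).

(* C is identified with R * R (carrying its Borel = product sigma-algebra). *)
Definition c2pair {R : realType} (z : R[i]) : R * R := (cRe z, cIm z).

Section Wigner.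
Context {R : realType} {d : measure_display} {Om : measurableType d}.

Definition entry {N : nat} (H : Om -> 'M[R[i]]_N) (i j : 'I_N) : Om -> R * R :=
  fun w => c2pair (H w i j).

(* Wigner conditions at fixed size N, except the uniform moment bounds. *)
Definition wigner_at (P : probability Om R) (N : nat) (H : Om -> 'M[R[i]]_N) : Prop :=
  (forall w (i j : 'I_N), H w j i = cconj (H w i j)) /\
  (forall i j : 'I_N, measurable_fun setT (entry H i j)) /\
  (forall (S : {set 'I_N * 'I_N}) (B : 'I_N * 'I_N -> set (R * R)),
     (forall k, k \in S -> (k.1 <= k.2)%N) ->
     (forall k, measurable (B k)) ->
     P (\big[setI/setT]_(k in S) (entry H k.1 k.2 @^-1` B k)) =
     (\prod_(k in S) P (entry H k.1 k.2 @^-1` B k))%E) /\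
  (forall (i j k l : 'I_N) (B : set (R * R)), (i < j)%N -> (k < l)%N -> measurable B ->
     P (entry H i j @^-1` B) = P (entry H k l @^-1` B)) /\
  (forall (i k : 'I_N) (B : set (R * R)), measurable B ->
     P (entry H i i @^-1` B) = P (entry H k k @^-1` B)) /\
  (forall (i j : 'I_N) (z : R * R), (i <= j)%N -> P (entry H i j @^-1` [set z]) = 0%E) /\
  (forall i j : 'I_N, (\int[P]_w (cRe (H w i j))%:E = 0)%E /\
                      (\int[P]_w (cIm (H w i j))%:E = 0)%E) /\
  (forall i j : 'I_N, (\int[P]_w ((cabs (H w i j)) ^+ 2)%:E = (N%:R^-1)%:E)%E).

End Wigner.

Definition wigner_seq {R : realType} {d : nat -> measure_display}
  {Om : forall N, measurableType (d N)} (P : forall N, probability (Om N) R)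
  (H : forall N, Om N -> 'M[R[i]]_N) : Prop :=
  (forall N, wigner_at (P N) (H N)) /\
  exists C : nat -> R, forall (p N : nat) (i j : 'I_N),
    (\int[P N]_w ((Num.sqrt N%:R * cabs (H N w i j)) ^+ p)%:E <= (C p)%:E)%E.

Definition with_high_probability {R : realType} {d : nat -> measure_display}
  {Om : forall N, measurableType (d N)} (P : forall N, probability (Om N) R)
  (A : forall N, set (Om N)) : Prop :=
  forall D : R, 0 < D -> exists N0 : nat, forall N : nat, (N0 <= N)%N ->
    exists E : set (Om N), measurable E /\ E `<=` A N /\
      (P N (~` E) < (N%:R `^ (- D))%:E)%E.

Definition unit_vec {R : realType} {N : nat} (v : 'cV[R[i]]_N) : Prop :=
  \sum_(k < N) cabs (v k 0) ^+ 2 = 1.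

Definition vvstar {R : realType} {N : nat} (v : 'cV[R[i]]_N) : 'M[R[i]]_N :=
  v *m (map_mx cconj v)^T.

Definition Gt {R : realType} {N : nat} (H : 'M[R[i]]_N) (v : 'cV[R[i]]_N) (t : R)
  : 'M[R[i]]_N := H + ('i%C * t%:C%C) *: vvstar v.

Definition tstar {R : realType} (t : R) : R := t - t^-1.

Definition outlier_config {R : realType} {N : nat} (M : 'M[R[i]]_N) (c : R[i]) (r b : R)
  : Prop :=
  exists lam : 'I_N -> R[i],
    char_poly M = \prod_(j < N) ('X - (lam j)%:P) /\
    exists j0 : 'I_N, cabs (lam j0 - c) < r /\
      forall j : 'I_N, j != j0 -> cIm (lam j) < b.

(* Main.v *)
Require Import Defs.
From HB Require Import structures.
From mathcomp Require Import all_boot all_order all_algebra.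
From mathcomp Require Import all_classical all_reals all_analysis.
From mathcomp Require Import measurable_realfun.
From mathcomp Require Import complex.
From mathcomp Require Import zify ring lra.
Set Implicit Arguments. Unset Strict Implicit. Unset Printing Implicit Defensive.
Import Order.TTheory GRing.Theory Num.Theory.
Local Open Scope classical_set_scope.
Local Open Scope ring_scope.

(** Put $S(z)=v^{*}(H-z)^{-1}v$ ([form]). Since $G_t$ is a rank-one perturbation of $H$, every
    eigenvalue of $G_t$ in the open upper half-plane solves $S(z)=i/t$ ([det_rank_one],
    [root_form]). If $S$ is close to the Stieltjes transform $m(z)$ of the semicircle law, for which
    $z=-1/m-m$ ([spectral_point]), such an eigenvalue is close to $-1/(i/t)-i/t=it^*$. So two things
    are needed: a local law for $S$, and a count of the eigenvalues near $it^*$.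

    Local law at one point ([local_law_at]). Fix the target value $m$. The matrix is revealed row by
    row, so that its upper left minor grows from size $0$ to $N$, and meanwhile the spectral
    parameter moves along a discrete characteristic: $z_0=-1/m$ and $z_{k+1}=z_k-m_k/N$ with
    $m_k=-1/w_k$, $w_k=z_k+N^{-1}\mathrm{tr}\,G_k(z_k)$, where $G_k$ is the Green function of the
    minor. The Schur complement formula ([green_step]) shows that $w_k$ is conserved and that
    $v^{*}G_kv$ grows by $m_k|v_k|^2$, in both cases up to a martingale increment and a small error
    ([stage_trace_step], [stage_form_step]). Hence $w_k\approx -1/m$ and $m_k\approx m$, the flow
    ends near $z=-1/m-m$, and there $v^{*}Gv\approx m\sum_k|v_k|^2=m$. The increments are centred
    polynomials of degree two in the new row whose coefficients depend on earlier rows only. An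
    exponential supermartingale for truncated entries bounds their sums ([concentration],
    [row_concentration]), and Ward identities bound the coefficients in terms of the very quantities
    that are being controlled, so the estimate closes by induction on $k$ ([flow_inv_step]).

    A union bound over a polynomially fine grid of values $m$ and a Lipschitz estimate give the law
    at all admissible $m$ at once ([rare_not_local_law]). Too close to the real axis for the law to
    apply, $\Im S$ is bounded by going up vertically to the boundary of its domain
    ([form_Im_small]). Together they force every eigenvalue to have small imaginary part or to be
    very close to $it^*$ ([root_location]).

    Count. All eigenvalues $\lambda_j$ of $G_t$ lie in the closed upper half-plane, and
    $\prod_j|z-\lambda_j|/|z-\bar\lambda_j|=|1+itS(z)|/|1-itS(z)|$ ([blaschke]). The right-hand side
    is compared at two points slightly above $it^*$, the second about ten times farther from it than
    the first; the law says that it changes by a factor of about $10$. A factor of an eigenvalue far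
    from $it^*$ hardly changes, and that of a near one changes by about $10$, so exactly one is near
    ([count_near], [outlier_count]).

    The law involves only $H$ and $v$, so a single event serves all $t$. *)

(** * Independence of the past and of a new random variable *)

Section Freezing.
Context {R : realType} {d d' : measure_display} {Om : measurableType d}
  {S : measurableType d'}.
Variables (P : probability Om R) (G : set (set Om)) (h : Om -> S).
Hypothesis mG : G `<=` measurable.
Hypothesis GT : G setT.
Hypothesis GI : setI_closed G.
Hypothesis mh : measurable_fun setT h.
Hypothesis indep : forall A B, G A -> measurable B ->
  (P (A `&` h @^-1` B) = P A * P (h @^-1` B))%E.

(** The same sample space with the smaller sigma-algebra generated by [G]; being adapted is then
    plain measurability out of this type. *)
Let OmG : measurableType G.-sigma := g_sigma_algebraType G.
Local Notation idG := (idfun : Om -> OmG).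

Lemma measurable_g_sigma_algebra (A : set Om) : measurable (A : set OmG) -> measurable A.
Proof.
move=> mA; apply: (smallest_sub _ mG mA).
split; [exact: measurable0|by move=> B mB; exact: measurableD|].
by move=> F mF; exact: bigcup_measurable.
Qed.

Lemma measurable_id_g_sigma_algebra : measurable_fun setT idG.
Proof. by move=> _ A mA; rewrite setTI; exact: measurable_g_sigma_algebra. Qed.

(** As functions of [A], both sides are finite measures that agree on the pi-system [G], which
    contains the whole space; they therefore agree on the sigma-algebra it generates. *)
Lemma independent_g_sigma_algebra (A : set OmG) (B : set S) : measurable A ->
  measurable B -> (P (A `&` h @^-1` B) = P A * P (h @^-1` B))%E.
Proof.
move=> mA mB.
have mhB : measurable (h @^-1` B) by rewrite -[X in measurable X]setTI; exact: mh.
pose m1 := measure_function_pushforward__canonical__measure_function_Measure (mrestr P mhB) measurable_id_g_sigma_algebra.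
have r0 : (0 <= fine (P (h @^-1` B)))%R by exact: fine_ge0.
pose m2 : {measure set OmG -> \bar R} := mscale (NngNum r0) (measure_function_pushforward__canonical__measure_function_Measure P measurable_id_g_sigma_algebra).
have PB : P (h @^-1` B) = (fine (P (h @^-1` B)))%:E by rewrite fineK// fin_num_measure.
have := @measure_unique _ R OmG G (fun=> setT) (erefl _) GI (fun=> GT) _ m1 m2 _ _ A mA.
rewrite /m1 /m2 /= /mscale /mrestr /pushforward /= /preimage /= => H.
rewrite [LHS]H.
- by rewrite muleC PB.
- by apply/seteqP; split => // x _; exists 0%N.
- by move=> A' GA'; rewrite [LHS]indep// muleC PB.
- by move=> _; rewrite setTI; apply: (le_lt_trans (probability_le1 P mhB)); rewrite ltry.
Qed.

(** This takes the place of conditional expectation. Independence makes the joint law of the past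
    and [h] a product measure, and Tonelli's theorem integrates [h] out with the past frozen. *)
Lemma freezing (f : OmG * S -> \bar R) : measurable_fun setT f ->
  (forall x, 0 <= f x)%E ->
  (\int[P]_w f (w, h w) = \int[P]_w \int[P]_w' f (w, h w'))%E.
Proof.
move=> mf f0.
have mpair : measurable_fun setT (fun w => (idG w, h w)).
  exact: (measurable_fun_pair measurable_id_g_sigma_algebra mh).
pose HI := isMeasurableFun.Build _ _ _ _ idG measurable_id_g_sigma_algebra.
pose idM : {mfun Om >-> OmG} := HB.pack idG HI.
pose HH := isMeasurableFun.Build _ _ _ _ h mh.
pose hM : {mfun Om >-> S} := HB.pack h HH.
pose HP := isMeasurableFun.Build _ _ _ _ (fun w => (idG w, h w)) mpair.
pose pM : {mfun Om >-> (OmG * S)%type} := HB.pack (fun w => (idG w, h w)) HP.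
pose m1 := distribution P idM.
pose m2 := distribution P hM.
have E (X : set (OmG * S)) : measurable X -> (m1 \x m2)%E X = distribution P pM X.
  apply: product_measure_unique => A B mA mB.
  by rewrite /m1 /m2 /distribution /pushforward /= -[RHS]independent_g_sigma_algebra.
transitivity (\int[distribution P pM]_z f z)%E.
  by rewrite ge0_integral_pushforward// preimage_setT.
transitivity (\int[(m1 \x m2)%E]_z f z)%E.
  apply: eq_measure_integral => A mA _. exact: esym (E _ mA).
rewrite fubini_tonelli1// /fubini_F ge0_integral_pushforward//; last 2 first.
  exact: (measurable_fun_fubini_tonelli_F _ mf f0).
  by move=> y _; apply: integral_ge0 => *; exact: f0.
rewrite preimage_setT; apply: eq_integral => w _.
rewrite /= (@ge0_integral_pushforward _ _ _ _ _ _ mh P) ?preimage_setT//.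
exact: measurableT_comp.
Qed.

Lemma measurable_freezing (f : OmG * S -> \bar R) : measurable_fun setT f ->
  (forall x, 0 <= f x)%E ->
  measurable_fun setT (fun w : Om => \int[P]_w' f (w, h w'))%E.
Proof.
move=> mf f0.
pose HH := isMeasurableFun.Build _ _ _ _ h mh.
pose hM : {mfun Om >-> S} := HB.pack h HH.
have mF : measurable_fun setT (fubini_F (distribution P hM) f).
  exact: (measurable_fun_fubini_tonelli_F _ mf f0).
have E : fubini_F (distribution P hM) f = (fun w : Om => \int[P]_w' f (w, h w'))%E.
  apply/funext => w; rewrite /fubini_F.
  rewrite (@ge0_integral_pushforward _ _ _ _ _ _ mh P) ?preimage_setT//.
  exact: measurableT_comp.
by rewrite -E => _ B mB; apply: measurable_g_sigma_algebra; exact: mF.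
Qed.
End Freezing.

(** * Exponential moments and exponential supermartingales *)

Lemma expR_le_quadratic (R : realType) (x : R) : x <= 1 / 2 -> expR x <= 1 + x + 2 * x ^+ 2.
Proof.
move=> x2; have := expR_ge1Dx (- x); rewrite expRN => h.
have e0 := expR_gt0 x; have h1 : (1 - x) * expR x <= 1.
  by rewrite -(ler_pM2r e0) mulVf ?gt_eqF// in h.
(* Because $(1-x)(1+x+2x^2)=1+x^2(1-2x)\ge 1\ge(1-x)e^x$. *)
have : 0 <= (1 - x) * (1 + x + 2 * x ^+ 2 - expR x) by nra.
by rewrite pmulr_rge0 ?subr_ge0//; lra.
Qed.

Section Mgf.
Context {R : realType} {d : measure_display} {Om : measurableType d}
  (P : probability Om R).

Lemma bounded_integrable (f : Om -> R) (M : R) : measurable_fun setT f ->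
  (forall w, `|f w| <= M) -> P.-integrable setT (EFin \o f).
Proof.
move=> mf fM; apply: measurable_bounded_integrable => //.
  by apply: le_lt_trans (probability_le1 P measurableT) _; rewrite ltry.
exists M; split; [exact: num_real|] => x Mx w _ /=.
by apply: le_trans (fM w) (ltW Mx).
Qed.

Lemma Rintegral_integral (f : Om -> R) : P.-integrable setT (EFin \o f) ->
  (\int[P]_w (f w)%:E = (\int[P]_w f w)%R%:E)%E.
Proof. by move=> fi; rewrite /Rintegral fineK//; exact: integrable_fin_num. Qed.

Lemma Rintegral_probability_cst (c : R) : \int[P]_w c = c.
Proof. by rewrite /Rintegral integral_cst//= probability_setT mule1. Qed.

(** Integrate the quadratic bound on the exponential. The means are allowed to be as large as [tau]
    because truncating a centred variable shifts its mean. *)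
Lemma integral_expR_le (X1 X2 X3 : Om -> R) (a1 a2 a3 M B tau : R) :
  measurable_fun setT X1 -> measurable_fun setT X2 -> measurable_fun setT X3 ->
  (forall w, `|X1 w| <= M) -> (forall w, `|X2 w| <= M) -> (forall w, `|X3 w| <= M) ->
  `|\int[P]_w X1 w| <= tau -> `|\int[P]_w X2 w| <= tau -> `|\int[P]_w X3 w| <= tau ->
  (forall w, a1 * X1 w + a2 * X2 w + a3 * X3 w <= 1 / 2) ->
  (forall w, (a1 * X1 w + a2 * X2 w + a3 * X3 w) ^+ 2 <= B) ->
  (\int[P]_w (expR (a1 * X1 w + a2 * X2 w + a3 * X3 w))%:E <=
   (expR (2 * B + (`|a1| + `|a2| + `|a3|) * tau))%:E)%E.
Proof.
move=> mX1 mX2 mX3 b1 b2 b3 i1 i2 i3 e1 e2.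
pose Y w := a1 * X1 w + a2 * X2 w + a3 * X3 w.
have I1 := bounded_integrable mX1 b1; have I2 := bounded_integrable mX2 b2.
have I3 := bounded_integrable mX3 b3.
have mY : measurable_fun setT Y.
  by repeat apply: measurable_funD; apply: measurable_funM.
have J (a : R) f (fi : P.-integrable setT (EFin \o f)) :
    P.-integrable setT (EFin \o (fun w => a * f w)).
  by have := integrableZl measurableT a fi; apply: eq_integrable.
have K f g (fi : P.-integrable setT (EFin \o f)) (gi : P.-integrable setT (EFin \o g)) :
    P.-integrable setT (EFin \o (fun w => f w + g w)).
  by have := integrableD measurableT fi gi; apply: eq_integrable.
have IY : P.-integrable setT (EFin \o Y) by apply: (K); [apply: (K)|]; apply: (J).
have IC (c : R) : P.-integrable setT (EFin \o (fun _ : Om => c)).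
  by apply: (@bounded_integrable _ `|c|).
apply: (@le_trans _ _ (\int[P]_w (Y w + (1 + 2 * B))%:E)%E).
  apply: ge0_le_integral => //=.
  - apply/measurable_EFinP; exact: (measurableT_comp (@measurable_expR R) mY).
  - by apply/measurable_EFinP; apply: (@measurable_funD _ _ _ _ Y).
  - move=> w _; rewrite lee_fin; apply: le_trans (expR_le_quadratic (e1 w)) _.
    have := e2 w; rewrite -/(Y w); lra.
rewrite Rintegral_integral; last exact: K.
rewrite lee_fin RintegralD//.
rewrite Rintegral_probability_cst.
have -> : \int[P]_w Y w = a1 * \int[P]_w X1 w + a2 * \int[P]_w X2 w + a3 * \int[P]_w X3 w.
  rewrite /Y RintegralD//; [|by apply: (K); apply: (J)|by apply: (J)].
  rewrite RintegralD//; [|by apply: (J)|by apply: (J)].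
  by rewrite !RintegralZl.
apply: le_trans (expR_ge1Dx _).
have T a x : `|x| <= tau -> a * x <= `|a| * tau.
  by move=> h; apply: le_trans (ler_norm _) _; rewrite normrM ler_wpM2l.
have := T a1 _ i1; have := T a2 _ i2; have := T a3 _ i3; lra.
Qed.
End Mgf.

Section Filtration.
Context {R : realType} {d : measure_display} {Om : measurableType d}
  (P : probability Om R).
Variables (G : nat -> set (set Om)) (h : nat -> Om -> R * R) (M : nat).
Let F n : measurableType (G n).-sigma := g_sigma_algebraType (G n).
Definition adapted {d'} {U : measurableType d'} n (f : Om -> U) :=
  measurable_fun (setT : set (F n)) f.
Hypothesis mG : forall n, G n `<=` measurable.
Hypothesis GT : forall n, G n setT.
Hypothesis GI : forall n, setI_closed (G n).
Hypothesis GS : forall n A, (n < M)%N -> G n A -> <<s G n.+1 >> A.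
Hypothesis mh : forall n, (n < M)%N -> adapted n.+1 (h n).
Hypothesis indep : forall n A B, (n < M)%N -> G n A -> measurable B ->
  (P (A `&` h n @^-1` B) = P A * P (h n @^-1` B))%E.

Lemma adapted_measurable d' (U : measurableType d') n (f : Om -> U) :
  adapted n f -> measurable_fun setT f.
Proof.
by move=> mf _ B mB; apply: (measurable_g_sigma_algebra (@mG n)); exact: mf.
Qed.

Lemma adapted_le d' (U : measurableType d') m n (f : Om -> U) : (m <= n)%N ->
  (n <= M)%N -> adapted m f -> adapted n f.
Proof.
elim: n => [|n IH]; first by rewrite leqn0 => /eqP ->.
rewrite leq_eqVlt => /orP[/eqP <- //|]; rewrite ltnS => mn nM /(IH mn (ltnW nM)) mf _ B mB.
have /= := mf measurableT B mB; rewrite !setTI.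
apply: smallest_sub; first exact: smallest_sigma_algebra.
by move=> A; exact: GS.
Qed.

Variables (e : nat -> Om * (R * R) -> R) (s : nat -> Om -> R).
Hypothesis me : forall n, (n < M)%N ->
  measurable_fun (setT : set (F n * (R * R)%type)%type) (e n).
Hypothesis ms : forall n, (n < M)%N -> adapted n (s n).
Hypothesis es : forall n w, (n < M)%N ->
  (\int[P]_w' (expR (e n (w, h n w')))%:E <= (expR (s n w))%:E)%E.

Let Z n w := expR (\sum_(i < n) (e i (w, h i w) - s i w)).

Lemma adapted_expR_sum n : (n <= M)%N -> adapted n (Z n).
Proof.
move=> nM; apply: (measurableT_comp (@measurable_expR R)).
have H (i : 'I_n) : adapted n (fun w => e i (w, h i w) - s i w).
  have iM : (i < M)%N := leq_trans (ltn_ord i) nM.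
  apply: measurable_funB.
    have hh : measurable_fun (setT : set (F n)) (fun w : F n => ((w : F i), h i w)).
      apply: measurable_fun_pair.
        by apply: (adapted_le (ltnW (ltn_ord i)) nM); exact: measurable_id.
      exact: (adapted_le (ltn_ord i) nM (mh iM)).
    exact: (measurableT_comp (me iM) hh).
  exact: (adapted_le (ltnW (ltn_ord i)) nM (ms iM)).
exact: measurable_sum.
Qed.

(** [e n] is the increment of the exponent, a function of the past and of the new variable, and the
    predictable [s n] dominates its conditional log-Laplace transform. Freezing the past in the last
    factor therefore cannot increase the integral. *)
Lemma expR_supermartingale n : (n <= M)%N -> (\int[P]_w (Z n w)%:E <= 1)%E.
Proof.
elim: n => [|n IH] nM.
  under eq_integral do rewrite /Z big_ord0 expR0.
  by rewrite integral_cst//= mul1e probability_le1.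
apply: le_trans (IH (ltnW nM)).
have mZ : measurable_fun setT (Z n) by exact: adapted_measurable (adapted_expR_sum (ltnW nM)).
(* Everything except the factor [expR (e n x)] is determined by the past. *)
pose f (x : F n * (R * R)) := (Z n x.1 * expR (- s n x.1) * expR (e n x))%:E.
have mf : measurable_fun setT f.
  apply/measurable_EFinP; apply: measurable_funM; last first.
    exact: (measurableT_comp (@measurable_expR R) (me nM)).
  apply: measurable_funM.
    exact: (measurableT_comp (adapted_expR_sum (ltnW nM)) (@measurable_fst _ _ _ _)).
  apply: (measurableT_comp (@measurable_expR R)).
  apply: measurableT_comp => //.
  exact: (measurableT_comp (ms nM) (@measurable_fst _ _ _ _)).
have mhn := adapted_measurable (mh nM).
have f0 x : (0 <= f x)%E by rewrite lee_fin !mulr_ge0 ?expR_ge0.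
have -> : (\int[P]_w (Z n.+1 w)%:E = \int[P]_w f (w, h n w))%E.
  apply: eq_integral => w _; congr EFin; rewrite /Z big_ord_recr /= expRD expRD.
  by rewrite -/(Z n w); ring.
rewrite (freezing (@mG n) (@GT n) (@GI n) mhn (fun A B => @indep n A B nM) mf f0).
have mf1 w : measurable_fun setT (fun w' => (expR (e n (w, h n w')))%:E).
  apply/measurable_EFinP; apply: (measurableT_comp (@measurable_expR R)).
  apply: (measurableT_comp (T2 := (R * R)%type) (f := fun x => e n (w, x))) => //.
  exact: (measurableT_comp (me nM) (measurable_pair1 _)).
apply: ge0_le_integral => //.
- by move=> w _; apply: integral_ge0 => *; exact: f0.
- exact: (measurable_freezing P (@mG n) mhn mf f0).
- exact/measurable_EFinP.
move=> w _; rewrite /f /=.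
under eq_integral do rewrite EFinM.
rewrite ge0_integralZl//; last by rewrite lee_fin mulr_ge0 ?expR_ge0.
  apply: (@le_trans _ _ ((Z n w * expR (- s n w))%:E * (expR (s n w))%:E)%E).
    by apply: lee_pmul => //; rewrite ?lee_fin ?mulr_ge0 ?expR_ge0// ?integral_ge0// ?es//.
  by rewrite -EFinM -mulrA -expRD addNr expR0 mulr1.
Qed.
End Filtration.

Definition sqnorm2 (R : realType) (x : R * R) : R := x.1 ^+ 2 + x.2 ^+ 2.
(** The value is replaced by 0 beyond the level, so it is bounded everywhere and unchanged on the
    event that the entries are bounded, to which all conclusions are restricted. *)
Definition truncated (R : realType) (k : R) (f : R * R -> R) (x : R * R) : R :=
  if sqnorm2 x <= k then f x else 0.

Lemma measurable_sqnorm2 (R : realType) :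
  measurable_fun (setT : set (R * R)) (@sqnorm2 R).
Proof. by apply: measurable_funD; apply: measurable_funX. Qed.

Lemma measurable_truncated (R : realType) (k : R) (f : R * R -> R) :
  measurable_fun setT f -> measurable_fun setT (truncated k f).
Proof.
move=> mf; apply: measurable_fun_ifT => //.
by apply: measurable_fun_ler => //; exact: measurable_sqnorm2.
Qed.

(** * Outer probability bounds *)

Section Rare.
Context {R : realType} {d : measure_display} {Om : measurableType d}
  (P : probability Om R).

(** An outer probability. The events below quantify over uncountably many parameters or come from
    implications between inequalities, and covering them by a measurable set avoids proving that
    they are measurable. *)
Definition rare (A : set Om) (a : R) :=
  exists B, [/\ measurable B, A `<=` B & (P B <= a%:E)%E].

Lemma rareS (A B : set Om) (a b : R) : A `<=` B -> a <= b -> rare B a -> rare A b.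
Proof.
move=> AB ab [C [mC BC PC]]; exists C; split => //; first exact: subset_trans AB BC.
by apply: le_trans PC _; rewrite lee_fin.
Qed.

Lemma rare0 : rare set0 0.
Proof. by exists set0; split => //; rewrite measure0. Qed.

Lemma rareU (A B : set Om) (a b : R) : rare A a -> rare B b -> rare (A `|` B) (a + b).
Proof.
move=> [A' [mA AA PA]] [B' [mB BB PB]]; exists (A' `|` B'); split.
- exact: measurableU.
- exact: setUSS.
- rewrite EFinD; apply: le_trans (leeD PA PB).
  exact: measureU2.
Qed.

Lemma rare_seq (I : eqType) (r : seq I) (A : I -> set Om) (a : R) :
  (forall i, i \in r -> rare (A i) a) ->
  rare [set w | exists2 i, i \in r & A i w] ((size r)%:R * a).
Proof.
elim: r => [|i r IH] h.
  by rewrite mul0r; apply: rareS rare0 => // w [].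
have hr : forall j, j \in r -> rare (A j) a by move=> j jr; apply: h; rewrite inE jr orbT.
have := rareU (h i (mem_head _ _)) (IH hr); apply: rareS; last first.
  by rewrite /= -natr1 mulrDl mul1r addrC.
move=> w [j]; rewrite inE => /orP[/eqP ->|jr]; first by left.
by right; exists j.
Qed.

Lemma rare_fin (I : finType) (A : I -> set Om) (a : R) :
  (forall i, rare (A i) a) -> rare [set w | exists i, A i w] (#|I|%:R * a).
Proof.
move=> h; have := @rare_seq I (enum I) A a (fun i _ => h i).
by rewrite -cardE; apply: rareS => // w [i Ai]; exists i => //; rewrite mem_enum.
Qed.

End Rare.

(** * Concentration of sums that are linear and quadratic in successive variables *)

Section Concentration.
Context {R : realType} {d : measure_display} {Om : measurableType d}
  (P : probability Om R).
Variables (G : nat -> set (set Om)) (h : nat -> Om -> R * R) (M : nat).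
Hypothesis mG : forall n, G n `<=` measurable.
Hypothesis GT : forall n, G n setT.
Hypothesis GI : forall n, setI_closed (G n).
Hypothesis GS : forall n A, (n < M)%N -> G n A -> <<s G n.+1 >> A.
Hypothesis mh : forall n, (n < M)%N -> adapted G n.+1 (h n).
Hypothesis indep : forall n A B, (n < M)%N -> G n A -> measurable B ->
  (P (A `&` h n @^-1` B) = P A * P (h n @^-1` B))%E.
(** [nu] is the variance scale of the variables, [k] below is the truncation level for their squared
    modulus, [sg n] is the variance of the [n]-th one, and [tau] bounds the mean shifts caused by
    truncation, whose total effect is at most 1 by [tauM]. *)
Variables (nu L tau : R) (sg : nat -> R).
Hypotheses (nu0 : 0 < nu) (nu1 : nu <= 1) (L1 : 1 <= L) (sgn : forall n, 0 <= sg n <= nu) (tauM : M%:R * (3 * tau / nu) <= 1).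
Let k := L ^+ 2 * nu.
Let ph1 := truncated k fst.
Let ph2 := truncated k snd.
Let ph3 n := truncated k (fun x => sqnorm2 x - sg n).
Hypothesis t1 : forall n, (n < M)%N -> `|\int[P]_w ph1 (h n w)| <= tau.
Hypothesis t2 : forall n, (n < M)%N -> `|\int[P]_w ph2 (h n w)| <= tau.
Hypothesis t3 : forall n, (n < M)%N -> `|\int[P]_w ph3 n (h n w)| <= tau.

Lemma truncated_sq n x : [/\ ph1 x ^+ 2 <= k, ph2 x ^+ 2 <= k & ph3 n x ^+ 2 <= k ^+ 2].
Proof.
have k0 : nu <= k by rewrite /k ler_peMl ?(ltW nu0)// expr_ge1// (le_trans _ L1).
rewrite /ph1 /ph2 /ph3 /truncated /sqnorm2; have k1 : 0 <= k by apply: le_trans k0; exact: ltW.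
case: ifPn => h1; last by rewrite !expr0n; split => //; exact: sqr_ge0.
have := sqr_ge0 x.1; have := sqr_ge0 x.2 => s2 s1; split; [lra|lra|].
set u := _ + _ in h1 *; have u0 : 0 <= u by rewrite addr_ge0.
have /andP[sg0 sg1] := sgn n.
rewrite -subr_ge0; have -> : k ^+ 2 - (u - sg n) ^+ 2 = (k - u + sg n) * (k + u - sg n) by ring.
by apply: mulr_ge0; lra.
Qed.

Section Coefficients.
Variables (a1 a2 c : nat -> Om -> R).
Hypothesis ma1 : forall n, (n < M)%N -> adapted G n (a1 n).
Hypothesis ma2 : forall n, (n < M)%N -> adapted G n (a2 n).
Hypothesis mc : forall n, (n < M)%N -> adapted G n (c n).
(** A predictable proxy for the conditional variance of [X n]: the two coordinates fluctuate on the
    scale $\sqrt\nu$ and the squared modulus on the scale $\nu$. *)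
Let V n w := nu * (a1 n w ^+ 2 + a2 n w ^+ 2) + nu ^+ 2 * c n w ^+ 2.
Let X n w := a1 n w * (h n w).1 + a2 n w * (h n w).2 + c n w * (sqnorm2 (h n w) - sg n).
Let small n w := 12 * L ^+ 4 * V n w <= 1.
(** The increment is switched off when its variance proxy is too large. This condition is
    predictable, and it keeps the exponent at most 1/2 at every sample point, as the Laplace bound
    requires. *)
Let e n (x : Om * (R * R)) : R :=
  if small n x.1 then a1 n x.1 * ph1 x.2 + a2 n x.1 * ph2 x.2 + c n x.1 * ph3 n x.2 else 0.
Let s n w : R := if small n w then 6 * L ^+ 4 * V n w + 3 * tau / nu else 0.

Let V0 n w : 0 <= V n w.
Proof. by rewrite /V addr_ge0// mulr_ge0 ?sqr_ge0 ?addr_ge0 ?sqr_ge0 ?(ltW nu0). Qed.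

Lemma adapted_V n : (n < M)%N -> adapted G n (V n).
Proof.
move=> nM; have H1 := ma1 nM; have H2 := ma2 nM; have H3 := mc nM.
by apply: measurable_funD; apply: measurable_funM => //;
  [apply: measurable_funD|]; apply: measurable_funX.
Qed.

Lemma adapted_small n : (n < M)%N -> adapted G n (small n).
Proof.
move=> nM; apply: measurable_fun_ler => //; apply: measurable_funM => //.
exact: adapted_V.
Qed.

Lemma adapted_s n : (n < M)%N -> adapted G n (s n).
Proof.
move=> nM; apply: measurable_fun_ifT; [exact: adapted_small| |exact: measurable_cst].
by apply: measurable_funD => //; apply: measurable_funM => //; exact: adapted_V.
Qed.

Lemma measurable_e n : (n < M)%N ->
  measurable_fun (setT : set (g_sigma_algebraType (G n) * (R * R)%type)%type) (e n).
Proof.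
move=> nM; have mf d' (U : measurableType d') f (mf : adapted G n (f : Om -> U)) :
    measurable_fun (setT : set (g_sigma_algebraType (G n) * (R * R)%type)%type)
      (fun x => f x.1) by exact: (measurableT_comp mf (@measurable_fst _ _ _ _)).
have mg f (mf' : measurable_fun setT (f : R * R -> R)) :
    measurable_fun (setT : set (g_sigma_algebraType (G n) * (R * R)%type)%type)
      (fun x => f x.2) by exact: (measurableT_comp mf' (@measurable_snd _ _ _ _)).
apply: measurable_fun_ifT => //; first exact: (mf _ _ _ (adapted_small nM)).
apply: measurable_funD; [apply: measurable_funD|]; apply: measurable_funM.
- exact: (mf _ _ _ (ma1 nM)).
- by apply: (mg ph1); exact: measurable_truncated.
- exact: (mf _ _ _ (ma2 nM)).
- by apply: (mg ph2); exact: measurable_truncated.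
- exact: (mf _ _ _ (mc nM)).
- apply: (mg (ph3 n)); apply: measurable_truncated; apply: measurable_funB => //.
  exact: measurable_sqnorm2.
Qed.

(** The square of a sum of three terms is at most three times the sum of their squares, and
    truncation costs at most a factor $L^4$, so the squared exponent is at most $3L^4V\le 1/4$. Then
    [integral_expR_le] applies. *)
Lemma expR_e_le n w : (n < M)%N ->
  (\int[P]_w' (expR (e n (w, h n w')))%:E <= (expR (s n w))%:E)%E.
Proof.
move=> nM; rewrite /e /s /=; case: ifPn => [sm|_]; last first.
  by rewrite integral_cst//= probability_setT mule1.
have mhn := adapted_measurable mG (mh nM).
have mk f (mf : measurable_fun setT (f : R * R -> R)) : measurable_fun setT (f \o h n).
  exact: measurableT_comp.
have L4 : 1 <= L ^+ 4 by rewrite expr_ge1// (le_trans _ L1).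
have k0 : 0 <= k by rewrite /k mulr_ge0 ?sqr_ge0 ?(ltW nu0).
have kE : k = L ^+ 2 * nu by [].
have kL : k <= L ^+ 4 * nu.
  rewrite kE; have -> : L ^+ 4 = L ^+ 2 * L ^+ 2 by ring.
  by rewrite ler_wpM2r ?(ltW nu0)// ler_peMl ?sqr_ge0// expr_ge1// (le_trans _ L1).
have sq w' : (a1 n w * ph1 (h n w') + a2 n w * ph2 (h n w') + c n w * ph3 n (h n w')) ^+ 2
    <= 3 * L ^+ 4 * V n w.
  have [p1 p2 p3] := truncated_sq n (h n w').
  set x1 := ph1 _ in p1 *; set x2 := ph2 _ in p2 *; set x3 := ph3 _ _ in p3 *.
  have q1 : a1 n w ^+ 2 * x1 ^+ 2 <= a1 n w ^+ 2 * (L ^+ 4 * nu).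
    by rewrite ler_wpM2l ?sqr_ge0// (le_trans p1).
  have q2 : a2 n w ^+ 2 * x2 ^+ 2 <= a2 n w ^+ 2 * (L ^+ 4 * nu).
    by rewrite ler_wpM2l ?sqr_ge0// (le_trans p2).
  have q3 : c n w ^+ 2 * x3 ^+ 2 <= c n w ^+ 2 * (L ^+ 4 * nu ^+ 2).
    rewrite ler_wpM2l ?sqr_ge0// (le_trans p3)// kE.
    by have -> : (L ^+ 2 * nu) ^+ 2 = L ^+ 4 * nu ^+ 2 by ring.
  rewrite /V; set A := a1 n w in q1 *; set B := a2 n w in q2 *; set C := c n w in q3 *.
  have := sqr_ge0 (A * x1 - B * x2); have := sqr_ge0 (A * x1 - C * x3).
  have := sqr_ge0 (B * x2 - C * x3); nra.
have sq4 w' := le_trans (sq w') (_ : _ <= 1 / 4).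
have V1 : 3 * L ^+ 4 * V n w <= 1 / 4 by move: sm; rewrite /small; lra.
have kx w' : [/\ `|ph1 (h n w')| <= 1 + k, `|ph2 (h n w')| <= 1 + k &
    `|ph3 n (h n w')| <= 1 + k].
  have [p1 p2 p3] := truncated_sq n (h n w').
  have U x : x ^+ 2 <= k -> `|x| <= 1 + k.
    by move=> xk; rewrite ler_norml; nra.
  split; [exact: U|exact: U|].
  by rewrite -ler_sqr ?nnegrE ?addr_ge0// real_normK ?num_real//; nra.
apply: le_trans (integral_expR_le (M := 1 + k) (B := 3 * L ^+ 4 * V n w) (tau := tau)
  _ _ _ _ _ _ (t1 nM) (t2 nM) (t3 nM) _ _) _ => //.
- by apply: (mk ph1); exact: measurable_truncated.
- by apply: (mk ph2); exact: measurable_truncated.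
- apply: (mk (ph3 n)); apply: measurable_truncated; apply: measurable_funB => //.
  exact: measurable_sqnorm2.
- by move=> w'; case: (kx w').
- by move=> w'; case: (kx w').
- by move=> w'; case: (kx w').
- by move=> w'; have := sq4 V1 w'; set x := (_ + _); nra.
have tau0 : 0 <= tau by apply: le_trans (t1 nM).
(* With the variance proxy at most 1, each coefficient is at most $1/\nu$, which turns the three
   mean shifts into the summand $3\tau/\nu$ of [s]. *)
have V4 : V n w <= 1 by have := V0 n w; nra.
have U x : nu * x ^+ 2 <= 1 -> `|x| <= nu^-1.
  move=> nx; rewrite -ler_sqr ?nnegrE ?invr_ge0 ?(ltW nu0)// real_normK ?num_real//.
  rewrite -(ler_pM2l (exprn_gt0 2 nu0)) -[X in _ <= X]exprMn divff ?gt_eqF// expr1n.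
  by apply: le_trans nx; rewrite ler_wpM2r ?sqr_ge0// expr2 ler_piMr ?(ltW nu0).
have i0 : 0 < nu^-1 by rewrite invr_gt0.
have [u1 u2] : nu * a1 n w ^+ 2 <= 1 /\ nu * a2 n w ^+ 2 <= 1.
  move: V4; rewrite /V mulrDr.
  have : 0 <= nu * a1 n w ^+ 2 by rewrite mulr_ge0 ?sqr_ge0 ?(ltW nu0).
  have : 0 <= nu * a2 n w ^+ 2 by rewrite mulr_ge0 ?sqr_ge0 ?(ltW nu0).
  have : 0 <= nu ^+ 2 * c n w ^+ 2 by rewrite mulr_ge0 ?sqr_ge0.
  by split; lra.
have A1 := U _ u1; have A2 := U _ u2.
have A3 : `|c n w| <= nu^-1.
  rewrite -ler_sqr ?nnegrE ?(ltW i0)// real_normK ?num_real//.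
  rewrite -(ler_pM2l (exprn_gt0 2 nu0)) -[X in _ <= X]exprMn divff ?gt_eqF// expr1n.
  move: V4; rewrite /V; have : 0 <= nu * (a1 n w ^+ 2 + a2 n w ^+ 2); last by lra.
  by rewrite mulr_ge0 ?addr_ge0 ?sqr_ge0 ?(ltW nu0).
rewrite lee_fin ler_expR.
have -> : 6 * L ^+ 4 * V n w + 3 * tau / nu = 2 * (3 * L ^+ 4 * V n w) +
  (nu^-1 + nu^-1 + nu^-1) * tau by ring.
by rewrite lerD2l ler_wpM2r// !lerD.
Qed.

(** Markov's inequality for the supermartingale. On the event no truncation or switch acts, and the
    compensators add up to at most $1/2+1$, so the exponent is at least [la - 2]. *)
Lemma concentration_aux (la : R) :
  rare P [set w | [/\ la <= \sum_(n < M) X n w, 12 * L ^+ 4 * (\sum_(n < M) V n w) <= 1 &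
     forall n, (n < M)%N -> sqnorm2 (h n w) <= k]] (expR (2 - la)).
Proof.
have L4 : 0 < L ^+ 4 by rewrite exprn_gt0// (lt_le_trans _ L1).
set E := [set w | _].
pose Z w := expR (\sum_(i < M) (e i (w, h i w) - s i w)).
have mZ : measurable_fun setT Z.
  apply: (adapted_measurable mG (n := M)).
  exact: (adapted_expR_sum GS mh (fun n => @measurable_e n) (fun n => @adapted_s n)).
have iZ : (\int[P]_w (Z w)%:E <= 1)%E.
  exact: (expR_supermartingale mG GT GI GS mh indep (fun n => @measurable_e n)
    (fun n => @adapted_s n) (fun n w => @expR_e_le n w)).
have mhn (n : 'I_M) : measurable_fun setT (h n) := adapted_measurable mG (mh (ltn_ord n)).
have mE : measurable E.
  have -> : E = [set w | la <= \sum_(n < M) X n w] `&`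
      ([set w | 12 * L ^+ 4 * (\sum_(n < M) V n w) <= 1] `&`
       \bigcap_(n in [set n | (n < M)%N]) [set w | sqnorm2 (h n w) <= k]).
    by apply/seteqP; split => w /=; [case|case=> ? []].
  have ml (f g : Om -> R) : measurable_fun setT f -> measurable_fun setT g ->
      measurable [set w | f w <= g w].
    move=> mf mg; have := measurable_fun_ler mf mg measurableT (_ : measurable [set true]).
    move=> /(_ I).
    by rewrite setTI; congr measurable; apply/seteqP; split.
  have m1 (n : 'I_M) := adapted_measurable mG (ma1 (ltn_ord n)).
  have m2 (n : 'I_M) := adapted_measurable mG (ma2 (ltn_ord n)).
  have m3 (n : 'I_M) := adapted_measurable mG (mc (ltn_ord n)).
  apply: measurableI; [|apply: measurableI].
  - apply: ml => //; apply: measurable_sum => n.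
    apply: measurable_funD; [apply: measurable_funD|]; apply: measurable_funM => //.
    + exact: (measurableT_comp (@measurable_fst _ _ _ _) (mhn n)).
    + exact: (measurableT_comp (@measurable_snd _ _ _ _) (mhn n)).
    + apply: measurable_funB => //; exact: (measurableT_comp (@measurable_sqnorm2 R) (mhn n)).
  - apply: ml => //; apply: measurable_funM => //; apply: measurable_sum => n.
    exact: (adapted_measurable mG (adapted_V (ltn_ord n))).
  - apply: bigcap_measurableType => n /= nM; apply: ml => //.
    exact: (measurableT_comp (@measurable_sqnorm2 R) (mhn (Ordinal nM))).
have EZ w : E w -> expR (la - 2) <= Z w.
  move=> [h1 h2 h3]; rewrite /Z ler_expR.
  have sV n : (n < M)%N -> small n w.
    move=> nM; rewrite /small; apply: le_trans h2; rewrite ler_pM2l; last by rewrite mulr_gt0.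
    by rewrite (bigD1 (Ordinal nM))//= lerDl; apply: sumr_ge0.
  rewrite [leRHS](_ : _ =
      \sum_(i < M) X i w - (\sum_(i < M) 6 * L ^+ 4 * V i w + M%:R * (3 * tau / nu))).
    have -> : \sum_(i < M) 6 * L ^+ 4 * V i w = 6 * L ^+ 4 * (\sum_(i < M) V i w).
      by rewrite mulr_sumr.
    by move: tauM h1 h2; lra.
  have -> : M%:R * (3 * tau / nu) = \sum_(i < M) (3 * tau / nu).
    by rewrite sumr_const card_ord mulr_natl.
  rewrite -big_split/= -sumrB.
  apply: eq_bigr => i _; rewrite /e /s /= sV//.
  by rewrite /X /ph1 /ph2 /ph3 /truncated (h3 i (ltn_ord i)).
have e0 := expR_gt0 (2 - la).
exists E; split => //.
have -> : (P E = \int[P]_w (\1_E w)%:E)%E by rewrite integral_indic// setIT.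
apply: (@le_trans _ _ (\int[P]_w ((expR (2 - la))%:E * (Z w)%:E))%E).
  apply: ge0_le_integral => //=.
  - by apply/measurable_EFinP; exact: measurable_indic.
  - by apply/measurable_EFinP; exact: measurable_funM.
  - move=> w _; rewrite lee_fin indicE; case: (boolP (w \in E)) => [|_]; last first.
      by rewrite mulr_ge0 ?expR_ge0.
    rewrite inE => /EZ EZw; have -> : 2 - la = - (la - 2) by ring.
    by rewrite expRN mulrC ler_pdivlMr ?expR_gt0// mul1r.
rewrite ge0_integralZl//=; last 2 first.
- by apply/measurable_EFinP.
- by move=> w _; rewrite lee_fin expR_ge0.
by rewrite -[leRHS]mule1; apply: lee_wpmul2l => //; rewrite lee_fin ltW.
Qed.
End Coefficients.

Lemma concentration (a1 a2 c : nat -> Om -> R) :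
  (forall n, (n < M)%N -> adapted G n (a1 n)) ->
  (forall n, (n < M)%N -> adapted G n (a2 n)) ->
  (forall n, (n < M)%N -> adapted G n (c n)) ->
  rare P [set w | [/\ 4 * L ^+ 3 <= \sum_(n < M) (a1 n w * (h n w).1 + a2 n w * (h n w).2 +
        c n w * (sqnorm2 (h n w) - sg n)),
      \sum_(n < M) (nu * (a1 n w ^+ 2 + a2 n w ^+ 2) + nu ^+ 2 * c n w ^+ 2) <= 1 &
     forall n, (n < M)%N -> sqnorm2 (h n w) <= L ^+ 2 * nu]] (expR (2 - L)).
Proof.
move=> m1 m2 m3; have L0 : 0 < L by apply: lt_le_trans L1.
(* With this scaling the threshold $4L^3$ becomes $L$, and a variance budget of 1 becomes
   $12L^4t^2=3/4\le 1$. *)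
pose t : R := (4 * L ^+ 2)^-1.
have t0 : 0 < t by rewrite invr_gt0 mulr_gt0// exprn_gt0.
have ms f : (forall n, (n < M)%N -> adapted G n (f n : Om -> R)) ->
    forall n, (n < M)%N -> adapted G n (fun w => t * f n w).
  by move=> mf n nM; apply: measurable_funM => //; exact: mf.
apply: rareS (lexx _) (concentration_aux (ms _ m1) (ms _ m2) (ms _ m3) L).
move=> w /= [h1 h2 h3]; split => //.
  have -> : \sum_(n < M) (t * a1 n w * (h n w).1 + t * a2 n w * (h n w).2 +
        t * c n w * (sqnorm2 (h n w) - sg n)) = t * \sum_(n < M) (a1 n w * (h n w).1 +
        a2 n w * (h n w).2 + c n w * (sqnorm2 (h n w) - sg n)).
    by rewrite mulr_sumr; apply: eq_bigr => i _; ring.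
  rewrite mulrC /t ler_pdivlMr ?mulr_gt0 ?exprn_gt0//.
  by apply: le_trans h1; rewrite le_eqVlt; apply/orP; left; apply/eqP; ring.
have -> : \sum_(n < M) (nu * ((t * a1 n w) ^+ 2 + (t * a2 n w) ^+ 2) +
    nu ^+ 2 * (t * c n w) ^+ 2) = t ^+ 2 *
    \sum_(n < M) (nu * (a1 n w ^+ 2 + a2 n w ^+ 2) + nu ^+ 2 * c n w ^+ 2).
  by rewrite mulr_sumr; apply: eq_bigr => i _; ring.
set S := \sum_(n < M) _ in h2 *; rewrite mulrA.
have -> : 12 * L ^+ 4 * t ^+ 2 = 3 / 4 by rewrite /t; field; rewrite gt_eqF.
by move: h2; lra.
Qed.
End Concentration.

(** * Revealing the matrix entry by entry *)

Section EntryFiltration.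
Context {R : realType} {d : measure_display} {Om : measurableType d}
  (P : probability Om R) (n0 : nat).
Local Notation N := n0.+1.
Variable H : Om -> 'M[R[i]]_N.
Hypothesis HW : wigner_at P H.

(** Time $n=kN+j$ stands for the position $(k,j)$. Positions above the diagonal also get a time, at
    which [entry_seq] reveals only the constant 0; this keeps the arithmetic of times simple. *)
Definition row_of (n : nat) : 'I_N := inord (n %/ N).
Definition col_of (n : nat) : 'I_N := inord (n %% N).

Lemma row_ofK n : (n < N * N)%N -> row_of n = (n %/ N)%N :> nat.
Proof. by move=> h; rewrite inordK// ltn_divLR. Qed.
Lemma col_ofK n : col_of n = (n %% N)%N :> nat.
Proof. by rewrite inordK// ltn_pmod. Qed.
Lemma row_col_of n : (n < N * N)%N -> n = (row_of n * N + col_of n)%N.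
Proof. by move=> h; rewrite row_ofK// col_ofK -divn_eq. Qed.
Lemma row_ofE (k j : 'I_N) : row_of (k * N + j) = k.
Proof. by apply: ord_inj; rewrite /row_of inordK divnMDl// divn_small ?addn0. Qed.
Lemma col_ofE (k j : 'I_N) : col_of (k * N + j) = j.
Proof. by apply: ord_inj; rewrite col_ofK modnMDl modn_small. Qed.

Lemma sum_row_col (f : 'I_N -> 'I_N -> R) :
  \sum_(n < N * N) f (row_of n) (col_of n) = \sum_k \sum_j f k j.
Proof.
rewrite pair_big /=.
have lt (p : 'I_N * 'I_N) : (p.1 * N + p.2 < N * N)%N.
  have := ltn_ord p.1; have := ltn_ord p.2; nia.
rewrite (reindex_onto (fun p : 'I_N * 'I_N => Ordinal (lt p))
  (fun n : 'I_(N * N) => (row_of n, col_of n))) /=; last first.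
  by move=> n _; apply: ord_inj; rewrite /= -row_col_of.
apply: eq_big => [p|p _]; last by rewrite row_ofE col_ofE.
by rewrite row_ofE col_ofE -surjective_pairing eqxx.
Qed.

Definition entry_seq (n : nat) (w : Om) : R * R :=
  if (col_of n <= row_of n)%N then c2pair (H w (row_of n) (col_of n)) else (0, 0).

(** The lower triangular entry $(k,j)$ is recorded through its conjugate at $(j,k)$, since
    [wigner_at] states independence for the upper triangle. *)
Definition past_entries (n : nat) : {set 'I_N * 'I_N} :=
  [set p : 'I_N * 'I_N | (p.1 <= p.2)%N && (p.2 * N + p.1 < n)%N].

(** Only the pi-system of cylinder events is taken, so that independence can be read off from
    [wigner_at]; the generated sigma-algebra comes in through [adapted]. *)
Definition past (n : nat) : set (set Om) :=
  [set A | exists B : 'I_N * 'I_N -> set (R * R), (forall p, measurable (B p)) /\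
    A = \big[setI/setT]_(p in past_entries n) (entry H p.1 p.2 @^-1` B p)].

Lemma measurable_entry i j : measurable_fun setT (entry H i j).
Proof. by have [_ []] := HW. Qed.

Lemma measurable_entry_preimage i j B : measurable B -> measurable (entry H i j @^-1` B).
Proof. by move=> mB; rewrite -[X in measurable X]setTI; exact: measurable_entry. Qed.

Lemma past_measurable n : past n `<=` measurable.
Proof.
move=> _ [B [mB ->]]; elim/big_ind : _ => //; first by move=> ? ?; exact: measurableI.
by move=> p _; exact: measurable_entry_preimage.
Qed.

Lemma pastT n : past n setT.
Proof. by exists (fun=> setT); split => //; rewrite big1. Qed.

Lemma pastI n : setI_closed (past n).
Proof.
move=> _ _ [B [mB ->]] [C [mC ->]]; exists (fun p => B p `&` C p); split.
  by move=> p; exact: measurableI.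
by rewrite -big_split.
Qed.

Lemma past_sub m n A : (m <= n)%N -> past m A -> past n A.
Proof.
move=> mn [B [mB ->]].
exists (fun p => if p \in past_entries m then B p else setT); split.
  by move=> p; case: ifP.
rewrite big_mkcond [RHS]big_mkcond; apply: eq_bigr => p _.
case: ifP => [pm|_]; last by case: ifP.
suff -> : p \in past_entries n by [].
by move: pm; rewrite !inE => /andP[-> h]; exact: leq_trans mn.
Qed.

Lemma past_subS n A : (n < N * N)%N -> past n A -> <<s past n.+1 >> A.
Proof. by move=> _ pA; apply: sub_sigma_algebra; apply: past_sub pA. Qed.

Lemma adapted_upper n (j k : 'I_N) : (j <= k)%N -> (k * N + j < n)%N ->
  adapted past n (entry H j k).
Proof.
move=> jk kn _ B mB; rewrite setTI; apply: sub_sigma_algebra.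
exists (fun p => if p == (j, k) then B else setT); split; first by move=> p; case: ifP.
rewrite (bigD1 (j, k)) ?inE/= ?jk ?kn// eqxx big1 ?setIT//.
by move=> p /andP[_ /negbTE ->].
Qed.

Lemma entry_conj (j k : 'I_N) w :
  entry H j k w = ((entry H k j w).1, - (entry H k j w).2).
Proof.
have [Hc _] := HW; rewrite /entry /c2pair (Hc w k j) /=.
by case: (H w k j).
Qed.

Lemma adapted_entry n (j k : 'I_N) : (maxn j k * N + minn j k < n)%N ->
  adapted past n (entry H j k).
Proof.
case: (leqP j k) => [jk|kj] h; first exact: adapted_upper.
have -> : entry H j k = (fun w => ((entry H k j w).1, - (entry H k j w).2)).
  by apply/funext => w; exact: entry_conj.
have e := adapted_upper (ltnW kj) h.
apply: measurable_fun_pair.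
  exact: (measurableT_comp (@measurable_fst _ _ _ _) e).
apply: (measurableT_comp (@oppr_measurable R setT)).
exact: (measurableT_comp (@measurable_snd _ _ _ _) e).
Qed.

Lemma adapted_entry_seq n : (n < N * N)%N -> adapted past n.+1 (entry_seq n).
Proof.
move=> nN; rewrite /entry_seq.
case h: (col_of n <= row_of n)%N; last exact: measurable_cst.
apply: (@adapted_entry _ (row_of n) (col_of n)).
by move/maxn_idPl: (h) => ->; move/minn_idPr: (h) => ->; rewrite -row_col_of.
Qed.

(** At a time above the diagonal the variable is constant. Otherwise the new index is not among the
    past ones, and the product formula over the past indices together with the new one factors. *)
Lemma past_indep n A B : (n < N * N)%N -> past n A -> measurable B ->
  (P (A `&` entry_seq n @^-1` B) = P A * P (entry_seq n @^-1` B))%E.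
Proof.
move=> nN pA mB; case: (leqP (col_of n) (row_of n)) => h; last first.
  rewrite /entry_seq leqNgt h /=; case: (pselect (B (0, 0))) => B0.
    have -> : (fun=> (0, 0)) @^-1` B = [set: Om] by apply/seteqP; split.
    by rewrite setIT probability_setT mule1.
  have -> : (fun=> (0, 0)) @^-1` B = set0 :> set Om by apply/seteqP; split.
  by rewrite setI0 measure0 mule0.
set j := col_of n in h *; set k := row_of n in h *.
(* The image of [B] under conjugation, which passes from the revealed entry $(k,j)$ to the upper
   triangular one. *)
pose B' : set (R * R) := (fun x => (x.1, - x.2)) @^-1` B.
have mB' : measurable B'.
  rewrite -[X in measurable X]setTI; have mm : measurable_fun setT
    (fun x : R * R => (x.1, - x.2)); last exact: mm.
  by apply: measurable_fun_pair => //; apply: measurableT_comp.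
have E : entry_seq n @^-1` B = entry H j k @^-1` B'.
  suff -> : entry_seq n = (fun x => (x.1, - x.2)) \o entry H j k by [].
  apply/funext => w; rewrite [LHS]/entry_seq h.
  by have -> : c2pair (H w (row_of n) (col_of n)) = entry H k j w by []; exact: entry_conj.
have [_ [_ [ind _]]] := HW.
case: pA => C [mC ->]; rewrite E.
pose S := (j, k) |: past_entries n.
pose D p := if p == (j, k) then B' else C p.
have nS : (j, k) \notin past_entries n.
  by rewrite inE/= -row_col_of// ltnn andbF.
have SE (F : 'I_N * 'I_N -> set Om) :
    \big[setI/setT]_(p in past_entries n) (entry H p.1 p.2 @^-1` C p) =
    \big[setI/setT]_(p in past_entries n) (entry H p.1 p.2 @^-1` D p).
  apply: eq_bigr => p pn; rewrite /D ifF//; apply/negbTE/eqP => pe.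
  by move: nS; rewrite -pe pn.
have uS k' : k' \in past_entries n -> (k'.1 <= k'.2)%N by rewrite inE => /andP[].
have mD k' : measurable (D k') by rewrite /D; case: ifP.
have uT k' : k' \in S -> (k'.1 <= k'.2)%N.
  by rewrite !inE => /orP[/eqP ->//|/andP[]].
have DJ : D (j, k) = B' by rewrite /D eqxx.
have := ind S D uT mD; rewrite /S !big_setU1//= DJ => ES.
rewrite (SE (fun=> setT)) setIC ES muleC; congr (_ * _)%E.
exact: esym (ind _ D uS mD).
Qed.
End EntryFiltration.

(** * Truncation errors from moment bounds *)

Section TruncatedMoments.
Context {R : realType} {d : measure_display} {Om : measurableType d}
  (P : probability Om R).

Lemma integrable_le (f g : Om -> R) : measurable_fun setT f ->
  P.-integrable setT (EFin \o g) -> (forall w, `|f w| <= g w) ->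
  P.-integrable setT (EFin \o f).
Proof.
move=> mf ig fg; apply: le_integrable ig => //; first exact/measurable_EFinP.
by move=> w _ /=; rewrite lee_fin (le_trans (fg w))// ler_norm.
Qed.

Variables (q : Om -> R) (p : nat) (C L : R).
Hypotheses (mq : measurable_fun setT q) (q0 : forall w, 0 <= q w) (L1 : 1 <= L).
Hypothesis qp : (\int[P]_w ((q w) ^+ p.+2)%:E <= C%:E)%E.

Let L0 : 0 < L. Proof. exact: lt_le_trans L1. Qed.

Lemma integrable_moment : P.-integrable setT (EFin \o (fun w => q w ^+ p.+2)).
Proof.
apply/integrableP; split; first by apply/measurable_EFinP; exact: measurable_funX.
apply: (@le_lt_trans _ _ (C%:E)); last by rewrite ltry.
apply: le_trans qp; rewrite le_eqVlt; apply/orP; left; apply/eqP.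
by apply: eq_integral => w _ /=; rewrite ger0_norm// exprn_ge0.
Qed.

Lemma moment_tail w : L < q w -> q w ^+ 2 <= q w ^+ p.+2 / L ^+ p.
Proof.
move=> Lq; rewrite ler_pdivlMr ?exprn_gt0// -[p.+2]addn2 exprD mulrC.
by rewrite ler_wpM2r ?sqr_ge0// lerXn2r ?nnegrE ?(ltW L0) ?q0 ?(ltW Lq).
Qed.

(** Since [u] has mean zero, its truncated mean is minus the mean of its tail. There $|u|\le q^2\le
    q^{p+2}/L^p$, which the moment bound controls. *)
Lemma truncated_mean (u : Om -> R) : measurable_fun setT u ->
  (\int[P]_w (u w)%:E = 0)%E -> (forall w, `|u w| <= 1 + q w ^+ 2) ->
  (forall w, L < q w -> `|u w| <= q w ^+ 2) ->
  `|\int[P]_w (if q w <= L then u w else 0)| <= C / L ^+ p.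
Proof.
move=> mu iu u1 u2.
have I1 : P.-integrable setT (EFin \o (fun=> 1 : R)).
  by apply: (@bounded_integrable _ _ _ _ _ 1) => // w; rewrite normr1.
have Iu : P.-integrable setT (EFin \o u).
  apply: (integrable_le (g := fun w => 2 + q w ^+ p.+2)) => //.
    have := integrableD measurableT (integrableZl measurableT 2 I1) integrable_moment.
    by apply: eq_integrable => // w _ /=; rewrite -EFinM -EFinD mulr1.
  move=> w; apply: le_trans (u1 w) _; have := q0 w => qw.
  have [q1|q1] := leP (q w) 1.
    have : q w ^+ 2 <= 1 by rewrite expr_le1.
    have : 0 <= q w ^+ p.+2 by rewrite exprn_ge0.
    lra.
  have : q w ^+ 2 <= q w ^+ p.+2 by rewrite ler_eXn2l.
  by lra.
have mb : measurable_fun setT (fun w => q w <= L) by exact: measurable_fun_ler.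
pose u' w := if q w <= L then 0 else u w.
have mu' : measurable_fun setT u' by apply: measurable_fun_ifT.
have Iu' : P.-integrable setT (EFin \o u').
  apply: (integrable_le (g := fun w => `|u w|)) => //.
    by have := integrable_norm Iu; apply: eq_integrable.
  by move=> w; rewrite /u'; case: ifP; rewrite ?normr0.
have -> : \int[P]_w (if q w <= L then u w else 0) = - \int[P]_w u' w.
  have -> : (fun w => if q w <= L then u w else 0) = (fun w => u w - u' w).
    by apply/funext => w; rewrite /u'; case: ifP; rewrite ?subr0 ?subrr.
  by rewrite RintegralB// /Rintegral iu /= sub0r.
rewrite normrN.
have IT : P.-integrable setT (EFin \o (fun w => (L ^+ p)^-1 * q w ^+ p.+2)).
  by have := integrableZl measurableT (L ^+ p)^-1 integrable_moment; apply: eq_integrable.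
have B : \int[P]_w `|u' w| <= \int[P]_w ((L ^+ p)^-1 * q w ^+ p.+2).
  apply: le_Rintegral => //.
    by have := integrable_norm Iu'; apply: eq_integrable.
  move=> w _; rewrite /u'; case: ifPn => [_|]; first by rewrite normr0 mulr_ge0 ?invr_ge0 ?exprn_ge0 ?(ltW L0).
  by rewrite -ltNge => Lq; rewrite mulrC; exact: le_trans (u2 _ Lq) (moment_tail Lq).
apply: le_trans (le_normr_Rintegral _ _) _ => //; apply: le_trans B _.
rewrite RintegralZl//; last exact: integrable_moment.
rewrite mulrC ler_wpM2r ?invr_ge0 ?exprn_ge0 ?(ltW L0)//.
by rewrite -lee_fin -(Rintegral_integral integrable_moment).
Qed.

Lemma rare_tail : rare P [set w | L < q w] (C / L ^+ p).
Proof.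
have mA : measurable [set w | L < q w].
  have H : measurable_fun setT (fun w => q w <= L) by exact: measurable_fun_ler.
  have := H measurableT [set false] I; rewrite setTI; congr measurable.
  apply/seteqP; split => w /=; first by move/negbT; rewrite -ltNge.
  by rewrite ltNge => /negbTE.
set T := [set w | L < q w] in mA *; exists T; split => //.
have -> : (P T = \int[P]_w (\1_T w)%:E)%E.
  by rewrite integral_indic// setIT.
apply: (@le_trans _ _ (\int[P]_w ((L ^+ p)^-1%:E * (q w ^+ p.+2)%:E))%E).
  apply: ge0_le_integral => //=.
  - by apply/measurable_EFinP; exact: measurable_indic.
  - by apply/measurable_EFinP; apply: measurable_funM => //; exact: measurable_funX.
  - move=> w _; rewrite -EFinM lee_fin indicE; case: (boolP (w \in _)) => [|_]; last first.
      by rewrite mulr_ge0 ?invr_ge0 ?exprn_ge0 ?(ltW L0).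
    rewrite inE /= => Lq; rewrite mulrC; apply: le_trans (moment_tail Lq).
    by rewrite expr_ge1// ?q0// ltW// (le_lt_trans L1).
rewrite ge0_integralZl//=; last 3 first.
- by apply/measurable_EFinP; exact: measurable_funX.
- by move=> w _; rewrite lee_fin exprn_ge0.
- by rewrite lee_fin invr_ge0 exprn_ge0 ?(ltW L0).
have -> : ((C / L ^+ p)%:E = (L ^+ p)^-1%:E * C%:E)%E by rewrite -EFinM mulrC.
apply: lee_wpmul2l; last exact: qp.
by rewrite lee_fin invr_ge0 exprn_ge0 ?(ltW L0).
Qed.
End TruncatedMoments.

(** * Complex numbers, the Cauchy-Schwarz inequality and measurability *)

Section ComplexNumbers.
Context {R : realType}.
Implicit Types (z u : R[i]) (a : R).

Lemma cabsE z : cabs z = ComplexField.Normc.normc z. Proof. by case: z. Qed.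
Lemma cabs_ge0 z : 0 <= cabs z. Proof. exact: sqrtr_ge0. Qed.
Lemma cabs_sq z : cabs z ^+ 2 = cRe z ^+ 2 + cIm z ^+ 2.
Proof. by rewrite sqr_sqrtr// addr_ge0 ?sqr_ge0. Qed.
Lemma cabsM z u : cabs (z * u) = cabs z * cabs u.
Proof. by rewrite !cabsE ComplexField.Normc.normcM. Qed.
Lemma cabsD z u : cabs (z + u) <= cabs z + cabs u.
Proof. by rewrite !cabsE le_normcD. Qed.
Lemma cReD z u : cRe (z + u) = cRe z + cRe u. Proof. by case: z; case: u. Qed.
Lemma cImD z u : cIm (z + u) = cIm z + cIm u. Proof. by case: z; case: u. Qed.
Lemma cReN z : cRe (- z) = - cRe z. Proof. by case: z. Qed.
Lemma cImN z : cIm (- z) = - cIm z. Proof. by case: z. Qed.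
Lemma cReB z u : cRe (z - u) = cRe z - cRe u. Proof. by rewrite cReD cReN. Qed.
Lemma cImB z u : cIm (z - u) = cIm z - cIm u. Proof. by rewrite cImD cImN. Qed.
Lemma cReM z u : cRe (z * u) = cRe z * cRe u - cIm z * cIm u.
Proof. by case: z; case: u. Qed.
Lemma cImM z u : cIm (z * u) = cRe z * cIm u + cIm z * cRe u.
Proof. by case: z; case: u. Qed.
Lemma cRe_conj z : cRe (cconj z) = cRe z. Proof. by case: z. Qed.
Lemma cIm_conj z : cIm (cconj z) = - cIm z. Proof. by case: z. Qed.
Lemma cRe_real a : cRe a%:C%C = a. Proof. by []. Qed.
Lemma cIm_real a : cIm a%:C%C = 0. Proof. by []. Qed.
Lemma cRe0 : cRe (0 : R[i]) = 0. Proof. by []. Qed.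
Lemma cIm0 : cIm (0 : R[i]) = 0. Proof. by []. Qed.
Lemma cRe1 : cRe (1 : R[i]) = 1. Proof. by []. Qed.
Lemma cRe_i : cRe ('i%C : R[i]) = 0. Proof. by []. Qed.
Lemma cIm_i : cIm ('i%C : R[i]) = 1. Proof. by []. Qed.
Lemma complex_eq z u : cRe z = cRe u -> cIm z = cIm u -> z = u.
Proof. by case: z; case: u => /= a b c e' -> ->. Qed.
Lemma cconjM z u : cconj (z * u) = cconj z * cconj u.
Proof. by apply: complex_eq; rewrite !(cReM, cImM, cRe_conj, cIm_conj); ring. Qed.
Lemma cconjD z u : cconj (z + u) = cconj z + cconj u.
Proof. by apply: complex_eq; rewrite !(cReD, cImD, cRe_conj, cIm_conj); ring. Qed.
Lemma cconjN z : cconj (- z) = - cconj z.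
Proof. by apply: complex_eq; rewrite !(cReN, cImN, cRe_conj, cIm_conj); ring. Qed.
Lemma cconjB z u : cconj (z - u) = cconj z - cconj u.
Proof. by rewrite cconjD cconjN. Qed.
Lemma cconjK z : cconj (cconj z) = z.
Proof. by apply: complex_eq; rewrite !(cRe_conj, cIm_conj)// opprK. Qed.
Lemma cconj0 : cconj (0 : R[i]) = 0.
Proof. by apply: complex_eq; rewrite !(cRe_conj, cIm_conj) /= ?oppr0. Qed.
Lemma cconj1 : cconj (1 : R[i]) = 1.
Proof. by apply: complex_eq; rewrite !(cRe_conj, cIm_conj) /= ?oppr0. Qed.
Lemma cconj_real a : cconj a%:C%C = a%:C%C.
Proof. by apply: complex_eq; rewrite !(cRe_conj, cIm_conj) /= ?oppr0. Qed.
Lemma cconj_sum (I : Type) (r : seq I) (Q : pred I) (F : I -> R[i]) :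
  cconj (\sum_(i <- r | Q i) F i) = \sum_(i <- r | Q i) cconj (F i).
Proof. by apply: big_morph; [exact: cconjD|exact: cconj0]. Qed.
Lemma cRe_sum (I : Type) (r : seq I) (Q : pred I) (F : I -> R[i]) :
  cRe (\sum_(i <- r | Q i) F i) = \sum_(i <- r | Q i) cRe (F i).
Proof. by apply: big_morph; [exact: cReD|]. Qed.
Lemma cIm_sum (I : Type) (r : seq I) (Q : pred I) (F : I -> R[i]) :
  cIm (\sum_(i <- r | Q i) F i) = \sum_(i <- r | Q i) cIm (F i).
Proof. by apply: big_morph; [exact: cImD|]. Qed.
Lemma mul_cconj z : z * cconj z = (cabs z ^+ 2)%:C%C.
Proof.
apply: complex_eq; rewrite !(cReM, cImM, cRe_conj, cIm_conj) ?cRe_real ?cIm_real ?cabs_sq; ring.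
Qed.
Lemma cabs0 : cabs (0 : R[i]) = 0.
Proof. by rewrite /cabs expr0n /= addr0 sqrtr0. Qed.
Lemma cabs_real a : cabs a%:C%C = `|a|.
Proof. by rewrite /cabs cRe_real cIm_real expr0n addr0 sqrtr_sqr. Qed.
Lemma cabs1 : cabs (1 : R[i]) = 1.
Proof. by rewrite (cabs_real 1) normr1. Qed.
Lemma cabs_i : cabs ('i%C : R[i]) = 1.
Proof. by rewrite /cabs cRe_i cIm_i expr0n add0r expr1n sqrtr1. Qed.
Lemma cabsN z : cabs (- z) = cabs z. Proof. by rewrite /cabs cReN cImN !sqrrN. Qed.
Lemma cabs_conj z : cabs (cconj z) = cabs z.
Proof. by rewrite /cabs cRe_conj cIm_conj sqrrN. Qed.
Lemma cabsBC z u : cabs (z - u) = cabs (u - z). Proof. by rewrite -cabsN opprB. Qed.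
Lemma cabsB z u : cabs (z - u) <= cabs z + cabs u.
Proof. by rewrite -(cabsN u); exact: cabsD. Qed.
Lemma cabs_eq0 z : (cabs z == 0) = (z == 0).
Proof.
apply/eqP/eqP => [h|->]; last exact: cabs0.
have := cabs_sq z; rewrite h expr0n /= => /eqP; rewrite eq_sym paddr_eq0 ?sqr_ge0//.
by rewrite !sqrf_eq0 => /andP[/eqP r /eqP i]; exact: complex_eq.
Qed.
Lemma cabs_gt0 z : (0 < cabs z) = (z != 0).
Proof. by rewrite lt_neqAle cabs_ge0 andbT eq_sym cabs_eq0. Qed.
Lemma cabsV z : cabs z^-1 = (cabs z)^-1.
Proof. by rewrite !cabsE ComplexField.Normc.normcV. Qed.
Lemma cabsX z n : cabs (z ^+ n) = cabs z ^+ n.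
Proof. by elim: n => [|n IH]; rewrite ?expr0 ?cabs1// !exprS cabsM IH. Qed.
Lemma cabs_prod (I : Type) (r : seq I) (Q : pred I) (F : I -> R[i]) :
  cabs (\prod_(i <- r | Q i) F i) = \prod_(i <- r | Q i) cabs (F i).
Proof. by apply: big_morph; [exact: cabsM|exact: cabs1]. Qed.
Lemma cabs_sum (I : Type) (r : seq I) (Q : pred I) (F : I -> R[i]) :
  cabs (\sum_(i <- r | Q i) F i) <= \sum_(i <- r | Q i) cabs (F i).
Proof.
elim/big_ind2 : _ => [|a b c e h1 h2|//]; first by rewrite cabs0.
by apply: le_trans (cabsD _ _) _; exact: lerD.
Qed.
Lemma cRe_le z : `|cRe z| <= cabs z.
Proof. by rewrite -sqrtr_sqr ler_wsqrtr// lerDl sqr_ge0. Qed.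
Lemma cIm_le z : `|cIm z| <= cabs z.
Proof. by rewrite -sqrtr_sqr ler_wsqrtr// lerDr sqr_ge0. Qed.
Lemma cRe_ub z : cRe z <= cabs z.
Proof. exact: le_trans (ler_norm _) (cRe_le z). Qed.
Lemma cIm_ub z : cIm z <= cabs z.
Proof. exact: le_trans (ler_norm _) (cIm_le z). Qed.
Lemma cIm_lb z : - cabs z <= cIm z.
Proof. by rewrite lerNl -cabsN -cImN; exact: cIm_ub. Qed.
Lemma cabs_le_ReIm z : cabs z <= `|cRe z| + `|cIm z|.
Proof.
rewrite -ler_sqr ?nnegrE ?cabs_ge0 ?addr_ge0// cabs_sq.
rewrite -(real_normK (num_real (cRe z))) -(real_normK (num_real (cIm z))).
by have := normr_ge0 (cRe z); have := normr_ge0 (cIm z); nra.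
Qed.
Lemma cabs_lb z u : cabs z - cabs u <= cabs (z - u).
Proof. by rewrite lerBlDr -{1}(subrK u z); exact: cabsD. Qed.
Lemma complexV_Im z : cIm z^-1 = - cIm z / cabs z ^+ 2.
Proof. by rewrite cabs_sq; case: z => a b; rewrite mulNr. Qed.
Lemma complexV_Re z : cRe z^-1 = cRe z / cabs z ^+ 2.
Proof. by rewrite cabs_sq; case: z. Qed.

Lemma cauchy_schwarz_real (I : finType) (a b : I -> R) :
  (\sum_i a i * b i) ^+ 2 <= (\sum_i a i ^+ 2) * (\sum_i b i ^+ 2).
Proof.
set A := \sum_i a i ^+ 2; set B := \sum_i b i ^+ 2; set S := \sum_i a i * b i.
have A0 : 0 <= A by apply: sumr_ge0 => i _; exact: sqr_ge0.
have key t : 0 <= t ^+ 2 * A - 2 * t * S + B.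
  have -> : t ^+ 2 * A - 2 * t * S + B = \sum_i (t * a i - b i) ^+ 2.
    rewrite !mulr_sumr -sumrB -big_split /=; apply: eq_bigr => i _; ring.
  by apply: sumr_ge0 => i _; exact: sqr_ge0.
have [A0'|/eqP A0'] := eqVneq A 0; last first.
  have Ap : 0 < A by rewrite lt_neqAle eq_sym A0 andbT; apply/eqP.
  have := key (S / A).
  have -> : (S / A) ^+ 2 * A - 2 * (S / A) * S + B = B - S ^+ 2 / A.
    by field; rewrite gt_eqF.
  by rewrite subr_ge0 ler_pdivrMr// mulrC.
have : S = 0.
  apply: big1 => i _; have : \sum_i a i ^+ 2 == 0 by apply/eqP.
  rewrite psumr_eq0 => [|j _]; last exact: sqr_ge0.
  by move=> /allP /(_ i (mem_index_enum _)); rewrite sqrf_eq0 => /eqP ->; rewrite mul0r.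
by move=> ->; rewrite A0' mul0r expr0n.
Qed.

Lemma cauchy_schwarz (I : finType) (a b : I -> R[i]) :
  cabs (\sum_i a i * b i) ^+ 2 <= (\sum_i cabs (a i) ^+ 2) * (\sum_i cabs (b i) ^+ 2).
Proof.
apply: le_trans (cauchy_schwarz_real _ _).
rewrite lerXn2r ?nnegrE ?cabs_ge0 ?sumr_ge0// => [i _|]; first by rewrite mulr_ge0 ?cabs_ge0.
by apply: le_trans (cabs_sum _ _ _) _; apply: ler_sum => i _; rewrite cabsM.
Qed.
End ComplexNumbers.

Section ComplexMeasurable.
Context {R : realType} {d : measure_display} {T : measurableType d}.
Definition cmeasurable (f : T -> R[i]) :=
  measurable_fun setT (fun w => cRe (f w)) /\ measurable_fun setT (fun w => cIm (f w)).

Lemma cmeasurable_cst z : cmeasurable (fun=> z).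
Proof. by split; exact: measurable_cst. Qed.
Lemma cmeasurable_real (f : T -> R) : measurable_fun setT f ->
  cmeasurable (fun w => (f w)%:C%C).
Proof. by move=> mf; split => //; exact: measurable_cst. Qed.
Lemma cmeasurableD f g : cmeasurable f -> cmeasurable g -> cmeasurable (fun w => f w + g w).
Proof.
move=> [f1 f2] [g1 g2]; split.
  by under eq_fun do rewrite cReD; exact: measurable_funD.
by under eq_fun do rewrite cImD; exact: measurable_funD.
Qed.
Lemma cmeasurableN f : cmeasurable f -> cmeasurable (fun w => - f w).
Proof.
move=> [f1 f2]; split.
  by under eq_fun do rewrite cReN; exact: measurableT_comp.
by under eq_fun do rewrite cImN; exact: measurableT_comp.
Qed.
Lemma cmeasurableB f g : cmeasurable f -> cmeasurable g -> cmeasurable (fun w => f w - g w).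
Proof. by move=> mf mg; apply: cmeasurableD => //; exact: cmeasurableN. Qed.
Lemma cmeasurableM f g : cmeasurable f -> cmeasurable g -> cmeasurable (fun w => f w * g w).
Proof.
move=> [f1 f2] [g1 g2]; split.
  under eq_fun do rewrite cReM.
  by apply: measurable_funB; exact: measurable_funM.
under eq_fun do rewrite cImM.
by apply: measurable_funD; exact: measurable_funM.
Qed.
Lemma cmeasurable_conj f : cmeasurable f -> cmeasurable (fun w => cconj (f w)).
Proof.
move=> [f1 f2]; split.
  by under eq_fun do rewrite cRe_conj.
by under eq_fun do rewrite cIm_conj; exact: measurableT_comp.
Qed.
Lemma measurable_cabs_sq f : cmeasurable f -> measurable_fun setT (fun w => cabs (f w) ^+ 2).
Proof.
move=> [f1 f2]; under eq_fun do rewrite cabs_sq.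
by apply: measurable_funD; exact: measurable_funX.
Qed.
Lemma measurable_invr (g : T -> R) : (forall w, 0 <= g w) -> measurable_fun setT g ->
  measurable_fun setT (fun w => (g w)^-1).
Proof.
move=> g0 mg; under eq_fun do rewrite -powR_inv1//.
exact: (measurableT_comp (measurable_powR _) mg).
Qed.
Lemma measurable_sqrtr (g : T -> R) : (forall w, 0 <= g w) -> measurable_fun setT g ->
  measurable_fun setT (fun w => Num.sqrt (g w)).
Proof.
move=> g0 mg; under eq_fun do rewrite -powR12_sqrt//.
exact: (measurableT_comp (measurable_powR _) mg).
Qed.
Lemma cmeasurableV f : cmeasurable f -> cmeasurable (fun w => (f w)^-1).
Proof.
move=> mf; have [f1 f2] := mf; have mn := measurable_invr (fun w => sqr_ge0 (cabs (f w))) (measurable_cabs_sq mf); split.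
  by under eq_fun do rewrite complexV_Re; exact: measurable_funM.
under eq_fun do rewrite complexV_Im.
by apply: measurable_funM => //; exact: measurableT_comp.
Qed.
Lemma cmeasurable_sum (I : Type) (r : seq I) (Q : pred I) (F : I -> T -> R[i]) :
  (forall i, Q i -> cmeasurable (F i)) -> cmeasurable (fun w => \sum_(i <- r | Q i) F i w).
Proof.
move=> mF; elim: r => [|i r IH].
  by under eq_fun do rewrite big_nil; exact: cmeasurable_cst.
under eq_fun do rewrite big_cons.
by case Qi: (Q i) => //; apply: cmeasurableD => //; exact: mF.
Qed.
Lemma cmeasurable_prod (I : Type) (r : seq I) (Q : pred I) (F : I -> T -> R[i]) :
  (forall i, Q i -> cmeasurable (F i)) -> cmeasurable (fun w => \prod_(i <- r | Q i) F i w).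
Proof.
move=> mF; elim: r => [|i r IH].
  by under eq_fun do rewrite big_nil; exact: cmeasurable_cst.
under eq_fun do rewrite big_cons.
by case Qi: (Q i) => //; apply: cmeasurableM => //; exact: mF.
Qed.
Lemma measurable_cabs f : cmeasurable f -> measurable_fun setT (fun w => cabs (f w)).
Proof.
move=> [f1 f2]; apply: measurable_sqrtr => [w|]; first by rewrite addr_ge0 ?sqr_ge0.
by apply: measurable_funD; exact: measurable_funX.
Qed.
End ComplexMeasurable.

(** * Concentration for sums over the matrix entries *)

Section EntryConcentration.
Context {R : realType} {d : measure_display} {Om : measurableType d}
  (P : probability Om R) (n0 : nat).
Local Notation N := n0.+1.
Variable H : Om -> 'M[R[i]]_N.
Hypothesis HW : wigner_at P H.
Variables (p : nat) (C L : R).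
Hypothesis L1 : 1 <= L.
Hypothesis Hp : forall i j,
  (\int[P]_w ((Num.sqrt N%:R * cabs (H w i j)) ^+ p.+2)%:E <= C%:E)%E.
Hypothesis CL : (N * N)%:R * (3 * (C / L ^+ p) / N%:R^-1) <= 1.
Local Notation nu := (N%:R^-1 : R).
Let nu0 : 0 < nu. Proof. by rewrite invr_gt0 ltr0n. Qed.
Let nu1 : nu <= 1. Proof. by rewrite invf_le1 ?ltr0n// ler1n. Qed.
Let L0 : 0 < L. Proof. exact: lt_le_trans L1. Qed.

(** The event on which no truncation acts. The concentration statements are restricted to it, and
    its complement is paid for once, by [rare_unbounded_entries]. *)
Definition bounded_entries (w : Om) := forall i j, cabs (H w i j) ^+ 2 <= L ^+ 2 * nu.

Definition cadapted n (f : Om -> R[i]) :=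
  cmeasurable (f : g_sigma_algebraType (past H n) -> R[i]).

Let q i j w := Num.sqrt N%:R * cabs (H w i j).
Let q0 i j w : 0 <= q i j w. Proof. by rewrite mulr_ge0 ?sqrtr_ge0 ?cabs_ge0. Qed.

Lemma cmeasurable_entry i j : cmeasurable (fun w => H w i j).
Proof.
have m := measurable_entry HW i j; split.
  exact: (measurableT_comp (@measurable_fst _ _ _ _) m).
exact: (measurableT_comp (@measurable_snd _ _ _ _) m).
Qed.

Lemma cadapted_entry n (j k : 'I_N) : (maxn j k * N + minn j k < n)%N ->
  cadapted n (fun w => H w j k).
Proof.
move=> h; have m := adapted_entry HW h; split.
  exact: (measurableT_comp (@measurable_fst _ _ _ _) m).
exact: (measurableT_comp (@measurable_snd _ _ _ _) m).
Qed.

Let mq i j : measurable_fun setT (q i j).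
Proof. by apply: measurable_funM => //; apply: measurable_cabs; exact: cmeasurable_entry. Qed.

Let q_sq i j w : q i j w ^+ 2 = N%:R * cabs (H w i j) ^+ 2.
Proof. by rewrite /q exprMn sqr_sqrtr. Qed.

Lemma scaled_entry_le i j w : (q i j w <= L) = (cabs (H w i j) ^+ 2 <= L ^+ 2 * nu).
Proof.
rewrite -ler_sqr ?nnegrE ?q0 ?(ltW L0)// q_sq mulrC -ler_pdivlMr ?ltr0n//.
Qed.

Lemma rare_unbounded_entries : rare P [set w | ~ bounded_entries w] ((N * N)%:R * (C / L ^+ p)).
Proof.
have h (ij : 'I_N * 'I_N) : rare P [set w | L < q ij.1 ij.2 w] (C / L ^+ p).
  exact: (rare_tail (mq _ _) (q0 _ _) L1 (Hp _ _)).
have := rare_fin h; rewrite card_prod card_ord; apply: rareS => // w /= nb.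
apply: contrapT => ne; apply: nb => i j; rewrite -scaled_entry_le leNgt.
by apply/negP => lt; apply: ne; exists (i, j).
Qed.

(** At the times above the diagonal the variable is the constant 0, so its variance has to be 0 for
    the centred square to vanish. *)
Definition seq_variance (n : nat) : R := if (col_of n0 n <= row_of n0 n)%N then nu else 0.

(** The first alternative is meant for the centred square of the modulus, the second for the real
    and imaginary parts. *)
Lemma truncated_entry_mean (i j : 'I_N) (f : R * R -> R) : measurable_fun setT f ->
  (\int[P]_w (f (c2pair (H w i j)))%:E = 0)%E ->
  (forall w, `|f (c2pair (H w i j))| <= Num.max nu (q i j w ^+ 2)) \/
  (forall w, `|f (c2pair (H w i j))| <= q i j w) ->
  `|\int[P]_w (truncated (L ^+ 2 * nu) f (c2pair (H w i j)))| <= C / L ^+ p.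
Proof.
move=> mf f0 fb.
have mu : measurable_fun setT (fun w => f (c2pair (H w i j))).
  exact: (measurableT_comp mf (measurable_entry HW i j)).
have := @truncated_mean _ _ _ P (q i j) p C L (mq i j) (q0 i j) L1 (Hp i j) _ mu f0.
have -> : (fun w => if q i j w <= L then f (c2pair (H w i j)) else 0) =
    (fun w => truncated (L ^+ 2 * nu) f (c2pair (H w i j))).
  apply/funext => w; rewrite /truncated scaled_entry_le.
  by rewrite /sqnorm2 /c2pair /= -cabs_sq.
apply.
  move=> w; case: fb => /(_ w) /le_trans; apply.
    have := sqr_ge0 (q i j w); rewrite ge_max => h; apply/andP; split; last by lra.
    by apply: le_trans nu1 _; lra.
  by have := q0 i j w; nra.
move=> w Lq; case: fb => /(_ w) /le_trans; apply.
  rewrite ge_max lexx andbT; apply: le_trans nu1 _.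
  by rewrite expr_ge1// ?q0// (le_trans L1)// ltW.
by rewrite expr2 ler_peMl ?q0// (le_trans L1)// ltW.
Qed.

Let N1 : 1 <= Num.sqrt N%:R :> R.
Proof. by rewrite -[leLHS]sqrtr1 ler_wsqrtr// ler1n. Qed.

Lemma truncated_zero k : truncated (L ^+ 2 * nu) (fun x => sqnorm2 x - k) (0, 0) = - k.
Proof.
rewrite /truncated /sqnorm2 /= expr0n /= addr0 sub0r ifT//.
by rewrite mulr_ge0 ?sqr_ge0// ltW.
Qed.

Let CL0 : 0 <= C / L ^+ p.
Proof.
rewrite divr_ge0 ?exprn_ge0 ?(ltW L0)// -lee_fin; apply: le_trans (Hp 0 0).
by apply: integral_ge0 => w _; rewrite lee_fin exprn_ge0// q0.
Qed.

Let seq_mean (f : nat -> R * R -> R) n :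
  ((col_of n0 n <= row_of n0 n)%N ->
    `|\int[P]_w (truncated (L ^+ 2 * nu) (f n) (c2pair (H w (row_of n0 n) (col_of n0 n))))|
      <= C / L ^+ p) ->
  truncated (L ^+ 2 * nu) (f n) (0, 0) = 0 \/ (col_of n0 n <= row_of n0 n)%N ->
  `|\int[P]_w (truncated (L ^+ 2 * nu) (f n) (entry_seq H n w))| <= C / L ^+ p.
Proof.
move=> h h0; rewrite /entry_seq; case e: (col_of n0 n <= row_of n0 n)%N; first exact: h.
case: h0 => [->|]; last by rewrite e.
by rewrite Rintegral_probability_cst normr0.
Qed.

Lemma integral_sqnorm2_entry i j :
  (\int[P]_w (sqnorm2 (c2pair (H w i j)) - nu)%:E = 0)%E.
Proof.
have [_ [_ [_ [_ [_ [_ [_ Hv]]]]]]] := HW; have vE := Hv i j.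
have m2 : measurable_fun setT (fun w => cabs (H w i j) ^+ 2).
  exact/measurable_cabs_sq/cmeasurable_entry.
have I2 : P.-integrable setT (EFin \o (fun w => cabs (H w i j) ^+ 2)).
  apply/integrableP; split; first exact/measurable_EFinP.
  apply: (@le_lt_trans _ _ (nu%:E)); last by rewrite ltry.
  rewrite -vE le_eqVlt; apply/orP; left; apply/eqP.
  by apply: eq_integral => w _ /=; rewrite ger0_norm// sqr_ge0.
under eq_integral do rewrite /sqnorm2 /c2pair /= -cabs_sq.
have Ic : P.-integrable setT (EFin \o (fun=> nu)).
  by apply: (@bounded_integrable _ _ _ _ _ nu) => // w; rewrite ger0_norm// ltW.
under eq_integral do rewrite EFinB.
rewrite integralB// vE integral_cst//= probability_setT mule1.
by rewrite -EFinB subrr.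
Qed.

(** The coefficients at position $(k,j)$ may depend on everything revealed before it, including
    earlier entries of the same row; this is what brings quadratic forms in a row within reach. *)
Lemma entry_concentration (a : 'I_N -> 'I_N -> Om -> R[i]) (c : 'I_N -> 'I_N -> Om -> R) :
  (forall k j : 'I_N, (j <= k)%N -> cadapted (k * N + j) (a k j)) ->
  (forall k j : 'I_N, (j <= k)%N -> adapted (past H) (k * N + j) (c k j)) ->
  rare P [set w | [/\ 4 * L ^+ 3 <= \sum_(k < N) \sum_(j < N | (j <= k)%N)
       (cRe (a k j w * H w k j) + c k j w * (cabs (H w k j) ^+ 2 - nu)),
      \sum_(k < N) \sum_(j < N | (j <= k)%N) (nu * cabs (a k j w) ^+ 2 + nu ^+ 2 * c k j w ^+ 2) <= 1 &
      bounded_entries w]] (expR (2 - L)).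
Proof.
move=> ma mc.
pose lo n := (col_of n0 n <= row_of n0 n)%N.
pose a1 n w := if lo n then cRe (a (row_of n0 n) (col_of n0 n) w) else 0.
(* The sign comes from $\Re(ah)=\Re a\,\Re h-\Im a\,\Im h$. *)
pose a2 n w := if lo n then - cIm (a (row_of n0 n) (col_of n0 n) w) else 0.
pose c1 n w := if lo n then c (row_of n0 n) (col_of n0 n) w else 0.
have := @concentration _ _ _ P (past H) (entry_seq H) (N * N)%N (past_measurable HW)
  (@pastT _ _ _ _ H) (@pastI _ _ _ _ H) (@past_subS _ _ _ _ H) (adapted_entry_seq HW)
  (past_indep HW) nu L (C / L ^+ p) seq_variance nu0 nu1 L1 _ CL _ _ _ a1 a2 c1.
move=> /(_ _) cc; apply: rareS (lexx _) (cc _ _ _ _ _ _ _).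
- move=> w /= [h1 h2 h3]; split.
  + apply: le_trans h1 _; rewrite le_eqVlt; apply/orP; left; apply/eqP.
    pose F (k j : 'I_N) := if (j <= k)%N then cRe (a k j w * H w k j) +
       c k j w * (cabs (H w k j) ^+ 2 - nu) else 0.
    transitivity (\sum_(k < N) \sum_(j < N) F k j).
      by apply: eq_bigr => k _; rewrite [LHS]big_mkcond.
    rewrite -sum_row_col; apply: eq_bigr => n _.
    rewrite /F /a1 /a2 /c1 /seq_variance /entry_seq /lo.
    case: ifP => _; last by rewrite !mul0r !addr0.
    by rewrite cReM /sqnorm2 /= -cabs_sq mulNr.
  + apply: le_trans h2; rewrite le_eqVlt; apply/orP; left; apply/eqP.
    pose F (k j : 'I_N) := if (j <= k)%N then nu * cabs (a k j w) ^+ 2 +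
       nu ^+ 2 * c k j w ^+ 2 else 0.
    transitivity (\sum_(k < N) \sum_(j < N) F k j); last first.
      by apply: eq_bigr => k _; rewrite [RHS]big_mkcond.
    rewrite -sum_row_col; apply: eq_bigr => n _.
    rewrite /F /a1 /a2 /c1 /lo.
    case: ifP => _; last by rewrite !expr0n /= !addr0 !mulr0 addr0.
    by rewrite cabs_sq sqrrN.
  + move=> n nM; rewrite /entry_seq; case: ifP => _.
      by rewrite /sqnorm2 /= -cabs_sq; exact: h3.
    by rewrite /sqnorm2 /= expr0n /= addr0 mulr_ge0 ?sqr_ge0// ltW.
- by move=> n; rewrite /seq_variance; case: ifP => _; rewrite ?lexx ?ltW.
- have [_ [_ [_ [_ [_ [_ [Hm _]]]]]]] := HW.
  move=> n nM; apply: (seq_mean (f := fun=> fst)) => [ij|]; last first.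
    by left; rewrite /truncated /=; case: ifP.
  apply: truncated_entry_mean => //; first exact: (Hm _ _).1.
  right=> w; rewrite /c2pair /=; apply: le_trans (cRe_le _) _.
  by rewrite /q ler_peMl ?cabs_ge0.
- have [_ [_ [_ [_ [_ [_ [Hm _]]]]]]] := HW.
  move=> n nM; apply: (seq_mean (f := fun=> snd)) => [ij|]; last first.
    by left; rewrite /truncated /=; case: ifP.
  apply: truncated_entry_mean => //; first exact: (Hm _ _).2.
  right=> w; rewrite /c2pair /=; apply: le_trans (cIm_le _) _.
  by rewrite /q ler_peMl ?cabs_ge0.
- move=> n nM.
  apply: (seq_mean (f := fun n x => sqnorm2 x - seq_variance n)) => [e|]; last first.
    case e: (lo n); first by right.
    by left; rewrite truncated_zero /seq_variance -/(lo n) e oppr0.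
  rewrite /seq_variance e.
  apply: truncated_entry_mean => //.
  + by apply: measurable_funB => //; exact: measurable_sqnorm2.
  + exact: integral_sqnorm2_entry.
  + set i := row_of n0 n; set j := col_of n0 n.
    left=> w; rewrite /sqnorm2 /= -cabs_sq -/(cRe _).
    have c0 := sqr_ge0 (cabs (H w i j)).
    have : cabs (H w i j) ^+ 2 <= q i j w ^+ 2.
      by rewrite q_sq ler_peMl// ler1n.
    move=> cq; have n0' := ltW nu0; set x := cabs _ ^+ 2 in c0 cq *; set y := q _ _ _ ^+ 2 in cq *.
    rewrite le_max; case: (leP x nu) => h; apply/orP; [left|right];
      rewrite ler_norml; move: n0' c0 cq h; move: (nu) x y => nn x y *; apply/andP; split; lra.
- move=> n nM; rewrite /a1; case e: (lo n); last exact: measurable_cst.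
  by have [] := ma _ _ e; rewrite -row_col_of.
- move=> n nM; rewrite /a2; case e: (lo n); last exact: measurable_cst.
  have [_] := ma _ _ e; rewrite -row_col_of// => m2.
  exact: (measurableT_comp (@oppr_measurable R setT) m2).
- move=> n nM; rewrite /c1; case e: (lo n); last exact: measurable_cst.
  by have := mc _ _ e; rewrite -row_col_of.
Qed.
End EntryConcentration.

(** * Centred quadratic forms in a new row and their concentration *)

Lemma sum_square_split (V : nmodType) N (k : nat) (F : 'I_N -> 'I_N -> V) :
  \sum_(i < N | (i < k)%N) \sum_(j < N | (j < k)%N) F i j =
  \sum_(i < N | (i < k)%N) (F i i + \sum_(j < N | (j < i)%N) (F i j + F j i)).
Proof.
have E (i : 'I_N) : (i < k)%N -> \sum_(j < N | (j < k)%N) F i j =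
    F i i + \sum_(j < N | (j < i)%N) F i j + \sum_(j < N | (j < k)%N && (i < j)%N) F i j.
  move=> ik; rewrite (bigD1 i)//= -addrA; congr (_ + _).
  rewrite (bigID (fun j : 'I_N => (j < i)%N)) /=; congr (_ + _); apply: eq_bigl => j.
    by rewrite -(inj_eq val_inj) /=; lia.
  by rewrite -(inj_eq val_inj) /=; lia.
rewrite (eq_bigr _ E) big_split /= [X in _ + X](exchange_big_dep (fun j : 'I_N => (j < k)%N)) /=.
  rewrite -big_split /=; apply: eq_bigr => i ik; rewrite -addrA; congr (_ + _).
  rewrite big_split /=; congr (_ + _); apply: eq_bigl => j.
  by rewrite ik /=; lia.
by move=> i j _ /andP[].
Qed.

Section HilbertSchmidt.
Context {R : realType}.
Definition hs2 m n (A : 'M[R[i]]_(m, n)) : R := \sum_i \sum_j cabs (A i j) ^+ 2.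
Definition ctr m n (A : 'M[R[i]]_(m, n)) : 'M[R[i]]_(n, m) := (map_mx cconj A)^T.
Lemma ctrE m n (A : 'M[R[i]]_(m, n)) i j : ctr A i j = cconj (A j i).
Proof. by rewrite !mxE. Qed.
Lemma hs2_ge0 m n (A : 'M[R[i]]_(m, n)) : 0 <= hs2 A.
Proof. by do 2!apply: sumr_ge0 => ? _; exact: sqr_ge0. Qed.
Lemma cabs_entry_le_hs2 m n (A : 'M[R[i]]_(m, n)) i j : cabs (A i j) ^+ 2 <= hs2 A.
Proof.
rewrite /hs2 (bigD1 i)//= (bigD1 j)//= -addrA lerDl addr_ge0//.
  by apply: sumr_ge0 => ? _; exact: sqr_ge0.
by do 2!apply: sumr_ge0 => ? _; exact: sqr_ge0.
Qed.
Lemma hs2_ctr m n (A : 'M[R[i]]_(m, n)) : hs2 (ctr A) = hs2 A.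
Proof.
rewrite /hs2 exchange_big /=; apply: eq_bigr => i _; apply: eq_bigr => j _.
by rewrite ctrE cabs_conj.
Qed.
Lemma hs2Z m n (a : R[i]) (A : 'M[R[i]]_(m, n)) : hs2 (a *: A) = cabs a ^+ 2 * hs2 A.
Proof.
rewrite /hs2 mulr_sumr; apply: eq_bigr => i _; rewrite mulr_sumr; apply: eq_bigr => j _.
by rewrite mxE cabsM exprMn.
Qed.
End HilbertSchmidt.

Section RowForms.
Context {R : realType} (N : nat) (nu : R).
Implicit Types (A B : 'M[R[i]]_N) (k : 'I_N).

Definition row_below A k : 'rV[R[i]]_N := \row_j (if (j < k)%N then A k j else 0).

(** With $x$ the part of row $k$ left of the diagonal, this is a general polynomial of degree two in
    the new row. If [nu] is the variance of the entries, the subtracted trace is the conditional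
    mean of $xBx^{*}$, so the whole is centred. *)
Definition row_form A k B (al : 'cV[R[i]]_N) (be : 'rV[R[i]]_N) (ga : R[i]) : R[i] :=
  (row_below A k *m B *m ctr (row_below A k)) 0 0 - nu%:C%C * \sum_(i < N | (i < k)%N) B i i +
  (row_below A k *m al) 0 0 + (be *m ctr (row_below A k)) 0 0 + ga * A k k.

(** The row is revealed from left to right and each mixed product is charged to its later entry;
    terms in $\overline{A_{ki}}$ are conjugated, as only the real part is considered. The
    coefficient of $A_{ki}$ then depends on earlier entries only, so the quadratic form becomes a
    martingale sum along the row. *)
Definition row_coef A k B (al : 'cV[R[i]]_N) (be : 'rV[R[i]]_N) (ga : R[i]) (i : 'I_N) : R[i] :=
  if (i < k)%N then al i 0 + cconj (be 0 i) +
    \sum_(j < N | (j < i)%N) (B i j + cconj (B j i)) * cconj (A k j)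
  else ga.

Lemma row_formE A k B al be ga : row_form A k B al be ga =
  \sum_(i < N | (i < k)%N) \sum_(j < N | (j < k)%N) A k i * B i j * cconj (A k j)
  - nu%:C%C * \sum_(i < N | (i < k)%N) B i i + \sum_(i < N | (i < k)%N) A k i * al i 0 +
  \sum_(i < N | (i < k)%N) be 0 i * cconj (A k i) + ga * A k k.
Proof.
rewrite /row_form; congr (_ - _ + _ + _ + _).
- rewrite mxE exchange_big /= [RHS]big_mkcond; apply: eq_bigr => j _.
  rewrite !mxE; case: ifP => jk; last by rewrite cconj0 mulr0.
  rewrite big_distrl /= [RHS]big_mkcond; apply: eq_bigr => i _; rewrite !mxE.
  by case: ifP => //; rewrite !mul0r.
- rewrite mxE [RHS]big_mkcond; apply: eq_bigr => j _; rewrite !mxE.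
  by case: ifP => //; rewrite mul0r.
- rewrite mxE [RHS]big_mkcond; apply: eq_bigr => j _; rewrite !mxE.
  by case: ifP => //; rewrite cconj0 mulr0.
Qed.

Lemma cRe_row_form A k B al be ga : cRe (row_form A k B al be ga) =
  \sum_(j < N | (j <= k)%N) (cRe (row_coef A k B al be ga j * A k j) +
    (if (j < k)%N then cRe (B j j) else 0) * (cabs (A k j) ^+ 2 - nu)).
Proof.
rewrite row_formE [RHS](bigD1 k)//= /row_coef ltnn mul0r addr0.
rewrite sum_square_split !cReD cReN !cRe_sum cReM cRe_real cIm_real mul0r subr0 cRe_sum.
rewrite [RHS]addrC; congr (_ + _).
rewrite (eq_bigl (fun j : 'I_N => (j < k)%N)); last first.
  by move=> j; rewrite -(inj_eq val_inj) /=; lia.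
rewrite mulr_sumr -sumrB -!big_split /=; apply: eq_bigr => i ik; rewrite ik.
have -> : cRe (A k i * B i i * cconj (A k i) + \sum_(j < N | (j < i)%N)
     (A k i * B i j * cconj (A k j) + A k j * B j i * cconj (A k i))) =
    cRe (B i i) * cabs (A k i) ^+ 2 +
    cRe ((\sum_(j < N | (j < i)%N) (B i j + cconj (B j i)) * cconj (A k j)) * A k i).
  rewrite cReD; congr (_ + _).
    by rewrite cabs_sq !(cReM, cImM, cRe_conj, cIm_conj); ring.
  rewrite mulr_suml !cRe_sum; apply: eq_bigr => j _.
  by rewrite !(cReM, cImM, cRe_conj, cIm_conj, cReD, cImD); ring.
rewrite !(mulrDl, cReD).
rewrite !(cReM, cImM, cRe_conj, cIm_conj, cReD, cImD); ring.
Qed.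

Lemma row_formZ A k z B al be ga :
  row_form A k (z *: B) (z *: al) (z *: be) (z * ga) = z * row_form A k B al be ga.
Proof.
have Z m n (M : 'M[R[i]]_(m, n)) i j : (z *: M) i j = z * M i j by rewrite mxE.
rewrite /row_form -!scalemxAr -!scalemxAl !Z.
rewrite (eq_bigr (fun i => z * B i i)) => [|i _]; last exact: Z.
by rewrite -mulr_sumr; ring.
Qed.
End RowForms.

(** This reduces a bound on the modulus to four bounds on real parts, at the price of a factor 2 in
    the threshold and 4 in the probability. *)
Lemma cabs_rotation (R : realType) (z : R[i]) (t : R) : 2 * t <= cabs z ->
  exists2 u, u \in [:: 1; -1; 'i%C; - 'i%C] & t <= cRe (u * z).
Proof.
move=> tz; have := cabs_le_ReIm z => h.
have [h1|h1] := leP t (cRe z); first by exists 1; rewrite ?inE ?eqxx// mul1r.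
have [h2|h2] := leP t (- cRe z).
  by exists (-1); rewrite ?inE ?eqxx ?orbT// mulN1r cReN.
have [h3|h3] := leP t (- cIm z).
  by exists 'i%C; rewrite ?inE ?eqxx ?orbT// cReM cRe_i cIm_i mul0r mul1r sub0r.
exists (- 'i%C); rewrite ?inE ?eqxx ?orbT// mulNr cReN cReM cRe_i cIm_i mul0r mul1r sub0r opprK.
have : `|cRe z| < t by rewrite ltr_norml; apply/andP; split; lra.
case: (ger0P (cIm z)) h => _; lra.
Qed.

Section RowConcentration.
Context {R : realType} {d : measure_display} {Om : measurableType d}
  (P : probability Om R) (n0 : nat).
Local Notation N := n0.+1.
Variable H : Om -> 'M[R[i]]_N.
Hypothesis HW : wigner_at P H.
Variables (p : nat) (C L : R).
Hypothesis L1 : 1 <= L.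
Hypothesis Hp : forall i j,
  (\int[P]_w ((Num.sqrt N%:R * cabs (H w i j)) ^+ p.+2)%:E <= C%:E)%E.
Hypothesis CL : (N * N)%:R * (3 * (C / L ^+ p) / N%:R^-1) <= 1.
Local Notation nu := (N%:R^-1 : R).
Let nu0 : 0 < nu. Proof. by rewrite invr_gt0 ltr0n. Qed.
Let L0 : 0 < L. Proof. exact: lt_le_trans L1. Qed.
Local Notation cadapted := (cadapted H).
Local Notation bounded := (bounded_entries H L).

Lemma cadapted_le m n (f : Om -> R[i]) : (m <= n)%N -> (n <= N * N)%N ->
  cadapted m f -> cadapted n f.
Proof.
move=> mn nN [m1 m2]; split.
  exact: (adapted_le (@past_subS _ _ _ _ H) mn nN m1).
exact: (adapted_le (@past_subS _ _ _ _ H) mn nN m2).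
Qed.

Let ltNN (k i : 'I_N) : (k * N + i <= N * N)%N.
Proof. by have := ltn_ord k; have := ltn_ord i; nia. Qed.

(** The form is divided by its conditional standard deviation, which is known before row [k] is
    revealed, so that the variance budget is exactly 1. *)
Lemma linear_concentration (k i : 'I_N) (b : 'I_N -> Om -> R[i]) : (i <= k)%N ->
  (forall j, cadapted (k * N) (b j)) ->
  rare P [set w | 8 * L ^+ 3 * Num.sqrt (nu * \sum_(j < N | (j < i)%N) cabs (b j w) ^+ 2) <
      cabs (\sum_(j < N | (j < i)%N) b j w * cconj (H w k j)) /\ bounded w]
    (4 * expR (2 - L)).
Proof.
move=> ik mb.
pose r w : R := Num.sqrt (nu * \sum_(j < N | (j < i)%N) cabs (b j w) ^+ 2).
have s0 w : 0 <= nu * \sum_(j < N | (j < i)%N) cabs (b j w) ^+ 2.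
  by rewrite mulr_ge0 ?(ltW nu0)// sumr_ge0// => j _; exact: sqr_ge0.
(* Conjugated because $\Re(\overline{zb}\,h)=\Re(zb\,\bar h)$: the linear form contains conjugated
   entries, while [entry_concentration] does not. *)
pose a (z : R[i]) (k' j : 'I_N) w : R[i] := if (k' == k) && (j < i)%N then
  cconj (z * b j w) * ((r w)^-1)%:C%C else 0.
have mr : measurable_fun (setT : set (g_sigma_algebraType (past H (k * N)))) r.
  apply: measurable_sqrtr => //; apply: measurable_funM => //.
  rewrite (_ : (fun w => _) = (fun w => \sum_(j < N) (if (j < i)%N then cabs (b j w) ^+ 2 else 0))).
    apply: measurable_sum => j; case: (j < i)%N; last exact: measurable_cst.
    exact: (measurable_cabs_sq (mb j)).
  by apply/funext => w; rewrite big_mkcond.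
have ma z (k' j : 'I_N) : (j <= k')%N -> cadapted (k' * N + j) (a z k' j).
  move=> jk; rewrite /a; case e: (_ && _); last exact: cmeasurable_cst.
  case/andP: e => /eqP -> _.
  apply: (@cadapted_le (k * N)) => //; first by rewrite leq_addr.
  apply: cmeasurableM; first exact: (cmeasurable_conj (cmeasurableM (cmeasurable_cst z) (mb j))).
  apply: cmeasurable_real; apply: measurable_invr => // w; exact: sqrtr_ge0.
have mc (k' j : 'I_N) : (j <= k')%N -> adapted (past H) (k' * N + j) (fun _ : Om => 0 : R).
  by move=> _; exact: measurable_cst.
have := @rare_seq _ _ _ P _ [:: 1; -1; 'i%C; - 'i%C : R[i]] _ _
  (fun z _ => entry_concentration HW L1 Hp CL (ma z) mc).
apply: rareS => //= w [lt bw].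
(* If the standard deviation vanished, so would all coefficients and hence the form, against the
   strict inequality. *)
have rp : 0 < r w.
  rewrite /r sqrtr_gt0 lt_neqAle s0 andbT eq_sym; apply/eqP => e0.
  move: lt; rewrite e0 sqrtr0 mulr0 big1 ?cabs0 ?ltxx// => j ji.
  move/eqP: e0; rewrite mulf_eq0 gt_eqF//= psumr_eq0 => [|? _]; last exact: sqr_ge0.
  by move=> /allP /(_ j (mem_index_enum _)); rewrite ji /= sqrf_eq0 cabs_eq0 => /eqP ->; rewrite mul0r.
have [|z z4 hz] := @cabs_rotation _ (\sum_(j < N | (j < i)%N) b j w * cconj (H w k j))
  (4 * L ^+ 3 * r w).
  by apply: le_trans (ltW lt); rewrite /r; lra.
have z1 : cabs z = 1.
  move: z4; rewrite !inE => /or4P[] /eqP ->; by rewrite ?cabsN ?cabs1 ?cabs_i.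
exists z => //; split => //.
- rewrite (bigD1 k)//= [X in _ + X]big1 => [|k' k'k]; last first.
    by apply: big1 => j _; rewrite /a (negbTE k'k) !mul0r addr0.
  rewrite addr0 -(ler_pM2r rp); apply: le_trans hz _.
  rewrite le_eqVlt; apply/orP; left; apply/eqP.
  rewrite mulr_sumr cRe_sum mulr_suml (bigID (fun j : 'I_N => (j < i)%N) (fun j : 'I_N => (j <= k)%N)) /=.
  rewrite [X in _ = _ + X]big1 ?addr0 => [|j /andP[_ /negbTE ji]]; last first.
    by rewrite /a ji andbF !mul0r cRe0 addr0 mul0r.
  apply: eq_big => [j|j ji]; first by apply/idP/idP => [|/andP[]//]; lia.
  rewrite /a eqxx ji /= mul0r addr0 mulrA.
  set hh := H w k j; set zb := z * b j w.
  rewrite !(cReM, cImM, cRe_conj, cIm_conj, cRe_real, cIm_real).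
  by rewrite !(mulr0, addr0, subr0, add0r, oppr0) /=; field; rewrite gt_eqF.
- rewrite (bigD1 k)//= [X in _ + X]big1 => [|k' k'k]; last first.
    by apply: big1 => j _; rewrite /a (negbTE k'k) cabs0 !expr0n /= !mulr0 addr0.
  rewrite addr0 (bigID (fun j : 'I_N => (j < i)%N) (fun j : 'I_N => (j <= k)%N)) /=.
  rewrite [X in _ + X]big1 ?addr0 => [|j /andP[_ /negbTE ji]]; last first.
    by rewrite /a ji andbF cabs0 !expr0n /= !mulr0 addr0.
  rewrite (eq_big (fun j : 'I_N => (j < i)%N)
     (fun j => (nu * cabs (b j w) ^+ 2) * ((r w)^-1 ^+ 2))).
  + by rewrite -mulr_suml -mulr_sumr exprVn sqr_sqrtr// divff ?gt_eqF// -sqrtr_gt0.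
  + by move=> j; apply/idP/idP => [/andP[]//|]; lia.
  + move=> j /andP[_ ji]; rewrite /a eqxx ji /= expr0n /= mulr0 addr0 cabsM cabs_conj cabsM z1 mul1r.
    by rewrite cabs_real ger0_norm ?invr_ge0 ?sqrtr_ge0// exprMn mulrA.
Qed.

Section Real.
Variables (B : 'I_N -> Om -> 'M[R[i]]_N) (al : 'I_N -> Om -> 'cV[R[i]]_N)
  (be : 'I_N -> Om -> 'rV[R[i]]_N) (ga : 'I_N -> Om -> R[i]).
Hypothesis mB : forall (k i j : 'I_N), cadapted (k * N) (fun w => B k w i j).
Hypothesis mal : forall (k i : 'I_N), cadapted (k * N) (fun w => al k w i 0).
Hypothesis mbe : forall (k i : 'I_N), cadapted (k * N) (fun w => be k w 0 i).
Hypothesis mga : forall (k : 'I_N), cadapted (k * N) (ga k).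
Let V k w := nu ^+ 2 * hs2 (B k w) + nu * (hs2 (al k w) + hs2 (be k w) + cabs (ga k w) ^+ 2).

(** This scale turns the threshold $128L^6$ into the $4L^3$ of [entry_concentration]; the other
    factor $32L^3$ pays for the linear forms hidden in the coefficients. *)
Let s : R := (32 * L ^+ 3)^-1.
Let s0 : 0 < s. Proof. by rewrite invr_gt0 mulr_gt0// exprn_gt0. Qed.
Let a (k j : 'I_N) w := s%:C%C * row_coef (H w) k (B k w) (al k w) (be k w) (ga k w) j.
Let c (k j : 'I_N) w := s * (if (j < k)%N then cRe (B k w j j) else 0).

Let ma (k j : 'I_N) : (j <= k)%N -> cadapted (k * N + j) (a k j).
Proof.
move=> jk; apply: cmeasurableM; first exact: cmeasurable_cst.
have le f : cadapted (k * N) f -> cadapted (k * N + j) f.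
  by apply: cadapted_le => //; rewrite leq_addr.
rewrite /row_coef; case e: (j < k)%N; last exact/le/mga.
apply: cmeasurableD; first apply: cmeasurableD.
- exact/le/mal.
- by apply: cmeasurable_conj; exact/le/mbe.
apply: cmeasurable_sum => l lj; apply: cmeasurableM.
  by apply: cmeasurableD; [exact/le/mB|apply: cmeasurable_conj; exact/le/mB].
apply: cmeasurable_conj; apply: (cadapted_entry HW).
have lk : (l <= k)%N by exact: ltnW (ltn_trans lj e).
by move/maxn_idPl: (lk) => ->; move/minn_idPr: (lk) => ->; rewrite ltn_add2l.
Qed.

Let mc (k j : 'I_N) : (j <= k)%N -> adapted (past H) (k * N + j) (c k j).
Proof.
move=> jk; rewrite /c; case: (j < k)%N; last exact: measurable_cst.
apply: measurable_funM => //.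
have : cadapted (k * N + j) (fun w => B k w j j).
  by apply: (@cadapted_le (k * N)) => //; rewrite leq_addr.
by case.
Qed.

(** A coefficient contains a random linear form in earlier entries of its row. Once that form is at
    most $8L^3$ standard deviations, its square is absorbed by $s^2=1/(1024L^6)$, and the remaining
    sum is bounded by Hilbert-Schmidt norms. *)
Lemma row_coef_bound w : bounded w -> (forall (k i : 'I_N), (i < k)%N ->
    cabs (\sum_(j < N | (j < i)%N) (B k w i j + cconj (B k w j i)) * cconj (H w k j)) <=
    8 * L ^+ 3 * Num.sqrt (nu *
      \sum_(j < N | (j < i)%N) cabs (B k w i j + cconj (B k w j i)) ^+ 2)) ->
  \sum_(k < N) \sum_(j < N | (j <= k)%N) (nu * cabs (a k j w) ^+ 2 + nu ^+ 2 * c k j w ^+ 2) <=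
  \sum_k V k w.
Proof.
move=> bw lin; apply: ler_sum => k _.
have LL : 1 <= L ^+ 6 by rewrite expr_ge1// ltW.
have sE : s ^+ 2 * (1024 * L ^+ 6) = 1.
  by rewrite /s; field; rewrite gt_eqF.
have s2 : 0 < s ^+ 2 by rewrite exprn_gt0.
have s1 : 1024 * s ^+ 2 <= 1.
  have : 0 <= s ^+ 2 * (L ^+ 6 - 1) by rewrite mulr_ge0 ?subr_ge0// ltW.
  by move: sE; lra.
pose T (j : 'I_N) := cabs (al k w j 0) ^+ 2 + cabs (be k w 0 j) ^+ 2.
pose U (j : 'I_N) := \sum_(l < N) (cabs (B k w j l) ^+ 2 + cabs (B k w l j) ^+ 2).
have T0 j : 0 <= T j by rewrite addr_ge0 ?sqr_ge0.
have U0 j : 0 <= U j by apply: sumr_ge0 => l _; rewrite addr_ge0 ?sqr_ge0.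
have sq2 (x y : R[i]) : cabs (x + y) ^+ 2 <= 2 * (cabs x ^+ 2 + cabs y ^+ 2).
  have := cabsD x y; have := cabs_ge0 (x + y); have := cabs_ge0 x; have := cabs_ge0 y.
  by have := sqr_ge0 (cabs x - cabs y); nra.
have b1 (j : 'I_N) : (j < k)%N -> nu * cabs (a k j w) ^+ 2 + nu ^+ 2 * c k j w ^+ 2 <=
    nu * (T j / 4) + nu ^+ 2 * (U j / 2).
  move=> jk; rewrite /a /c /row_coef jk cabsM cabs_real (ger0_norm (ltW s0)).
  set S := \sum_(l < N | _) _.
  have hS : cabs S ^+ 2 <= 128 * L ^+ 6 * (nu * U j).
    apply: (@le_trans _ _ ((8 * L ^+ 3) ^+ 2 * (nu *
      \sum_(l < N | (l < j)%N) cabs (B k w j l + cconj (B k w l j)) ^+ 2))).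
      rewrite -[X in _ * X]sqr_sqrtr; last first.
        by rewrite mulr_ge0 ?(ltW nu0)// sumr_ge0// => l _; exact: sqr_ge0.
      rewrite -exprMn lerXn2r ?nnegrE ?cabs_ge0//; last exact: lin.
      by rewrite !mulr_ge0 ?exprn_ge0 ?sqrtr_ge0// ltW.
    have -> : (8 * L ^+ 3) ^+ 2 = 64 * L ^+ 6 by ring.
    have -> : 128 * L ^+ 6 * (nu * U j) = 64 * L ^+ 6 * (nu * (2 * U j)) by ring.
    rewrite !ler_wpM2l ?(ltW nu0)// ?mulr_ge0 ?exprn_ge0 ?(ltW L0)//.
    rewrite /U mulr_sumr [leRHS](bigID (fun l : 'I_N => (l < j)%N)) /=.
    rewrite -[leLHS]addr0 lerD//; last first.
      by apply: sumr_ge0 => l _; rewrite mulr_ge0 ?addr_ge0 ?sqr_ge0.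
    by apply: ler_sum => l _; apply: le_trans (sq2 _ _) _; rewrite cabs_conj.
  have hT : cabs (al k w j 0 + cconj (be k w 0 j) + S) ^+ 2 <= 4 * T j + 2 * cabs S ^+ 2.
    apply: le_trans (sq2 _ _) _; rewrite mulrDr lerD2r.
    have := sq2 (al k w j 0) (cconj (be k w 0 j)); rewrite cabs_conj /T; lra.
  have hB : cRe (B k w j j) ^+ 2 <= U j.
    apply: (@le_trans _ _ (cabs (B k w j j) ^+ 2)).
      by rewrite cabs_sq lerDl sqr_ge0.
    rewrite /U (bigD1 j)//= -addrA lerDl addr_ge0 ?sqr_ge0//.
    by apply: sumr_ge0 => l _; rewrite addr_ge0 ?sqr_ge0.
  rewrite !exprMn.
  have e1 : s ^+ 2 * cabs (al k w j 0 + cconj (be k w 0 j) + S) ^+ 2 <=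
      T j / 4 + nu * U j / 4.
    apply: (@le_trans _ _ (s ^+ 2 * (4 * T j + 2 * (128 * L ^+ 6 * (nu * U j))))).
      by rewrite ler_wpM2l ?(ltW s2)// (le_trans hT)// lerD2l ler_wpM2l.
    have -> : s ^+ 2 * (4 * T j + 2 * (128 * L ^+ 6 * (nu * U j))) =
      4 * s ^+ 2 * T j + s ^+ 2 * (1024 * L ^+ 6) * (nu * U j / 4) by field.
    rewrite sE mul1r mulrA lerD2r; have := T0 j; nra.
  have e2 : s ^+ 2 * cRe (B k w j j) ^+ 2 <= U j / 4.
    apply: (@le_trans _ _ (s ^+ 2 * U j)); first by rewrite ler_wpM2l ?(ltW s2).
    by have := U0 j; nra.
  have E1 := ler_wpM2l (ltW nu0) e1; have E2 := ler_wpM2l (exprn_ge0 2 (ltW nu0)) e2.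
  set x1 := s ^+ 2 * cabs _ ^+ 2 in E1 *; set x2 := s ^+ 2 * cRe _ ^+ 2 in E2 *.
  by move: E1 E2; move: (nu) x1 x2 (T j) (U j) => nn x1 x2 tj uj; lra.
rewrite (bigD1 k)//= (eq_bigl (fun j : 'I_N => (j < k)%N)); last first.
  by move=> j; rewrite andbC -(inj_eq val_inj) /= -ltn_neqAle.
apply: (@le_trans _ _ (nu * cabs (ga k w) ^+ 2 +
  \sum_(j < N) (nu * (T j / 4) + nu ^+ 2 * (U j / 2)))).
  apply: lerD.
    rewrite /a /c /row_coef ltnn mulr0 expr0n /= mulr0 addr0 cabsM cabs_real.
    rewrite (ger0_norm (ltW s0)) exprMn ler_wpM2l ?(ltW nu0)//.
    by rewrite ler_piMl ?sqr_ge0//; have := s2; lra.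
  rewrite [leRHS](bigID (fun j : 'I_N => (j < k)%N)) /= -[leLHS]addr0 lerD//.
    exact: ler_sum.
  apply: sumr_ge0 => j _; rewrite addr_ge0// mulr_ge0 ?exprn_ge0 ?(ltW nu0)//.
    by have := T0 j; lra.
  by have := U0 j; lra.
rewrite big_split /= -!mulr_sumr -!mulr_suml.
have TE : \sum_(j < N) T j = hs2 (al k w) + hs2 (be k w).
  rewrite big_split /=; congr (_ + _); first by apply: eq_bigr => j _; rewrite big_ord1.
  by rewrite /hs2 big_ord1.
have UE : \sum_(j < N) U j = 2 * hs2 (B k w).
  rewrite /U /hs2; under eq_bigr do rewrite big_split.
  by rewrite big_split /= [X in _ + X]exchange_big /=; ring.
rewrite TE UE /V.
have := hs2_ge0 (al k w); have := hs2_ge0 (be k w); have := nu0.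
have -> : 2 * hs2 (B k w) / 2 = hs2 (B k w) by field.
set x := hs2 (al k w); set y := hs2 (be k w) => nn y0 x0.
have : 0 <= nu * (x + y) by rewrite mulr_ge0 ?addr_ge0// ltW.
by move: nn y0 x0; move: (nu) x y (hs2 _) (cabs _) => n' x' y' b' g'; lra.
Qed.

(** Either one of the at most $N^2$ linear forms exceeds its bound, or the coefficients respect the
    variance budget and the entrywise concentration applies. *)
Lemma row_concentration_real :
  rare P [set w | [/\ 128 * L ^+ 6 <= cRe (\sum_k
        row_form nu (H w) k (B k w) (al k w) (be k w) (ga k w)),
      \sum_k V k w <= 1 & bounded w]] ((1 + 4 * (N * N)%:R) * expR (2 - L)).
Proof.
pose lin (ki : 'I_N * 'I_N) := [set w | (ki.2 < ki.1)%N /\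
  8 * L ^+ 3 * Num.sqrt (nu * \sum_(j < N | (j < ki.2)%N)
      cabs (B ki.1 w ki.2 j + cconj (B ki.1 w j ki.2)) ^+ 2) <
      cabs (\sum_(j < N | (j < ki.2)%N) (B ki.1 w ki.2 j + cconj (B ki.1 w j ki.2)) *
         cconj (H w ki.1 j)) /\ bounded w].
have rl ki : rare P (lin ki) (4 * expR (2 - L)).
  case: (ltnP ki.2 ki.1) => h; last first.
    apply: rareS (rare0 P); last by rewrite mulr_ge0 ?expR_ge0.
    by move=> w []; rewrite ltnNge h.
  apply: rareS (lexx _) (@linear_concentration ki.1 ki.2
    (fun j w => B ki.1 w ki.2 j + cconj (B ki.1 w j ki.2)) (ltnW h) _); first by move=> w [].
  by move=> j; apply: cmeasurableD; [exact: mB|apply: cmeasurable_conj; exact: mB].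
have := rareU (entry_concentration HW L1 Hp CL ma mc) (rare_fin rl).
rewrite card_prod card_ord; apply: rareS; last first.
  by rewrite le_eqVlt; apply/orP; left; apply/eqP; ring.
move=> w /= [h1 h2 bw]; apply: contrapT => /not_orP[n1 n2]; apply: n1; split => //.
  apply: (@le_trans _ _ (s * (128 * L ^+ 6))).
    by rewrite /s le_eqVlt; apply/orP; left; apply/eqP; field; rewrite gt_eqF.
  apply: (@le_trans _ _ (s * cRe (\sum_k
        row_form nu (H w) k (B k w) (al k w) (be k w) (ga k w)))).
    by rewrite ler_wpM2l// ltW.
  rewrite cRe_sum mulr_sumr le_eqVlt; apply/orP; left; apply/eqP.
  apply: eq_bigr => k _; rewrite cRe_row_form mulr_sumr; apply: eq_bigr => j _.
  rewrite /a /c !(cReM, cImM) cRe_real cIm_real; ring.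
apply: le_trans h2; apply: row_coef_bound => // k i ik.
rewrite leNgt; apply/negP => lt; apply: n2; exists (k, i); split => //.
Qed.
End Real.

Theorem row_concentration (B : 'I_N -> Om -> 'M[R[i]]_N) (al : 'I_N -> Om -> 'cV[R[i]]_N)
  (be : 'I_N -> Om -> 'rV[R[i]]_N) (ga : 'I_N -> Om -> R[i]) :
  (forall (k i j : 'I_N), cadapted (k * N) (fun w => B k w i j)) ->
  (forall (k i : 'I_N), cadapted (k * N) (fun w => al k w i 0)) ->
  (forall (k i : 'I_N), cadapted (k * N) (fun w => be k w 0 i)) ->
  (forall (k : 'I_N), cadapted (k * N) (ga k)) ->
  rare P [set w | [/\ 256 * L ^+ 6 <= cabs (\sum_k
        row_form nu (H w) k (B k w) (al k w) (be k w) (ga k w)),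
      \sum_k (nu ^+ 2 * hs2 (B k w) +
        nu * (hs2 (al k w) + hs2 (be k w) + cabs (ga k w) ^+ 2)) <= 1 &
      bounded w]] (20 * (N * N)%:R * expR (2 - L)).
Proof.
move=> mB mal mbe mga.
have h (z : R[i]) : rare P [set w | [/\ 128 * L ^+ 6 <= cRe (\sum_k
        row_form nu (H w) k (z *: B k w) (z *: al k w) (z *: be k w) (z * ga k w)),
      \sum_k (nu ^+ 2 * hs2 (z *: B k w) +
        nu * (hs2 (z *: al k w) + hs2 (z *: be k w) + cabs (z * ga k w) ^+ 2)) <= 1 &
      bounded w]] ((1 + 4 * (N * N)%:R) * expR (2 - L)).
  have mz n (f : Om -> R[i]) : cadapted n f -> cadapted n (fun w => z * f w).
    by move=> mf; exact: (cmeasurableM (cmeasurable_cst z) mf).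
  apply: (@row_concentration_real (fun k w => z *: B k w) (fun k w => z *: al k w)
    (fun k w => z *: be k w) (fun k w => z * ga k w)) => [k i j|k i|k i|k].
  - by under eq_fun do rewrite mxE; exact: mz.
  - by under eq_fun do rewrite mxE; exact: mz.
  - by under eq_fun do rewrite mxE; exact: mz.
  - exact: mz.
have := @rare_seq _ _ _ P _ [:: 1; -1; 'i%C; - 'i%C : R[i]] _ _ (fun z _ => h z).
apply: rareS => [w /= [h1 h2 bw]|]; last first.
  rewrite /= mulrA ler_wpM2r ?expR_ge0//.
  have : 1 <= (N * N)%:R :> R by rewrite ler1n muln_gt0.
  lra.
have [|z z4 hz] := @cabs_rotation _ (\sum_k
        row_form nu (H w) k (B k w) (al k w) (be k w) (ga k w)) (128 * L ^+ 6).
  by apply: le_trans h1; lra.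
have z1 : cabs z = 1.
  move: z4; rewrite !inE => /or4P[] /eqP ->; by rewrite ?cabsN ?cabs1 ?cabs_i.
exists z => //; split => //.
  apply: le_trans hz _; rewrite mulr_sumr le_eqVlt; apply/orP; left; apply/eqP.
  by congr cRe; apply: eq_bigr => k _; rewrite row_formZ.
apply: le_trans h2; rewrite le_eqVlt; apply/orP; left; apply/eqP.
by apply: eq_bigr => k _; rewrite !hs2Z cabsM z1 expr1n !mul1r.
Qed.
End RowConcentration.

(** * Green functions of the minors *)

Section Adjoint.
Context {R : realType}.
Lemma ctrK m n (A : 'M[R[i]]_(m, n)) : ctr (ctr A) = A.
Proof. by apply/matrixP => i j; rewrite !ctrE cconjK. Qed.
Lemma ctrM m n l (A : 'M[R[i]]_(m, n)) (B : 'M[R[i]]_(n, l)) :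
  ctr (A *m B) = ctr B *m ctr A.
Proof.
apply/matrixP => i j; rewrite ctrE !mxE cconj_sum; apply: eq_bigr => k _.
by rewrite !ctrE cconjM mulrC.
Qed.
Lemma ctrD m n (A B : 'M[R[i]]_(m, n)) : ctr (A + B) = ctr A + ctr B.
Proof. by apply/matrixP => i j; rewrite !(ctrE, mxE) cconjD. Qed.
Lemma ctrN m n (A : 'M[R[i]]_(m, n)) : ctr (- A) = - ctr A.
Proof. by apply/matrixP => i j; rewrite !(ctrE, mxE) cconjN. Qed.
Lemma ctrB m n (A B : 'M[R[i]]_(m, n)) : ctr (A - B) = ctr A - ctr B.
Proof. by rewrite ctrD ctrN. Qed.
Lemma ctrZ m n a (A : 'M[R[i]]_(m, n)) : ctr (a *: A) = cconj a *: ctr A.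
Proof. by apply/matrixP => i j; rewrite !(ctrE, mxE) cconjM. Qed.
Lemma ctr_scalar n a : ctr (a%:M : 'M[R[i]]_n) = (cconj a)%:M.
Proof. by apply/matrixP => i j; rewrite !(ctrE, mxE) eq_sym; case: eqP; rewrite ?cconj0. Qed.

Lemma mxtrace_ctr_mul m n (A : 'M[R[i]]_(m, n)) : \tr (ctr A *m A) = (hs2 A)%:C%C.
Proof.
rewrite /mxtrace /hs2 exchange_big /= rmorph_sum; apply: eq_bigr => i _.
rewrite mxE rmorph_sum; apply: eq_bigr => j _.
by rewrite ctrE mulrC mul_cconj.
Qed.

Lemma mxtrace_cauchy_schwarz m n (A : 'M[R[i]]_(m, n)) (B : 'M[R[i]]_(n, m)) :
  cabs (\tr (A *m B)) ^+ 2 <= hs2 A * hs2 B.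
Proof.
have -> : \tr (A *m B) = \sum_(p : 'I_m * 'I_n) A p.1 p.2 * B p.2 p.1.
  rewrite -(pair_bigA _ (fun i j => A i j * B j i)) /=.
  by apply: eq_bigr => i _; rewrite mxE.
apply: le_trans (cauchy_schwarz _ _) _.
rewrite /hs2 [X in _ <= _ * X]exchange_big /= !pair_big /=; exact: lexx.
Qed.

Lemma hs2_eq0 m n (A : 'M[R[i]]_(m, n)) : hs2 A = 0 -> A = 0.
Proof.
move=> h; apply/matrixP => i j; have := cabs_entry_le_hs2 A i j.
by rewrite h mxE => h2; apply/eqP; rewrite -cabs_eq0 -sqrf_eq0 eq_le h2 sqr_ge0.
Qed.

Lemma cauchy_schwarz_sqrt m n (A : 'M[R[i]]_(m, n)) (B : 'M[R[i]]_(n, m)) :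
  cabs (\tr (A *m B)) <= Num.sqrt (hs2 A) * Num.sqrt (hs2 B).
Proof.
rewrite -ler_sqr ?nnegrE ?cabs_ge0 ?mulr_ge0 ?sqrtr_ge0//.
by rewrite exprMn (sqr_sqrtr (hs2_ge0 A)) (sqr_sqrtr (hs2_ge0 B)); exact: mxtrace_cauchy_schwarz.
Qed.
End Adjoint.

Section Resolvent.
Context {R : realType} (N : nat) (A : 'M[R[i]]_N).
Hypothesis Ah : ctr A = A.

Definition proj_below (k : nat) : 'M[R[i]]_N := \matrix_(i, j) (if (i == j) && (i < k)%N then 1 else 0).
(** The shift acts on the whole space, not only on the block, so that the padded matrix stays
    invertible. *)
Definition shifted_minor (k : nat) (z : R[i]) : 'M[R[i]]_N :=
  proj_below k *m A *m proj_below k - z%:M.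
(* The Green function of the upper left [k x k] minor, padded with zeros; it is written
   with the adjugate so that it is defined (and measurable) without any invertibility. *)
Definition green (k : nat) (z : R[i]) : 'M[R[i]]_N :=
  (\det (shifted_minor k z))^-1 *: (proj_below k *m \adj (shifted_minor k z)).

Lemma mul_proj_below m k (B : 'M[R[i]]_(N, m)) i j :
  (proj_below k *m B) i j = if (i < k)%N then B i j else 0.
Proof.
rewrite mxE (bigD1 i)//= mxE eqxx /= big1 => [|l li]; last first.
  by rewrite mxE eq_sym (negbTE li) mul0r.
by case: ifP => _; rewrite ?mul1r ?mul0r addr0.
Qed.

Lemma proj_below_idem k : proj_below k *m proj_below k = proj_below k.
Proof.
apply/matrixP => i j; rewrite mul_proj_below mxE.
by case: (i < k)%N; rewrite ?andbF.
Qed.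

Lemma ctr_proj_below k : ctr (proj_below k) = proj_below k.
Proof.
apply/matrixP => i j; rewrite ctrE !mxE eq_sym.
case: eqP => [->|_]; last by rewrite [LHS]cconj0.
by case: (_ < k)%N; [rewrite [LHS]cconj1|rewrite [LHS]cconj0].
Qed.

Lemma shifted_minor_proj k z : proj_below k *m shifted_minor k z = shifted_minor k z *m proj_below k.
Proof.
rewrite /shifted_minor mulmxBr mulmxBl !mulmxA proj_below_idem -!mulmxA proj_below_idem.
by rewrite scalar_mxC.
Qed.

Lemma shifted_minor_projE k z :
  proj_below k *m shifted_minor k z = proj_below k *m (A - z%:M) *m proj_below k.
Proof.
rewrite /shifted_minor !mulmxBr mulmxBl !mulmxA proj_below_idem; congr (_ - _).
by rewrite -[RHS]mulmxA -scalar_mxC mulmxA proj_below_idem.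
Qed.

(** For a null vector [u] the quadratic form of a Hermitian matrix, which is real, would equal
    $z\|u\|^2$, whose imaginary part is positive unless $u=0$. *)
Lemma shifted_minor_unit k z : 0 < cIm z -> shifted_minor k z \in unitmx.
Proof.
move=> z0; rewrite unitmxE unitfE; apply/det0P => -[u u0 uM].
have := congr1 (fun X => \tr (X *m ctr u)) uM.
rewrite mul0mx raddf0 /shifted_minor mulmxBr mulmxBl raddfB /=.
set B := proj_below k *m A *m proj_below k.
have hB : ctr B = B by rewrite /B !ctrM ctr_proj_below Ah mulmxA.
move: B hB => B hB; have r : cIm (\tr (u *m B *m ctr u)) = 0.
  have : ctr (u *m B *m ctr u) = u *m B *m ctr u by rewrite !ctrM ctrK hB mulmxA.
  move=> /(congr1 (fun M => cIm (\tr M))) /=.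
  have -> : \tr (ctr (u *m B *m ctr u)) = cconj (\tr (u *m B *m ctr u)).
    by rewrite /mxtrace cconj_sum; apply: eq_bigr => i _; rewrite ctrE.
  by rewrite cIm_conj => h; lra.
have -> : \tr (u *m z%:M *m ctr u) = z * (hs2 (ctr u))%:C%C.
  by rewrite mul_mx_scalar -scalemxAl mxtraceZ -{1}(ctrK u) mxtrace_ctr_mul.
move=> /(congr1 cIm); rewrite cImB r cImM cRe_real cIm_real mulr0 !add0r.
move=> /eqP; rewrite oppr_eq0 mulf_eq0 (gt_eqF z0) /= => /eqP /hs2_eq0 h.
by move/eqP: u0; apply; rewrite -(ctrK u) h; apply/matrixP => i j; rewrite ctrE !mxE cconj0.
Qed.

Lemma greenE k z : 0 < cIm z -> green k z = proj_below k *m invmx (shifted_minor k z).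
Proof.
by move=> z0; rewrite /green /invmx shifted_minor_unit// scalemxAr.
Qed.

Lemma invmx_proj k z : 0 < cIm z ->
  proj_below k *m invmx (shifted_minor k z) = invmx (shifted_minor k z) *m proj_below k.
Proof.
move=> z0; have U := shifted_minor_unit k z0.
have e : shifted_minor k z *m (proj_below k *m invmx (shifted_minor k z)) = proj_below k.
  by rewrite mulmxA -shifted_minor_proj -mulmxA mulmxV// mulmx1.
by rewrite -[LHS](mulKmx U) e.
Qed.

Lemma proj_green k z : 0 < cIm z -> proj_below k *m green k z = green k z.
Proof. by move=> z0; rewrite greenE// mulmxA proj_below_idem. Qed.

Lemma green_proj k z : 0 < cIm z -> green k z *m proj_below k = green k z.
Proof. by move=> z0; rewrite greenE// invmx_proj// -mulmxA proj_below_idem. Qed.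

Lemma mul_green k z : 0 < cIm z -> proj_below k *m (A - z%:M) *m green k z = proj_below k.
Proof.
move=> z0; rewrite greenE// mulmxA -shifted_minor_projE -mulmxA.
by rewrite mulmxV ?shifted_minor_unit// mulmx1.
Qed.

Lemma green_mul k z : 0 < cIm z -> green k z *m (A - z%:M) *m proj_below k = proj_below k.
Proof.
move=> z0; rewrite -green_proj// -!mulmxA [proj_below k *m (_ *m _)]mulmxA -shifted_minor_projE.
rewrite shifted_minor_proj greenE// invmx_proj// -!mulmxA [proj_below k *m (_ *m _)]mulmxA.
rewrite shifted_minor_proj -[(_ *m _) *m proj_below k]mulmxA proj_below_idem.
by rewrite mulmxA mulVmx ?shifted_minor_unit// mul1mx.
Qed.

Lemma green_uniq k z X : 0 < cIm z -> proj_below k *m X = X ->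
  proj_below k *m (A - z%:M) *m X = proj_below k -> X = green k z.
Proof.
move=> z0 pX hX.
have : green k z *m (A - z%:M) *m X = X by rewrite -pX mulmxA green_mul// pX.
move=> <-; rewrite -(green_proj k z0) -[in LHS](mulmxA (green k z)) -mulmxA hX.
by rewrite green_proj.
Qed.

Lemma ctr_green_mul k z : 0 < cIm z ->
  ctr (green k z) *m (A - (cconj z)%:M) *m proj_below k = proj_below k.
Proof.
move=> z0; have := congr1 (@ctr _ _ _) (mul_green k z0).
by rewrite !ctrM ctr_proj_below ctrB Ah ctr_scalar mulmxA.
Qed.

Lemma mul_ctr_green k z : 0 < cIm z ->
  proj_below k *m (A - (cconj z)%:M) *m ctr (green k z) = proj_below k.
Proof.
move=> z0; have := congr1 (@ctr _ _ _) (green_mul k z0).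
by rewrite !ctrM ctr_proj_below ctrB Ah ctr_scalar mulmxA.
Qed.

Lemma ctr_green_proj k z : 0 < cIm z -> ctr (green k z) *m proj_below k = ctr (green k z).
Proof. by move=> z0; rewrite -[in RHS]proj_green// ctrM ctr_proj_below. Qed.
Lemma proj_ctr_green k z : 0 < cIm z -> proj_below k *m ctr (green k z) = ctr (green k z).
Proof. by move=> z0; rewrite -[in RHS]green_proj// ctrM ctr_proj_below. Qed.

Let sub_shift m (B C : 'M[R[i]]_m) (M : 'M[R[i]]_m) a b :
  B *m (M - a%:M) *m C - B *m (M - b%:M) *m C = (b - a) *: (B *m C).
Proof.
rewrite -mulmxBl -mulmxBr opprB [_ + (_ - M)]addrC addrA subrK -raddfB /=.
by rewrite mul_mx_scalar -scalemxAl.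
Qed.

(** The Ward identity. Both sides come from sandwiching the difference of the two shifts of [A]
    between the adjoint Green function and the Green function. *)
Lemma ward_l k z : 0 < cIm z ->
  green k z - ctr (green k z) = (z - cconj z) *: (ctr (green k z) *m green k z).
Proof.
move=> z0; rewrite -(sub_shift _ _ A); congr (_ - _).
  by rewrite -[X in _ = _ *m X](proj_green k z0) mulmxA ctr_green_mul// proj_green.
rewrite -[X in _ = X *m _ *m _](ctr_green_proj k z0) -!mulmxA [proj_below k *m _]mulmxA.
by rewrite mul_green// ctr_green_proj.
Qed.

Lemma ward_r k z : 0 < cIm z ->
  green k z - ctr (green k z) = (z - cconj z) *: (green k z *m ctr (green k z)).
Proof.
move=> z0; rewrite -(sub_shift _ _ A); congr (_ - _).
  rewrite -[X in _ = X *m _ *m _](green_proj k z0) -!mulmxA [proj_below k *m _]mulmxA.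
  by rewrite mul_ctr_green// green_proj.
by rewrite -[X in _ = _ *m X](proj_ctr_green k z0) mulmxA green_mul// proj_ctr_green.
Qed.

Lemma resolvent_identity k z u : 0 < cIm z -> 0 < cIm u ->
  green k z - green k u = (z - u) *: (green k z *m green k u).
Proof.
move=> z0 u0; rewrite -(sub_shift _ _ A); congr (_ - _).
  rewrite -[X in _ = X *m _ *m _](green_proj k z0) -!mulmxA [proj_below k *m _]mulmxA.
  by rewrite mul_green// green_proj.
by rewrite -[X in _ = _ *m X](proj_green k u0) mulmxA green_mul// proj_green.
Qed.

(** The form of the Ward identity used throughout: a Hilbert-Schmidt norm is read off from an
    imaginary part, which is far smaller than the bound by the operator norm. *)
Lemma hs2_green k z p (B : 'M[R[i]]_(N, p)) : 0 < cIm z ->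
  cIm z * hs2 (green k z *m B) = cIm (\tr (ctr B *m green k z *m B)).
Proof.
move=> z0; move: (ward_l k z0); move: (green k z) => G.
move/(congr1 (fun X => cIm (\tr (ctr B *m X *m B)))).
rewrite /= mulmxBr mulmxBl raddfB /= -scalemxAr -scalemxAl mxtraceZ.
have -> : ctr B *m (ctr G *m G) *m B = ctr (G *m B) *m (G *m B).
  by rewrite ctrM !mulmxA.
have -> : \tr (ctr B *m ctr G *m B) = cconj (\tr (ctr B *m G *m B)).
  rewrite /mxtrace cconj_sum; apply: eq_bigr => i _.
  by rewrite -ctrE !ctrM ctrK mulmxA.
rewrite mxtrace_ctr_mul cImB cIm_conj cImM cRe_real cIm_real mulr0 add0r cImB cIm_conj.
by lra.
Qed.

(** Comparing the two Ward identities shows that the Green function is a normal matrix. *)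
Lemma hs2_ctr_green k z p (B : 'M[R[i]]_(N, p)) : 0 < cIm z ->
  hs2 (ctr (green k z) *m B) = hs2 (green k z *m B).
Proof.
move=> z0; apply: complexI; rewrite -!mxtrace_ctr_mul; congr (\tr _).
move: (ward_l k z0); rewrite (ward_r _ z0); move: (green k z) => G h.
have {}h : G *m ctr G = ctr G *m G.
  have zz : z - cconj z != 0.
    rewrite -cabs_gt0; apply: lt_le_trans (cIm_ub _).
    by rewrite cImB cIm_conj; lra.
  by have := congr1 (fun X => (z - cconj z)^-1 *: X) h; rewrite /= !scalerA mulVf// !scale1r.
by rewrite !ctrM ctrK -!mulmxA [G *m _]mulmxA h !mulmxA.
Qed.

(** The bound $\|G\|\le 1/\Im z$, obtained from the Ward identity and Cauchy-Schwarz without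
    spectral theory. *)
Lemma hs2_green_le k z p (B : 'M[R[i]]_(N, p)) : 0 < cIm z ->
  cIm z ^+ 2 * hs2 (green k z *m B) <= hs2 B.
Proof.
move=> z0; set X := hs2 (green k z *m B); set Y := hs2 B.
have X0 : 0 <= X by exact: hs2_ge0.
have Y0 : 0 <= Y by exact: hs2_ge0.
have h : cIm z * X <= Num.sqrt Y * Num.sqrt X.
  rewrite hs2_green// -mulmxA; apply: le_trans (cIm_ub _) _.
  by apply: le_trans (cauchy_schwarz_sqrt _ _) _; rewrite hs2_ctr.
have [X1|X1] := eqVneq X 0; first by rewrite X1 mulr0.
have Xp : 0 < X by rewrite lt_neqAle eq_sym X1.
have : (cIm z * X) ^+ 2 <= Y * X.
  apply: (@le_trans _ _ ((Num.sqrt Y * Num.sqrt X) ^+ 2)).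
    by rewrite lerXn2r// nnegrE mulr_ge0 ?sqrtr_ge0// ltW.
  by rewrite exprMn !sqr_sqrtr.
by rewrite exprMn [X ^+ 2]expr2 mulrA ler_pM2r.
Qed.
End Resolvent.

(** * The Schur complement: adding one row and column *)

Section GreenStep.
Context {R : realType} (N : nat) (A : 'M[R[i]]_N).
Hypothesis Ah : ctr A = A.
Variables (k : 'I_N) (z : R[i]).
Hypothesis z0 : 0 < cIm z.
Let x := row_below A k.
Let e : 'cV[R[i]]_N := delta_mx k 0.
Let f : 'rV[R[i]]_N := delta_mx 0 k.
Let G := green A k z.
Let p := @proj_below R N k.

(** The last diagonal entry of the Green function of the enlarged minor. *)
Definition green_diag : R[i] := (A k k - z - (x *m G *m ctr x) 0 0)^-1.

Lemma mul_proj_below_r m (B : 'M[R[i]]_(m, N)) l i j :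
  (B *m @proj_below R N l) i j = if (j < l)%N then B i j else 0.
Proof.
have -> : B *m @proj_below R N l = ctr (@proj_below R N l *m ctr B).
  by rewrite ctrM ctrK ctr_proj_below.
by rewrite ctrE mul_proj_below; case: ifP; rewrite ?cconj0// ctrE cconjK.
Qed.

Lemma proj_belowS : @proj_below R N k.+1 = p + e *m f.
Proof.
apply/matrixP => i j; rewrite mul_delta_mx !mxE ltnS leq_eqVlt.
case: (eqVneq i j) => [->|ij] /=; last first.
  by case: eqP => [ik|_] /=; rewrite ?add0r//; case: eqP => // jk; case/eqP: ij; rewrite ik jk.
rewrite andbb (inj_eq val_inj); case: eqP => [->|_] /=; last by rewrite addr0.
by rewrite ltnn add0r.
Qed.

Lemma Im_quadratic : cIm ((x *m G *m ctr x) 0 0) = cIm z * hs2 (G *m ctr x).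
Proof. by rewrite hs2_green// ctrK /mxtrace big_ord1. Qed.

(** By the Ward identity the quadratic form has nonnegative imaginary part and $A_{kk}$ is real, so
    the Schur denominator cannot vanish. *)
Lemma green_denom_Im : cIm (A k k - z - (x *m G *m ctr x) 0 0) <= - cIm z.
Proof.
have r : cIm (A k k) = 0.
  have := congr1 (fun M : 'M[R[i]]_N => cIm (M k k)) Ah; rewrite /= ctrE cIm_conj => h; lra.
rewrite !cImB r Im_quadratic sub0r gerDl oppr_le0 mulr_ge0 ?hs2_ge0//.
exact: ltW.
Qed.

Lemma green_denom_neq0 : A k k - z - (x *m G *m ctr x) 0 0 != 0.
Proof.
have := green_denom_Im; apply: contraTN => /eqP ->; rewrite cIm0 -ltNge oppr_lt0.
exact: z0.
Qed.

Let pe : p *m e = 0.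
Proof.
apply/matrixP => i j; rewrite mul_proj_below !mxE.
by case: (eqVneq i k) => [->|_]; rewrite ?ltnn//; case: (_ < _)%N.
Qed.
Let fp : f *m p = 0.
Proof.
apply/matrixP => i j; rewrite mul_proj_below_r !mxE.
by case: (eqVneq j k) => [->|_]; rewrite ?ltnn ?andbF//; case: (_ < _)%N.
Qed.
Let xp : x *m p = x.
Proof. by apply/matrixP => i j; rewrite mul_proj_below_r !mxE; case: (_ < _)%N. Qed.
Let px : p *m ctr x = ctr x.
Proof. by rewrite -[in RHS]xp ctrM ctr_proj_below. Qed.
Let Ge : G *m e = 0.
Proof. by rewrite -[G](green_proj Ah)// -mulmxA pe mulmx0. Qed.
Let fG : f *m G = 0.
Proof. by rewrite -[G](proj_green Ah)// mulmxA fp mul0mx. Qed.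
Let fe : f *m e = 1%:M.
Proof. by apply/matrixP => i j; rewrite mul_delta_mx !ord1 !mxE. Qed.
Let xe : x *m e = 0.
Proof. by rewrite -xp -mulmxA pe mulmx0. Qed.
Let fx : f *m ctr x = 0.
Proof. by rewrite -px mulmxA fp mul0mx. Qed.

Lemma minor_step : @proj_below R N k.+1 *m (A - z%:M) *m @proj_below R N k.+1 =
  p *m (A - z%:M) *m p + e *m x + ctr x *m f + (A k k - z) *: (e *m f).
Proof.
apply/matrixP => i j; rewrite mul_proj_below_r mul_proj_below.
rewrite [in RHS]mxE [X in _ = X + _]mxE [X in _ = X + _ + _]mxE mul_proj_below_r mul_proj_below.
rewrite mul_delta_mx [X in _ = _ + X]mxE [delta_mx _ _ _ _]mxE.
have -> : (e *m x) i j = if i == k then x 0 j else 0.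
  rewrite mxE big_ord1 !mxE eqxx andbT.
  by case: (i == k); rewrite ?mul1r ?mul0r.
have -> : (ctr x *m f) i j = if j == k then cconj (x 0 i) else 0.
  rewrite mxE big_ord1 ctrE !mxE eqxx /=.
  by case: (j == k); rewrite ?mulr1 ?mulr0.
have L (l : 'I_N) : (l < k.+1)%N = (l == k) || (l < k)%N.
  by rewrite ltnS leq_eqVlt -(inj_eq val_inj).
have Aji : cconj (A k i) = A i k by rewrite -ctrE Ah.
rewrite !L /x !mxE.
have [->|ik] := eqVneq i k; have [->|jk] := eqVneq j k;
  rewrite ?ltnn ?orTb ?orFb ?cconj0 ?eqxx.
- by rewrite mulr1n mulr1 !add0r.
- rewrite andbF mulr0n subr0 mulr0 !addr0.
  by case: (j < k)%N; rewrite ?add0r ?addr0.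
- rewrite (negbTE ik) andFb !mulr0n subr0 mulr0 addr0.
  by case: (i < k)%N; rewrite !add0r ?cconj0.
- by rewrite andFb mulr0 !addr0.
Qed.

(** The right-hand side is checked to be supported on the larger block and to invert the shifted
    minor there; [green_uniq] then identifies it. *)
Theorem green_step : green A k.+1 z = G + green_diag *: ((e - G *m ctr x) *m (f - x *m G)).
Proof.
set X := G + _.
have pX : @proj_below R N k.+1 *m X = X.
  rewrite /X proj_belowS mulmxDr.
  have -> : (p + e *m f) *m G = G.
    by rewrite mulmxDl [p *m G](proj_green Ah)// -mulmxA fG mulmx0 addr0.
  rewrite -scalemxAr mulmxA.
  have -> : (p + e *m f) *m (e - G *m ctr x) = e - G *m ctr x; last by [].
  rewrite mulmxDl !mulmxBr pe [p *m _]mulmxA [p *m G](proj_green Ah)// -[e *m f *m e]mulmxA.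
  by rewrite fe mulmx1 mulmxA -[e *m f *m G]mulmxA fG mulmx0 mul0mx subr0 sub0r addrC.
apply/esym/(green_uniq Ah) => //.
rewrite -pX mulmxA minor_step /X mulmxDr.
set M1 := _ + (A k k - z) *: _.
set y := f - x *m G.
have M1G : M1 *m G = p + e *m (x *m G).
  rewrite /M1 !mulmxDl -[_ *m p *m G]mulmxA [p *m G](proj_green Ah)// mul_green//.
  rewrite -[ctr x *m f *m G]mulmxA fG mulmx0 addr0 -scalemxAl -[e *m f *m G]mulmxA fG.
  by rewrite mulmx0 scaler0 addr0 -mulmxA.
have M1e : M1 *m e = ctr x + (A k k - z) *: e.
  rewrite /M1 !mulmxDl -[_ *m p *m e]mulmxA pe mulmx0 -[e *m x *m e]mulmxA xe mulmx0.
  by rewrite !add0r -[ctr x *m f *m e]mulmxA fe mulmx1 -scalemxAl -[e *m f *m e]mulmxA fe mulmx1.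
have M1x : M1 *m (e - G *m ctr x) = (A k k - z - (x *m G *m ctr x) 0 0) *: e.
  rewrite mulmxBr M1e mulmxA M1G mulmxDl px -[e *m _ *m _]mulmxA.
  rewrite [X in _ - (_ + e *m X)]mx11_scalar mul_mx_scalar opprD addrACA subrr add0r.
  by rewrite -scalerBl.
rewrite M1G -[M1 *m (_ *: _)]scalemxAr [M1 *m (_ *m _)]mulmxA M1x.
rewrite -scalemxAl scalerA /green_diag mulVf ?green_denom_neq0// scale1r mulmxBr.
by rewrite proj_belowS -addrA; congr (_ + _); rewrite addrC subrK.
Qed.

Lemma green_step_trace : \tr (green A k.+1 z) =
  \tr G + green_diag * (1 + (x *m (G *m G) *m ctr x) 0 0).
Proof.
have := green_step; move: fG Ge; move: (green A k.+1 z) green_diag (G) => G1 gd G0 fG0 Ge0 ->.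
rewrite mxtraceD mxtraceZ mxtrace_mulC; congr (_ + _ * _).
rewrite mulmxBl !mulmxBr fe [f *m (G0 *m _)]mulmxA fG0 mul0mx subr0.
rewrite -[x *m G0 *m e]mulmxA Ge0 mulmx0 sub0r opprK /mxtrace big_ord1 mxE.
by congr (_ + _); [rewrite !mxE|rewrite !mulmxA].
Qed.

Lemma green_step_form (v : 'cV[R[i]]_N) : (ctr v *m green A k.+1 z *m v) 0 0 =
  (ctr v *m G *m v) 0 0 + green_diag * ((cconj (v k 0) - (ctr v *m G *m ctr x) 0 0) *
    (v k 0 - (x *m (G *m v)) 0 0)).
Proof.
have := green_step; move: (green A k.+1 z) green_diag (G) => G1 gd G0 ->.
rewrite mulmxDr mulmxDl mxE; congr (_ + _).
rewrite -scalemxAr -scalemxAl [LHS]mxE; congr (_ * _).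
have -> : ctr v *m ((e - G0 *m ctr x) *m (f - x *m G0)) *m v =
  (ctr v *m (e - G0 *m ctr x)) *m ((f - x *m G0) *m v) by rewrite !mulmxA.
rewrite [LHS]mxE big_ord1; congr (_ * _).
  rewrite mulmxBr [LHS]mxE; congr (_ + _); last by rewrite [LHS]mxE mulmxA.
  rewrite [LHS]mxE (bigD1 k)//= big1 ?addr0 => [|j jk]; last by rewrite !mxE (negbTE jk) mulr0.
  by rewrite ctrE !mxE !eqxx mulr1.
rewrite mulmxBl [LHS]mxE; congr (_ + _); last by rewrite [LHS]mxE mulmxA.
rewrite [LHS]mxE (bigD1 k)//= big1 ?addr0 => [|j jk].
  by rewrite !mxE !eqxx mul1r.
by rewrite !mxE (negbTE jk) andbF mul0r.
Qed.
End GreenStep.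

Section Helpers.
Context {R : realType}.
Lemma hs2D m n (A B : 'M[R[i]]_(m, n)) : hs2 (A + B) <= 2 * hs2 A + 2 * hs2 B.
Proof.
rewrite /hs2 !mulr_sumr -big_split /=; apply: ler_sum => i _.
rewrite !mulr_sumr -big_split /=; apply: ler_sum => j _; rewrite mxE.
have := cabsD (A i j) (B i j); have := cabs_ge0 (A i j + B i j).
have := cabs_ge0 (A i j); have := cabs_ge0 (B i j).
by have := sqr_ge0 (cabs (A i j) - cabs (B i j)); nra.
Qed.

Lemma hs2M_col_row n (u : 'cV[R[i]]_n) (w : 'rV[R[i]]_n) : hs2 (u *m w) = hs2 u * hs2 w.
Proof.
rewrite /hs2 mulr_suml; apply: eq_bigr => i _; rewrite !big_ord1 mulr_sumr.
by apply: eq_bigr => j _; rewrite mxE big_ord1 cabsM exprMn.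
Qed.

Lemma cauchy_schwarz_row_col n (w : 'rV[R[i]]_n) (u : 'cV[R[i]]_n) :
  cabs ((w *m u) 0 0) ^+ 2 <= hs2 w * hs2 u.
Proof. by have := mxtrace_cauchy_schwarz w u; rewrite {1}/mxtrace big_ord1. Qed.

Lemma sum_diag_below n k (B : 'M[R[i]]_n) : proj_below n k *m B = B ->
  \sum_(i < n | (i < k)%N) B i i = \tr B.
Proof.
move=> pB; rewrite /mxtrace big_mkcond; apply: eq_bigr => i _.
by rewrite -[in RHS]pB mul_proj_below.
Qed.

Lemma ler_of_sq (x y : R) : 0 <= y -> x ^+ 2 <= y ^+ 2 -> x <= y.
Proof.
move=> y0 h; have [x0|x0] := leP 0 x; last by apply: le_trans y0; exact: ltW.
by rewrite -ler_sqr ?nnegrE.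
Qed.
End Helpers.

(** * One step of the characteristic flow *)

Section Stage.
Context {R : realType} (N : nat) (A : 'M[R[i]]_N).
Hypothesis Ah : ctr A = A.
(** For a target value $m$, [y] is $\Im m$, [a] is $|m|$, [e] is the predicted $\Im z$, [p] is the
    loss in the concentration bounds, and [P] measures how far $y e$ exceeds [nu]. [T] combines the
    old minor with the new parameter [z1]: since [z1] is fixed by the rows before [k], [T] is known
    before row [k] is revealed. *)
Variables (k : 'I_N) (v : 'cV[R[i]]_N) (z z1 : R[i]) (nu y a e p P : R).
Hypotheses (nu0 : 0 < nu) (y0 : 0 < y) (ya : y <= a) (a1 : a <= 1) (e0 : 0 < e)
  (aey : a ^+ 2 * e <= y) (p1 : 10 ^+ 3 <= p) (Pp : 100 * p ^+ 8 <= P) (Pe : P * nu <= y * e).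
Variables G T : 'M[R[i]]_N.
Hypotheses (GE : G = green A k z) (TE : T = green A k z1).
Let w := z + nu%:C%C * \tr G.
Let mk := - w^-1.
Hypothesis z1E : z1 = z - nu%:C%C * mk.
Hypotheses (iz : 9 / 10 * e <= cIm z) (iz1 : 9 / 10 * e <= cIm z1).
Hypothesis trG : nu * cIm (\tr G) <= 11 / 10 * y.
Hypothesis aw : 98 / 100 <= a * cabs w.

Let a0 : 0 < a. Proof. exact: lt_le_trans ya. Qed.
Let p0 : 0 < p. Proof. by have := p1; lra. Qed.
Let z0 : 0 < cIm z. Proof. by apply: lt_le_trans iz; have := e0; lra. Qed.
Let z10 : 0 < cIm z1. Proof. by apply: lt_le_trans iz1; have := e0; lra. Qed.
Let psi := y * nu / e.
Let psi0 : 0 < psi. Proof. by rewrite divr_gt0// mulr_gt0. Qed.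
Let psiE : psi * e = y * nu. Proof. by rewrite /psi mulfVK// gt_eqF. Qed.
Let ae1 : a * e <= 1.
Proof.
rewrite -(ler_pM2l a0) mulr1; apply: le_trans ya; rewrite mulrA -expr2; exact: aey.
Qed.
Let p2 : 10 ^+ 6 <= p ^+ 2.
Proof.
have -> : (10 ^+ 6 : R) = (10 ^+ 3) ^+ 2 by rewrite -exprM.
by rewrite lerXn2r ?nnegrE ?(ltW p0)// exprn_ge0.
Qed.
Let p8 : p ^+ 2 <= p ^+ 8.
Proof. by rewrite ler_weXn2l//; have := p1; lra. Qed.
Let P0 : 0 < P.
Proof. by apply: lt_le_trans Pp; have := exprn_gt0 8 p0; lra. Qed.
Let y1 : y <= 1. Proof. exact: le_trans a1. Qed.
Let Ppsi : P * psi <= y ^+ 2.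
Proof.
rewrite -(ler_pM2r e0) -mulrA psiE; have := ler_wpM2l (ltW y0) Pe; lra.
Qed.
(* [psi] is much smaller than any power of [p] that occurs below *)
Let p2psi : 100 * p ^+ 8 * psi <= y ^+ 2.
Proof. by apply: le_trans Ppsi; rewrite ler_wpM2r// ltW. Qed.
Let a2nu : a ^+ 2 * nu <= psi.
Proof. by rewrite -(ler_pM2r e0) psiE; have := ler_wpM2r (ltW nu0) aey; lra. Qed.

Lemma stage_mk : cabs mk <= 105 / 100 * a.
Proof.
rewrite /mk cabsN cabsV; have w0 : 0 < cabs w.
  by rewrite -(pmulr_rgt0 _ a0); apply: lt_le_trans aw; lra.
by rewrite -(ler_pM2r w0) mulVf ?gt_eqF//; have := aw; lra.
Qed.

Let mk2 : cabs mk <= 2 * a. Proof. by have := stage_mk; have := a0; lra. Qed.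

Lemma stage_diff : T - G = - (nu%:C%C * mk) *: (T *m G).
Proof. by rewrite TE GE (resolvent_identity Ah k z10 z0) z1E addrAC subrr add0r. Qed.

(** Ward identity: $\Im z$ times the squared norm of [G] is the imaginary part of its trace, which
    is controlled by hypothesis. *)
Lemma stage_hs2G : nu * hs2 G <= 2 * (y / e).
Proof.
have := @hs2_green _ _ _ Ah k z N 1%:M z0; rewrite ctr_scalar cconj1 mul1mx !mulmx1 -GE => h.
rewrite mulrA ler_pdivlMr//.
have : nu * hs2 G * (9 / 10 * e) <= 11 / 10 * y.
  apply: le_trans trG; rewrite -h.
  by have := ler_wpM2r (mulr_ge0 (ltW nu0) (hs2_ge0 G)) iz; lra.
have := y0; lra.
Qed.

Let tiny : (nu * (2 * a)) ^+ 2 <= 1 / 100 * (9 / 10 * e) ^+ 2.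
Proof.
have PP : 10 ^+ 8 <= P.
  apply: le_trans Pp; have := le_trans p2 p8; lra.
have h : 10 ^+ 8 * nu <= e.
  apply: (@le_trans _ _ (P * nu)); first by rewrite ler_wpM2r// ltW.
  by apply: le_trans Pe _; rewrite ler_piMl// ltW.
have h1 : nu * (2 * a) <= 2 * nu by have := ler_wpM2l (ltW nu0) a1; lra.
apply: (@le_trans _ _ ((2 * nu) ^+ 2)).
  by rewrite lerXn2r ?nnegrE// ?mulr_ge0// ltW.
have : (30 * nu) ^+ 2 <= e ^+ 2.
  rewrite lerXn2r ?nnegrE ?mulr_ge0 ?(ltW nu0) ?(ltW e0)//.
  by apply: le_trans h; rewrite ler_wpM2r ?(ltW nu0)//; lra.
by have := sqr_ge0 e; lra.
Qed.

(** The shift $z_1-z$ has modulus at most $2a\nu$, far below [e] by [tiny], so the correction in the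
    resolvent identity is absorbed. *)
Lemma stage_perturb q (B : 'M[R[i]]_(N, q)) : hs2 (T *m B) <= 21 / 10 * hs2 (G *m B).
Proof.
have E : T *m B = G *m B + (- (nu%:C%C * mk)) *: (T *m (G *m B)).
  by rewrite mulmxA scalemxAl -stage_diff mulmxBl addrC subrK.
rewrite E; apply: le_trans (hs2D _ _) _.
rewrite hs2Z cabsN cabsM cabs_real (ger0_norm (ltW nu0)).
have := hs2_green_le Ah k (G *m B) z10; rewrite -TE.
set X := hs2 (T *m _); set Y := hs2 (G *m B) => h.
have X0 : 0 <= X by exact: hs2_ge0.
have Y0 : 0 <= Y by exact: hs2_ge0.
have h1 : (9 / 10 * e) ^+ 2 * X <= Y.
  apply: le_trans h; rewrite ler_wpM2r// lerXn2r ?nnegrE ?(ltW z10)//.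
  by rewrite mulr_ge0// ltW.
have h2 : (nu * cabs mk) ^+ 2 * X <= 1 / 100 * Y.
  apply: (@le_trans _ _ ((nu * (2 * a)) ^+ 2 * X)).
    rewrite ler_wpM2r// lerXn2r ?nnegrE ?mulr_ge0 ?cabs_ge0 ?(ltW nu0)// ?(ltW a0)//.
    by rewrite ler_wpM2l// ltW.
  apply: (@le_trans _ _ (1 / 100 * (9 / 10 * e) ^+ 2 * X)).
    by rewrite ler_wpM2r.
  by rewrite -mulrA ler_wpM2l.
lra.
Qed.

Lemma stage_hs2T : nu * hs2 T <= 4 * (y / e).
Proof.
have := stage_perturb 1%:M; rewrite !mulmx1 => /(ler_wpM2l (ltW nu0)).
have := stage_hs2G; have : 0 < y / e by rewrite divr_gt0.
have := @hs2_green _ _ _ Ah k z N 1%:M z0; rewrite ctr_scalar cconj1 mul1mx !mulmx1 -GE => h.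
have h2 : nu * hs2 G <= 11 / 9 * (y / e).
  rewrite mulrA ler_pdivlMr//.
  have : nu * hs2 G * (9 / 10 * e) <= 11 / 10 * y.
    apply: le_trans trG; rewrite -h.
    by have := ler_wpM2r (mulr_ge0 (ltW nu0) (hs2_ge0 G)) iz; lra.
  lra.
lra.
Qed.

Let shrink q (B : 'M[R[i]]_(N, q)) (u : R[i]) b : 9 / 10 * e <= cIm u -> 0 <= b ->
  hs2 B <= b -> hs2 (green A k u *m B) <= 5 / 4 * b / e ^+ 2.
Proof.
move=> iu b0 Bb; have u0 : 0 < cIm u by apply: lt_le_trans iu; rewrite mulr_gt0.
rewrite ler_pdivlMr ?exprn_gt0//; have := hs2_green_le Ah k B u0.
set X := hs2 (green A k u *m B) => h; have X0 : 0 <= X by exact: hs2_ge0.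
have : (9 / 10 * e) ^+ 2 * X <= b.
  apply: le_trans Bb; apply: le_trans h; rewrite ler_wpM2r// lerXn2r ?nnegrE ?(ltW u0)//.
  by rewrite mulr_ge0// ltW.
lra.
Qed.

Lemma stage_hs2TT : nu ^+ 2 * hs2 (T *m T) <= 5 * psi / e ^+ 2.
Proof.
have b0 : 0 <= 4 * (y / e) / nu by rewrite !mulr_ge0 ?invr_ge0 ?ltW.
have h : hs2 T <= 4 * (y / e) / nu by rewrite ler_pdivlMr// mulrC; exact: stage_hs2T.
have := ler_wpM2l (exprn_ge0 2 (ltW nu0)) (shrink iz1 b0 h); rewrite -TE.
move/le_trans; apply; rewrite le_eqVlt; apply/orP; left; apply/eqP.
by rewrite /psi; field; rewrite !gt_eqF.
Qed.

Let tr_bound (X Y : 'M[R[i]]_N) b c t : 0 <= t -> nu * hs2 X <= b -> nu * hs2 Y <= c ->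
  b * c <= t ^+ 2 -> nu * cabs (\tr (X *m Y)) <= t.
Proof.
move=> t0 Xb Yc bc; apply: ler_of_sq => //; apply: le_trans bc.
rewrite exprMn; apply: le_trans (ler_wpM2l (exprn_ge0 2 (ltW nu0)) (mxtrace_cauchy_schwarz _ _)) _.
rewrite expr2 mulrACA; apply: ler_pM => //; by rewrite mulr_ge0 ?hs2_ge0// ltW.
Qed.

Let ye0 : 0 < y / e. Proof. by rewrite divr_gt0. Qed.

Lemma stage_trTT : nu * cabs (\tr (T *m T)) <= 4 * (y / e).
Proof.
apply: (tr_bound _ stage_hs2T stage_hs2T); first by rewrite mulr_ge0// ltW.
by rewrite expr2.
Qed.

Lemma stage_trTG : nu * cabs (\tr (T *m G)) <= 3 * (y / e).
Proof.
apply: (tr_bound _ stage_hs2T stage_hs2G); first by rewrite mulr_ge0// ltW.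
have := sqr_ge0 (y / e); lra.
Qed.

Let mu := - (z1 + nu%:C%C * \tr T)^-1.
Let wt := z1 + nu%:C%C * \tr T.

Lemma stage_wt : cabs (wt - w) <= cabs mk * nu * (1 + 3 * (y / e)).
Proof.
have -> : wt - w = (z1 - z) * (1 + nu%:C%C * \tr (T *m G)).
  have : \tr T - \tr G = (z1 - z) * \tr (T *m G).
    by rewrite -raddfB /= TE GE (resolvent_identity Ah k z10 z0) mxtraceZ.
  rewrite /wt /w => h.
  have -> : z1 + nu%:C%C * \tr T - (z + nu%:C%C * \tr G) =
    (z1 - z) + nu%:C%C * (\tr T - \tr G) by ring.
  by rewrite h; ring.
rewrite cabsM z1E [_ - _]addrAC subrr add0r cabsN cabsM cabs_real (ger0_norm (ltW nu0)).
rewrite [nu * _]mulrC ler_wpM2l ?mulr_ge0 ?cabs_ge0 ?(ltW nu0)//.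
apply: le_trans (cabsD _ _) _; rewrite cabs1 lerD2l cabsM cabs_real (ger0_norm (ltW nu0)).
exact: stage_trTG.
Qed.

Let psi_small : 10 ^+ 8 * psi <= 1.
Proof.
apply: (@le_trans _ _ (y ^+ 2)); last by rewrite expr_le1 ?(ltW y0).
apply: le_trans p2psi; rewrite ler_wpM2r ?(ltW psi0)//.
by have := le_trans p2 p8; lra.
Qed.

Lemma stage_awt : 97 / 100 <= a * cabs wt.
Proof.
have h := cabs_lb w (w - wt); rewrite subKr in h.
have h2 : a * cabs (w - wt) <= 9 * psi.
  rewrite cabsBC; apply: le_trans (ler_wpM2l (ltW a0) stage_wt) _.
  apply: (@le_trans _ _ (a * (2 * a * nu * (1 + 3 * (y / e))))).
    rewrite ler_wpM2l ?(ltW a0)// ler_wpM2r ?ler_wpM2r ?(ltW nu0)//.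
    by rewrite addr_ge0// mulr_ge0// ltW.
  have -> : a * (2 * a * nu * (1 + 3 * (y / e))) = 2 * (a ^+ 2 * nu) + 6 * (a ^+ 2 * psi).
    by rewrite /psi; field; rewrite gt_eqF.
  have : a ^+ 2 * psi <= psi by rewrite ler_piMl ?(ltW psi0)// expr_le1// ltW.
  by have := a2nu; have := psi0; lra.
have := ler_wpM2l (ltW a0) h; have := aw; have := psi_small; rewrite mulrBr; lra.
Qed.

Lemma stage_mu : cabs mu <= 105 / 100 * a.
Proof.
rewrite /mu -/wt cabsN cabsV; have w0 : 0 < cabs wt.
  by rewrite -(pmulr_rgt0 _ a0); apply: lt_le_trans stage_awt; lra.
by rewrite -(ler_pM2r w0) mulVf ?gt_eqF//; have := stage_awt; lra.
Qed.

Let mu2 : cabs mu <= 2 * a. Proof. by have := stage_mu; have := a0; lra. Qed.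

Let wt_neq0 : wt != 0.
Proof.
by rewrite -cabs_gt0 -(pmulr_rgt0 _ a0); apply: lt_le_trans stage_awt; lra.
Qed.
Let w_neq0 : w != 0.
Proof. by rewrite -cabs_gt0 -(pmulr_rgt0 _ a0); apply: lt_le_trans aw; lra. Qed.

Lemma stage_mu_mk : cabs (mu - mk) <= 32 * (a * psi).
Proof.
have -> : mu - mk = (wt - w) * (mu * mk).
  by rewrite /mu -/wt /mk; field; rewrite wt_neq0 w_neq0.
rewrite !cabsM.
have h : cabs (wt - w) <= 2 * a * nu * (1 + 3 * (y / e)).
  apply: le_trans stage_wt _; rewrite ler_wpM2r ?ler_wpM2r ?(ltW nu0)//.
  by rewrite addr_ge0// mulr_ge0// ltW.
have h2 : cabs mu * cabs mk <= (2 * a) * (2 * a) by rewrite ler_pM ?cabs_ge0.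
apply: le_trans (ler_pM (cabs_ge0 _) (mulr_ge0 (cabs_ge0 _) (cabs_ge0 _)) h h2) _.
have -> : 2 * a * nu * (1 + 3 * (y / e)) * (2 * a * (2 * a)) =
  8 * a * (a ^+ 2 * nu) + 24 * (a * (a ^+ 2 * psi)).
  by rewrite /psi; field; rewrite gt_eqF.
have h3 : a * (a ^+ 2 * nu) <= a * psi by rewrite ler_wpM2l// ltW.
have h4 : a * (a ^+ 2 * psi) <= a * psi.
  by rewrite ler_wpM2l ?(ltW a0)// ler_piMl ?(ltW psi0)// expr_le1// ltW.
lra.
Qed.

Let x := row_below A k.
(** The Schur denominator equals $-(z_1+\nu\,\mathrm{tr}\,T)-F$, so [F] is its centred fluctuation;
    [q2], [X] and [Y] are the other fluctuating quantities in the trace and in the form in [v]. *)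
Let F := (x *m T *m ctr x) 0 0 - nu%:C%C * \tr T - A k k.
Let q2 := (x *m (T *m T) *m ctr x) 0 0 - nu%:C%C * \tr (T *m T).
Let X := (x *m (T *m v)) 0 0.
Let Y := (ctr v *m T *m ctr x) 0 0.
Hypothesis hF : cabs F ^+ 2 <= p ^+ 2 * (nu ^+ 2 * hs2 T + nu).
Hypothesis hq2 : cabs q2 ^+ 2 <= p ^+ 2 * (nu ^+ 2 * hs2 (T *m T)).
Hypothesis hX : cabs X ^+ 2 <= p ^+ 2 * (nu * hs2 (T *m v)).
Hypothesis hY : cabs Y ^+ 2 <= p ^+ 2 * (nu * hs2 (ctr v *m T)).
Hypothesis trv : cIm ((ctr v *m G *m v) 0 0) <= 115 / 100 * y.
Let vk := v k 0.
Hypothesis vk1 : cabs vk <= 1.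
Let s := Num.sqrt psi.
Let s0 : 0 < s. Proof. by rewrite sqrtr_gt0. Qed.
Let sE : s ^+ 2 = psi. Proof. by rewrite sqr_sqrtr// ltW. Qed.

Let p4s : 10 * p ^+ 4 * s <= 1.
Proof.
apply: (@le_trans _ _ y) => //; apply: ler_of_sq; first exact: ltW.
by apply: le_trans p2psi; rewrite -sE; lra.
Qed.

Let ps_small : p * s <= 1 / 10.
Proof.
have : 0 <= (p ^+ 3 - 1) * (p * s).
  rewrite mulr_ge0 ?(ltW (mulr_gt0 p0 s0))// subr_ge0 expr_ge1//; have := p1; lra.
have := p4s; lra.
Qed.

Lemma stage_hs2Gv : hs2 (G *m v) <= 2 * (y / e).
Proof.
have := hs2_green Ah k v z0; rewrite -GE /mxtrace big_ord1 => h.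
rewrite mulrA ler_pdivlMr//.
have : hs2 (G *m v) * (9 / 10 * e) <= 115 / 100 * y.
  by apply: le_trans trv; rewrite -h; have := ler_wpM2r (hs2_ge0 (G *m v)) iz; lra.
by have := y0; lra.
Qed.

Lemma stage_hs2Tv : hs2 (T *m v) <= 4 * (y / e).
Proof.
apply: le_trans (stage_perturb v) _.
have := hs2_green Ah k v z0; rewrite -GE /mxtrace big_ord1 => h.
have : hs2 (G *m v) <= 4 * 10 / 21 * (y / e).
  rewrite mulrA ler_pdivlMr//.
  have : hs2 (G *m v) * (9 / 10 * e) <= 115 / 100 * y.
    by apply: le_trans trv; rewrite -h; have := ler_wpM2r (hs2_ge0 (G *m v)) iz; lra.
  by have := y0; lra.
lra.
Qed.

Lemma stage_hs2vT : hs2 (ctr v *m T) <= 4 * (y / e).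
Proof.
rewrite -hs2_ctr ctrM ctrK TE hs2_ctr_green// -TE; exact: stage_hs2Tv.
Qed.

Let sq_le (b c : R) (u : R[i]) : 0 <= c -> b <= c ^+ 2 -> cabs u ^+ 2 <= b -> cabs u <= c.
Proof. by move=> c0 bc ub; apply: ler_of_sq => //; exact: le_trans bc. Qed.

Let pse0 : 0 <= psi / e. Proof. exact: divr_ge0 (ltW psi0) (ltW e0). Qed.
Let ps0 : 0 < p * s. Proof. exact: mulr_gt0. Qed.

Lemma stage_X : cabs X <= 2 * (p * s).
Proof.
apply: (sq_le _ _ hX); first by rewrite mulr_ge0// ltW.
have := ler_wpM2l (sqr_ge0 p) (ler_wpM2l (ltW nu0) stage_hs2Tv).
move/le_trans; apply; rewrite le_eqVlt; apply/orP; left; apply/eqP.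
by rewrite !exprMn sE /psi; field; rewrite gt_eqF.
Qed.

Lemma stage_Y : cabs Y <= 2 * (p * s).
Proof.
apply: (sq_le _ _ hY); first by rewrite mulr_ge0// ltW.
have := ler_wpM2l (sqr_ge0 p) (ler_wpM2l (ltW nu0) stage_hs2vT).
move/le_trans; apply; rewrite le_eqVlt; apply/orP; left; apply/eqP.
by rewrite !exprMn sE /psi; field; rewrite gt_eqF.
Qed.

Lemma stage_q2 : cabs q2 <= 3 * (p * s) / e.
Proof.
apply: (sq_le _ _ hq2); first by rewrite !mulr_ge0 ?invr_ge0 ?ltW.
have := ler_wpM2l (sqr_ge0 p) stage_hs2TT.
move/le_trans; apply.
have -> : (3 * (p * s) / e) ^+ 2 = 9 * (p ^+ 2 * (psi / e ^+ 2)).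
  by rewrite -sE; field; rewrite gt_eqF.
have : 0 <= p ^+ 2 * (psi / e ^+ 2).
  by apply: mulr_ge0; [exact: sqr_ge0|apply: divr_ge0; [exact: ltW|exact: sqr_ge0]].
lra.
Qed.

Lemma stage_aF : a * cabs F <= 3 * (p * s).
Proof.
apply: ler_of_sq; first by rewrite mulr_ge0// ltW.
rewrite exprMn; apply: le_trans (ler_wpM2l (sqr_ge0 a) hF) _.
have h1 : nu ^+ 2 * hs2 T <= 4 * psi.
  rewrite expr2 -mulrA; apply: le_trans (ler_wpM2l (ltW nu0) stage_hs2T) _.
  by rewrite le_eqVlt; apply/orP; left; apply/eqP; rewrite /psi; field; rewrite gt_eqF.
have h2 : a ^+ 2 * (nu ^+ 2 * hs2 T + nu) <= 5 * psi.
  have a21 : a ^+ 2 <= 1 by rewrite expr_le1// ltW.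
  have : a ^+ 2 * (nu ^+ 2 * hs2 T) <= nu ^+ 2 * hs2 T.
    by rewrite ler_piMl// mulr_ge0 ?hs2_ge0// exprn_ge0// ltW.
  have := a2nu; lra.
have := ler_wpM2l (sqr_ge0 p) h2.
have : 0 <= p ^+ 2 * psi by rewrite mulr_ge0 ?sqr_ge0// ltW.
rewrite -!sE; lra.
Qed.

Let g := green_diag A k z1.

Let g_inv : g * (- wt - F) = 1.
Proof.
have n0 := green_denom_neq0 Ah k z10; rewrite -TE -/x in n0.
rewrite /g /green_diag -TE -/x /wt /F.
set Q := (x *m T *m ctr x) 0 0 in n0 *.
have -> : - (z1 + nu%:C%C * \tr T) - (Q - nu%:C%C * \tr T - A k k) = A k k - z1 - Q by ring.
by rewrite mulVf.
Qed.

Let muwt : mu * - wt = 1. Proof. by rewrite /mu -/wt mulrNN mulVf. Qed.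

(** A fixed-point equation for the new diagonal entry; used twice, it expands the entry to second
    order in [F]. *)
Lemma stage_gE : g = mu + mu * g * F.
Proof.
have := congr1 (fun t => mu * t) g_inv; rewrite mulr1 => h.
have -> : mu * g * F = mu * (- wt) * g - mu * (g * (- wt - F)) by ring.
by rewrite h muwt; ring.
Qed.

Lemma stage_g : cabs g <= 4 * a.
Proof.
have h : cabs mu * cabs F <= 1 / 2.
  apply: (@le_trans _ _ (105 / 100 * a * cabs F)).
    by rewrite ler_wpM2r ?cabs_ge0//; exact: stage_mu.
  by have := stage_aF; have := ps_small; lra.
have := cabsD mu (mu * g * F); rewrite -stage_gE !cabsM.
have : cabs mu * cabs g * cabs F <= 1 / 2 * cabs g.
  by rewrite mulrAC ler_wpM2r ?cabs_ge0.
by have := mu2; lra.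
Qed.

Let s2 := nu%:C%C * \tr (T *m T).
Let s2_le : cabs s2 <= 4 * (y / e).
Proof. by rewrite /s2 cabsM cabs_real (ger0_norm (ltW nu0)); exact: stage_trTT. Qed.

Let ie0 : 0 < e^-1. Proof. by rewrite invr_gt0. Qed.
Let a_ie : a <= e^-1. Proof. by rewrite -(ler_pM2r e0) mulVf ?gt_eqF. Qed.
Let y_ie : y / e <= e^-1. Proof. by rewrite ler_piMl// ltW. Qed.

Lemma stage_1s2 : a * cabs (1 + s2) <= 5 / e.
Proof.
have := cabsD 1 s2; rewrite cabs1 => h.
have := ler_wpM2l (ltW a0) (le_trans h (_ : _ <= 1 + 4 * (y / e))).
move=> /(_ _)/le_trans; apply; first by rewrite lerD2l.
have : a * (y / e) <= y / e by rewrite ler_piMl// ltW.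
by have := a_ie; have := y_ie; lra.
Qed.


Let B5 := nu%:C%C *: ((mu ^+ 2 * (1 + s2)) *: T + mu *: (T *m T)).
Let ga5 := - (nu%:C%C * (mu ^+ 2 * (1 + s2))).

Let proj_T m (M : 'M[R[i]]_(N, m)) : proj_below N k *m (T *m M) = T *m M.
Proof. by rewrite mulmxA; congr (_ *m _); rewrite TE; exact: (proj_green Ah k z10). Qed.
Let proj_T1 : proj_below N k *m T = T.
Proof. by rewrite TE; exact: (proj_green Ah k z10). Qed.
Let zero_mxE m n i j : (0 : 'M[R[i]]_(m, n)) i j = 0. Proof. by rewrite mxE. Qed.

Let row_form_T c : row_form nu A k (c *: T) 0 0 (- c) = c * F.
Proof.
have := row_formZ nu A k c T 0 0 (-1); rewrite !scaler0 mulrN1 => ->.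
by rewrite /row_form mulmx0 mul0mx !zero_mxE (sum_diag_below proj_T1) /F -/x; ring.
Qed.

Let row_formB (B1 B2 : 'M[R[i]]_N) al1 al2 be1 be2 ga1 ga2 :
  row_form nu A k (B1 + B2) (al1 + al2) (be1 + be2) (ga1 + ga2) =
  row_form nu A k B1 al1 be1 ga1 + row_form nu A k B2 al2 be2 ga2.
Proof.
rewrite /row_form mulmxDr !mulmxDl mulmxDr.
have E m n (U V : 'M[R[i]]_(m, n)) i j : (U + V) i j = U i j + V i j by rewrite mxE.
rewrite !E; under eq_bigr do rewrite E.
by rewrite big_split /=; ring.
Qed.

Lemma stage_row_form5 : row_form nu A k B5 0 0 ga5 =
  nu%:C%C * (mu ^+ 2 * F * (1 + s2) + mu * q2).
Proof.
have -> : B5 = (nu%:C%C * (mu ^+ 2 * (1 + s2))) *: T + (nu%:C%C * mu) *: (T *m T).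
  by rewrite /B5 scalerDr !scalerA.
have := row_formB ((nu%:C%C * (mu ^+ 2 * (1 + s2))) *: T) ((nu%:C%C * mu) *: (T *m T)) 0 0 0 0 ga5 0.
rewrite !addr0 => ->; rewrite row_form_T.
have := row_formZ nu A k (nu%:C%C * mu) (T *m T) 0 0 0; rewrite !scaler0 mulr0 => ->.
rewrite {1}/row_form mulmx0 mul0mx !zero_mxE mul0r !addr0 (sum_diag_below (proj_T T)) -/x -/q2.
ring.
Qed.

(** The point of the characteristic: the deterministic part of $\nu g(1+\nu\,\mathrm{tr}\,T^2)$,
    where $g$ is the new diagonal entry, is compensated by $z_1-z=-\nu m_k$ and by the effect of
    this shift on the trace of the old minor. What remains to first order is the centred form [B5],
    [ga5]. *)
Lemma stage_trace_step : cabs (z1 + nu%:C%C * \tr (green A k.+1 z1) - w -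
    row_form nu A k B5 0 0 ga5) <= 1100 * p ^+ 2 * nu * (psi / e).
Proof.
rewrite stage_row_form5 (green_step_trace Ah k z10) -TE -/x -/g.
have -> : (x *m (T *m T) *m ctr x) 0 0 = q2 + s2 by rewrite /q2 /s2 subrK.
have trD : \tr T - \tr G = - (nu%:C%C * mk) * \tr (T *m G).
  by rewrite -raddfB /= stage_diff mxtraceZ.
(* The four errors: a product of two fluctuations, the second-order remainder of the diagonal entry,
   and the two effects of having [T] instead of [G]. *)
pose E1 := mu * mu * (F * q2).
pose E2 := mu * mu * g * F * F * (1 + s2 + q2).
pose E3 := (mu - mk) * (1 + s2).
pose E4 := mk * (nu%:C%C * \tr (T *m (T - G))).
have -> : z1 + nu%:C%C * (\tr T + g * (1 + (q2 + s2))) - w -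
    nu%:C%C * (mu ^+ 2 * F * (1 + s2) + mu * q2) = nu%:C%C * (E1 + E2 + E3 + E4).
  have gE : g = mu + mu * mu * F + mu * mu * g * F * F.
    by rewrite {1}stage_gE {1}stage_gE; ring.
  have -> : z1 + nu%:C%C * (\tr T + g * (1 + (q2 + s2))) - w =
      (z1 - z) + nu%:C%C * (\tr T - \tr G + g * (1 + (q2 + s2))).
    by rewrite /w; ring.
  rewrite trD z1E /E1 /E2 /E3 /E4 mulmxBr raddfB /= {1}gE.
  rewrite /s2; move: (\tr (T *m T)) (\tr (T *m G)) (nu%:C%C) => t1 t2 n1; ring.
rewrite cabsM cabs_real (ger0_norm (ltW nu0)).
have -> : 1100 * p ^+ 2 * nu * (psi / e) = nu * (1100 * p ^+ 2 * (psi / e)) by ring.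
rewrite ler_wpM2l ?(ltW nu0)//.
set u := p ^+ 2 * (psi / e).
have u0 : 0 <= u by exact: mulr_ge0 (sqr_ge0 p) pse0.
have pe1 : psi / e <= u.
  rewrite /u ler_peMl// expr_ge1//; have := p1; lra.
have aF0 : 0 <= a * cabs F by rewrite mulr_ge0 ?cabs_ge0// ltW.
have H1 : cabs E1 <= 36 * u.
  rewrite /E1 !cabsM.
  apply: (@le_trans _ _ ((2 * a) * (2 * a) * (cabs F * (3 * (p * s) / e)))).
    apply: ler_pM; rewrite ?mulr_ge0 ?cabs_ge0//; first by rewrite ler_pM ?cabs_ge0.
    by rewrite ler_wpM2l ?cabs_ge0//; exact: stage_q2.
  have -> : 2 * a * (2 * a) * (cabs F * (3 * (p * s) / e)) =
     12 * (a * ((a * cabs F) * (p * s / e))) by ring.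
  have h : (a * cabs F) * (p * s / e) <= 3 * u.
    have -> : 3 * u = 3 * (p * s) * (p * s / e) by rewrite /u -sE; ring.
    by apply: ler_wpM2r; [exact: divr_ge0 (ltW ps0) (ltW e0)|exact: stage_aF].
  have h0 : 0 <= (a * cabs F) * (p * s / e).
    exact: mulr_ge0 aF0 (divr_ge0 (ltW ps0) (ltW e0)).
  have : a * ((a * cabs F) * (p * s / e)) <= (a * cabs F) * (p * s / e) by rewrite ler_piMl.
  lra.
have aq : a * cabs (1 + s2 + q2) <= 6 / e.
  have := cabsD (1 + s2) q2 => h; have := ler_wpM2l (ltW a0) h; rewrite mulrDr => h1.
  have h2 : a * cabs q2 <= 1 / e.
    apply: (@le_trans _ _ (cabs q2)); first by rewrite ler_piMl ?cabs_ge0.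
    apply: le_trans stage_q2 _; rewrite ler_wpM2r ?(ltW ie0)//.
    by have := ps_small; lra.
  by have := stage_1s2; lra.
have H2 : cabs E2 <= 864 * u.
  rewrite /E2 !cabsM.
  have -> : cabs mu * cabs mu * cabs g * cabs F * cabs F * cabs (1 + s2 + q2) =
    (cabs mu * cabs mu * cabs g) * (cabs F * cabs F * cabs (1 + s2 + q2)) by ring.
  apply: (@le_trans _ _ ((2 * a) * (2 * a) * (4 * a) * (cabs F * cabs F * cabs (1 + s2 + q2)))).
    rewrite ler_wpM2r ?mulr_ge0 ?cabs_ge0//.
    apply: ler_pM; rewrite ?mulr_ge0 ?cabs_ge0//; last exact: stage_g.
    by rewrite ler_pM ?cabs_ge0.
  have -> : 2 * a * (2 * a) * (4 * a) * (cabs F * cabs F * cabs (1 + s2 + q2)) =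
    16 * ((a * cabs F) * (a * cabs F) * (a * cabs (1 + s2 + q2))) by ring.
  have : (a * cabs F) * (a * cabs F) * (a * cabs (1 + s2 + q2)) <=
     3 * (p * s) * (3 * (p * s)) * (6 / e).
    apply: ler_pM => //; rewrite ?mulr_ge0 ?cabs_ge0// ?(ltW a0)//.
    by apply: ler_pM => //; exact: stage_aF.
  have -> : 3 * (p * s) * (3 * (p * s)) * (6 / e) = 54 * u by rewrite /u -sE; ring.
  lra.
have H3 : cabs E3 <= 160 * u.
  rewrite /E3 cabsM.
  apply: (@le_trans _ _ (32 * (a * psi) * cabs (1 + s2))).
    by rewrite ler_wpM2r ?cabs_ge0//; exact: stage_mu_mk.
  have := ler_wpM2l (ltW psi0) stage_1s2.
  have -> : psi * (5 / e) = 5 * (psi / e) by ring.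
  by have := pe1; lra.
have H4 : cabs E4 <= 20 * u.
  rewrite /E4 stage_diff -scalemxAr mxtraceZ !(cabsM, cabsN, cabs_real) !(ger0_norm (ltW nu0)).
  have -> : cabs w^-1 = cabs mk by rewrite /mk cabsN.
  have b0 : 0 <= 2 * (y / e) / nu by rewrite !mulr_ge0 ?invr_ge0 ?ltW.
  have hG : hs2 G <= 2 * (y / e) / nu by rewrite ler_pdivlMr// mulrC; exact: stage_hs2G.
  have hTG : nu * hs2 (T *m G) <= 5 / 2 * (y / e) / e ^+ 2.
    have := ler_wpM2l (ltW nu0) (shrink iz1 b0 hG); rewrite -TE => /le_trans; apply.
    by rewrite le_eqVlt; apply/orP; left; apply/eqP; field; rewrite !gt_eqF.
  have ht : nu * cabs (\tr (T *m (T *m G))) <= 4 * (y / e / e).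
    apply: (tr_bound _ stage_hs2T hTG).
      by rewrite mulr_ge0//; exact: divr_ge0 (ltW ye0) (ltW e0).
    have -> : 4 * (y / e) * (5 / 2 * (y / e) / e ^+ 2) = 10 * (y / e / e) ^+ 2.
      by field; rewrite gt_eqF.
    by have := sqr_ge0 (y / e / e); lra.
  have m0 := cabs_ge0 mk.
  rewrite [leLHS](_ : _ =
    (cabs mk * cabs mk) * (nu * (nu * cabs (\tr (T *m (T *m G)))))); last by ring.
  apply: (@le_trans _ _ ((2 * a) * (2 * a) * (nu * (4 * (y / e / e))))).
    apply: ler_pM; rewrite ?mulr_ge0 ?cabs_ge0 ?(ltW nu0)//; first by rewrite ler_pM.
    by rewrite ler_wpM2l// ltW.
  have -> : 2 * a * (2 * a) * (nu * (4 * (y / e / e))) = 16 * (a ^+ 2 * (psi / e)).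
    by rewrite /psi; field; rewrite gt_eqF.
  have : a ^+ 2 * (psi / e) <= psi / e.
    by rewrite ler_piMl// expr_le1// ltW.
  by have := pe1; lra.
apply: le_trans (cabsD _ _) _; apply: le_trans (lerD (cabsD _ _) H4) _.
apply: le_trans (lerD (lerD (cabsD _ _) H3) (lexx _)) _.
have -> : 1100 * p ^+ 2 * (psi / e) = 1100 * u by rewrite /u; ring.
lra.
Qed.

Let mu_sq : cabs mu ^+ 2 <= 4 * a ^+ 2.
Proof.
have -> : 4 * a ^+ 2 = (2 * a) ^+ 2 by ring.
by rewrite lerXn2r ?nnegrE ?cabs_ge0 ?mulr_ge0 ?(ltW a0).
Qed.
Let a21 : a ^+ 2 <= 1. Proof. by rewrite expr_le1// ltW. Qed.
Let nuT : nu ^+ 2 * hs2 T <= 4 * psi.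
Proof.
rewrite expr2 -mulrA; apply: le_trans (ler_wpM2l (ltW nu0) stage_hs2T) _.
by rewrite le_eqVlt; apply/orP; left; apply/eqP; rewrite /psi; field; rewrite gt_eqF.
Qed.
Let sqr_e0 : 0 < e ^+ 2. Proof. exact: exprn_gt0. Qed.

(** The predictable variance of the increment of $w_k$, to be summed over the flow. *)
Lemma stage_V5 : nu ^+ 2 * hs2 B5 + nu * cabs ga5 ^+ 2 <=
  3240 * nu ^+ 2 * (psi / e ^+ 2) + 400 * nu ^+ 2 * (nu / e ^+ 2).
Proof.
have c1 : cabs (mu ^+ 2 * (1 + s2)) <= 20 / e.
  rewrite cabsM cabsX; apply: (@le_trans _ _ (4 * a ^+ 2 * cabs (1 + s2))).
    by rewrite ler_wpM2r ?cabs_ge0.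
  have -> : 4 * a ^+ 2 * cabs (1 + s2) = 4 * (a * (a * cabs (1 + s2))) by ring.
  have h0 : 0 <= a * cabs (1 + s2) by rewrite mulr_ge0 ?cabs_ge0// ltW.
  have := stage_1s2; have : a * (a * cabs (1 + s2)) <= a * cabs (1 + s2) by rewrite ler_piMl.
  lra.
have c2 : cabs (mu ^+ 2 * (1 + s2)) ^+ 2 <= 400 / e ^+ 2.
  have -> : 400 / e ^+ 2 = (20 / e) ^+ 2 by field; rewrite gt_eqF.
  rewrite lerXn2r ?nnegrE ?cabs_ge0//; apply: divr_ge0; [lra|exact: ltW].
have nn : 0 <= nu ^+ 2 by exact: sqr_ge0.
apply: lerD.
  rewrite /B5 hs2Z cabs_real (ger0_norm (ltW nu0)) -[leRHS]mulrA [3240 * _]mulrC -[leRHS]mulrA.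
  rewrite ler_wpM2l//.
  apply: (@le_trans _ _ (nu ^+ 2 * (2 * (400 / e ^+ 2 * hs2 T) + 2 * (4 * hs2 (T *m T))))).
    rewrite ler_wpM2l//; apply: le_trans (hs2D _ _) _; rewrite !hs2Z.
    apply: lerD; apply: ler_wpM2l => //; apply: ler_wpM2r; rewrite ?hs2_ge0//.
    by apply: le_trans mu_sq _; have := a21; lra.
  have -> : nu ^+ 2 * (2 * (400 / e ^+ 2 * hs2 T) + 2 * (4 * hs2 (T *m T))) =
    800 / e ^+ 2 * (nu ^+ 2 * hs2 T) + 8 * (nu ^+ 2 * hs2 (T *m T)) by ring.
  have h1 : 800 / e ^+ 2 * (nu ^+ 2 * hs2 T) <= 800 / e ^+ 2 * (4 * psi).
    by apply: ler_wpM2l nuT; apply: divr_ge0; [lra|exact: ltW].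
  have h2 := stage_hs2TT; lra.
rewrite /ga5 cabsN cabsM cabs_real (ger0_norm (ltW nu0)) exprMn.
apply: (@le_trans _ _ (nu * (nu ^+ 2 * (400 / e ^+ 2)))).
  by apply: ler_wpM2l; [exact: ltW|apply: ler_wpM2l].
by rewrite le_eqVlt; apply/orP; left; apply/eqP; ring.
Qed.

Let cc := cconj vk.
Let n2 := vk * cc.
Let n2E : cabs n2 = cabs vk ^+ 2. Proof. by rewrite /n2 cabsM /cc cabs_conj. Qed.
Let B6 := (mu ^+ 2 * n2) *: T + mu *: ((T *m v) *m (ctr v *m T)).
Let al6 := - (mu * cc) *: (T *m v).
Let be6 := - (mu * vk) *: (ctr v *m T).
Let ga6 := - (mu ^+ 2 * n2).
Let Q := (ctr v *m T *m (T *m v)) 0 0.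

Let trQ : \tr ((T *m v) *m (ctr v *m T)) = Q.
Proof. by rewrite mxtrace_mulC /mxtrace big_ord1. Qed.

Let XY : (x *m ((T *m v) *m (ctr v *m T)) *m ctr x) 0 0 = X * Y.
Proof.
have -> : x *m ((T *m v) *m (ctr v *m T)) *m ctr x =
  (x *m (T *m v)) *m (ctr v *m T *m ctr x) by rewrite !mulmxA.
by rewrite mxE big_ord1.
Qed.

Lemma stage_row_form6 : row_form nu A k B6 al6 be6 ga6 =
  mu ^+ 2 * n2 * F - mu * (cc * X + vk * Y) + mu * (X * Y - nu%:C%C * Q).
Proof.
have := row_formB ((mu ^+ 2 * n2) *: T) (mu *: ((T *m v) *m (ctr v *m T))) 0 al6 0 be6 ga6 0.
rewrite !add0r addr0 -/B6 => ->; rewrite row_form_T.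
rewrite /row_form mul0r addr0 -!scalemxAr -!scalemxAl.
have Z m n c (M : 'M[R[i]]_(m, n)) i j : (c *: M) i j = c * M i j by rewrite mxE.
rewrite !Z; under eq_bigr do rewrite Z; rewrite -mulr_sumr.
rewrite sum_diag_below; last by rewrite -mulmxA proj_T.
rewrite trQ XY -/x -/X -/Y; ring.
Qed.

Lemma stage_Q : cabs Q <= 4 * (y / e).
Proof.
apply: ler_of_sq; first by rewrite mulr_ge0// ltW.
apply: le_trans (cauchy_schwarz_row_col _ _) _; rewrite expr2.
by apply: ler_pM; rewrite ?hs2_ge0//; [exact: stage_hs2vT|exact: stage_hs2Tv].
Qed.

(** The form in [v] gains $m_k|v_k|^2$. The conditional mean of the product [X * Y] is compensated
    by the change of the form when the parameter moves from [z] to [z1]. *)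
Lemma stage_form_step : cabs ((ctr v *m green A k.+1 z1 *m v) 0 0 - (ctr v *m G *m v) 0 0 -
    mk * n2 - row_form nu A k B6 al6 be6 ga6) <=
  144 * p ^+ 2 * psi * cabs vk ^+ 2 + 32 * psi * cabs vk ^+ 2 + 96 * p ^+ 2 * psi * cabs vk +
  96 * p ^+ 3 * psi * s + 128 * psi ^+ 2 + 16 * nu * (psi / e).
Proof.
rewrite stage_row_form6 (green_step_form Ah k z10) -TE -/x -/g -/X -/Y -/vk -/cc.
have vD : (ctr v *m T *m v) 0 0 - (ctr v *m G *m v) 0 0 =
    - (nu%:C%C * mk) * (ctr v *m (T *m G) *m v) 0 0.
  have := congr1 (fun M => (ctr v *m M *m v) 0 0) stage_diff.
  rewrite mulmxBr mulmxBl -scalemxAr -scalemxAl.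
  have Z m n c (M : 'M[R[i]]_(m, n)) i j : (c *: M) i j = c * M i j by rewrite mxE.
  have B m n (M M' : 'M[R[i]]_(m, n)) i j : (M - M') i j = M i j - M' i j by rewrite !mxE.
  by rewrite Z B.
have vD2 : (ctr v *m (T *m G) *m v) 0 0 = Q + nu%:C%C * mk * (ctr v *m T *m (T *m (G *m v))) 0 0.
  have -> : T *m G = T *m T + (nu%:C%C * mk) *: (T *m (T *m G)).
    have -> : (nu%:C%C * mk) *: (T *m (T *m G)) = - (T *m (T - G)).
      by rewrite stage_diff -scalemxAr scaleNr opprK.
    by rewrite mulmxBr opprB addrC subrK.
  rewrite mulmxDr mulmxDl -scalemxAr -scalemxAl.
  have Z m n c (M : 'M[R[i]]_(m, n)) i j : (c *: M) i j = c * M i j by rewrite mxE.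
  have D m n (M M' : 'M[R[i]]_(m, n)) i j : (M + M') i j = M i j + M' i j by rewrite !mxE.
  by rewrite D Z /Q !mulmxA.
set Q3 := (ctr v *m T *m (T *m (G *m v))) 0 0 in vD2.
set AT := (ctr v *m T *m v) 0 0 in vD *; set AG := (ctr v *m G *m v) 0 0 in vD *.
(* [E1], [E3] and [E4] come from the random part of the diagonal entry, [E2] and [E5] from replacing
   [mk] by [mu], and [E6] from the second-order effect of the shift of the parameter. *)
pose E1 := mu * mu * g * F * F * n2.
pose E2 := (mu - mk) * n2.
pose E3 := - (mu * g * F * (cc * X + vk * Y)).
pose E4 := mu * g * F * (X * Y).
pose E5 := nu%:C%C * ((mu - mk) * Q).
pose E6 := - (mk * mk * (nu%:C%C * (nu%:C%C * Q3))).
have -> : AT + g * ((cc - Y) * (vk - X)) - AG - mk * n2 -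
    (mu ^+ 2 * n2 * F - mu * (cc * X + vk * Y) + mu * (X * Y - nu%:C%C * Q)) =
    E1 + E2 + E3 + E4 + E5 + E6.
  have gE : g = mu + mu * mu * F + mu * mu * g * F * F.
    by rewrite {1}stage_gE {1}stage_gE; ring.
  have -> : AT = AG - nu%:C%C * mk * (Q + nu%:C%C * mk * Q3).
    by rewrite -vD2 -[RHS]addrC -mulNr -vD; ring.
  have -> : g * ((cc - Y) * (vk - X)) = g * n2 - g * (cc * X + vk * Y) + g * (X * Y).
    by rewrite /n2; ring.
  have g1 : g * n2 = (mu + mu * mu * F + mu * mu * g * F * F) * n2 by rewrite {1}gE.
  have g2 t : g * t = (mu + mu * g * F) * t by rewrite {1}stage_gE.
  rewrite g1 (g2 (cc * X + vk * Y)) (g2 (X * Y)) /E1 /E2 /E3 /E4 /E5 /E6; ring.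
have v0 := cabs_ge0 vk.
have aF0 : 0 <= a * cabs F by rewrite mulr_ge0 ?cabs_ge0// ltW.
have ps2 : (p * s) ^+ 2 = p ^+ 2 * psi by rewrite exprMn sE.
have muF : cabs mu * cabs g * cabs F <= 24 * (p * s).
  apply: (@le_trans _ _ (2 * a * (4 * a) * cabs F)).
    by rewrite ler_wpM2r ?cabs_ge0// ler_pM ?cabs_ge0//; exact: stage_g.
  have : a * (a * cabs F) <= a * cabs F by rewrite ler_piMl.
  have := stage_aF; lra.
have H1 : cabs E1 <= 144 * p ^+ 2 * psi * cabs vk ^+ 2.
  rewrite /E1 cabsM n2E ler_wpM2r ?sqr_ge0// !cabsM.
  apply: (@le_trans _ _ ((2 * a) * (2 * a) * (4 * a) * (cabs F * cabs F))).
    rewrite -mulrA; apply: ler_pM; rewrite ?mulr_ge0 ?cabs_ge0//.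
    by rewrite ler_pM ?mulr_ge0 ?cabs_ge0// ?ler_pM ?cabs_ge0//; exact: stage_g.
  have -> : 2 * a * (2 * a) * (4 * a) * (cabs F * cabs F) =
    16 * (a * ((a * cabs F) * (a * cabs F))) by ring.
  have h1 : (a * cabs F) * (a * cabs F) <= 9 * (p ^+ 2 * psi).
    rewrite -ps2; have -> : 9 * (p * s) ^+ 2 = 3 * (p * s) * (3 * (p * s)) by ring.
    by apply: ler_pM => //; exact: stage_aF.
  have : a * ((a * cabs F) * (a * cabs F)) <= (a * cabs F) * (a * cabs F).
    by rewrite ler_piMl// mulr_ge0.
  lra.
have H2 : cabs E2 <= 32 * psi * cabs vk ^+ 2.
  rewrite /E2 cabsM n2E ler_wpM2r ?sqr_ge0//; apply: le_trans stage_mu_mk _.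
  by rewrite ler_wpM2l// ler_piMl// ltW.
have H3 : cabs E3 <= 96 * p ^+ 2 * psi * cabs vk.
  rewrite /E3 cabsN cabsM !cabsM.
  have h : cabs (cc * X + vk * Y) <= 4 * (p * s) * cabs vk.
    apply: le_trans (cabsD _ _) _; rewrite !cabsM /cc cabs_conj.
    by have := ler_wpM2l v0 stage_X; have := ler_wpM2l v0 stage_Y; lra.
  apply: le_trans (ler_pM _ (cabs_ge0 _) muF h) _; first by rewrite !mulr_ge0 ?cabs_ge0.
  by rewrite le_eqVlt; apply/orP; left; apply/eqP; rewrite -sE; ring.
have H4 : cabs E4 <= 96 * p ^+ 3 * psi * s.
  rewrite /E4 !cabsM.
  have h : cabs X * cabs Y <= 2 * (p * s) * (2 * (p * s)).
    by apply: ler_pM; rewrite ?cabs_ge0//; [exact: stage_X|exact: stage_Y].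
  apply: le_trans (ler_pM _ _ muF h) _; rewrite ?mulr_ge0 ?cabs_ge0//.
  by rewrite le_eqVlt; apply/orP; left; apply/eqP; rewrite -sE; ring.
have H5 : cabs E5 <= 128 * psi ^+ 2.
  rewrite /E5 !cabsM cabs_real (ger0_norm (ltW nu0)).
  have h := ler_pM (cabs_ge0 _) (cabs_ge0 _) stage_mu_mk stage_Q.
  apply: le_trans (ler_wpM2l (ltW nu0) h) _.
  have -> : nu * (32 * (a * psi) * (4 * (y / e))) = 128 * (a * psi ^+ 2).
    by rewrite /psi; field; rewrite gt_eqF.
  have : a * psi ^+ 2 <= psi ^+ 2 by rewrite ler_piMl// exprn_ge0// ltW.
  lra.
have H6 : cabs E6 <= 16 * nu * (psi / e).
  rewrite /E6 cabsN !cabsM !cabs_real !(ger0_norm (ltW nu0)).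
  have b0 : 0 <= 2 * (y / e) by rewrite mulr_ge0// ltW.
  have hTG := shrink iz1 b0 stage_hs2Gv; rewrite -TE in hTG.
  have hQ3 : cabs Q3 <= 4 * (y / e / e).
    apply: ler_of_sq; first by rewrite mulr_ge0//; exact: divr_ge0 (ltW ye0) (ltW e0).
    apply: le_trans (cauchy_schwarz_row_col _ _) _.
    apply: le_trans (ler_pM (hs2_ge0 _) (hs2_ge0 _) stage_hs2vT hTG) _.
    have -> : 4 * (y / e) * (5 / 4 * (2 * (y / e)) / e ^+ 2) = 10 * (y / e / e) ^+ 2.
      by field; rewrite gt_eqF.
    by have := sqr_ge0 (y / e / e); lra.
  have hm : cabs mk * cabs mk <= 2 * a * (2 * a) by rewrite ler_pM ?cabs_ge0.
  have hn : nu * (nu * cabs Q3) <= nu * (nu * (4 * (y / e / e))).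
    by rewrite !ler_wpM2l// ltW.
  apply: le_trans (ler_pM _ _ hm hn) _; rewrite ?mulr_ge0 ?cabs_ge0 ?(ltW nu0)//.
  have -> : 2 * a * (2 * a) * (nu * (nu * (4 * (y / e / e)))) = 16 * nu * (a ^+ 2 * (psi / e)).
    by rewrite /psi; field; rewrite gt_eqF.
  rewrite ler_wpM2l ?mulr_ge0 ?(ltW nu0)// ler_piMl//.
apply: le_trans (cabsD _ _) _; apply: lerD => //.
apply: le_trans (cabsD _ _) _; apply: lerD => //.
apply: le_trans (cabsD _ _) _; apply: lerD => //.
apply: le_trans (cabsD _ _) _; apply: lerD => //.
by apply: le_trans (cabsD _ _) _; exact: lerD.
Qed.

Lemma stage_V6 : nu ^+ 2 * hs2 B6 + nu * (hs2 al6 + hs2 be6 + cabs ga6 ^+ 2) <=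
  176 * psi * cabs vk ^+ 2 + 128 * psi ^+ 2.
Proof.
have v2 : cabs vk ^+ 2 <= 1 by rewrite expr_le1 ?cabs_ge0.
have vv0 := sqr_ge0 (cabs vk).
have m4 : (cabs mu ^+ 2) ^+ 2 <= 16 * a ^+ 2.
  apply: (@le_trans _ _ ((4 * a ^+ 2) ^+ 2)).
    apply: lerXn2r; rewrite ?nnegrE; [exact: sqr_ge0| |exact: mu_sq].
    by apply: mulr_ge0 => //; exact: sqr_ge0.
  have -> : (4 * a ^+ 2) ^+ 2 = 16 * (a ^+ 2 * a ^+ 2) by ring.
  by rewrite ler_wpM2l// ler_piMl ?sqr_ge0.
have c1 : cabs (mu ^+ 2 * n2) ^+ 2 <= 16 * a ^+ 2 * cabs vk ^+ 2.
  rewrite cabsM cabsX n2E exprMn; apply: ler_pM => //; rewrite ?sqr_ge0//.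
  by rewrite expr2 ler_piMl.
have nTv : nu * hs2 (T *m v) <= 4 * psi.
  have := ler_wpM2l (ltW nu0) stage_hs2Tv => /le_trans; apply.
  by rewrite le_eqVlt; apply/orP; left; apply/eqP; rewrite /psi; field; rewrite gt_eqF.
have nvT : nu * hs2 (ctr v *m T) <= 4 * psi.
  have := ler_wpM2l (ltW nu0) stage_hs2vT => /le_trans; apply.
  by rewrite le_eqVlt; apply/orP; left; apply/eqP; rewrite /psi; field; rewrite gt_eqF.
have m4' : cabs mu ^+ 2 <= 4 by apply: le_trans mu_sq _; have := a21; lra.
have h1 : nu ^+ 2 * hs2 B6 <= 128 * psi * cabs vk ^+ 2 + 128 * psi ^+ 2.
  apply: (@le_trans _ _ (nu ^+ 2 * (2 * (16 * cabs vk ^+ 2 * hs2 T) +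
      2 * (4 * (hs2 (T *m v) * hs2 (ctr v *m T)))))).
    apply: ler_wpM2l; first exact: sqr_ge0.
    apply: le_trans (hs2D _ _) _; rewrite !hs2Z hs2M_col_row.
    apply: lerD; apply: ler_wpM2l => //; apply: ler_wpM2r; rewrite ?mulr_ge0 ?hs2_ge0//.
    apply: le_trans c1 _; rewrite ler_wpM2r//; have := a21; lra.
  have -> : nu ^+ 2 * (2 * (16 * cabs vk ^+ 2 * hs2 T) +
      2 * (4 * (hs2 (T *m v) * hs2 (ctr v *m T)))) =
    32 * cabs vk ^+ 2 * (nu ^+ 2 * hs2 T) +
      8 * ((nu * hs2 (T *m v)) * (nu * hs2 (ctr v *m T))) by ring.
  apply: lerD.
    have := ler_wpM2l (mulr_ge0 (ler0n R 32) vv0) nuT => /le_trans; apply.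
    by rewrite le_eqVlt; apply/orP; left; apply/eqP; ring.
  have := ler_pM (mulr_ge0 (ltW nu0) (hs2_ge0 _)) (mulr_ge0 (ltW nu0) (hs2_ge0 _)) nTv nvT.
  lra.
have h2 : nu * hs2 al6 <= 16 * psi * cabs vk ^+ 2.
  rewrite /al6 hs2Z cabsN cabsM /cc cabs_conj exprMn.
  have -> : nu * (cabs mu ^+ 2 * cabs vk ^+ 2 * hs2 (T *m v)) =
    cabs mu ^+ 2 * (nu * hs2 (T *m v)) * cabs vk ^+ 2 by ring.
  rewrite ler_wpM2r//; have -> : 16 * psi = 4 * (4 * psi) by ring.
  by rewrite ler_pM ?sqr_ge0// mulr_ge0 ?hs2_ge0// ltW.
have h3 : nu * hs2 be6 <= 16 * psi * cabs vk ^+ 2.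
  rewrite /be6 hs2Z cabsN cabsM exprMn.
  have -> : nu * (cabs mu ^+ 2 * cabs vk ^+ 2 * hs2 (ctr v *m T)) =
    cabs mu ^+ 2 * (nu * hs2 (ctr v *m T)) * cabs vk ^+ 2 by ring.
  rewrite ler_wpM2r//; have -> : 16 * psi = 4 * (4 * psi) by ring.
  by rewrite ler_pM ?sqr_ge0// mulr_ge0 ?hs2_ge0// ltW.
have h4 : nu * cabs ga6 ^+ 2 <= 16 * psi * cabs vk ^+ 2.
  rewrite /ga6 cabsN; apply: le_trans (ler_wpM2l (ltW nu0) c1) _.
  have -> : nu * (16 * a ^+ 2 * cabs vk ^+ 2) = 16 * (a ^+ 2 * nu) * cabs vk ^+ 2 by ring.
  by rewrite ler_wpM2r// ler_wpM2l.
rewrite !mulrDr; lra.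
Qed.
End Stage.

Lemma cImZ (R : realType) (c : R) (z : R[i]) : cIm (c%:C%C * z) = c * cIm z.
Proof. by rewrite cImM cRe_real cIm_real mul0r addr0. Qed.

(** * Sums along an arithmetic progression, and stability under a shift of the parameter *)

Section Telescoping.
Context {R : realType} (e : nat -> R) (h : R) (N : nat).
Hypotheses (h0 : 0 <= h) (eS : forall k, (k < N)%N -> e k = e k.+1 + h)
  (e0 : forall k, (k <= N)%N -> 0 < e k).

(** Each summand is dominated by the increment of a primitive [F]; the three lemmas that follow are
    discrete versions of $\int ds/s^2$, $\int ds/s^3$ and $\int ds/s^{3/2}$. *)
Lemma telescope_le (f F : nat -> R) K : (K <= N)%N ->
  (forall k, (k < N)%N -> f k <= F k.+1 - F k) -> 0 <= F 0%N ->
  \sum_(k < K) f k <= F K.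
Proof.
move=> + fF F0; elim: K => [|K IH] KN; first by rewrite big_ord0.
by rewrite big_ord_recr /=; have := IH (ltnW KN); have := fF K KN; lra.
Qed.

Lemma sum_inv2 K : (K <= N)%N -> \sum_(k < K) h / e k ^+ 2 <= (e K)^-1.
Proof.
move=> KN; apply: (telescope_le (f := fun k => h / e k ^+ 2) (F := fun k => (e k)^-1)) => //.
  move=> k kN; have k1 := e0 kN; have k2 := e0 (ltnW kN).
  have E := eS kN; rewrite ler_pdivrMr ?exprn_gt0//.
  have -> : ((e k.+1)^-1 - (e k)^-1) * e k ^+ 2 = (e k - e k.+1) * (e k / e k.+1).
    by field; rewrite !gt_eqF.
  rewrite E addrAC subrr add0r ler_peMr//.
  by rewrite ler_pdivlMr// mul1r lerDl.
by rewrite invr_ge0 ltW// e0.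
Qed.

Lemma sum_inv3 K : (K <= N)%N -> \sum_(k < K) h / e k ^+ 3 <= (e K ^+ 2)^-1.
Proof.
move=> KN; apply: (telescope_le (f := fun k => h / e k ^+ 3) (F := fun k => (e k ^+ 2)^-1)) => //.
  move=> k kN; have k1 := e0 kN; have k2 := e0 (ltnW kN).
  have E := eS kN; rewrite ler_pdivrMr ?exprn_gt0//.
  have -> : ((e k.+1 ^+ 2)^-1 - (e k ^+ 2)^-1) * e k ^+ 3 =
     (e k - e k.+1) * ((e k / e k.+1) * (1 + e k / e k.+1)).
    by field; rewrite !gt_eqF.
  have r1 : 1 <= e k / e k.+1 by rewrite ler_pdivlMr// mul1r E lerDl.
  have -> : e k - e k.+1 = h by rewrite E; ring.
  by rewrite ler_peMr//; nra.
by rewrite invr_ge0 sqr_ge0.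
Qed.

Lemma sum_inv32 K : (K <= N)%N ->
  \sum_(k < K) h / (e k * Num.sqrt (e k)) <= 2 / Num.sqrt (e K).
Proof.
move=> KN; apply: (telescope_le (f := fun k => h / (e k * Num.sqrt (e k)))
  (F := fun k => 2 / Num.sqrt (e k))) => //.
  move=> k kN; have k1 := e0 kN; have k2 := e0 (ltnW kN).
  have E := eS kN; set a := Num.sqrt (e k); set b := Num.sqrt (e k.+1).
  have a0 : 0 < a by rewrite sqrtr_gt0.
  have b0 : 0 < b by rewrite sqrtr_gt0.
  have aE : e k = a ^+ 2 by rewrite sqr_sqrtr// ltW.
  have bE : e k.+1 = b ^+ 2 by rewrite sqr_sqrtr// ltW.
  have ba : b <= a by rewrite ler_wsqrtr// E lerDl.
  have -> : h = (a - b) * (a + b) by rewrite -[h](addKr (e k.+1)) -E aE bE; ring.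
  rewrite aE -subr_ge0.
  have -> : 2 / b - 2 / a - (a - b) * (a + b) / (a ^+ 2 * a) =
    (a - b) * ((a - b) * (2 * a + b)) / (a ^+ 3 * b).
    by field; rewrite !gt_eqF.
  rewrite divr_ge0 ?mulr_ge0 ?exprn_ge0 ?subr_ge0 ?(ltW a0) ?(ltW b0)//.
  by rewrite addr_ge0 ?mulr_ge0 ?(ltW a0) ?(ltW b0).
Qed.

Lemma le_e i k : (i <= k)%N -> (k <= N)%N -> e k <= e i.
Proof.
elim: k => [|k IH]; first by rewrite leqn0 => /eqP ->.
rewrite leq_eqVlt => /orP[/eqP -> //|]; rewrite ltnS => ik kN.
apply: le_trans (IH ik (ltnW kN)); rewrite (eS kN) lerDl//.
Qed.
End Telescoping.

Lemma green0 (R : realType) N (A : 'M[R[i]]_N) z : green A 0 z = 0.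
Proof.
have p0 : proj_below N 0 = 0 :> 'M[R[i]]_N by apply/matrixP=> i j; rewrite !mxE ltn0 andbF.
by rewrite /green p0 mul0mx scaler0.
Qed.

(** Resolvent identity, Cauchy-Schwarz, and the Ward identity for both factors. *)
Lemma green_form_perturb (R : realType) N (A : 'M[R[i]]_N) k (v : 'cV[R[i]]_N) z u :
  ctr A = A -> 0 < cIm z -> 0 < cIm u ->
  cabs ((ctr v *m green A k u *m v) 0 0 - (ctr v *m green A k z *m v) 0 0) ^+ 2 <=
    cabs (u - z) ^+ 2 * (cIm ((ctr v *m green A k z *m v) 0 0) / cIm z) *
      (cIm ((ctr v *m green A k u *m v) 0 0) / cIm u).
Proof.
move=> Ah z0 u0.
have h1 := hs2_green Ah k v z0; have h2 := hs2_green Ah k v u0.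
have h3 := hs2_ctr_green Ah k v u0; have h4 := resolvent_identity Ah k u0 z0.
rewrite /mxtrace big_ord1 in h1; rewrite /mxtrace big_ord1 in h2.
move: (green A k z) (green A k u) h1 h2 h3 h4 => G U h1 h2 h3 h4.
have -> : (ctr v *m U *m v) 0 0 - (ctr v *m G *m v) 0 0 =
    (u - z) * ((ctr v *m U) *m (G *m v)) 0 0.
  have := congr1 (fun M => (ctr v *m M *m v) 0 0) h4.
  have Z m n c (M : 'M[R[i]]_(m, n)) i j : (c *: M) i j = c * M i j by rewrite mxE.
  have B m n (M M' : 'M[R[i]]_(m, n)) i j : (M - M') i j = M i j - M' i j by rewrite !mxE.
  by rewrite mulmxBr mulmxBl -scalemxAr -scalemxAl Z B !mulmxA.
rewrite cabsM exprMn -h1 -h2 ![_ * _ / _]mulrAC !divff ?gt_eqF// !mul1r -mulrA.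
rewrite ler_wpM2l ?sqr_ge0//.
have := cauchy_schwarz_row_col (ctr v *m U) (G *m v); rewrite mulrC.
have -> : hs2 (ctr v *m U) = hs2 (U *m v) by rewrite -h3 -hs2_ctr ctrM ctrK.
by [].
Qed.

Lemma green_form_Im_ge0 (R : realType) N (A : 'M[R[i]]_N) k (v : 'cV[R[i]]_N) z :
  ctr A = A -> 0 < cIm z -> 0 <= cIm ((ctr v *m green A k z *m v) 0 0).
Proof.
move=> Ah z0; have := hs2_green Ah k v z0; rewrite /mxtrace big_ord1 => <-.
by rewrite mulr_ge0 ?hs2_ge0// ltW.
Qed.

(** A self-bounding estimate: [D] is the change of a quantity whose two values [x], [x'] differ by
    at most [D]. Since $d/\eta\le 1/50$, the case $D>x'/20$ is contradictory, and otherwise [x] is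
    comparable to [x']. *)
Lemma perturb_bound (R : realType) (D d x x' eta eta' y : R) : 0 <= D -> 0 <= d ->
  0 < eta -> d <= eta / 50 -> 9 / 10 * eta <= eta' -> 0 <= x -> 0 <= x' -> x <= x' + D ->
  x' <= 115 / 100 * y -> D ^+ 2 <= d ^+ 2 * (x / eta) * (x' / eta') -> D <= 2 * (d / eta) * y.
Proof.
move=> D0 d0 e0 de ee x0 x'0 xx xy hD.
set t := d / eta; have t0 : 0 <= t by rewrite divr_ge0// ltW.
have t1 : t <= 1 / 50 by rewrite ler_pdivrMr//; lra.
have e'0 : 0 < eta' by lra.
have h1 : D ^+ 2 <= t ^+ 2 * (x * x') * (10 / 9).
  apply: le_trans hD _.
  have -> : d ^+ 2 * (x / eta) * (x' / eta') = t ^+ 2 * (x * x') * (eta / eta').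
    by rewrite /t; field; rewrite !gt_eqF.
  apply: ler_wpM2l; first exact: (mulr_ge0 (sqr_ge0 t) (mulr_ge0 x0 x'0)).
  by rewrite ler_pdivrMr//; lra.
have y0 : 0 <= y by lra.
have h2 : D ^+ 2 <= t ^+ 2 * ((x' + D) * x') * (10 / 9).
  apply: le_trans h1 _; apply: ler_wpM2r; first by lra.
  by apply: ler_wpM2l; rewrite ?sqr_ge0//; apply: ler_wpM2r.
have t2 : t ^+ 2 <= 1 / 2500.
  have -> : (1 / 2500 : R) = (1 / 50) ^+ 2 by field.
  by rewrite lerXn2r ?nnegrE//; lra.
have h3 : D <= x' / 20.
  rewrite leNgt; apply/negP => h.
  have Dp : 0 < D by lra.
  have h4 : (x' + D) * x' <= 420 * D ^+ 2 by nra.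
  have h5 : t ^+ 2 * ((x' + D) * x') <= 1 / 2500 * (420 * D ^+ 2).
    by apply: ler_pM => //; [exact: sqr_ge0|rewrite mulr_ge0// addr_ge0].
  by have := exprn_gt0 2 Dp; lra.
have h6 : x * x' <= 3 * y ^+ 2 by nra.
apply: ler_of_sq; first by apply: mulr_ge0 => //; apply: mulr_ge0.
have := ler_wpM2l (sqr_ge0 t) h6; have -> : (2 * t * y) ^+ 2 = 4 * (t ^+ 2 * y ^+ 2) by ring.
by clearbody t; have := mulr_ge0 (sqr_ge0 t) (sqr_ge0 y); move: hD => _; lra.
Qed.

(** * The characteristic flow from the empty minor to the full matrix *)

Section Flow.
Context {R : realType} (N : nat) (A : 'M[R[i]]_N) (nu : R) (w0 : R[i]) (v : 'cV[R[i]]_N).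

(** Discrete characteristic $z_{k+1}=z_k-\nu m_k$ with $m_k=-1/w_k$, coupled to the size of the
    minor. With $m_k$ frozen at $m$ it runs in a straight line from $-1/m$ to $-1/m-m$ in $N$
    steps. *)
Fixpoint flow_z (k : nat) : R[i] :=
  if k is k'.+1 then flow_z k' - nu%:C%C * - (flow_z k' + nu%:C%C * \tr (green A k' (flow_z k')))^-1
  else w0.
Definition flow_w k := flow_z k + nu%:C%C * \tr (green A k (flow_z k)).
Definition flow_m k := - (flow_w k)^-1.
Definition flow_T k := green A k (flow_z k.+1).
Definition flow_mu k := - (flow_z k.+1 + nu%:C%C * \tr (flow_T k))^-1.
Definition flow_c k := flow_mu k ^+ 2 * (1 + nu%:C%C * \tr (flow_T k *m flow_T k)).
Definition flow_B5 k := nu%:C%C *: (flow_c k *: flow_T k + flow_mu k *: (flow_T k *m flow_T k)).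
Definition flow_g5 k := - (nu%:C%C * flow_c k).
Definition flow_n2 (k : 'I_N) := v k 0 * cconj (v k 0).
Definition flow_B6 (k : 'I_N) := (flow_mu k ^+ 2 * flow_n2 k) *: flow_T k +
  flow_mu k *: ((flow_T k *m v) *m (ctr v *m flow_T k)).
Definition flow_al6 (k : 'I_N) := - (flow_mu k * cconj (v k 0)) *: (flow_T k *m v).
Definition flow_be6 (k : 'I_N) := - (flow_mu k * v k 0) *: (ctr v *m flow_T k).
Definition flow_g6 (k : 'I_N) := - (flow_mu k ^+ 2 * flow_n2 k).
Definition flow_A k := (ctr v *m green A k (flow_z k) *m v) 0 0.

Lemma flow_zS k : flow_z k.+1 = flow_z k - nu%:C%C * flow_m k. Proof. by []. Qed.

Lemma row_form_diag (k : 'I_N) (M : 'M[R[i]]_N) ga : proj_below N k *m M = M ->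
  row_form nu A k M 0 0 ga = (row_below A k *m M *m ctr (row_below A k)) 0 0 -
    nu%:C%C * \tr M + ga * A k k.
Proof.
move=> pM; have Z m n i j : (0 : 'M[R[i]]_(m, n)) i j = 0 by rewrite mxE.
by rewrite /row_form mulmx0 mul0mx !Z !addr0 sum_diag_below.
Qed.

Lemma row_form_col (k : 'I_N) (al : 'cV[R[i]]_N) :
  row_form nu A k 0 al 0 0 = (row_below A k *m al) 0 0.
Proof.
have Z m n i j : (0 : 'M[R[i]]_(m, n)) i j = 0 by rewrite mxE.
rewrite /row_form mulmx0 !mul0mx !Z big1 => [|i _]; last by rewrite Z.
by rewrite mulr0 subr0 mul0r !addr0 add0r.
Qed.

Lemma row_form_row (k : 'I_N) (be : 'rV[R[i]]_N) :
  row_form nu A k 0 0 be 0 = (be *m ctr (row_below A k)) 0 0.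
Proof.
have Z m n i j : (0 : 'M[R[i]]_(m, n)) i j = 0 by rewrite mxE.
rewrite /row_form !mulmx0 !mul0mx !Z big1 => [|i _]; last by rewrite Z.
by rewrite mulr0 subr0 mul0r !addr0 add0r.
Qed.

Hypothesis Ah : ctr A = A.
Variables (m : R[i]) (p P ell : R).
Let y := cIm m.
Let a := cabs m.
(** The imaginary part of the straight line $-1/m-k\nu m$; at $k=N$ it is $\Im(-1/m-m)$. *)
Definition flow_e k : R := y / a ^+ 2 - k%:R * (nu * y).
Local Notation e := flow_e.
Hypotheses (N0 : (0 < N)%N) (nuE : nu * N%:R = 1) (w0E : w0 = - m^-1) (y0 : 0 < y)
  (p1 : 10 ^+ 4 <= p) (Pp : 100 * p ^+ 8 <= P) (Pe : P * nu <= y * e N)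
  (ellP : 100 * (p ^+ 3 * ell) <= P) (v1 : \sum_k cabs (v k 0) ^+ 2 = 1).
Hypothesis ellE : \sum_(k < N) nu * y / e k <= ell.
(** These are the probabilistic inputs. The first four compare a form of a single row with its own
    predictable size. [H5] and [H6] concern sums with deterministic variance budgets, which are
    known to hold only after the earlier stages are controlled and so appear as premises; their
    constants fit because $3240+400\le 64^2$ and $176+128\le 18^2$. *)
Hypothesis H1 : forall k : 'I_N, cabs (row_form nu A k (flow_T k) 0 0 (-1)) ^+ 2 <=
  p ^+ 2 * (nu ^+ 2 * hs2 (flow_T k) + nu).
Hypothesis H2 : forall k : 'I_N, cabs (row_form nu A k (flow_T k *m flow_T k) 0 0 0) ^+ 2 <=
  p ^+ 2 * (nu ^+ 2 * hs2 (flow_T k *m flow_T k)).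
Hypothesis H3 : forall k : 'I_N, cabs (row_form nu A k 0 (flow_T k *m v) 0 0) ^+ 2 <=
  p ^+ 2 * (nu * hs2 (flow_T k *m v)).
Hypothesis H4 : forall k : 'I_N, cabs (row_form nu A k 0 0 (ctr v *m flow_T k) 0) ^+ 2 <=
  p ^+ 2 * (nu * hs2 (ctr v *m flow_T k)).
Hypothesis H5 : forall K, (K <= N)%N ->
  \sum_(k < N | (k < K)%N) (nu ^+ 2 * hs2 (flow_B5 k) + nu * cabs (flow_g5 k) ^+ 2) <=
    (64 * (nu / e K)) ^+ 2 ->
  cabs (\sum_(k < N | (k < K)%N) row_form nu A k (flow_B5 k) 0 0 (flow_g5 k)) <=
    p * (64 * (nu / e K)).
Hypothesis H6 : forall K, (K <= N)%N ->
  \sum_(k < N | (k < K)%N) (nu ^+ 2 * hs2 (flow_B6 k) + nu * (hs2 (flow_al6 k) +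
      hs2 (flow_be6 k) + cabs (flow_g6 k) ^+ 2)) <= (18 * Num.sqrt (y * nu / e K)) ^+ 2 ->
  cabs (\sum_(k < N | (k < K)%N) row_form nu A k (flow_B6 k) (flow_al6 k) (flow_be6 k) (flow_g6 k))
    <= p * (18 * Num.sqrt (y * nu / e K)).

Let nu0 : 0 < nu.
Proof.
have N0' : 0 < N%:R :> R by rewrite ltr0n.
by rewrite -(pmulr_lgt0 _ N0') nuE ltr01.
Qed.
Let p0 : 0 < p. Proof. by have := p1; lra. Qed.
Let P0 : 0 < P. Proof. by apply: lt_le_trans Pp; have := exprn_gt0 8 p0; lra. Qed.
Let eN0 : 0 < e N.
Proof. by rewrite -(pmulr_rgt0 _ y0); apply: lt_le_trans Pe; exact: mulr_gt0. Qed.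
Let a0 : 0 < a.
Proof. by rewrite /a; apply: lt_le_trans (cIm_ub m). Qed.
Let ya : y <= a. Proof. exact: cIm_ub. Qed.
Let eS k : e k = e k.+1 + nu * y. Proof. by rewrite /flow_e -natr1; ring. Qed.
Let nuy0 : 0 < nu * y. Proof. exact: mulr_gt0. Qed.
Let e_gt0 k : (k <= N)%N -> 0 < e k.
Proof.
move=> kN; apply: lt_le_trans eN0 _; rewrite /flow_e lerD2l lerN2 ler_wpM2r ?(ltW nuy0)//.
by rewrite ler_nat.
Qed.
Let le_ee i k : (i <= k)%N -> (k <= N)%N -> e k <= e i.
Proof. exact: (@le_e _ e (nu * y) N (ltW nuy0) (fun k _ => eS k)). Qed.
Let a1 : a <= 1.
Proof.
have : 0 < y / a ^+ 2 - y by have := eN0; rewrite /flow_e mulrA [_ * nu]mulrC nuE mul1r.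
rewrite subr_gt0 ltr_pdivlMr ?exprn_gt0// gtr_pMr// => /ltW.
by rewrite expr_le1// ltW.
Qed.
Let aey k : a ^+ 2 * e k <= y.
Proof.
rewrite /flow_e mulrBr mulrCA divff ?mulr1 ?gt_eqF ?exprn_gt0// gerDl oppr_le0.
by rewrite !mulr_ge0 ?exprn_ge0 ?ler0n ?(ltW nu0) ?(ltW a0) ?(ltW y0).
Qed.
Let Pek k : (k <= N)%N -> P * nu <= y * e k.
Proof. by move=> kN; apply: le_trans Pe _; rewrite ler_wpM2l ?(ltW y0)// le_ee. Qed.
Let w0_abs : cabs w0 = a^-1. Proof. by rewrite w0E cabsN cabsV. Qed.
Let w0_Im : cIm w0 = y / a ^+ 2.
Proof. by rewrite w0E cImN complexV_Im; rewrite mulNr opprK. Qed.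
Let m_neq0 : m != 0. Proof. by rewrite -cabs_gt0. Qed.

Let p3P k : (k <= N)%N -> p ^+ 3 * (nu / e k) <= y / 100.
Proof.
move=> kN; have ek := e_gt0 kN.
rewrite mulrA ler_pdivrMr//; have := Pek kN.
have : 100 * p ^+ 3 * nu <= P * nu.
  rewrite ler_wpM2r ?(ltW nu0)//; apply: le_trans Pp; rewrite ler_wpM2l//.
  by rewrite ler_weXn2l//; have := p1; lra.
lra.
Qed.

Definition flow_inv k := cabs (flow_w k - w0) <= p ^+ 3 * (nu / e k) /\
  cabs (flow_A k - \sum_(i < N | (i < k)%N) flow_m i * flow_n2 i) <=
    p ^+ 4 * Num.sqrt (y * nu / e k).

Let aw k : (k <= N)%N -> flow_inv k -> 98 / 100 <= a * cabs (flow_w k).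
Proof.
move=> kN [h _]; have := cabs_lb w0 (w0 - flow_w k); rewrite subKr cabsBC => h2.
have : p ^+ 3 * (nu / e k) <= 1 / 100.
  by apply: le_trans (p3P kN) _; have := le_trans ya a1; lra.
have : a * cabs w0 = 1 by rewrite w0_abs divff ?gt_eqF.
have := ler_wpM2l (ltW a0) h2; rewrite mulrBr.
have : a * cabs (flow_w k - w0) <= cabs (flow_w k - w0) by rewrite ler_piMl ?cabs_ge0.
lra.
Qed.

Let m_diff k : (k <= N)%N -> flow_inv k ->
  cabs (flow_m k - m) <= 2 * a ^+ 2 * (p ^+ 3 * (nu / e k)).
Proof.
move=> kN I; have W := aw kN I; case: I => h _.
have w_gt0 : 0 < cabs (flow_w k) by rewrite -(pmulr_rgt0 _ a0); apply: lt_le_trans W; lra.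
have wn0 : flow_w k != 0 by rewrite -cabs_gt0.
have -> : flow_m k - m = (flow_w k - w0) * (flow_m k * m).
  by rewrite /flow_m w0E; field; rewrite wn0 m_neq0.
rewrite !cabsM.
have hm : cabs (flow_m k) <= 2 * a.
  rewrite /flow_m cabsN cabsV -(ler_pM2r w_gt0) mulVf ?gt_eqF//.
  by have := W; lra.
apply: le_trans (ler_pM (cabs_ge0 _) _ h _) _; first by rewrite mulr_ge0 ?cabs_ge0.
  exact: (ler_wpM2r (cabs_ge0 m) hm).
by rewrite -/a le_eqVlt; apply/orP; left; apply/eqP; ring.
Qed.


(** At each step $m_i$ is replaced by [m] at a cost of order $\nu/e_i$; the sum over the steps is
    harmonic, hence only logarithmic in [N]. *)
Let z_dev k : (k <= N)%N -> (forall i, (i < k)%N -> flow_inv i) ->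
  cabs (flow_z k - (w0 - (k%:R * nu)%:C%C * m)) <=
    2 * a ^+ 2 * p ^+ 3 * nu / y * \sum_(i < k) nu * y / e i.
Proof.
elim: k => [|k IH] kN I.
  by rewrite mul0r mul0r subr0 subrr cabs0 big_ord0 mulr0.
rewrite flow_zS big_ord_recr /= mulrDr.
have -> : flow_z k - nu%:C%C * flow_m k - (w0 - (k.+1%:R * nu)%:C%C * m) =
  (flow_z k - (w0 - (k%:R * nu)%:C%C * m)) - nu%:C%C * (flow_m k - m).
  by rewrite -natr1 mulrDl mul1r rmorphD /=; ring.
apply: le_trans (cabsB _ _) _; apply: lerD.
  by apply: IH => [|i ik]; [exact: ltnW|apply: I; exact: ltnW].
rewrite cabsM cabs_real (ger0_norm (ltW nu0)).
have := ler_wpM2l (ltW nu0) (m_diff (ltnW kN) (I k (ltnSn k))).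
move/le_trans; apply; rewrite le_eqVlt; apply/orP; left; apply/eqP.
by field; rewrite !gt_eqF ?e_gt0 ?(ltnW kN).
Qed.

Let psi k := y * nu / e k.
Let psi_gt0 k : (k <= N)%N -> 0 < psi k.
Proof. by move=> kN; rewrite divr_gt0 ?mulr_gt0// e_gt0. Qed.
Let le_psi i k : (i <= k)%N -> (k <= N)%N -> psi i <= psi k.
Proof.
move=> ik kN; rewrite ler_wpM2l ?mulr_ge0 ?(ltW y0) ?(ltW nu0)// lef_pV2 ?posrE ?e_gt0//.
  exact: le_ee.
exact: leq_trans ik kN.
Qed.

Let z_dev2 k : (k <= N)%N -> (forall i, (i < k)%N -> flow_inv i) ->
  cabs (flow_z k - (w0 - (k%:R * nu)%:C%C * m)) <= 2 * a ^+ 2 * p ^+ 3 * ell * nu / y.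
Proof.
move=> kN I; apply: le_trans (z_dev kN I) _.
have h : \sum_(i < k) nu * y / e i <= ell.
  apply: le_trans ellE; rewrite (big_ord_widen N (fun i => nu * y / e i) kN).
  rewrite big_mkcond /=; apply: ler_sum => i _; case: ifP => // _.
  by rewrite divr_ge0 ?(ltW nuy0)// ltW// e_gt0// ltnW.
have -> : 2 * a ^+ 2 * p ^+ 3 * ell * nu / y = 2 * a ^+ 2 * p ^+ 3 * nu / y * ell by ring.
rewrite ler_wpM2l// divr_ge0 ?(ltW y0)// !mulr_ge0 ?exprn_ge0 ?(ltW nu0) ?(ltW a0) ?(ltW p0)//.
Qed.

Let z_dev3 k : (k <= N)%N -> (forall i, (i < k)%N -> flow_inv i) ->
  cabs (flow_z k - (w0 - (k%:R * nu)%:C%C * m)) <= a ^+ 2 * e N / 50.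
Proof.
move=> kN I; apply: le_trans (z_dev2 kN I) _; rewrite ler_pdivrMr//.
have h1 : 100 * (p ^+ 3 * ell) * nu <= y * e N.
  by apply: le_trans Pe; rewrite ler_wpM2r// ltW.
have := ler_wpM2l (sqr_ge0 a) h1; lra.
Qed.

Let Im_z k : (k <= N)%N -> (forall i, (i < k)%N -> flow_inv i) ->
  cIm (flow_z k) >= e k - a ^+ 2 * e N / 50.
Proof.
move=> kN I; have := z_dev3 kN I.
have : flow_z k = (flow_z k - (w0 - (k%:R * nu)%:C%C * m)) + (w0 - (k%:R * nu)%:C%C * m).
  by rewrite subrK.
move: (flow_z k - _) => d -> h; rewrite cImD cImB cImZ w0_Im -/y.
have -> : e k = y / a ^+ 2 - k%:R * nu * y by rewrite /flow_e mulrA.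
have := cIm_lb d; lra.
Qed.

Let a2e k : (k <= N)%N -> a ^+ 2 * e N <= e k.
Proof.
move=> kN; apply: le_trans (le_ee kN (leqnn N)).
by rewrite ler_piMl ?(ltW eN0)// expr_le1// ltW.
Qed.

Let p8psi j : (j <= N)%N -> p ^+ 4 * Num.sqrt (psi j) <= y / 10.
Proof.
move=> jN; apply: ler_of_sq; first by apply: divr_ge0; [exact: ltW|lra].
rewrite exprMn -exprM sqr_sqrtr ?(ltW (psi_gt0 jN))// /psi mulrA ler_pdivrMr ?e_gt0//.
have := Pek jN; have : 100 * p ^+ 8 * nu <= P * nu by rewrite ler_wpM2r ?(ltW nu0).
move=> h1 h2; have := ler_wpM2l (ltW y0) (le_trans h1 h2); rewrite exprMn; lra.
Qed.

Section Step.
Variable k : 'I_N.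
Hypothesis I : forall i, (i <= k)%N -> flow_inv i.
Let kN : (k <= N)%N := ltnW (ltn_ord k).
Let ek := e_gt0 kN.

Let nuye : 100 * (nu * y) <= e k.
Proof.
have h1 : 1 <= p ^+ 3 by apply: exprn_ege1; have := p1; lra.
have h := p3P kN; have h2 : nu / e k <= y / 100.
  by apply: le_trans h; rewrite ler_peMl ?divr_ge0 ?(ltW nu0) ?(ltW ek).
move: h2; rewrite ler_pdivrMr// => h2.
have := ler_wpM2r (ltW y0) h2.
have y1 : y <= 1 by apply: le_trans ya a1.
have : y * y <= 1 by apply: mulr_ile1 => //; exact: ltW.
have : y / 100 * e k * y = (y * y) * e k / 100 by ring.
move=> -> yy h3; have := ler_wpM2r (ltW ek) yy; lra.
Qed.

Let iz : 9 / 10 * e k <= cIm (flow_z k).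
Proof.
have := Im_z kN (fun i h => I (ltnW h)); have := a2e kN; have := ek; lra.
Qed.

Let iz1 : 9 / 10 * e k <= cIm (flow_z k.+1).
Proof.
have := Im_z (ltn_ord k) (fun i (h : (i < k.+1)%N) => I h).
have := a2e kN; have := ek; have := nuye; have := eS k; lra.
Qed.

Let trG : nu * cIm (\tr (green A k (flow_z k))) <= 11 / 10 * y.
Proof.
have [h _] := I (leqnn k).
have h1 := Im_z kN (fun i h => I (ltnW h)).
have h2 := le_trans h (p3P kN).
have h3 := le_trans (cIm_ub _) h2; move: h3; rewrite cImB w0_Im {1}/flow_w cImD cImZ.
have : y / a ^+ 2 - e k <= y.
  rewrite /flow_e opprB addrCA subrr addr0 mulrA -[leRHS]mul1r ler_wpM2r ?(ltW y0)//.
  by rewrite -[leRHS]nuE [nu * _]mulrC ler_wpM2r ?(ltW nu0)// ler_nat.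
have := aey N; have := y0; lra.
Qed.

Let err5 : cabs (flow_w k.+1 - flow_w k - row_form nu A k (flow_B5 k) 0 0 (flow_g5 k)) <=
  1100 * p ^+ 2 * nu * (psi k / e k).
Proof.
have p1' : 10 ^+ 3 <= p by have := p1; lra.
apply: (@stage_trace_step _ _ A Ah k (flow_z k) (flow_z k.+1) nu y a (e k) p P nu0 y0 ya a1 ek
  (aey k) p1' Pp (Pek kN) _ _ erefl erefl erefl iz iz1 trG (aw kN (I (leqnn k)))).
  by have := H1 k; rewrite row_form_diag ?proj_green// ?mulN1r//; have := iz1; have := ek; lra.
have := H2 k; rewrite row_form_diag ?mul0r ?addr0//.
by rewrite mulmxA proj_green//; have := iz1; have := ek; lra.
Qed.

Let V5 : nu ^+ 2 * hs2 (flow_B5 k) + nu * cabs (flow_g5 k) ^+ 2 <=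
  3240 * nu ^+ 2 * (psi k / e k ^+ 2) + 400 * nu ^+ 2 * (nu / e k ^+ 2).
Proof.
have p1' : 10 ^+ 3 <= p by have := p1; lra.
exact: (@stage_V5 _ _ A Ah k (flow_z k) (flow_z k.+1) nu y a (e k) p P nu0 y0 ya a1 ek
  (aey k) p1' Pp (Pek kN) _ _ erefl erefl erefl iz iz1 trG (aw kN (I (leqnn k)))).
Qed.


Let vk1 : cabs (v k 0) <= 1.
Proof.
rewrite -(@expr_le1 _ 2)// ?cabs_ge0// -v1 (bigD1 k)//= lerDl.
by apply: sumr_ge0 => i _; exact: sqr_ge0.
Qed.

Let Im_m j : (j <= N)%N -> flow_inv j -> cIm (flow_m j) <= 51 / 50 * y.
Proof.
move=> jN /(m_diff jN) h; have := le_trans (cIm_ub _) h; rewrite cImB -/y.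
have : a ^+ 2 * (p ^+ 3 * (nu / e j)) <= p ^+ 3 * (nu / e j).
  rewrite ler_piMl ?expr_le1// ?(ltW a0)// mulr_ge0 ?exprn_ge0 ?(ltW p0)//.
  by rewrite divr_ge0 ?(ltW nu0)// ltW// e_gt0.
have := p3P jN; lra.
Qed.

(** The drift has imaginary part at most $\frac{51}{50}y\sum_i|v_i|^2$, and the fluctuation is below
    $y/10$. This bound feeds the Ward estimates of the next step. *)
Lemma flow_Im_A j : (j <= N)%N -> (forall i, (i <= j)%N -> flow_inv i) ->
  cIm (flow_A j) <= 115 / 100 * y.
Proof.
move=> jN J; have [_ h] := J j (leqnn j).
have := le_trans (cIm_ub _) (le_trans h (p8psi jN)); rewrite cImB cIm_sum.
have : \sum_(i < N | (i < j)%N) cIm (flow_m i * flow_n2 i) <= 51 / 50 * y.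
  rewrite -[leRHS]mulr1 -[X in _ * X]v1 mulr_sumr big_mkcond /=; apply: ler_sum => i _.
  have yy : 0 <= 51 / 50 * y by have := y0; lra.
  case: ifP => ij; last exact: (mulr_ge0 yy (sqr_ge0 _)).
  rewrite /flow_n2 mul_cconj mulrC cImZ mulrC ler_wpM2r //; first exact: sqr_ge0.
  apply: Im_m; first exact: ltnW.
  by apply: J; exact: ltnW.
by have := y0; lra.
Qed.

Let trv : cIm ((ctr v *m green A k (flow_z k) *m v) 0 0) <= 115 / 100 * y.
Proof. exact: flow_Im_A. Qed.

Let err6 : cabs (flow_A k.+1 - flow_A k - flow_m k * flow_n2 k -
    row_form nu A k (flow_B6 k) (flow_al6 k) (flow_be6 k) (flow_g6 k)) <=
  144 * p ^+ 2 * psi k * cabs (v k 0) ^+ 2 + 32 * psi k * cabs (v k 0) ^+ 2 +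
  96 * p ^+ 2 * psi k * cabs (v k 0) + 96 * p ^+ 3 * psi k * Num.sqrt (psi k) +
  128 * psi k ^+ 2 + 16 * nu * (psi k / e k).
Proof.
have p1' : 10 ^+ 3 <= p by have := p1; lra.
apply: (@stage_form_step _ _ A Ah k v (flow_z k) (flow_z k.+1) nu y a (e k) p P nu0 y0 ya a1 ek
  (aey k) p1' Pp (Pek kN) _ _ erefl erefl erefl iz iz1 trG (aw kN (I (leqnn k))) _ _ _ trv).
- by have := H1 k; rewrite row_form_diag ?proj_green// ?mulN1r//; have := iz1; have := ek; lra.
- by have := H3 k; rewrite row_form_col.
- by have := H4 k; rewrite row_form_row.
Qed.

Let V6 : nu ^+ 2 * hs2 (flow_B6 k) + nu * (hs2 (flow_al6 k) + hs2 (flow_be6 k) +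
    cabs (flow_g6 k) ^+ 2) <= 176 * psi k * cabs (v k 0) ^+ 2 + 128 * psi k ^+ 2.
Proof.
have p1' : 10 ^+ 3 <= p by have := p1; lra.
exact: (@stage_V6 _ _ A Ah k v (flow_z k) (flow_z k.+1) nu y a (e k) p P nu0 y0 ya a1 ek
  (aey k) p1' Pp (Pek kN) _ _ erefl erefl erefl iz iz1 trG (aw kN (I (leqnn k))) trv vk1).
Qed.

Lemma flow_step :
  [/\ cabs (flow_w k.+1 - flow_w k - row_form nu A k (flow_B5 k) 0 0 (flow_g5 k)) <=
        1100 * p ^+ 2 * nu * (psi k / e k),
    nu ^+ 2 * hs2 (flow_B5 k) + nu * cabs (flow_g5 k) ^+ 2 <=
      3240 * nu ^+ 2 * (psi k / e k ^+ 2) + 400 * nu ^+ 2 * (nu / e k ^+ 2),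
    cabs (flow_A k.+1 - flow_A k - flow_m k * flow_n2 k -
        row_form nu A k (flow_B6 k) (flow_al6 k) (flow_be6 k) (flow_g6 k)) <=
      144 * p ^+ 2 * psi k * cabs (v k 0) ^+ 2 + 32 * psi k * cabs (v k 0) ^+ 2 +
      96 * p ^+ 2 * psi k * cabs (v k 0) + 96 * p ^+ 3 * psi k * Num.sqrt (psi k) +
      128 * psi k ^+ 2 + 16 * nu * (psi k / e k) &
    nu ^+ 2 * hs2 (flow_B6 k) + nu * (hs2 (flow_al6 k) + hs2 (flow_be6 k) +
      cabs (flow_g6 k) ^+ 2) <= 176 * psi k * cabs (v k 0) ^+ 2 + 128 * psi k ^+ 2].
Proof. by split; [exact: err5|exact: V5|exact: err6|exact: V6]. Qed.
End Step.

Section Sums.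
Variable K : nat.
Hypothesis KN : (K <= N)%N.

Let sum_below (f : nat -> R) : \sum_(i < N | (i < K)%N) f i = \sum_(i < K) f i.
Proof. by rewrite (big_ord_widen N f KN). Qed.

Let psi1 : psi K <= Num.sqrt (psi K) * y.
Proof.
have := p8psi KN; have s0 := sqrtr_ge0 (psi K).
have p41 : 1 <= p ^+ 4 by apply: exprn_ege1; have := p1; lra.
have := ler_peMl s0 p41 => h1 h2.
rewrite -{1}(sqr_sqrtr (ltW (psi_gt0 KN))) expr2 ler_wpM2l//; have := y0; lra.
Qed.

Lemma nu_e_le : nu / e K <= Num.sqrt (psi K).
Proof. by rewrite -(ler_pM2r y0); move: psi1; rewrite {1}/psi; lra. Qed.

Lemma sum_psi_v2 : \sum_(k < N | (k < K)%N) psi k * cabs (v k 0) ^+ 2 <= psi K.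
Proof.
rewrite -[leRHS]mulr1 -[X in _ * X]v1 mulr_sumr big_mkcond /=; apply: ler_sum => i _.
case: ifP => iK; last by rewrite mulr_ge0 ?sqr_ge0 ?(ltW (psi_gt0 KN)).
by rewrite ler_wpM2r ?sqr_ge0// le_psi// ltnW.
Qed.

Lemma sum_psi_e : \sum_(k < N | (k < K)%N) psi k / e k <= (e K)^-1.
Proof.
rewrite (sum_below (fun k => psi k / e k)).
apply: le_trans (sum_inv2 (ltW nuy0) (fun k _ => eS k) (fun k => @e_gt0 k) KN).
by apply: ler_sum => i _; rewrite /psi mulrC [y * _]mulrC mulrCA -invfM -expr2.
Qed.

Lemma sum_psi2 : \sum_(k < N | (k < K)%N) psi k ^+ 2 <= psi K.
Proof.
have -> : \sum_(k < N | (k < K)%N) psi k ^+ 2 = y * nu * \sum_(k < N | (k < K)%N) psi k / e k.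
  by rewrite mulr_sumr; apply: eq_bigr => i _; rewrite /psi expr2; ring.
by rewrite ler_wpM2l ?sum_psi_e// mulr_ge0 ?(ltW y0) ?(ltW nu0).
Qed.

Lemma sum_psi_sqrt : \sum_(k < N | (k < K)%N) psi k * Num.sqrt (psi k) <= 2 * Num.sqrt (psi K).
Proof.
rewrite (sum_below (fun k => psi k * Num.sqrt (psi k))).
(* The inverses of [psi] form an arithmetic progression with step 1, so the telescoping bound
   applies to them in place of [e]. *)
have E k : (psi k)^-1 = (psi k.+1)^-1 + 1.
  by rewrite /psi !invf_div (eS k) mulrDl [nu * y]mulrC divff// gt_eqF// mulr_gt0.
have Q k : (k <= N)%N -> 0 < (psi k)^-1 by move=> kN; rewrite invr_gt0 psi_gt0.
have := sum_inv32 ler01 (fun k (_ : (k < N)%N) => E k) Q KN.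
rewrite sqrtrV ?(ltW (psi_gt0 KN))// invrK; apply: le_trans.
apply: ler_sum => i _; rewrite sqrtrV ?invfM ?invrK ?mul1r//.
by rewrite ltW// psi_gt0// (leq_trans _ KN)// ltnW.
Qed.

(** Cauchy-Schwarz with $\sum_k|v_k|^2=1$; bounding the coordinates of [v] one by one would be far
    too weak for a spread-out vector. *)
Lemma sum_psi_v : \sum_(k < N | (k < K)%N) psi k * cabs (v k 0) <= Num.sqrt (psi K).
Proof.
apply: ler_of_sq; first exact: sqrtr_ge0.
rewrite sqr_sqrtr ?(ltW (psi_gt0 KN))// big_mkcond /=.
have := cauchy_schwarz_real (fun k : 'I_N => if (k < K)%N then psi k else 0) (fun k => cabs (v k 0)).
rewrite v1 mulr1.
have -> : \sum_(k < N) (if (k < K)%N then psi k else 0) * cabs (v k 0) =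
    \sum_(k < N) (if (k < K)%N then psi k * cabs (v k 0) else 0).
  by apply: eq_bigr => k _; case: ifP => // _; rewrite mul0r.
have -> : \sum_(k < N) (if (k < K)%N then psi k else 0) ^+ 2 =
    \sum_(k < N | (k < K)%N) psi k ^+ 2.
  by rewrite [RHS]big_mkcond; apply: eq_bigr => k _; case: ifP => // _; rewrite expr0n.
move=> /le_trans; apply; exact: sum_psi2.
Qed.

Lemma sum_psi_e2 : \sum_(k < N | (k < K)%N) psi k / e k ^+ 2 <= (e K ^+ 2)^-1.
Proof.
rewrite (sum_below (fun k => psi k / e k ^+ 2)).
apply: le_trans (sum_inv3 (ltW nuy0) (fun k _ => eS k) (fun k => @e_gt0 k) KN).
apply: ler_sum => i _; have iN : 0 < e i by rewrite e_gt0// (leq_trans (ltnW (ltn_ord i)) KN).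
by rewrite le_eqVlt; apply/orP; left; apply/eqP; rewrite /psi; field; rewrite gt_eqF.
Qed.

Lemma sum_nu_e2 : \sum_(k < N | (k < K)%N) nu / e k ^+ 2 <= (e K ^+ 2)^-1.
Proof.
rewrite -[leRHS]mul1r -[X in X * _]nuE -mulrA -[X in X%:R](card_ord N) mulr_natl -sumr_const mulr_sumr.
rewrite big_mkcond /=; apply: ler_sum => i _.
have iN := e_gt0 (ltnW (ltn_ord i)).
case: ifP => iK; last by rewrite mulr_ge0 ?(ltW nu0)// invr_ge0 sqr_ge0.
rewrite ler_wpM2l ?(ltW nu0)// lef_pV2 ?posrE ?exprn_gt0 ?e_gt0//; last exact: ltnW.
rewrite lerXn2r ?nnegrE ?(ltW iN) ?(ltW (e_gt0 KN))//.
by apply: le_ee => //; exact: ltnW.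
Qed.

Lemma sum_below_le (V W : 'I_N -> R) : (forall k : 'I_N, (k < K)%N -> V k <= W k) ->
  \sum_(k < N | (k < K)%N) V k <= \sum_(k < N | (k < K)%N) W k.
Proof. by move=> h; apply: ler_sum => k; exact: h. Qed.

Hypothesis I : forall i, (i < K)%N -> flow_inv i.
Let II (k : 'I_N) : (k < K)%N -> forall i, (i <= k)%N -> flow_inv i.
Proof. by move=> kK i ik; apply: I; exact: leq_ltn_trans ik kK. Qed.

Let w_start : flow_w 0 = w0.
Proof. by rewrite /flow_w /= green0 mxtrace0 mulr0 addr0. Qed.
Let A_start : flow_A 0 = 0.
Proof. by rewrite /flow_A /= green0 mulmx0 mul0mx mxE. Qed.

Let step5 (k : 'I_N) : (k < K)%N -> nu ^+ 2 * hs2 (flow_B5 k) + nu * cabs (flow_g5 k) ^+ 2 <=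
  3240 * nu ^+ 2 * (psi k / e k ^+ 2) + 400 * nu ^+ 2 * (nu / e k ^+ 2).
Proof. by move=> kK; case: (flow_step (II kK)). Qed.
Let step6 (k : 'I_N) : (k < K)%N -> nu ^+ 2 * hs2 (flow_B6 k) + nu * (hs2 (flow_al6 k) +
    hs2 (flow_be6 k) + cabs (flow_g6 k) ^+ 2) <=
  176 * psi k * cabs (v k 0) ^+ 2 + 128 * psi k ^+ 2.
Proof. by move=> kK; case: (flow_step (II kK)). Qed.
Let serr5 (k : 'I_N) : (k < K)%N ->
  cabs (flow_w k.+1 - flow_w k - row_form nu A k (flow_B5 k) 0 0 (flow_g5 k)) <=
    1100 * p ^+ 2 * nu * (psi k / e k).
Proof. by move=> kK; case: (flow_step (II kK)). Qed.
Let serr6 (k : 'I_N) : (k < K)%N -> cabs (flow_A k.+1 - flow_A k - flow_m k * flow_n2 k -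
    row_form nu A k (flow_B6 k) (flow_al6 k) (flow_be6 k) (flow_g6 k)) <=
  144 * p ^+ 2 * psi k * cabs (v k 0) ^+ 2 + 32 * psi k * cabs (v k 0) ^+ 2 +
  96 * p ^+ 2 * psi k * cabs (v k 0) + 96 * p ^+ 3 * psi k * Num.sqrt (psi k) +
  128 * psi k ^+ 2 + 16 * nu * (psi k / e k).
Proof. by move=> kK; case: (flow_step (II kK)). Qed.

Let sum_V5 : \sum_(k < N | (k < K)%N) (nu ^+ 2 * hs2 (flow_B5 k) + nu * cabs (flow_g5 k) ^+ 2) <=
    (64 * (nu / e K)) ^+ 2.
Proof.
apply: le_trans (sum_below_le (fun k kK => step5 kK)) _.
rewrite big_split /= -!mulr_sumr.
have n2 : 0 <= nu ^+ 2 by exact: sqr_ge0.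
have h1 := ler_wpM2l n2 sum_psi_e2; have h2 := ler_wpM2l n2 sum_nu_e2.
have h3 : 0 <= nu ^+ 2 * (e K ^+ 2)^-1 by rewrite mulr_ge0// invr_ge0 sqr_ge0.
have -> : (64 * (nu / e K)) ^+ 2 = (64 * 64) * (nu ^+ 2 * (e K ^+ 2)^-1).
  by field; rewrite gt_eqF// e_gt0.
rewrite [nu * \sum_(i < N | _) _]mulr_sumr; lra.
Qed.

Let sum_V6 : \sum_(k < N | (k < K)%N) (nu ^+ 2 * hs2 (flow_B6 k) + nu * (hs2 (flow_al6 k) +
      hs2 (flow_be6 k) + cabs (flow_g6 k) ^+ 2)) <= (18 * Num.sqrt (psi K)) ^+ 2.
Proof.
apply: le_trans (sum_below_le (fun k kK => step6 kK)) _.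
rewrite big_split /=; under eq_bigr do rewrite -mulrA.
rewrite -!mulr_sumr exprMn sqr_sqrtr ?(ltW (psi_gt0 KN))//.
by have := sum_psi_v2; have := sum_psi2; have := psi_gt0 KN; lra.
Qed.

(** Telescoping writes the deviation as a sum of centred forms plus a sum of errors. The first is
    bounded through [H5] and [H6], the second by the sums above, and one spare power of [p] absorbs
    all constants. *)
Lemma flow_inv_step : flow_inv K.
Proof.
have eK := e_gt0 KN; have pK := psi_gt0 KN.
have p2 : 10 ^+ 4 * p <= p ^+ 2 by rewrite expr2 ler_wpM2r// ltW.
have p3 : 10 ^+ 4 * p ^+ 2 <= p ^+ 3 by rewrite [p ^+ 3]exprS ler_wpM2r// sqr_ge0.
have p4 : 10 ^+ 4 * p ^+ 3 <= p ^+ 4 by rewrite [p ^+ 4]exprS ler_wpM2r// exprn_ge0// ltW.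
have tele (F : nat -> R[i]) : \sum_(k < N | (k < K)%N) (F k.+1 - F k) = F K - F 0%N.
  have := big_ord_widen N (fun k => F k.+1 - F k) KN => <-.
  by rewrite -(big_mkord predT (fun k => F k.+1 - F k)) telescope_sumr.
split.
  have d : cabs (flow_w K - w0 - \sum_(k < N | (k < K)%N)
      row_form nu A k (flow_B5 k) 0 0 (flow_g5 k)) <= 1100 * p ^+ 2 * nu * (e K)^-1.
    rewrite -[X in _ - X - _]w_start -(tele flow_w) -sumrB.
    apply: le_trans (cabs_sum _ _ _) _.
    apply: le_trans (sum_below_le (fun k kK => serr5 kK)) _.
    have c0 := mulr_ge0 (sqr_ge0 p) (ltW nu0).
    have c1 : 0 <= 1100 * p ^+ 2 * nu by lra.
    rewrite -mulr_sumr; exact: (ler_wpM2l c1 sum_psi_e).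
  have := H5 KN sum_V5; have := cabs_lb (flow_w K - w0) (\sum_(k < N | (k < K)%N)
      row_form nu A k (flow_B5 k) 0 0 (flow_g5 k)).
  have : (64 * p + 1100 * p ^+ 2) * (nu / e K) <= p ^+ 3 * (nu / e K).
    apply: ler_wpM2r; first exact: divr_ge0 (ltW nu0) (ltW eK).
    by have := sqr_ge0 p; have := p1; lra.
  lra.
set S := \sum_(i < N | _) _.
set s := Num.sqrt (y * nu / e K).
have s0 : 0 <= s by exact: sqrtr_ge0.
have y1 : y <= 1 := le_trans ya a1.
have psis : psi K <= s * y by exact: psi1.
have psi_s : psi K <= s by apply: le_trans psis _; rewrite ler_piMr.
have nus : nu / e K <= s := nu_e_le.
have d : cabs (flow_A K - S - \sum_(k < N | (k < K)%N)
    row_form nu A k (flow_B6 k) (flow_al6 k) (flow_be6 k) (flow_g6 k)) <=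
    144 * p ^+ 2 * psi K + 32 * psi K + 96 * p ^+ 2 * s + 96 * p ^+ 3 * (2 * s) +
    128 * psi K + 16 * (nu / e K).
  have -> : flow_A K - S - \sum_(k < N | (k < K)%N)
      row_form nu A k (flow_B6 k) (flow_al6 k) (flow_be6 k) (flow_g6 k) =
    \sum_(k < N | (k < K)%N) (flow_A k.+1 - flow_A k - flow_m k * flow_n2 k -
      row_form nu A k (flow_B6 k) (flow_al6 k) (flow_be6 k) (flow_g6 k)).
    by rewrite [RHS]sumrB [in RHS]sumrB (tele flow_A) A_start subr0.
  apply: le_trans (cabs_sum _ _ _) _.
  apply: le_trans (sum_below_le (fun k kK => serr6 kK)) _.
  rewrite !big_split /=.
  have E c (f g : 'I_N -> R) b : 0 <= c -> \sum_(k < N | (k < K)%N) g k <= b ->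
      (forall k, f k = c * g k) -> \sum_(k < N | (k < K)%N) f k <= c * b.
    move=> c0 gb fg; rewrite (eq_bigr _ (fun k _ => fg k)) -mulr_sumr; exact: ler_wpM2l.
  have c2 : 0 <= p ^+ 2 by exact: sqr_ge0.
  have c3 : 0 <= p ^+ 3 by rewrite exprn_ge0// ltW.
  apply: lerD; last first.
    by apply: (E 16 _ (fun k : 'I_N => nu * (psi k / e k))) => [| |k]; [lra| |ring];
      rewrite -mulr_sumr ler_wpM2l ?(ltW nu0)// sum_psi_e.
  apply: lerD; last by apply: (E 128 _ _ _ _ sum_psi2) => [|k]; [lra|].
  apply: lerD; last first.
    by apply: (E (96 * p ^+ 3) _ _ _ _ sum_psi_sqrt) => [|k]; [lra|ring].
  apply: lerD; last by apply: (E (96 * p ^+ 2) _ _ _ _ sum_psi_v) => [|k]; [lra|ring].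
  apply: lerD; last by apply: (E 32 _ _ _ _ sum_psi_v2) => [|k]; [lra|ring].
  by apply: (E (144 * p ^+ 2) _ _ _ _ sum_psi_v2) => [|k]; [lra|ring].
have := H6 KN sum_V6; have := cabs_lb (flow_A K - S) (\sum_(k < N | (k < K)%N)
    row_form nu A k (flow_B6 k) (flow_al6 k) (flow_be6 k) (flow_g6 k)).
rewrite -/s.
have : 144 * p ^+ 2 * psi K <= 144 * p ^+ 2 * s.
  by apply: ler_wpM2l => //; have := sqr_ge0 p; lra.
have : (18 * p + 240 * p ^+ 2 + 192 * p ^+ 3 + 176) * s <= p ^+ 4 * s.
  by apply: ler_wpM2r => //; have := sqr_ge0 p; have := p1; lra.
lra.
Qed.
End Sums.

Lemma flow_inv_all k : (k <= N)%N -> flow_inv k.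
Proof.
elim/ltn_ind: k => k IH kN; apply: flow_inv_step => // i ik.
by apply: IH => //; rewrite (leq_trans (ltnW ik)).
Qed.

Lemma flow_end_z : cabs (flow_z N - (- m^-1 - m)) <= a ^+ 2 * e N / 50.
Proof.
have := z_dev3 (leqnn N) (fun i h => flow_inv_all (ltnW h)).
by rewrite [N%:R * nu]mulrC nuE mul1r w0E.
Qed.

Lemma flow_end_Im : 9 / 10 * e N <= cIm (flow_z N).
Proof.
have := Im_z (leqnn N) (fun i h => flow_inv_all (ltnW h)).
have := a2e (leqnn N); have := eN0; lra.
Qed.

Lemma flow_end_z2 : cabs (flow_z N - (- m^-1 - m)) <= 2 * a ^+ 2 * p ^+ 3 * ell * nu / y.
Proof.
have := z_dev2 (leqnn N) (fun i h => flow_inv_all (ltnW h)).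
by rewrite [N%:R * nu]mulrC nuE mul1r w0E.
Qed.

Lemma flow_end_Im_A : cIm (flow_A N) <= 115 / 100 * y.
Proof. by apply: flow_Im_A => // i; exact: flow_inv_all. Qed.

(** At $k=N$ the drift is $\sum_i m_i|v_i|^2$, which is close to [m] because every $m_i$ is and [v]
    is a unit vector. *)
Lemma flow_end_A : cabs (flow_A N - m) <= 2 * p ^+ 4 * Num.sqrt (psi N).
Proof.
have [_ h] := flow_inv_all (leqnn N).
set S := \sum_(i < N | _) _ in h.
have h1 : cabs (S - m) <= p ^+ 4 * Num.sqrt (psi N).
  have -> : S - m = \sum_(i < N) (flow_m i - m) * flow_n2 i.
    under eq_bigr do rewrite mulrBl.
    rewrite sumrB -mulr_sumr; congr (_ - _).
      by apply: eq_bigl => i; rewrite ltn_ord.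
    have -> : \sum_i flow_n2 i = 1; last by rewrite mulr1.
    have -> : (1 : R[i]) = (\sum_k cabs (v k 0) ^+ 2)%:C%C by rewrite v1.
    by rewrite rmorph_sum /=; apply: eq_bigr => i _; rewrite /flow_n2 mul_cconj.
  apply: le_trans (cabs_sum _ _ _) _.
  rewrite -[leRHS]mulr1 -[X in _ * X]v1 mulr_sumr; apply: ler_sum => i _.
  have iN := ltnW (ltn_ord i).
  rewrite cabsM /flow_n2 mul_cconj cabs_real ger0_norm ?sqr_ge0//.
  rewrite ler_wpM2r ?sqr_ge0//.
  apply: le_trans (m_diff iN (flow_inv_all iN)) _.
  have n1 := nu_e_le (leqnn N).
  have n2 : nu / e i <= Num.sqrt (psi N).
    apply: le_trans n1; rewrite ler_wpM2l ?(ltW nu0)// lef_pV2 ?posrE ?e_gt0//.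
    exact: le_ee.
  have p30 : 0 <= p ^+ 3 by rewrite exprn_ge0// ltW.
  have := ler_wpM2l p30 n2; have a2 : a ^+ 2 <= 1 by rewrite expr_le1// ltW.
  have : a ^+ 2 * (p ^+ 3 * (nu / e i)) <= p ^+ 3 * (nu / e i).
    by rewrite ler_piMl// mulr_ge0// divr_ge0 ?(ltW nu0)// ltW// e_gt0.
  have : 2 * p ^+ 3 * Num.sqrt (psi N) <= p ^+ 4 * Num.sqrt (psi N).
    rewrite ler_wpM2r ?sqrtr_ge0// [p ^+ 4]exprS ler_wpM2r//; have := p1; lra.
  lra.
have -> : flow_A N - m = (flow_A N - S) + (S - m) by ring.
apply: le_trans (cabsD _ _) _; rewrite /psi; lra.
Qed.

(** The flow ends only near $-1/m-m$; the remaining shift is small compared with the imaginary part,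
    so [perturb_bound] moves the estimate to the exact point. *)
Lemma flow_end_form : ell <= p ->
  cabs ((ctr v *m green A N (- m^-1 - m) *m v) 0 0 - m) <= 6 * p ^+ 4 * Num.sqrt (psi N).
Proof.
move=> ellp; set z := - m^-1 - m.
have zI : cIm z = e N.
  by rewrite /z cImB cImN complexV_Im mulNr opprK /flow_e mulrA [_ * nu]mulrC nuE mul1r.
set d := flow_z N - z.
have d1 : cabs d <= a ^+ 2 * e N / 50 by exact: flow_end_z.
have d2 : cabs d <= 2 * a ^+ 2 * p ^+ 3 * ell * nu / y by exact: flow_end_z2.
have iz := flow_end_Im.
have z0 : 0 < cIm z by rewrite zI.
have z'0 : 0 < cIm (flow_z N) by have := eN0; lra.
suff fin (S' S : R[i]) : cabs (S' - S) ^+ 2 <=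
      cabs d ^+ 2 * (cIm S / cIm z) * (cIm S' / cIm (flow_z N)) ->
    0 <= cIm S -> 0 <= cIm S' -> cIm S' <= 115 / 100 * y ->
    cabs (S' - m) <= 2 * p ^+ 4 * Num.sqrt (psi N) -> cabs (S - m) <= 6 * p ^+ 4 * Num.sqrt (psi N).
  exact: (fin _ _ (green_form_perturb N v Ah z0 z'0) (green_form_Im_ge0 N v Ah z0)
    (green_form_Im_ge0 N v Ah z'0) flow_end_Im_A flow_end_A).
move=> hD x0 x'0 hI hA.
have d0 : 0 <= cabs d by exact: cabs_ge0.
have d3 : cabs d <= cIm z / 50.
  rewrite zI; apply: le_trans d1 _.
  have : a ^+ 2 * e N <= e N by rewrite ler_piMl ?(ltW eN0)// expr_le1// ltW.
  lra.
have iz' : 9 / 10 * cIm z <= cIm (flow_z N) by rewrite zI.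
have xx : cIm S <= cIm S' + cabs (S' - S).
  by have := cIm_ub (S - S'); rewrite cabsBC cImB; lra.
have hd := perturb_bound (cabs_ge0 _) d0 z0 d3 iz' x0 x'0 xx hI hD.
have s0 : 0 <= Num.sqrt (psi N) by exact: sqrtr_ge0.
have p30 : 0 <= p ^+ 3 by rewrite exprn_ge0// ltW.
have hd2 : cabs (S' - S) <= 4 * p ^+ 4 * Num.sqrt (psi N).
  apply: le_trans hd _; rewrite zI.
  have : cabs d / e N * y <= 2 * a ^+ 2 * p ^+ 3 * ell * (nu / e N).
    have eV : 0 <= (e N)^-1 by rewrite invr_ge0 ltW// eN0.
    have := ler_wpM2r (ltW y0) (ler_wpM2r eV d2); move/le_trans; apply.
    by rewrite le_eqVlt; apply/orP; left; apply/eqP; field; rewrite !gt_eqF.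
  have h1 := nu_e_le (leqnn N).
  have : 2 * a ^+ 2 * p ^+ 3 * ell * (nu / e N) <= 2 * p ^+ 4 * Num.sqrt (psi N).
    have n0 : 0 <= nu / e N by rewrite divr_ge0 ?(ltW nu0)// ltW// eN0.
    have ea : a ^+ 2 * (p ^+ 3 * ell) <= p ^+ 4.
      have l1 : p ^+ 3 * ell <= p ^+ 4 by rewrite [p ^+ 4]exprSr ler_wpM2l.
      have l2 := ler_wpM2l (sqr_ge0 a) l1.
      apply: le_trans l2 _; rewrite ler_piMl ?expr_le1// ?(ltW a0)//.
      by rewrite exprn_ge0// ltW.
    have p40 : 0 <= p ^+ 4 by rewrite exprn_ge0// ltW.
    have := ler_wpM2r n0 ea; have := ler_wpM2l p40 h1; lra.
  lra.
have -> : S - m = (S' - m) - (S' - S) by ring.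
by apply: le_trans (cabsB _ _) _; lra.
Qed.
End Flow.

(** * Adaptedness of the flow and the local law at one point *)

Section MatrixMeasurability.
Context {R : realType} {d : measure_display} {T : measurableType d}.

Definition mxmeasurable m n (M : T -> 'M[R[i]]_(m, n)) :=
  forall i j, cmeasurable (fun w => M w i j).

Lemma mxmeasurable_cst m n (M : 'M[R[i]]_(m, n)) : mxmeasurable (fun=> M).
Proof. by move=> i j; exact: cmeasurable_cst. Qed.

Lemma mxmeasurableD m n (M M' : T -> 'M[R[i]]_(m, n)) : mxmeasurable M -> mxmeasurable M' ->
  mxmeasurable (fun w => M w + M' w).
Proof. by move=> h h' i j; under eq_fun do rewrite mxE; exact: cmeasurableD. Qed.

Lemma mxmeasurableZ m n (c : T -> R[i]) (M : T -> 'M[R[i]]_(m, n)) : cmeasurable c ->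
  mxmeasurable M -> mxmeasurable (fun w => c w *: M w).
Proof. by move=> h h' i j; under eq_fun do rewrite mxE; exact: cmeasurableM. Qed.

Lemma mxmeasurableM m n q (M : T -> 'M[R[i]]_(m, n)) (M' : T -> 'M[R[i]]_(n, q)) :
  mxmeasurable M -> mxmeasurable M' -> mxmeasurable (fun w => M w *m M' w).
Proof.
move=> h h' i j; under eq_fun do rewrite mxE.
by apply: cmeasurable_sum => l _; exact: cmeasurableM.
Qed.

Lemma cmeasurable_mxtrace n (M : T -> 'M[R[i]]_n) : mxmeasurable M ->
  cmeasurable (fun w => \tr (M w)).
Proof. by move=> h; apply: cmeasurable_sum. Qed.

Lemma cmeasurable_det n (M : T -> 'M[R[i]]_n) : mxmeasurable M ->
  cmeasurable (fun w => \det (M w)).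
Proof.
move=> h; apply: cmeasurable_sum => s _; apply: cmeasurableM; first exact: cmeasurable_cst.
by apply: cmeasurable_prod.
Qed.

Lemma mxmeasurable_adj n (M : T -> 'M[R[i]]_n) : mxmeasurable M ->
  mxmeasurable (fun w => \adj (M w)).
Proof.
move=> h i j; under eq_fun do rewrite mxE.
apply: cmeasurableM; first exact: cmeasurable_cst.
by apply: cmeasurable_det => a b; under eq_fun do rewrite !mxE; exact: h.
Qed.
End MatrixMeasurability.

Lemma expR_harmonic (R : realType) n : expR (\sum_(k < n) (k.+2%:R : R)^-1) <= n.+1%:R.
Proof.
elim: n => [|n IH]; first by rewrite big_ord0 expR0.
rewrite big_ord_recr /= expRD.
have n2 : 0 < n.+2%:R :> R by rewrite ltr0n.
have : expR (n.+2%:R^-1 : R) <= n.+2%:R / n.+1%:R.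
  have h := expR_ge1Dx (- (n.+2%:R^-1 : R)).
  rewrite -[leLHS]invrK -expRN -invf_div lef_pV2 ?posrE ?expR_gt0 ?divr_gt0 ?ltr0n//.
  apply: le_trans h; rewrite -[n.+2%:R]natr1 in n2 *.
  by rewrite le_eqVlt; apply/orP; left; apply/eqP; field; rewrite gt_eqF.
move/(ler_pM (expR_ge0 _) (expR_ge0 _) IH) /le_trans; apply.
by rewrite mulrCA divff ?mulr1// pnatr_eq0.
Qed.

Section LocalLawAtPoint.
Context {R : realType} {d : measure_display} {Om : measurableType d}
  (P : probability Om R) (n0 : nat).
Local Notation N := n0.+1.
Variable H : Om -> 'M[R[i]]_N.
Hypothesis HW : wigner_at P H.
Variables (p : nat) (C L : R).
Hypothesis L2 : 2 <= L.
Hypothesis Hp : forall i j,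
  (\int[P]_w ((Num.sqrt N%:R * cabs (H w i j)) ^+ p.+2)%:E <= C%:E)%E.
Hypothesis CL : (N * N)%:R * (3 * (C / L ^+ p) / N%:R^-1) <= 1.
Local Notation nu := (N%:R^-1 : R).
Let nu0 : 0 < nu. Proof. by rewrite invr_gt0 ltr0n. Qed.
Let L1 : 1 <= L. Proof. by have := L2; lra. Qed.
Local Notation cadapted := (cadapted H).
Local Notation bounded := (bounded_entries H L).
Definition mxadapted (n : nat) p q (M : Om -> 'M[R[i]]_(p, q)) :=
  forall i j, cadapted n (fun w => M w i j).

Let lekN (k : 'I_N) : (k * N <= N * N)%N.
Proof. by rewrite leq_mul2r ltnW ?orbT. Qed.

(** The Green function of the [k]-th minor reads only entries of that block, and these are all
    revealed before time [k * N]. *)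
Lemma cadapted_green (k : 'I_N) (z : Om -> R[i]) : cadapted (k * N) z ->
  mxadapted (k * N) (fun w => green (H w) k (z w)).
Proof.
move=> mz.
have ms : mxadapted (k * N) (fun w => shifted_minor (H w) k (z w)).
  move=> i j.
  have -> : (fun w => shifted_minor (H w) k (z w) i j) =
    (fun w => (if (i < k)%N && (j < k)%N then H w i j else 0) - (if i == j then z w else 0)).
    apply/funext => w; rewrite /shifted_minor -mulmxA.
    have B m n (M M' : 'M[R[i]]_(m, n)) i' j' : (M - M') i' j' = M i' j' - M' i' j' by rewrite !mxE.
    rewrite B mul_proj_below mul_proj_below_r mxE; case: (i < k)%N; case: (j < k)%N;
      by case: (i == j).
  apply: cmeasurableB.
    case e: (_ && _); last exact: cmeasurable_cst.
    apply: (cadapted_entry HW); case/andP: e => ik jk; have := ltn_ord i; have := ltn_ord j.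
    by rewrite /maxn /minn; case: ifP; nia.
  by case: (i == j) => //; exact: cmeasurable_cst.
apply: mxmeasurableZ.
  by apply: cmeasurableV; exact: cmeasurable_det ms.
apply: mxmeasurableM; first exact: mxmeasurable_cst.
exact: mxmeasurable_adj ms.
Qed.

(** Position [k] of the flow depends on the minor of size [k - 1] only, hence is known one row
    early. This makes [flow_T] predictable. *)
Lemma cadapted_flow_z (w0 : R[i]) (k : nat) : (k <= N)%N ->
  cadapted (k.-1 * N) (fun w => flow_z (H w) nu w0 k).
Proof.
elim: k => [|k IH] kN; first exact: cmeasurable_cst.
have mz : cadapted (k * N) (fun w => flow_z (H w) nu w0 k).
  apply: cadapted_le (IH (ltnW kN)); first by rewrite leq_mul2r leq_pred orbT.
  by rewrite leq_mul2r ltnW ?orbT.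
have mg := cadapted_green (k := Ordinal kN) mz.
apply: cmeasurableB => //; apply: cmeasurableM; first exact: cmeasurable_cst.
apply: cmeasurableN; apply: cmeasurableV; apply: cmeasurableD => //.
by apply: cmeasurableM; [exact: cmeasurable_cst|exact: cmeasurable_mxtrace mg].
Qed.

Lemma mxadapted_flow_T (w0 : R[i]) (k : 'I_N) :
  mxadapted (k * N) (fun w => flow_T (H w) nu w0 k).
Proof. by apply: cadapted_green; exact: (cadapted_flow_z w0 (ltn_ord k)). Qed.

(** Concentration for part of the rows, normalised by a factor that is already known when the first
    of them is revealed. *)
Lemma scaled_rows (Q : pred 'I_N) (c : Om -> R) (B : 'I_N -> Om -> 'M[R[i]]_N)
    (al : 'I_N -> Om -> 'cV[R[i]]_N) (be : 'I_N -> Om -> 'rV[R[i]]_N) (ga : 'I_N -> Om -> R[i]) :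
  (forall w, 0 <= c w) ->
  (forall k : 'I_N, Q k -> cadapted (k * N) (fun w => (c w)%:C%C)) ->
  (forall k : 'I_N, mxadapted (k * N) (B k)) -> (forall k : 'I_N, mxadapted (k * N) (al k)) ->
  (forall k : 'I_N, mxadapted (k * N) (be k)) -> (forall k : 'I_N, cadapted (k * N) (ga k)) ->
  rare P [set w | [/\ 256 * L ^+ 6 <=
        c w * cabs (\sum_(k | Q k) row_form nu (H w) k (B k w) (al k w) (be k w) (ga k w)),
      c w ^+ 2 * \sum_(k | Q k) (nu ^+ 2 * hs2 (B k w) +
        nu * (hs2 (al k w) + hs2 (be k w) + cabs (ga k w) ^+ 2)) <= 1 &
      bounded w]] (20 * (N * N)%:R * expR (2 - L)).
Proof.
move=> c0 mc mB mal mbe mga.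
pose t k w : R[i] := if Q k then (c w)%:C%C else 0.
have mt (k : 'I_N) : cadapted (k * N) (t k).
  by rewrite /t; case e: (Q k); [exact: mc|exact: cmeasurable_cst].
have := @row_concentration _ _ _ P n0 H HW p C L L1 Hp CL
  (fun k w => t k w *: B k w) (fun k w => t k w *: al k w) (fun k w => t k w *: be k w)
  (fun k w => t k w * ga k w).
move=> /(_ (fun k => mxmeasurableZ (mt k) (mB k)) (fun k i => mxmeasurableZ (mt k) (mal k) i 0)
  (fun k i => mxmeasurableZ (mt k) (mbe k) 0 i) (fun k => cmeasurableM (mt k) (mga k))).
apply: rareS => // w [h1 h2 h3]; split => //.
  rewrite (_ : \sum_k _ = (c w)%:C%C * \sum_(k | Q k)
      row_form nu (H w) k (B k w) (al k w) (be k w) (ga k w)).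
    by rewrite cabsM cabs_real ger0_norm.
  rewrite mulr_sumr [RHS]big_mkcond; apply: eq_bigr => k _.
  by rewrite row_formZ /t; case: ifP => // _; rewrite mul0r.
apply: le_trans h2; rewrite mulr_sumr [leRHS]big_mkcond; apply: ler_sum => k _.
rewrite !hs2Z cabsM exprMn /t; case: ifP => _.
  rewrite cabs_real ger0_norm// le_eqVlt; apply/orP; left; apply/eqP; ring.
by rewrite cabs0 expr0n /= !mul0r !addr0 !mulr0 addr0.
Qed.

(** Normalise by the random but predictable standard deviation of this row; this yields the inputs
    [H1] to [H4] of the flow. *)
Lemma single_row (k : 'I_N) (B : Om -> 'M[R[i]]_N) (al : Om -> 'cV[R[i]]_N)
    (be : Om -> 'rV[R[i]]_N) (ga : Om -> R[i]) :
  mxadapted (k * N) B -> mxadapted (k * N) al -> mxadapted (k * N) be -> cadapted (k * N) ga ->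
  rare P [set w | (256 * L ^+ 6) ^+ 2 * (nu ^+ 2 * hs2 (B w) +
        nu * (hs2 (al w) + hs2 (be w) + cabs (ga w) ^+ 2)) <
      cabs (row_form nu (H w) k (B w) (al w) (be w) (ga w)) ^+ 2 /\ bounded w]
    (20 * (N * N)%:R * expR (2 - L)).
Proof.
move=> mB mal mbe mga.
pose V w : R := nu ^+ 2 * hs2 (B w) + nu * (hs2 (al w) + hs2 (be w) + cabs (ga w) ^+ 2).
have V0 w : 0 <= V w.
  by rewrite /V addr_ge0// mulr_ge0 ?sqr_ge0 ?(ltW nu0)// ?addr_ge0 ?hs2_ge0 ?sqr_ge0.
pose c w := (Num.sqrt (V w))^-1.
have mhs m n (M : Om -> 'M[R[i]]_(m, n)) : mxadapted (k * N) M ->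
    measurable_fun (setT : set (g_sigma_algebraType (past H (k * N)))) (fun w => hs2 (M w)).
  move=> mM; apply: measurable_sum => i; apply: measurable_sum => j.
  exact: (measurable_cabs_sq (mM i j)).
have mV : measurable_fun (setT : set (g_sigma_algebraType (past H (k * N)))) V.
  apply: measurable_funD; first by apply: measurable_funM => //; exact: mhs.
  apply: measurable_funM => //; apply: measurable_funD.
    by apply: measurable_funD; exact: mhs.
  exact: measurable_cabs_sq.
have mc : cadapted (k * N) (fun w => (c w)%:C%C).
  have sm := @measurable_sqrtr _ _ (g_sigma_algebraType (past H (k * N))) V V0 mV.
  have im := @measurable_invr _ _ (g_sigma_algebraType (past H (k * N))) _
    (fun w => sqrtr_ge0 (V w)) sm.
  exact: cmeasurable_real im.
have z m n (k' : 'I_N) : mxadapted (k' * N) (fun=> (0 : 'M[R[i]]_(m, n))) := mxmeasurable_cst _.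
have := @scaled_rows (pred1 k) c (fun k' => if k' == k then B else fun=> 0)
  (fun k' => if k' == k then al else fun=> 0) (fun k' => if k' == k then be else fun=> 0)
  (fun k' => if k' == k then ga else fun=> 0).
have K m n (M : Om -> 'M[R[i]]_(m, n)) : mxadapted (k * N) M -> forall k' : 'I_N,
    mxadapted (k' * N) (if k' == k then M else fun=> 0).
  by move=> mM k'; case: eqP => [->|_].
have K0 (k' : 'I_N) : cadapted (k' * N) (if k' == k then ga else fun=> 0).
  by case: eqP => [->|_] //; exact: cmeasurable_cst.
have Kc (k' : 'I_N) : pred1 k k' -> cadapted (k' * N) (fun w => (c w)%:C%C).
  by move=> /eqP ->.
have c0 w : 0 <= c w by rewrite invr_ge0 sqrtr_ge0.
move=> /(_ c0 Kc (K _ _ _ mB) (K _ _ _ mal) (K _ _ _ mbe) K0); apply: rareS => // w [].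
rewrite -/(V w) => h bw; rewrite /= !big_pred1_eq eqxx.
(* A vanishing variance would make all coefficients vanish, and with them the form, against the
   strict inequality. *)
have Vp : 0 < V w.
  rewrite lt_neqAle V0 andbT eq_sym; apply/negP => /eqP V1.
  move: h; rewrite V1 mulr0.
  have := hs2_ge0 (B w); have := hs2_ge0 (al w); have := hs2_ge0 (be w).
  have := sqr_ge0 (cabs (ga w)); move=> h1 h2 h3 h4.
  have n2 : 0 < nu ^+ 2 by exact: exprn_gt0.
  have := V1; rewrite /V => /eqP; rewrite paddr_eq0 ?mulr_ge0 ?addr_ge0 ?(ltW n2) ?(ltW nu0)//.
  rewrite (mulf_eq0 (nu ^+ 2)) (gt_eqF n2) (mulf_eq0 nu) (gt_eqF nu0) /= !paddr_eq0 ?addr_ge0// => /andP[/eqP /hs2_eq0 ->].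
  case/andP=> /andP[/eqP /hs2_eq0 -> /eqP /hs2_eq0 ->].
  rewrite expf_eq0 /= cabs_eq0 => /eqP ->.
  rewrite /row_form !mulmx0 !mul0mx; under eq_bigr do rewrite mxE.
  by rewrite big1// !mxE !mul0r mulr0 subr0 !addr0 cabs0 expr0n ltxx.
have sV : 0 < Num.sqrt (V w) by rewrite sqrtr_gt0.
split=> //.
  rewrite [c w * _]mulrC /c ler_pdivlMr//; apply: ler_of_sq; first exact: cabs_ge0.
  by rewrite exprMn sqr_sqrtr// ltW.
by rewrite -/(V w) /c exprVn sqr_sqrtr// mulVf// gt_eqF.
Qed.

Let q := 256 * L ^+ 6.
Let q1 : 10 ^+ 4 <= q.
Proof.
have h : 2 ^+ 6 <= L ^+ 6 by rewrite lerXn2r ?nnegrE//; have := L2; lra.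
by rewrite /q; lra.
Qed.

(** Outside the union of the bad events for the six families of forms, the deterministic analysis of
    the flow applies with loss [q]. *)
Theorem local_law_at (v : 'cV[R[i]]_N) (m : R[i]) : N%:R <= expR L ->
  \sum_k cabs (v k 0) ^+ 2 = 1 -> 0 < cIm m -> 
  100 * q ^+ 8 * nu <= cIm m * cIm (- m^-1 - m) ->
  rare P [set w | 6 * q ^+ 4 * Num.sqrt (cIm m * nu / cIm (- m^-1 - m)) <
      cabs ((ctr v *m green (H w) N (- m^-1 - m) *m v) 0 0 - m) /\ bounded w]
    (160 * (N * N * N)%:R * expR (2 - L)).
Proof.
move=> NL v1 y0 ye.
have nuN : nu * N%:R = 1 by rewrite mulVf// pnatr_eq0.
set y := cIm m in y0 ye *; set w0 := - m^-1.
pose e := flow_e nu m.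
have eN : cIm (- m^-1 - m) = e N.
  by rewrite cImB cImN complexV_Im mulNr opprK /e /flow_e mulrA [_ * nu]mulrC nuN mul1r.
rewrite eN in ye *.
pose Tm (k : 'I_N) w := flow_T (H w) nu w0 k.
have mT (k : 'I_N) : mxadapted (k * N) (Tm k) by exact: mxadapted_flow_T.
have mTT (k : 'I_N) : mxadapted (k * N) (fun w => Tm k w *m Tm k w) := mxmeasurableM (mT k) (mT k).
have mTv (k : 'I_N) : mxadapted (k * N) (fun w => Tm k w *m v) :=
  mxmeasurableM (mT k) (mxmeasurable_cst v).
have mvT (k : 'I_N) : mxadapted (k * N) (fun w => ctr v *m Tm k w) :=
  mxmeasurableM (mxmeasurable_cst (ctr v)) (mT k).
have z0 (k : 'I_N) m n : mxadapted (k * N) (fun=> (0 : 'M[R[i]]_(m, n))) := mxmeasurable_cst _.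
have cc (k : 'I_N) c : cadapted (k * N) (fun=> c) := cmeasurable_cst c.
have mz (k : 'I_N) : cadapted (k * N) (fun w => flow_z (H w) nu w0 k.+1) :=
  cadapted_flow_z w0 (ltn_ord k).
have mmu (k : 'I_N) : cadapted (k * N) (fun w => flow_mu (H w) nu w0 k).
  exact: cmeasurableN (cmeasurableV (cmeasurableD (mz k) (cmeasurableM (cc k _)
    (cmeasurable_mxtrace (mT k))))).
have mmu2 (k : 'I_N) : cadapted (k * N) (fun w => flow_mu (H w) nu w0 k ^+ 2) :=
  cmeasurableM (mmu k) (mmu k).
have mc (k : 'I_N) : cadapted (k * N) (fun w => flow_c (H w) nu w0 k).
  exact: cmeasurableM (mmu2 k) (cmeasurableD (cc k 1) (cmeasurableM (cc k _)
    (cmeasurable_mxtrace (mTT k)))).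
have mB5 (k : 'I_N) : mxadapted (k * N) (fun w => flow_B5 (H w) nu w0 k).
  exact: mxmeasurableZ (cc k _) (mxmeasurableD (mxmeasurableZ (mc k) (mT k))
    (mxmeasurableZ (mmu k) (mTT k))).
have mg5 (k : 'I_N) : cadapted (k * N) (fun w => flow_g5 (H w) nu w0 k).
  exact: cmeasurableN (cmeasurableM (cc k _) (mc k)).
have mB6 (k : 'I_N) : mxadapted (k * N) (fun w => flow_B6 (H w) nu w0 v k).
  exact: mxmeasurableD (mxmeasurableZ (cmeasurableM (mmu2 k) (cc k _)) (mT k))
    (mxmeasurableZ (mmu k) (mxmeasurableM (mTv k) (mvT k))).
have mal6 (k : 'I_N) : mxadapted (k * N) (fun w => flow_al6 (H w) nu w0 v k).
  exact: mxmeasurableZ (cmeasurableN (cmeasurableM (mmu k) (cc k _))) (mTv k).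
have mbe6 (k : 'I_N) : mxadapted (k * N) (fun w => flow_be6 (H w) nu w0 v k).
  exact: mxmeasurableZ (cmeasurableN (cmeasurableM (mmu k) (cc k _))) (mvT k).
have mg6 (k : 'I_N) : cadapted (k * N) (fun w => flow_g6 (H w) nu w0 v k).
  exact: cmeasurableN (cmeasurableM (mmu2 k) (cc k _)).
have r1 (k : 'I_N) := single_row (mT k) (z0 k _ _) (z0 k _ _) (cc k (-1)).
have r2 (k : 'I_N) := single_row (mTT k) (z0 k _ _) (z0 k _ _) (cc k 0).
have r3 (k : 'I_N) := single_row (z0 k _ _) (mTv k) (z0 k _ _) (cc k 0).
have r4 (k : 'I_N) := single_row (z0 k _ _) (z0 k _ _) (mvT k) (cc k 0).
have q0 : 0 < q by have := q1; lra.
have eN0 : 0 < e N.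
  rewrite -(pmulr_rgt0 _ y0); apply: lt_le_trans ye.
  by apply: mulr_gt0 => //; have := exprn_gt0 8 q0; lra.
have eE K : (K <= N)%N -> e K = e N + (N - K)%:R * (nu * y).
  by move=> KN; rewrite /e /flow_e natrB//; ring.
have nuy0 : 0 < nu * y by rewrite mulr_gt0.
have e_gt0 K : (K <= N)%N -> 0 < e K.
  by move=> KN; rewrite eE// ltr_pwDl// mulr_ge0 ?(ltW nuy0).
pose c5 (K : 'I_N.+1) := (64 * (nu / e K))^-1.
pose c6 (K : 'I_N.+1) := (18 * Num.sqrt (y * nu / e K))^-1.
have c50' (K : nat) : (K <= N)%N -> 0 < 64 * (nu / e K).
  by move=> KN; apply: mulr_gt0; [lra|rewrite divr_gt0 ?e_gt0].
have c60' (K : nat) : (K <= N)%N -> 0 < 18 * Num.sqrt (y * nu / e K).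
  by move=> KN; apply: mulr_gt0; [lra|rewrite sqrtr_gt0 divr_gt0 ?e_gt0// mulr_gt0].
have c50 (K : 'I_N.+1) : 0 < c5 K by rewrite invr_gt0 c50' // -ltnS.
have c60 (K : 'I_N.+1) : 0 < c6 K by rewrite invr_gt0 c60' // -ltnS.
have r5 (K : 'I_N.+1) := @scaled_rows (fun k => k < K)%N (fun=> c5 K) _ _ _ _
  (fun _ => ltW (c50 K)) (fun k _ => cc k _) mB5 (fun k => z0 k _ _) (fun k => z0 k _ _) mg5.
have r6 (K : 'I_N.+1) := @scaled_rows (fun k => k < K)%N (fun=> c6 K) _ _ _ _
  (fun _ => ltW (c60 K)) (fun k _ => cc k _) mB6 mal6 mbe6 mg6.
have bad := rareU (rareU (rareU (rare_fin r1) (rare_fin r2)) (rareU (rare_fin r3) (rare_fin r4)))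
  (rareU (rare_fin r5) (rare_fin r6)).
apply: rareS bad.
  move=> w /= [lt bw]; apply: contrapT => ne; move: lt; apply/negP; rewrite -leNgt.
  have Ah : ctr (H w) = H w.
    by apply/matrixP => i j; rewrite ctrE [RHS](HW.1 w j i).
  have h0 m' n' : hs2 (0 : 'M[R[i]]_(m', n')) = 0.
    by rewrite /hs2 big1// => i _; rewrite big1// => j _; rewrite mxE cabs0 expr0n.
  (* Since $e_k\ge(N-k)\nu y$, the sum is at most the harmonic number of $N$, hence at most $1+\log
     N\le 1+L\le q$. *)
  have harm : \sum_(k < N) nu * y / e k <= q.
    apply: (@le_trans _ _ (\sum_(k < N) (k.+1%:R)^-1)).
      rewrite [leRHS](reindex_inj rev_ord_inj) /=; apply: ler_sum => k _.
      have kN := ltnW (ltn_ord k); rewrite subnSK//.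
      rewrite ler_pdivrMr ?e_gt0// eE// mulrDr mulKf; last first.
        by rewrite pnatr_eq0 -lt0n subn_gt0.
      by rewrite lerDr mulr_ge0 ?(ltW eN0)// invr_ge0.
    rewrite big_ord_recl /= invr1.
    have h := le_trans (expR_harmonic R n0) NL; rewrite ler_expR in h.
    have hL : L <= L ^+ 6 by rewrite ler_eXnr.
    have -> : \sum_(i < n0) (bump 0 i).+1%:R^-1 = \sum_(k < n0) (k.+2%:R : R)^-1 by [].
    by rewrite /q; have := L2; lra.
  apply: (@flow_end_form _ _ (H w) nu w0 v Ah m q (100 * q ^+ 8) q) => //.
  - rewrite -exprSr; apply: ler_wpM2l; first by lra.
    by apply: ler_weXn2l => //; have := q1; lra.
  - move=> k; rewrite leNgt; apply/negP => lt; apply: ne; left; left; left; exists k; split=> //.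
    by rewrite !h0 cabsN cabs1 expr1n !add0r mulr1.
  - move=> k; rewrite leNgt; apply/negP => lt; apply: ne; left; left; right; exists k; split=> //.
    by rewrite !h0 cabs0 expr0n /= !add0r mulr0 addr0.
  - move=> k; rewrite leNgt; apply/negP => lt; apply: ne; left; right; left; exists k; split=> //.
    by rewrite !h0 cabs0 expr0n /= !addr0 mulr0 add0r.
  - move=> k; rewrite leNgt; apply/negP => lt; apply: ne; left; right; right; exists k; split=> //.
    by rewrite !h0 cabs0 expr0n /= !addr0 mulr0 !add0r.
  - move=> K KN hV; rewrite leNgt; apply/negP => lt; apply: ne; right; left.
    have K0 := c50' K KN; exists (Ordinal (n:=N.+1) KN); split=> //.
      by rewrite /c5 [(_)^-1 * _]mulrC ler_pdivlMr// ltW.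
    rewrite /c5 exprVn mulrC ler_pdivrMr ?exprn_gt0// mul1r; apply: le_trans hV.
    by apply: ler_sum => k _; rewrite !h0 !add0r.
  - move=> K KN hV; rewrite leNgt; apply/negP => lt; apply: ne; right; right.
    have K0 := c60' K KN; exists (Ordinal (n:=N.+1) KN); split=> //.
      by rewrite /c6 [(_)^-1 * _]mulrC ler_pdivlMr// ltW.
    by rewrite /c6 exprVn mulrC ler_pdivrMr ?exprn_gt0// mul1r.
(* There are $4N+2(N+1)$ bad events, each of probability at most $20N^2e^{2-L}$. *)
rewrite !card_ord !natrM.
have N1 : 1 <= N%:R :> R by rewrite ler1n.
have E0 := expR_ge0 (2 - L).
rewrite -[N.+1%:R]natr1 -[X in _ <= 160 * X * _]mulrA.
move: (N%:R : R) (expR _) N1 E0 => x E x1 E0.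
have h1 : x * x <= x * (x * x) by rewrite ler_peMl// mulr_ge0//; lra.
have : x * x * E <= x * (x * x) * E by rewrite ler_wpM2r.
lra.
Qed.
End LocalLawAtPoint.

(** * Eigenvalues of the rank-one perturbation *)

Section RankOne.
Context {R : realType} (N : nat) (A : 'M[R[i]]_N) (v : 'cV[R[i]]_N).
Hypothesis Ah : ctr A = A.

Definition form (z : R[i]) : R[i] := (ctr v *m green A N z *m v) 0 0.

Lemma proj_below_full : proj_below N N = 1%:M :> 'M[R[i]]_N.
Proof. by apply/matrixP => i j; rewrite !mxE ltn_ord andbT; case: eqP. Qed.

Lemma green_full_l z : 0 < cIm z -> (A - z%:M) *m green A N z = 1%:M.
Proof. by move=> z0; have := mul_green Ah N z0; rewrite proj_below_full mul1mx. Qed.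

Lemma det_shift_neq0 z : 0 < cIm z -> \det (z%:M - A) != 0.
Proof.
move=> z0; rewrite -opprB -scaleN1r detZ mulf_neq0 ?expf_neq0 ?oppr_eq0 ?oner_eq0//.
have := congr1 determinant (green_full_l z0); rewrite det_mulmx det1 => h.
by apply: contra_eq_neq h => ->; rewrite mul0r eq_sym oner_eq0.
Qed.

(** Two unipotent block factors turn the block triangular matrix on one side into that on the other;
    compare determinants. *)
Lemma det_one_add_rank_one (a : 'cV[R[i]]_N) (b : 'rV[R[i]]_N) :
  \det (1%:M + a *m b) = 1 + (b *m a) 0 0.
Proof.
have e1 : block_mx 1%:M 0 b 1%:M *m block_mx (1%:M + a *m b) a 0 1%:M *m
    block_mx 1%:M 0 (- b) 1%:M = block_mx 1%:M a 0 (1%:M + b *m a).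
  rewrite !mulmx_block !(mul1mx, mulmx1, mul0mx, mulmx0, addr0, add0r) !mulmxN.
  rewrite addrK mulmxDr mulmxDl mulmx1 mul1mx mulmxA [b *m a + _]addrC.
  by rewrite [b + _]addrC subrr.
have := congr1 determinant e1.
rewrite !det_mulmx !det_lblock !det_ublock !det1 !mul1r !mulr1 => ->.
by rewrite det_mx11 !mxE eqxx.
Qed.

Lemma det_rank_one c z : 0 < cIm z ->
  \det (z%:M - (A + c *: (v *m ctr v))) = \det (z%:M - A) * (1 + c * form z).
Proof.
move=> z0.
have -> : z%:M - (A + c *: (v *m ctr v)) = (z%:M - A) *m (1%:M + (c *: (green A N z *m v)) *m ctr v).
  rewrite mulmxDr mulmx1 -scalemxAl -scalemxAr -mulmxA.
  have -> : (z%:M - A) *m (green A N z *m (v *m ctr v)) = - (v *m ctr v).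
    by rewrite -opprB mulNmx [(A - z%:M) *m (_ *m _)]mulmxA green_full_l// mul1mx.
  by rewrite scalerN opprD addrA.
rewrite det_mulmx det_one_add_rank_one -scalemxAr mxE /form mulmxA//.
Qed.

Variables (t : R) (lam : 'I_N -> R[i]).
Hypotheses (t0 : 0 < t) (lamE : char_poly (Gt A v t) = \prod_(j < N) ('X - (lam j)%:P)).

Lemma prod_sub_root z : \prod_(j < N) (z - lam j) = \det (z%:M - Gt A v t).
Proof.
have -> : \prod_j (z - lam j) = (char_poly (Gt A v t)).[z].
  by rewrite lamE horner_prod; apply: eq_bigr => j _; rewrite hornerXsubC.
rewrite /char_poly -horner_evalE -det_map_mx; congr (\det _).
apply/matrixP => i j; rewrite !mxE; move: (A i j + _) => c.
by rewrite -[LHS]/(('X *+ (i == j) - c%:P).[z]) hornerD hornerN hornerC hornerMn hornerX.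
Qed.

Lemma prod_sub_root_up z : 0 < cIm z ->
  \prod_(j < N) (z - lam j) = \det (z%:M - A) * (1 + 'i%C * t%:C%C * form z).
Proof. by move=> z0; rewrite prod_sub_root /Gt /vvstar det_rank_one. Qed.

Lemma det_ctr n (M : 'M[R[i]]_n) : \det (ctr M) = cconj (\det M).
Proof. by rewrite /ctr det_tr det_map_mx. Qed.

(** The conjugates of the eigenvalues are the eigenvalues of the adjoint, in which the sign of $t$
    is reversed. *)
Lemma prod_sub_conj_root_up z : 0 < cIm z ->
  \prod_(j < N) (z - cconj (lam j)) = \det (z%:M - A) * (1 - 'i%C * t%:C%C * form z).
Proof.
move=> z0; rewrite -mulNr -det_rank_one//.
have -> : z%:M - (A + - ('i%C * t%:C%C) *: (v *m ctr v)) = ctr ((cconj z)%:M - Gt A v t).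
  rewrite ctrB ctr_scalar cconjK /Gt ctrD ctrZ Ah /vvstar -/(ctr v) ctrM ctrK.
  by rewrite cconjM cconj_real (_ : cconj 'i%C = - 'i%C) ?mulNr//; apply: complex_eq;
    rewrite ?(cRe_conj, cIm_conj, cReN, cImN, cRe_i, cIm_i, oppr0).
rewrite det_ctr -prod_sub_root /cconj rmorph_prod; apply: eq_bigr => j _.
by rewrite -[RHS]/(cconj (cconj z - lam j)) cconjB cconjK.
Qed.

Lemma form_Im_ge0 z : 0 < cIm z -> 0 <= cIm (form z).
Proof. exact: green_form_Im_ge0. Qed.

Lemma cabs_one_sub_ge z : 0 < cIm z -> 1 <= cabs (1 - 'i%C * t%:C%C * form z).
Proof.
move=> z0; apply: le_trans (cRe_ub _); rewrite cReB cRe1 -mulrA [t%:C%C * _]mulrC !(cReM, cImM).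
rewrite cRe_i cIm_i cRe_real cIm_real; have := mulr_ge0 (form_Im_ge0 z0) (ltW t0); lra.
Qed.

(** An eigenvalue in the lower half-plane would make $1-itS$ vanish at its conjugate, but $\Im S\ge
    0$ there gives $\Re(1-itS)\ge 1$. *)
Lemma root_Im_ge0 j : 0 <= cIm (lam j).
Proof.
rewrite leNgt; apply/negP => h.
have z0 : 0 < cIm (cconj (lam j)) by rewrite cIm_conj; lra.
have := prod_sub_conj_root_up z0; rewrite (bigD1 j)//= subrr mul0r => /esym/eqP.
rewrite mulf_eq0 (negPf (det_shift_neq0 z0)) /= -cabs_eq0 => /eqP e.
by have := cabs_one_sub_ge z0; rewrite e; lra.
Qed.

Lemma root_form j : 0 < cIm (lam j) -> form (lam j) = 'i%C / t%:C%C.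
Proof.
move=> z0; have := prod_sub_root_up z0; rewrite (bigD1 j)//= subrr mul0r => /esym/eqP.
rewrite mulf_eq0 (negPf (det_shift_neq0 z0)) /= => /eqP e.
have t1 : t%:C%C != 0 :> R[i] by rewrite -cabs_gt0 cabs_real normr_gt0 gt_eqF.
have ii : 'i%C * 'i%C = -1 :> R[i] by rewrite -expr2 sqr_i.
apply: (mulfI t1); rewrite mulrCA divff// mulr1.
have : 'i%C * (1 + 'i%C * t%:C%C * form (lam j)) = 0 by rewrite e mulr0.
by rewrite mulrDr !mulrA ii mulr1 mulNr mul1r mulNr => /eqP; rewrite subr_eq0 => /eqP ->.
Qed.

(** Both products contain the determinant of $z-A$, so their ratio is the Blaschke product of the
    eigenvalues expressed through $S$ alone. *)
Lemma blaschke z : 0 < cIm z ->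
  (\prod_(j < N) cabs (z - lam j)) * cabs (1 - 'i%C * t%:C%C * form z) =
  (\prod_(j < N) cabs (z - cconj (lam j))) * cabs (1 + 'i%C * t%:C%C * form z).
Proof.
move=> z0; rewrite -!cabs_prod prod_sub_root_up// prod_sub_conj_root_up// !cabsM; ring.
Qed.
End RankOne.

(** * The semicircle parametrisation and the local law at all points *)

Section SpectralPoint.
Context {R : realType}.
Implicit Types (m z : R[i]).

(** The inverse of the Stieltjes transform of the semicircle law, used on $\Im m>0$, $|m|<1$.
    Parametrising by $m$ instead of $z$ removes square roots from all estimates. *)
Definition spectral_point (m : R[i]) : R[i] := - m^-1 - m.

Lemma spectral_point_Im m : cIm (spectral_point m) = cIm m * ((cabs m ^+ 2)^-1 - 1).
Proof. by rewrite cImB cImN complexV_Im mulNr opprK mulrBr mulr1. Qed.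

Lemma spectral_point_sub m m' : m != 0 -> m' != 0 ->
  spectral_point m - spectral_point m' = (m - m') * ((m * m')^-1 - 1).
Proof. by move=> m0 m'0; rewrite /spectral_point; field; rewrite m0 m'0. Qed.

(** The two roots of $m^2+zm+1$ have product 1 and sum $-z$. If both had modulus 1, they would be
    conjugate and $z$ would be real; otherwise the one of modulus less than 1 works. *)
Lemma spectral_point_surj z : 0 < cIm z ->
  exists m, [/\ 0 < cIm m, cabs m < 1 & spectral_point m = z].
Proof.
move=> z0.
pose s := sqrtc (z ^+ 2 - 4); have sE : s ^+ 2 = z ^+ 2 - 4 by exact: sqr_sqrtc.
pose m1 := (- z + s) / 2; pose m2 := (- z - s) / 2.
have two : (2 : R[i]) != 0 by rewrite pnatr_eq0.
have prd : m1 * m2 = 1.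
  have -> : m1 * m2 = (z ^+ 2 - s ^+ 2) / 4 by rewrite /m1 /m2; field.
  by rewrite sE opprB addrC subrK divff// pnatr_eq0.
have key m m' : m * m' = 1 -> m + m' = - z -> cabs m < 1 ->
    exists m, [/\ 0 < cIm m, cabs m < 1 & spectral_point m = z].
  move=> pm sm m1'; exists m.
  have m0 : m != 0 by apply: contra_eq_neq pm => ->; rewrite mul0r eq_sym oner_eq0.
  have zE : spectral_point m = z.
    have iE : m^-1 = m' by apply: (mulfI m0); rewrite mulfV.
    by rewrite /spectral_point iE -opprD [m' + m]addrC sm opprK.
  split=> //; have := spectral_point_Im m; rewrite zE => zI.
  have c0 : 0 < (cabs m ^+ 2)^-1 - 1.
    by rewrite subr_gt0 invf_gt1 ?exprn_gt0 ?cabs_gt0// expr_lt1// cabs_ge0.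
  by rewrite -(pmulr_lgt0 _ c0) -zI.
have sm : m1 + m2 = - z by rewrite /m1 /m2; field.
have := congr1 cabs prd; rewrite cabsM cabs1 => ap.
have [lt|gt|eq] := ltgtP (cabs m1) 1.
- exact: key prd sm lt.
- apply: (key m2 m1); [by rewrite mulrC|by rewrite addrC|].
  rewrite -(ltr_pM2l (lt_trans ltr01 gt)) ap mulr1//.
- have m2E : m2 = cconj m1.
    have m10 : m1 != 0 by rewrite -cabs_gt0 eq.
    by apply: (mulfI m10); rewrite prd mul_cconj eq expr1n.
  have := congr1 cIm sm; rewrite m2E cImD cIm_conj subrr cImN; lra.
Qed.

(** On this domain $\Im m$ and $1-|m|^2$ are at least $\nu^6$, so a move of $\nu^{12}/100$ changes
    every quantity of interest by a small factor only. *)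
Lemma grid_perturb (nu : R) m m' : 0 < nu -> nu <= 1 -> 0 < cIm m -> nu ^+ 3 <= cabs m ->
  nu <= cIm m * cIm (spectral_point m) -> cabs (m - m') <= nu ^+ 12 / 100 ->
  [/\ 0 < cIm m', m != 0, m' != 0,
      9 / 10 * (cIm m * cIm (spectral_point m)) <= cIm m' * cIm (spectral_point m') &
  [/\ 9 / 10 * cIm (spectral_point m) <= cIm (spectral_point m'),
      nu <= cIm (spectral_point m), nu ^+ 6 <= cIm m / cIm (spectral_point m),
      cIm m' / cIm (spectral_point m') <= 12 / 10 * (cIm m / cIm (spectral_point m)) &
      cabs (spectral_point m' - spectral_point m) <= 3 * cabs (m - m') / nu ^+ 6]].
Proof.
move=> n0 n1 y0 rn; rewrite !spectral_point_Im => yn; set h := cabs (m - m') => hn.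
set y := cIm m in y0 yn *; set y' := cIm m'; set r := cabs m in rn yn *; set r' := cabs m'.
have h0 : 0 <= h by exact: cabs_ge0.
have n6 : nu ^+ 12 <= nu ^+ 6 by apply: ler_wiXn2l => //; exact: ltW.
have r0 : 0 < r by apply: lt_le_trans rn; exact: exprn_gt0.
have r2 : nu ^+ 6 <= r ^+ 2.
  by rewrite (_ : 6 = 3 * 2)%N// exprM lerXn2r ?nnegrE ?exprn_ge0 ?(ltW n0) ?(ltW r0).
have r20 : 0 < r ^+ 2 by exact: exprn_gt0.
have yr : y <= r by exact: cIm_ub.
have yr2 : y ^+ 2 <= r ^+ 2 by rewrite lerXn2r ?nnegrE ?(ltW y0) ?(ltW r0).
have hr : nu * r ^+ 2 <= y ^+ 2 * (1 - r ^+ 2).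
  rewrite -ler_pdivlMr//; apply: le_trans yn _.
  by rewrite le_eqVlt; apply/orP; left; apply/eqP; field; rewrite gt_eqF.
have omr : nu <= 1 - r ^+ 2.
  have l0 : 0 < 1 - r ^+ 2.
    rewrite -(pmulr_rgt0 _ (exprn_gt0 2 y0)); apply: lt_le_trans hr; exact: mulr_gt0.
  by rewrite -(ler_pM2r r20) [leRHS]mulrC; apply: le_trans hr _; rewrite ler_wpM2r// ltW.
have y2 : nu * r ^+ 2 <= y ^+ 2.
  by apply: le_trans hr _; rewrite ler_piMr ?sqr_ge0//; lra.
have nu6 : 0 < nu ^+ 6 by exact: exprn_gt0.
have yn6 : nu ^+ 6 <= y.
  apply: ler_of_sq; first exact: ltW.
  apply: le_trans y2; rewrite -exprM.
  have -> : nu ^+ (6 * 2) = nu ^+ 6 * nu ^+ 6 by rewrite -exprD.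
  apply: ler_pM => //; rewrite ?(ltW nu6)//.
  by rewrite -[leRHS]expr1; apply: ler_wiXn2l => //; exact: ltW.
have omr6 : nu ^+ 6 <= 1 - r ^+ 2.
  by apply: le_trans omr; rewrite -[leRHS]expr1; apply: ler_wiXn2l => //; exact: ltW.
have h6 : h <= nu ^+ 6 / 100 by lra.
have yh := cIm_ub (m - m'); have yh' := cIm_ub (m' - m).
rewrite cabsBC in yh'; rewrite cImB -/y -/y' -/h in yh; rewrite cImB -/y -/y' -/h in yh'.
have rh : r - r' <= h by have := cabs_lb m (m - m'); rewrite subKr -/r -/r' -/h; lra.
have rh' : r' - r <= h by have := cabs_lb m' (m' - m); rewrite subKr cabsBC -/r -/r' -/h; lra.
have r1 : r <= 1 by rewrite -(@expr_le1 _ 2)// ?(ltW r0)//; lra.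
have n61 : nu ^+ 6 <= 1 by rewrite exprn_ile1// ltW.
have r'0 : 0 < r'.
  have : nu ^+ 6 <= nu ^+ 3 by apply: ler_wiXn2l => //; exact: ltW.
  lra.
have d1 : r' ^+ 2 - r ^+ 2 <= 3 * h by nra.
have d2 : r ^+ 2 - r' ^+ 2 <= 3 * h by nra.
have r'20 : 0 < r' ^+ 2 by exact: exprn_gt0.
have y'l : 99 / 100 * y <= y' by clear -yh yh' h6 yn6; lra.

have u1 : r' ^+ 2 <= 103 / 100 * r ^+ 2 by clear -d1 d2 h6 r2 omr6; lra.
have u2 : 97 / 100 * (1 - r ^+ 2) <= 1 - r' ^+ 2 by clear -d1 d2 h6 r2 omr6; lra.
have u3 : 97 / 100 * r ^+ 2 <= r' ^+ 2 by clear -d1 d2 h6 r2 omr6; lra.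
have u4 : 1 - r' ^+ 2 <= 103 / 100 * (1 - r ^+ 2) by clear -d1 d2 h6 r2 omr6; lra.
pose c := (r ^+ 2)^-1 - 1; pose c' := (r' ^+ 2)^-1 - 1.
have cE : c * r ^+ 2 = 1 - r ^+ 2 by rewrite /c mulrBl mulVf ?gt_eqF// mul1r.
have c'E : c' * r' ^+ 2 = 1 - r' ^+ 2 by rewrite /c' mulrBl mulVf ?gt_eqF// mul1r.
have c0 : 0 < c by rewrite -(pmulr_lgt0 _ r20) cE; clear -omr6 nu6; lra.
have c'0 : 0 < c' by rewrite -(pmulr_lgt0 _ r'20) c'E; clear -u2 omr6 nu6; lra.
have cc : 94 / 100 * c <= c'.
  rewrite -(ler_pM2r r'20) c'E; apply: le_trans u2.
  have := ler_wpM2l (ltW c0) u1; rewrite -cE; have := mulr_gt0 c0 r20; clear; lra.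
rewrite -/c -/c' in yn *; clearbody c c'.
have y'0 : 0 < y' by clear -y'l y0; lra.
clear hr omr y2 u2 u4 n6 yr2.
split=> //; rewrite -?cabs_gt0//.
  have -> : 9 / 10 * (y * (y * c)) = 9 / 10 * (y * y * c) by rewrite !mulrA.
  rewrite mulrA; have a1 : 99 / 100 * (99 / 100) * (y * y) <= y' * y'.
    have z0 : 0 <= 99 / 100 * y by clear -y0; lra.
    by have := ler_pM z0 z0 y'l y'l; clear; lra.
  have yy := mulr_gt0 y0 y0.
  have z1 : 0 <= 99 / 100 * (99 / 100) * (y * y) by clear -yy; lra.
  have z2 : 0 <= 94 / 100 * c by clear -c0; lra.
  apply: le_trans (ler_pM z1 z2 a1 cc).
  by have := mulr_gt0 yy c0; clear; lra.
split.
- have z0 : 0 <= 99 / 100 * y by clear -y0; lra.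
  have z2 : 0 <= 94 / 100 * c by clear -c0; lra.
  apply: le_trans (ler_pM z0 z2 y'l cc).
  by have := mulr_gt0 y0 c0; clear; lra.
- have y1 : y <= 1 by clear -yr r1; lra.
  by apply: le_trans yn _; rewrite ler_piMl// mulr_ge0// ltW.
- rewrite invfM mulrA divff ?gt_eqF// mul1r -(ler_pM2r c0) mulVf ?gt_eqF//.
  by apply: le_trans (ler_wpM2r (ltW c0) r2) _; rewrite mulrC cE; clear -r20; lra.
- have -> : y' / (y' * c') = c'^-1 by clear -y'0 c'0; field; rewrite !gt_eqF.
  have -> : y / (y * c) = c^-1 by clear -y0 c0; field; rewrite !gt_eqF.
  rewrite -(ler_pM2r c'0) mulVf ?gt_eqF// mulrAC ler_pdivlMr// mul1r; clear -cc c0; lra.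
rewrite spectral_point_sub -?cabs_gt0// cabsM cabsBC -/h [3 * h]mulrC -mulrA ler_wpM2l//.
apply: le_trans (cabsB _ _) _; rewrite cabs1 cabsV cabsM -/r -/r'.
have rr : 99 / 100 * nu ^+ 6 <= r' * r.
  have rl : r ^+ 2 <= r by rewrite expr2 ler_piMl// ltW.
  have l1 : 99 / 100 * r <= r' by clear -rl rh h6 r2; lra.
  by have := ler_wpM2r (ltW r0) l1; clear -r2; lra.
have rr0 : 0 < r' * r by exact: mulr_gt0.
rewrite ler_pdivlMr// mulrDl mul1r.
have : (r' * r)^-1 * nu ^+ 6 <= 2.
  by rewrite mulrC ler_pdivrMr//; clear -rr nu6 rr0; lra.
by clear -n61; lra.
Qed.
End SpectralPoint.

(** The constants 200 and 7 replace the 100 and 6 of the law at one point and leave room for passing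
    from the grid to all $m$. The lower bound on $|m|$ keeps the spectral points polynomially
    bounded. *)
Definition local_law {R : realType} N (A : 'M[R[i]]_N) (v : 'cV[R[i]]_N) (q : R) :=
  forall m, 0 < cIm m -> N%:R^-1 ^+ 3 <= cabs m ->
    200 * q ^+ 8 * N%:R^-1 <= cIm m * cIm (spectral_point m) ->
    cabs (form A v (spectral_point m) - m) <=
      7 * q ^+ 4 * Num.sqrt (cIm m * N%:R^-1 / cIm (spectral_point m)).

Lemma form_lipschitz (R : realType) N (A : 'M[R[i]]_N) (v : 'cV[R[i]]_N) z u : ctr A = A ->
  hs2 v = 1 -> 0 < cIm z -> 0 < cIm u ->
  cabs (form A v u - form A v z) <= cabs (u - z) / (cIm z * cIm u).
Proof.
move=> Ah v1 z0 u0; apply: ler_of_sq; first by rewrite divr_ge0 ?cabs_ge0// mulr_ge0// ltW.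
apply: le_trans (green_form_perturb N v Ah z0 u0) _.
have b x : 0 < cIm x -> 0 <= cIm (form A v x) / cIm x <= (cIm x ^+ 2)^-1.
  move=> x0; rewrite divr_ge0 ?(ltW x0) ?form_Im_ge0//=.
  have := hs2_green_le Ah N v x0; have := hs2_green Ah N v x0.
  rewrite /mxtrace big_ord1 -/(form A v x) v1 => <- h.
  rewrite [cIm x * _]mulrC mulfK ?gt_eqF// -[leRHS]mul1r ler_pdivlMr ?exprn_gt0//.
  by rewrite mulrC.
have /andP[b1 b2] := b z z0; have /andP[b3 b4] := b u u0.
rewrite exprMn exprVn exprMn invfM -mulrA ler_wpM2l ?sqr_ge0//.
exact: ler_pM.
Qed.

Definition grid_point {R : realType} (M : nat) (ij : 'I_(2 * M).+1 * 'I_(2 * M).+1) : R[i] :=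
  (ij.1%:R / M%:R - 1)%:C%C + 'i%C * (ij.2%:R / M%:R - 1)%:C%C.

Arguments grid_point {R} M ij.

Lemma grid_point_near (R : realType) (M : nat) (m : R[i]) : (0 < M)%N -> cabs m <= 1 ->
  exists ij, cabs (m - grid_point M ij) <= 2 / M%:R.
Proof.
move=> M0 m1; have MR : 0 < M%:R :> R by rewrite ltr0n.
have co (x : R) : `|x| <= 1 -> exists i : 'I_(2 * M).+1, `|x - (i%:R / M%:R - 1)| <= M%:R^-1.
  rewrite ler_norml => /andP[xl xu].
  have x0 : 0 <= (x + 1) * M%:R by rewrite mulr_ge0 ?(ltW MR)//; lra.
  have /andP[t1 t2] := Num.Theory.truncn_itv x0.
  have tM : (Num.truncn ((x + 1) * M%:R) < (2 * M).+1)%N.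
    rewrite ltnS -(ler_nat R); apply: le_trans t1 _.
    by rewrite natrM ler_wpM2r ?(ltW MR)//; lra.
  exists (Ordinal tM) => /=; move: t1 t2; set k := Num.truncn _ => t1 t2.
  rewrite -(ler_pM2r MR) mulVf ?gt_eqF// -{2}(ger0_norm (ltW MR)) -normrM.
  have -> : (x - (k%:R / M%:R - 1)) * M%:R = (x + 1) * M%:R - k%:R.
    by field; rewrite gt_eqF.
  by rewrite -natr1 in t2; rewrite ger0_norm; lra.
have [i hi] := co (cRe m) (le_trans (cRe_le m) m1).
have [j hj] := co (cIm m) (le_trans (cIm_le m) m1).
exists (i, j); apply: le_trans (cabs_le_ReIm _) _.
rewrite /grid_point /= cReB cImB cReD cImD !(cReM, cImM) !cRe_real !cIm_real cRe_i cIm_i.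
rewrite !mul0r mulr0 !subr0 !add0r mul1r !addr0 (_ : 2 / M%:R = M%:R^-1 + M%:R^-1); last by ring.
exact: lerD.
Qed.

(** Some grid point lies within $2/M=\nu^{12}/100$. The law there transfers, because both $m$ and
    $S$ move by much less than the allowed error, which is at least $\nu^4$. *)
Lemma local_law_of_grid (R : realType) N (A : 'M[R[i]]_N) (v : 'cV[R[i]]_N) (q : R) :
  let M := (200 * N ^ 12)%N in
  (0 < N)%N -> ctr A = A -> hs2 v = 1 -> 1 <= q ->
  (forall ij, let m := grid_point M ij : R[i] in
    0 < cIm m -> 100 * q ^+ 8 * N%:R^-1 <= cIm m * cIm (spectral_point m) ->
    cabs (form A v (spectral_point m) - m) <=
      6 * q ^+ 4 * Num.sqrt (cIm m * N%:R^-1 / cIm (spectral_point m))) ->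
  local_law A v q.
Proof.
move=> M N0 Ah hv q1 ne m y0 rn ye.
have q8 : 1 <= q ^+ 8 by exact: exprn_ege1.
have q4 : 1 <= q ^+ 4 by exact: exprn_ege1.
have n12 : 2 / M%:R = N%:R^-1 ^+ 12 / 100 :> R.
  have Nn : N%:R != 0 :> R by rewrite pnatr_eq0 -lt0n.
  by rewrite /M natrM natrX exprVn; move: (N%:R : R) Nn => x xn; field.
have M0 : (0 < M)%N by rewrite muln_gt0 expn_gt0 N0.
have nu0 : 0 < N%:R^-1 :> R by rewrite invr_gt0 ltr0n.
have nu1 : N%:R^-1 <= 1 :> R by rewrite invf_le1 ?ltr0n// ler1n.
clearbody M; move: (N%:R^-1 : R) nu0 nu1 n12 ne rn ye => nu nu0 nu1 n12 ne rn ye.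
have yn : nu <= cIm m * cIm (spectral_point m).
  by apply: le_trans ye; rewrite ler_peMl ?(ltW nu0)//; clear -q8; lra.
have eta0 : 0 < cIm (spectral_point m).
  by rewrite -(pmulr_rgt0 _ y0); exact: lt_le_trans yn.
have m1 : cabs m <= 1.
  have m0 : 0 < cabs m by apply: lt_le_trans rn; exact: exprn_gt0.
  move: eta0; rewrite spectral_point_Im pmulr_rgt0// subr_gt0 invf_gt1 ?exprn_gt0//.
  by rewrite expr_lt1 ?(ltW m0)// => /ltW.
have [ij hij] := grid_point_near M0 m1; rewrite n12 in hij.
have [y'0 _ _ a1 [a2 a3 a4 a5 a6]] := grid_perturb nu0 nu1 y0 rn yn hij.
move: hij a6; set m' := grid_point M ij in y'0 a1 a2 a3 a4 a5 *; set h := cabs (m - m') => hh a6.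
have okm : 100 * q ^+ 8 * nu <= cIm m' * cIm (spectral_point m').
  apply: le_trans a1; apply: le_trans (ler_wpM2l _ ye); last by clear; lra.
  by have := mulr_ge0 (le_trans ler01 q8) (ltW nu0); clear; lra.
have hS' : cabs (form A v (spectral_point m') - m') <=
    6 * q ^+ 4 * Num.sqrt (cIm m' * nu / cIm (spectral_point m')).
  exact: (ne ij).
set eta := cIm (spectral_point m) in eta0 a2 a3 a4 a5 *.
set eta' := cIm (spectral_point m') in a2 a5 hS'.
have eta'0 : 0 < eta' by clear -a2 eta0; lra.
have z : cabs (form A v (spectral_point m') - form A v (spectral_point m)) <=
    4 * h / nu ^+ 8.
  apply: le_trans (form_lipschitz Ah hv eta0 eta'0) _; rewrite -/eta -/eta' ler_pdivrMr ?mulr_gt0//.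
  apply: le_trans a6 _.
  have h0 : 0 <= h by exact: cabs_ge0.
  have l1 : 9 / 10 * (nu * nu) <= eta * eta'.
    have b : 9 / 10 * nu <= eta' by clear -a2 a3; lra.
    have b0 : 0 <= 9 / 10 * nu by have := nu0; clear; lra.
    by have := ler_pM (ltW nu0) b0 a3 b; clear; lra.
  have c0 : 0 <= 4 * h / nu ^+ 8 by apply: divr_ge0; [lra|exact: exprn_ge0 (ltW nu0)].
  apply: le_trans (ler_wpM2l c0 l1).
  have -> : 4 * h / nu ^+ 8 * (9 / 10 * (nu * nu)) = 36 / 10 * (h / nu ^+ 6).
    by clear -nu0; field; rewrite gt_eqF.
  have : 0 <= h / nu ^+ 6 by rewrite divr_ge0// exprn_ge0// ltW.
  by clear; lra.
set s := Num.sqrt (cIm m * nu / eta).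
have s0 : 0 <= s by exact: sqrtr_ge0.
have ss : Num.sqrt (cIm m' * nu / eta') <= 11 / 10 * s.
  apply: ler_of_sq; first by clear -s0; lra.
  rewrite exprMn !sqr_sqrtr ?mulr_ge0 ?invr_ge0 ?(ltW nu0) ?(ltW y0) ?(ltW y'0) ?(ltW eta0) ?(ltW eta'0)//.
  rewrite -mulrAC [cIm m * nu / eta]mulrAC.
  have b0 : 0 <= cIm m / eta by rewrite divr_ge0// ltW.
  have := ler_wpM2r (ltW nu0) a5; have := mulr_ge0 b0 (ltW nu0).
  by clear; lra.
have sn : nu ^+ 4 <= s.
  apply: ler_of_sq => //; rewrite sqr_sqrtr; last first.
    by rewrite divr_ge0 ?mulr_ge0 ?(ltW nu0) ?(ltW y0) ?(ltW eta0).
  rewrite mulrAC; apply: le_trans (ler_wpM2r (ltW nu0) a4); rewrite -exprSr -exprM.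
  by apply: ler_wiXn2l => //; exact: ltW.
have hs : h <= s / 100.
  apply: le_trans hh _; rewrite ler_wpM2r//; apply: le_trans sn.
  by apply: ler_wiXn2l => //; exact: ltW.
have hs8 : 4 * h / nu ^+ 8 <= s / 25.
  rewrite ler_pdivrMr ?exprn_gt0//.
  have := ler_wpM2r (exprn_ge0 8 (ltW nu0)) sn; rewrite -exprD.
  by move: hh; clear; lra.
have E (a b c d : R[i]) : a - c = (b - d) - (b - a) - (c - d) by ring.
rewrite (E _ (form A v (spectral_point m')) _ m').
apply: le_trans (cabsB _ _) _; apply: le_trans (lerD (cabsB _ _) (lexx _)) _; rewrite -/h.
have qs := ler_wpM2r s0 q4; have := ler_wpM2l (le_trans ler01 q4) ss.
by move: hS' z hs hs8 s0 qs; clear; lra.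
Qed.

Section Net.
Context {R : realType} {d : measure_display} {Om : measurableType d}
  (P : probability Om R) (n0 : nat).
Local Notation N := n0.+1.
Variable H : Om -> 'M[R[i]]_N.
Hypothesis HW : wigner_at P H.
Variables (p : nat) (C L : R).
Hypothesis L2 : 2 <= L.
Hypothesis Hp : forall i j,
  (\int[P]_w ((Num.sqrt N%:R * cabs (H w i j)) ^+ p.+2)%:E <= C%:E)%E.
Hypothesis CL : (N * N)%:R * (3 * (C / L ^+ p) / N%:R^-1) <= 1.
Local Notation nu := (N%:R^-1 : R).
Let q := 256 * L ^+ 6.
Let q1 : 1 <= q.
Proof.
have h : 1 <= L ^+ 6 by apply: exprn_ege1; have := L2; lra.
by rewrite /q; lra.
Qed.
Let M := (200 * N ^ 12)%N.

Theorem rare_not_local_law (v : 'cV[R[i]]_N) : N%:R <= expR L ->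
  \sum_k cabs (v k 0) ^+ 2 = 1 ->
  rare P [set w | ~ local_law (H w) v q /\ bounded_entries H L w]
    (((2 * M).+1 ^ 2)%:R * (160 * (N * N * N)%:R * expR (2 - L))).
Proof.
move=> NL v1.
pose ok (m : R[i]) := 0 < cIm m /\ 100 * q ^+ 8 * nu <= cIm m * cIm (- m^-1 - m).
have r ij : rare P [set w | ok (grid_point M ij) /\
    6 * q ^+ 4 * Num.sqrt (cIm (grid_point M ij) * nu / cIm (spectral_point (grid_point M ij))) <
      cabs (form (H w) v (spectral_point (grid_point M ij)) - grid_point M ij) /\
    bounded_entries H L w] (160 * (N * N * N)%:R * expR (2 - L)).
  case: (pselect (ok (grid_point M ij))) => [[h1 h2]|no].
    by apply: rareS (local_law_at HW L2 Hp CL NL v1 h1 h2) => // w [].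
  apply: rareS (rare0 P); last by rewrite !mulr_ge0 ?expR_ge0.
  by move=> w [].
have := rare_fin r; rewrite card_prod !card_ord -mulnn; apply: rareS => // w /= [nl bw].
apply: contrapT => ne; apply: nl; apply: local_law_of_grid => //.
- by apply/matrixP => i j; rewrite ctrE [RHS](HW.1 w j i).
- by rewrite -v1 /hs2; apply: eq_bigr => i _; rewrite big_ord1.
by move=> ij m y0 ye; rewrite leNgt; apply/negP => lt; apply: ne; exists ij.
Qed.
End Net.

(* On the vertical line [Re z = E], the modulus squared [s] of [m(z)] determines
   [Im m(z) * Im z = (1 - s) * (1 - E^2 s / (1 + s)^2)], which decreases from [1]. *)
Lemma spectral_point_above (R : realType) (m : R[i]) (k : R) : 0 < cIm m -> cabs m < 1 ->
  cIm m * cIm (spectral_point m) <= k -> 0 < k -> k <= 1 / 2 ->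
  exists m1, [/\ 0 < cIm m1, cRe (spectral_point m1) = cRe (spectral_point m),
    cIm m1 * cIm (spectral_point m1) = k, cIm (spectral_point m) <= cIm (spectral_point m1) &
    1 <= 2 * (1 + cRe (spectral_point m) ^+ 2) * cabs m1 ^+ 2].
Proof.
move=> y0 m1 yk k0 k2; set E := cRe (spectral_point m).
have m0 : 0 < cabs m by rewrite cabs_gt0; apply: contraTneq y0 => ->; rewrite cIm0 ltxx.
set s0 := cabs m ^+ 2.
have s00 : 0 < s0 by exact: exprn_gt0.
have s01 : s0 < 1 by rewrite expr_lt1 ?(ltW m0).
have ReE (u : R[i]) : 0 < cabs u ^+ 2 ->
    cRe (spectral_point u) = - (cRe u * (1 + cabs u ^+ 2) / cabs u ^+ 2).
  by move=> u0; rewrite cReB cReN complexV_Re; move: (cabs u ^+ 2) u0 => c c0; field; rewrite gt_eqF.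
have ImE (u : R[i]) : 0 < cabs u ^+ 2 ->
    cIm (spectral_point u) = cIm u * (1 - cabs u ^+ 2) / cabs u ^+ 2.
  by move=> u0; rewrite spectral_point_Im; move: (cabs u ^+ 2) u0 => c c0; field; rewrite gt_eqF.
have xE : cRe m * (1 + s0) = - (E * s0).
  by rewrite /E ReE//= -/s0; clearbody s0; clear -s00; field; rewrite gt_eqF.
have y2 : cIm m ^+ 2 * (1 + s0) ^+ 2 = s0 * ((1 + s0) ^+ 2 - E ^+ 2 * s0).
  have -> : cIm m ^+ 2 = s0 - cRe m ^+ 2 by rewrite /s0 cabs_sq; ring.
  have -> : (s0 - cRe m ^+ 2) * (1 + s0) ^+ 2 = s0 * (1 + s0) ^+ 2 - (cRe m * (1 + s0)) ^+ 2 by ring.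
  by rewrite xE; ring.
(* A sign change of this cubic in the squared modulus $s$, between 0 and the value at [m], gives the
   point on the vertical line with $\Im m\,\Im z=k$. *)
pose p : {poly R} := k *: (1 + 'X) ^+ 2 - (1 - 'X) * ((1 + 'X) ^+ 2 - E ^+ 2 *: 'X).
have pE x : p.[x] = k * (1 + x) ^+ 2 - (1 - x) * ((1 + x) ^+ 2 - E ^+ 2 * x).
  by rewrite /p !hornerE.
have p0 : p.[0] <= 0 by rewrite pE; lra.
have ps : 0 <= p.[s0].
  have e1 : (1 - s0) * ((1 + s0) ^+ 2 - E ^+ 2 * s0) =
      cIm m * cIm (spectral_point m) * (1 + s0) ^+ 2.
    apply: (mulfI (lt0r_neq0 s00)).
    by rewrite mulrCA -y2 ImE// -/s0; clearbody s0; clear -s00; field; rewrite gt_eqF.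
  by rewrite pE e1 -mulrBl mulr_ge0 ?sqr_ge0// subr_ge0.
have pp : p.[0] <= 0 <= p.[s0] by rewrite p0 ps.
have [s /andP[sl su] rs] := poly_ivt (ltW s00) pp.
have {rs} : k * (1 + s) ^+ 2 = (1 - s) * ((1 + s) ^+ 2 - E ^+ 2 * s).
  by move/eqP: rs; rewrite pE => /eqP; rewrite subr_eq0 => /eqP.
set D := (1 + s) ^+ 2 - E ^+ 2 * s => sE.
have sp : 0 < s.
  rewrite lt_neqAle sl andbT; apply/negP => /eqP z; move: sE; rewrite /D -z; lra.
have s1 : s < 1 by exact: le_lt_trans s01.
have D0 : 0 < D.
  have : 0 < 1 - s by rewrite subr_gt0.
  by move=> h; rewrite -(pmulr_rgt0 _ h) -sE mulr_gt0// exprn_gt0//; lra.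
have q0 : 0 < 1 + s by lra.
pose x := - (E * s / (1 + s)); pose y := Num.sqrt (s * D) / (1 + s).
have y1 : 0 < y by rewrite divr_gt0// sqrtr_gt0 mulr_gt0.
have ysq : y ^+ 2 = s * D / (1 + s) ^+ 2 by rewrite exprMn sqr_sqrtr ?exprVn// mulr_ge0 ?ltW.
pose u : R[i] := x%:C%C + 'i%C * y%:C%C.
have uR : cRe u = x by rewrite /u cReD cReM !cRe_real cIm_real cRe_i cIm_i; ring.
have uI : cIm u = y by rewrite /u cImD cImM !cRe_real !cIm_real cRe_i cIm_i; ring.
have ua : cabs u ^+ 2 = s.
  by rewrite cabs_sq uR uI ysq /x /D; field; rewrite gt_eqF.
have u2 : 0 < cabs u ^+ 2 by rewrite ua.
have uk : cIm u * cIm (spectral_point u) = k.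
  rewrite ImE// ua uI.
  have -> : y * (y * (1 - s) / s) = y ^+ 2 * (1 - s) / s by ring.
  have -> : y ^+ 2 * (1 - s) / s = ((1 - s) * D) / (1 + s) ^+ 2.
    by rewrite ysq; field; rewrite !gt_eqF.
  by rewrite -sE mulfK// gt_eqF// exprn_gt0.
exists u; split=> //.
- by rewrite uI.
- by rewrite ReE// ua uR /x; field; rewrite !gt_eqF.
- have sq (w : R[i]) : 0 < cIm w -> 0 < cabs w ^+ 2 -> cIm (spectral_point w) ^+ 2 =
      (cIm w * cIm (spectral_point w)) * ((1 - cabs w ^+ 2) / cabs w ^+ 2).
    by move=> w0 wa; rewrite ImE//; move: (cabs w ^+ 2) wa => c c0; field; rewrite gt_eqF.
  apply: ler_of_sq.
    by rewrite ImE// ua uI divr_ge0 ?(ltW sp)// mulr_ge0 ?(ltW y1)// subr_ge0 ltW.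
  rewrite (sq m)// (sq u) ?uI// -uI uk ua -/s0.
  apply: ler_pM => //.
  - have z0 : 0 < cIm (spectral_point m) by rewrite ImE// -/s0 divr_gt0 ?mulr_gt0 ?subr_gt0.
    exact: mulr_ge0 (ltW y0) (ltW z0).
  - by apply: divr_ge0; [rewrite subr_ge0; exact: ltW|exact: ltW].
  - have i0 : 0 <= 1 - s0 by rewrite subr_ge0; exact: ltW.
    have i1 : 0 <= s0^-1 by rewrite invr_ge0 ltW.
    have i2 : 1 - s0 <= 1 - s by rewrite lerD2l lerN2.
    by apply: (ler_pM i0 i1 i2); rewrite lef_pV2.
rewrite ua; have : 1 - s - E ^+ 2 * s <= k.
  have l1 : (1 - s) * (E ^+ 2 * s) <= E ^+ 2 * s * (1 + s) ^+ 2.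
    have e0 : 0 <= E ^+ 2 * s by rewrite mulr_ge0 ?sqr_ge0.
    rewrite mulrC ler_wpM2l//; nra.
  have q2 : 0 < (1 + s) ^+ 2 by exact: exprn_gt0.
  by rewrite -(ler_pM2r q2) sE /D; lra.
by lra.
Qed.

(** Go up vertically from $z=E+i\eta$ to the boundary of the domain of the law, at $E+i\eta_1$,
    where $\Im S\le 2\Im m$. By the Ward identity $\eta\,\Im S(z)=\eta^2\|G(z)v\|^2$, and the
    resolvent identity shows that this at most doubles on the way down. *)
Lemma form_Im_small (R : realType) N (A : 'M[R[i]]_N) (v : 'cV[R[i]]_N) (q : R) (m : R[i]) :
  (0 < N)%N -> ctr A = A -> hs2 v = 1 -> 1 <= q -> local_law A v q ->
  0 < cIm m -> cabs m < 1 -> 2 * (1 + cRe (spectral_point m) ^+ 2) <= N%:R ^+ 6 ->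
  cIm m * cIm (spectral_point m) <= 200 * q ^+ 8 * N%:R^-1 -> 400 * q ^+ 8 <= N%:R ->
  cIm (form A v (spectral_point m)) * cIm (spectral_point m) <= 800 * q ^+ 8 * N%:R^-1.
Proof.
move=> N0 Ah hv q1 ll y0 m1 EN yk qN.
have q8 : 1 <= q ^+ 8 by exact: exprn_ege1.
have NR : 0 < N%:R :> R by rewrite ltr0n.
have k0 : 0 < 200 * q ^+ 8 * N%:R^-1 by apply: mulr_gt0; [lra|rewrite invr_gt0].
have k2 : 200 * q ^+ 8 * N%:R^-1 <= 1 / 2 by rewrite ler_pdivrMr//; lra.
have [u [u0 uR uk uI ua]] := spectral_point_above y0 m1 yk k0 k2.
have nu0 : 0 < N%:R^-1 :> R by rewrite invr_gt0.
have nN : N%:R^-1 * N%:R = 1 :> R by rewrite mulVf// gt_eqF.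
move: k0 k2 yk uk ua EN qN (ll u u0) nu0 nN => {ll}.
move: (N%:R^-1 : R) => nu; move: (N%:R : R) NR => n n0 k0 k2 yk uk ua EN qN ll nu0 nN.
have z0 : 0 < cIm (spectral_point m).
  have m0 : 0 < cabs m by rewrite cabs_gt0; apply: contraTneq y0 => ->; rewrite cIm0 ltxx.
  rewrite spectral_point_Im mulr_gt0// subr_gt0 invf_gt1 ?exprn_gt0// expr_lt1 ?(ltW m0)//.
have z1 := lt_le_trans z0 uI.
have a3 : nu ^+ 3 <= cabs u.
  apply: ler_of_sq; first exact: cabs_ge0.
  have n6 : 0 < n ^+ 6 by exact: exprn_gt0.
  rewrite -exprM -(ler_pM2l n6) -exprMn [n * nu]mulrC nN expr1n; apply: le_trans ua _.
  by rewrite ler_wpM2r ?sqr_ge0.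
have {}ll := ll a3; rewrite uk lexx in ll; have {}ll := ll isT.
have hS : cIm (form A v (spectral_point u)) <= 2 * cIm u.
  have := cIm_ub (form A v (spectral_point u) - u); rewrite cImB.
  have : 7 * q ^+ 4 * Num.sqrt (cIm u * nu / cIm (spectral_point u)) <= cIm u.
    apply: ler_of_sq; first exact: ltW.
    rewrite exprMn sqr_sqrtr; last by rewrite divr_ge0 ?mulr_ge0// ltW.
    rewrite mulrA ler_pdivrMr// [cIm u ^+ 2]expr2 -[leRHS]mulrA uk exprMn -exprM.
    by have := mulr_gt0 (mulr_gt0 u0 nu0) (lt_le_trans ltr01 q8); lra.
  by move: ll; lra.
have g1 := hs2_green Ah N v z0; have g2 := hs2_green Ah N v z1.
rewrite /mxtrace big_ord1 -/(form A v (spectral_point m)) in g1.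
rewrite /mxtrace big_ord1 -/(form A v (spectral_point u)) in g2.
have cmp : cIm (spectral_point m) ^+ 2 * hs2 (green A N (spectral_point m) *m v) <=
    2 * (cIm (spectral_point u) ^+ 2 * hs2 (green A N (spectral_point u) *m v)).
  have rid := resolvent_identity Ah N z0 z1.
  have le := hs2_green_le Ah N (green A N (spectral_point u) *m v) z0.
  move: rid le g1 g2 => + + _ _.
  move: (green A N (spectral_point m)) => G; move: (green A N (spectral_point u)) => U rid le.
  have -> : G *m v = U *m v + (spectral_point m - spectral_point u) *: (G *m (U *m v)).
    by rewrite mulmxA scalemxAl -rid mulmxBl addrC subrK.
  apply: le_trans (ler_wpM2l (sqr_ge0 _) (hs2D _ _)) _; rewrite hs2Z.
  have -> : cabs (spectral_point m - spectral_point u) ^+ 2 =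
      (cIm (spectral_point u) - cIm (spectral_point m)) ^+ 2.
    by rewrite cabs_sq cReB cImB uR subrr expr0n add0r -sqrrN opprB.
  set a := cIm (spectral_point m) in z0 uI le *; set b := cIm (spectral_point u) in uI *.
  set X := hs2 (U *m v) in le *; set Y := hs2 (G *m _) in le *.
  have X0 : 0 <= X by exact: hs2_ge0.
  have h1 := ler_wpM2l (sqr_ge0 (b - a)) le.
  have ba : 0 <= b - a by rewrite subr_ge0.
  have h2 := mulr_ge0 X0 (mulr_ge0 (ltW z0) ba).
  by clearbody a b X Y; clear -h1 h2; lra.
have fin (a b X Y f g y k : R) : 0 < b -> a * X = f -> b * Y = g ->
    a ^+ 2 * X <= 2 * (b ^+ 2 * Y) -> g <= 2 * y -> y * b = k -> f * a <= 4 * k.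
  by clear; move=> b0 <- <- h1 h2 <-; have := ler_wpM2l (ltW b0) h2; lra.
by have := fin _ _ _ _ _ _ _ _ z1 g1 g2 cmp hS uk; rewrite !mulrA; congr (_ <= _ * _ * _); clear; ring.
Qed.

(** * Counting by comparing two Blaschke products *)

Lemma prod_one_sub_ge (R : realType) (I : Type) (r : seq I) (Q : pred I) (u : I -> R) :
  (forall i, Q i -> 0 <= u i <= 1) ->
  1 - \sum_(i <- r | Q i) u i <= \prod_(i <- r | Q i) (1 - u i).
Proof.
move=> h; elim: r => [|i r IH]; first by rewrite !big_nil subr0.
rewrite !big_cons; case: ifP => // Qi; have /andP[u0 u1] := h i Qi.
have p1 : \prod_(j <- r | Q j) (1 - u j) <= 1.
  apply: prodr_ile1 => j /h/andP[a b]; apply/andP; split; lra.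
have h1 : 0 <= 1 - u i by lra.
have := ler_wpM2l u0 p1; lra.
Qed.

Lemma prod_one_sub_le_exp (R : realType) (I : finType) (Q : pred I) (x : I -> R) :
  (forall i, Q i -> x i <= 1) -> \prod_(i | Q i) (1 - x i) <= expR (- \sum_(i | Q i) x i).
Proof.
move=> h; rewrite -sumrN expR_sum; apply: ler_prod => i Qi.
by rewrite subr_ge0 h//= expR_ge1Dx.
Qed.

(* [Ga] and [Gb] are the Blaschke factors at two points.  The far ones are nearly the same
   at both points, while each near one changes by a factor about [10], as their product does. *)
Lemma count_near (R : realType) n (near : pred 'I_n) (Ga Gb xa xb : 'I_n -> R) (th M : R) :
  (forall j, 0 < Ga j) -> (forall j, 0 < Gb j <= 1) ->
  (forall j, near j -> 97 / 10 * Gb j <= Ga j) ->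
  (forall j, ~~ near j -> [/\ Ga j ^+ 2 = 1 - xa j, Gb j ^+ 2 = 1 - xb j, 0 <= xb j <= 1 / 4 &
     `|xa j - xb j| <= th * xb j]) ->
  0 <= th <= 1 -> 4 * (th * M) <= 1 -> expR (- M) <= (\prod_j Gb j) ^+ 2 ->
  97 / 10 * \prod_j Gb j <= \prod_j Ga j -> \prod_j Ga j <= 103 / 10 * \prod_j Gb j ->
  exists j0, near j0 /\ forall j, j != j0 -> ~~ near j.
Proof.
move=> a0 b0 hn hf /andP[th0 th1] thM eM ab1 ab2.
pose fa := \prod_(j | ~~ near j) Ga j; pose fb := \prod_(j | ~~ near j) Gb j.
have fa0 : 0 < fa by apply: prodr_gt0.
have fb0 : 0 < fb by apply: prodr_gt0 => j _; case/andP: (b0 j).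
have nb0 : 0 < \prod_(j | near j) Gb j by apply: prodr_gt0 => j _; case/andP: (b0 j).
have Pa : \prod_j Ga j = \prod_(j | near j) Ga j * fa by rewrite (bigID near).
have Pb : \prod_j Gb j = \prod_(j | near j) Gb j * fb by rewrite (bigID near).
have nb1 : \prod_(j | near j) Gb j <= 1.
  by apply: prodr_ile1 => j _; case/andP: (b0 j) => /ltW -> ->.
pose X := \sum_(j | ~~ near j) xb j.
(* The far factors at the second point cannot be too small in total, since the full product is
   bounded below; this bounds the sum of the [xb]. *)
have XM : X <= M.
  have : expR (- M) <= expR (- X).
    apply: le_trans eM _; apply: le_trans (prod_one_sub_le_exp _); last first.
      by move=> j /hf[_ _ /andP[h1 h2] _]; lra.
    have -> : \prod_(j | ~~ near j) (1 - xb j) = fb ^+ 2.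
      by rewrite -prodrXl; apply: eq_bigr => j nj; case: (hf j nj).
    by rewrite lerXn2r ?nnegrE ?Pb ?mulr_ge0 ?(ltW nb0) ?(ltW fb0)// ler_piMl// ltW.
  by rewrite ler_expR lerN2.
have X0 : 0 <= X by apply: sumr_ge0 => j /hf[_ _ /andP[h1 h2] _].
have tX : 4 * (th * X) <= 1 by have := ler_wpM2l th0 XM; lra.
(* Hence the product of all far factors changes by a factor of at least 7/10 in either direction. *)
have half : 1 / 2 <= \prod_(j | ~~ near j) (1 - 2 * (th * xb j)).
  apply: le_trans (prod_one_sub_ge _ _); last first.
    move=> j /hf[_ _ /andP[h1 h2] _]; have := ler_pM th0 h1 th1 h2.
    by have := mulr_ge0 th0 h1; move=> ? ?; apply/andP; split; lra.
  by rewrite -!mulr_sumr -/X; lra.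
have cmp (f g : 'I_n -> R) : (forall j, ~~ near j -> 0 <= f j) ->
    (forall j, ~~ near j -> f j ^+ 2 * (1 - 2 * (th * xb j)) <= g j ^+ 2) ->
    (forall j, ~~ near j -> 0 <= g j) ->
    7 / 10 * \prod_(j | ~~ near j) f j <= \prod_(j | ~~ near j) g j.
  move=> f0 fg g0; have F0 : 0 <= \prod_(j | ~~ near j) f j by exact: prodr_ge0.
  apply: ler_of_sq; first exact: prodr_ge0.
  apply: (@le_trans _ _ (\prod_(j | ~~ near j) (f j ^+ 2 * (1 - 2 * (th * xb j))))).
    rewrite big_split /= prodrXl exprMn mulrC; have := ler_wpM2l (sqr_ge0 (\prod_(j | ~~ near j) f j)) half.
    by have := sqr_ge0 (\prod_(j | ~~ near j) f j); lra.
  rewrite -prodrXl; apply: ler_prod => j nj; rewrite fg// andbT mulr_ge0 ?sqr_ge0//.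
  have [_ _ /andP[h1 h2] _] := hf j nj; have := ler_pM th0 h1 th1 h2; lra.
have f1 : 7 / 10 * fb <= fa.
  apply: cmp => j nj; try by [apply: ltW|case/andP: (b0 j) => /ltW].
  have [-> -> /andP[h1 h2] h3] := hf j nj; have h4 := ler_norm (xa j - xb j).
  have h5 := mulr_ge0 th0 h1.
  have : 0 <= (th * xb j) * (1 - 2 * xb j) by rewrite mulr_ge0//; lra.
  by move: (xa j) (xb j) h1 h2 h3 h4 h5; clear => A B *; lra.
have f2 : 7 / 10 * fa <= fb.
  apply: cmp => j nj; try by [apply: ltW|case/andP: (b0 j) => /ltW].
  have [-> -> /andP[h1 h2] h3] := hf j nj; have h4 := ler_norm (xa j - xb j).
  have h4' := ler_norm (xb j - xa j); rewrite distrC in h4'.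
  have h5 := mulr_ge0 th0 h1; have h6 := ler_pM th0 h1 th1 h2.
  have : 0 <= (th * xb j) * (1 - 2 * xa j) by rewrite mulr_ge0//; lra.
  by move: (xa j) (xb j) h1 h2 h3 h4' h5; clear => A B *; lra.
(* Without a near factor the product would grow by at most $10/7<9.7$; two near ones would make it
   grow by at least $9.7^2\cdot 0.7>10.3$. *)
have [j0 nj0|none] := pickP near; last first.
  move: ab1 f2; rewrite Pa Pb !big_pred0// !mul1r; lra.
exists j0; split=> // j jj0; apply/negP => nj.
have rest : \prod_(i | near i && (i != j0) && (i != j)) Gb i <=
    \prod_(i | near i && (i != j0) && (i != j)) Ga i.
  apply: ler_prod => i /andP[/andP[ni _] _]; have /andP[g0 _] := b0 i.
  by rewrite (ltW g0)/=; have := hn i ni; lra.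
have r0 : 0 < \prod_(i | near i && (i != j0) && (i != j)) Gb i.
  by apply: prodr_gt0 => i _; case/andP: (b0 i).
have Na : \prod_(i | near i) Ga i = Ga j0 * (Ga j * \prod_(i | near i && (i != j0) && (i != j)) Ga i).
  by rewrite (bigD1 j0)//= (bigD1 j) ?nj.
have Nb : \prod_(i | near i) Gb i = Gb j0 * (Gb j * \prod_(i | near i && (i != j0) && (i != j)) Gb i).
  by rewrite (bigD1 j0)//= (bigD1 j) ?nj.
have /andP[g1 _] := b0 j0; have /andP[g2 _] := b0 j.
have e1 := hn j0 nj0; have e2 := hn j nj.
move: ab2; rewrite Pa Pb Na Nb; apply/negP; rewrite -ltNge.
move: rest r0; set Qa := \prod_(i | _) Ga i; set Qb := \prod_(i | _) Gb i => rest r0.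
have p1 : 0 <= 97 / 10 * Gb j0 by clear -g1; lra.
have p2 : 0 <= 97 / 10 * Gb j by clear -g2; lra.
have p3 : 0 <= 7 / 10 * fb by clear -fb0; lra.
have l1 := ler_pM p1 p2 e1 e2; have l2 := ler_pM (ltW r0) p3 rest f1.
have l3 := ler_pM (mulr_ge0 p1 p2) (mulr_ge0 (ltW r0) p3) l1 l2.
have := mulr_gt0 (mulr_gt0 g1 g2) (mulr_gt0 r0 fb0).
by move: l3; clearbody Qa Qb fa fb; move: (Gb j0) (Gb j) (Ga j0) (Ga j) => x y z t; clear; lra.
Qed.

(** The numerator grows from about [rho] to about [10 * rho], while the denominator, of order [yb],
    barely changes. *)
Lemma near_factor (R : realType) (yb ya rho Da Db da db : R) : 0 < rho -> 0 < yb ->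
  1000 * rho <= yb -> ya <= yb + 10 * rho -> 0 <= Da -> 0 < Db -> 0 < da -> 0 < db -> yb <= db ->
  da <= db + (ya - yb) -> 999 / 100 * rho <= Da -> Db <= 101 / 100 * rho ->
  97 / 10 * (Db / db) <= Da / da.
Proof.
move=> r0 y0 ry yy Da0 Db0 da0 db0 ydb dd hDa hDb.
rewrite ler_pdivlMr// mulrAC mulrA ler_pdivrMr//.
have h1 : da <= 101 / 100 * db by lra.
have h2 : Db * da <= 101 / 100 * rho * (101 / 100 * db) by apply: ler_pM => //; exact: ltW.
have h3 : 999 / 100 * rho * db <= Da * db by rewrite ler_wpM2r// ltW.
have := mulr_gt0 r0 db0; lra.
Qed.

(** With [e] the imaginary part of the root, the squared Blaschke factor is $1-4ye/d^2$, where $d$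
    is the distance to the conjugate root; $y$ and $d$ vary by relative amounts at most [th] between
    the two points. *)
Lemma far_factor (R : realType) (e yb ya th b da db : R) : 0 < yb -> yb <= ya ->
  ya <= yb * (1 + th) -> 0 <= th -> 0 <= e -> e <= b -> 16 * b <= yb -> yb <= db -> db <= da ->
  da <= db + (ya - yb) ->
  0 <= 4 * yb * e / db ^+ 2 <= 1 / 4 /\
  `|4 * ya * e / da ^+ 2 - 4 * yb * e / db ^+ 2| <= th * (4 * yb * e / db ^+ 2).
Proof.
move=> y0 yy yt t0 e0 eb by16 ydb dd dd2.
have db0 : 0 < db by lra.
have da0 : 0 < da by lra.
have ye0 : 0 <= 4 * yb * e by rewrite !mulr_ge0// ltW.
have x0 : 0 <= 4 * yb * e / db ^+ 2 by rewrite divr_ge0 ?sqr_ge0.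
have ye : 0 <= yb * e by rewrite mulr_ge0// ltW.
split.
  rewrite x0 /= ler_pdivrMr ?exprn_gt0//.
  have h1 : yb * e <= yb * (yb / 16) by rewrite ler_wpM2l ?(ltW y0)//; lra.
  have h2 : yb * yb <= db ^+ 2 by rewrite expr2 ler_pM// ltW.
  by clear -h1 h2; lra.
rewrite ler_norml; apply/andP; split; last first.
  have h1 : 4 * ya * e / da ^+ 2 <= 4 * ya * e / db ^+ 2.
    rewrite ler_wpM2l ?mulr_ge0//; [lra|].
    by rewrite lef_pV2 ?posrE ?exprn_gt0// lerXn2r ?nnegrE// ltW.
  have h2 : 4 * ya * e / db ^+ 2 <= 4 * (yb * (1 + th)) * e / db ^+ 2.
    rewrite ler_wpM2r ?invr_ge0 ?sqr_ge0// ler_wpM2r// ler_wpM2l//.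
  have -> : th * (4 * yb * e / db ^+ 2) = 4 * (yb * (1 + th)) * e / db ^+ 2 - 4 * yb * e / db ^+ 2.
    by ring.
  lra.
(* [da <= db ya / yb], so [ya / da^2 >= (yb / ya) yb / db^2] *)
have h1 : da * yb <= db * ya.
  have := ler_wpM2r (ltW y0) dd2.
  have : (ya - yb) * yb <= (ya - yb) * db by rewrite ler_wpM2l// subr_ge0.
  lra.
have h2 : da ^+ 2 * yb ^+ 2 <= db ^+ 2 * ya ^+ 2.
  by rewrite -!exprMn lerXn2r ?nnegrE ?mulr_ge0//; lra.
have ya0 : 0 < ya by lra.
have h3 : 4 * yb * e / db ^+ 2 * (yb / ya) <= 4 * ya * e / da ^+ 2.
  have -> : 4 * yb * e / db ^+ 2 * (yb / ya) = 4 * e * (yb ^+ 2 / (db ^+ 2 * ya)).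
    by field; rewrite !gt_eqF.
  have -> : 4 * ya * e / da ^+ 2 = 4 * e * (ya / da ^+ 2) by ring.
  rewrite ler_wpM2l ?mulr_ge0// ler_pdivrMr ?mulr_gt0 ?exprn_gt0//.
  rewrite mulrAC ler_pdivlMr ?exprn_gt0//.
  by move: h2; rewrite mulrC; lra.
have h4 : 1 - th <= yb / ya.
  rewrite ler_pdivlMr//.
  have := ler_wpM2r t0 yy; have := mulr_ge0 t0 (mulr_ge0 t0 (ltW y0)); lra.
have := ler_wpM2l x0 h4; lra.
Qed.

Section Count.
Context {R : realType} (N : nat) (A : 'M[R[i]]_N) (v : 'cV[R[i]]_N) (lam : 'I_N -> R[i]).
Variables (t u b M : R).
Hypotheses (Ah : ctr A = A) (t1 : 1 < t) (u0 : 0 < u) (tu : t * u <= 1 / 1000).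
Hypothesis lamE : char_poly (Gt A v t) = \prod_(j < N) ('X - (lam j)%:P).
Let t0 : 0 < t. Proof. exact: lt_trans t1. Qed.
Let mu k := t^-1 - k * u.
(** The height above $it^*$ of the point whose semicircle value is $i(1/t-ku)$. *)
Definition outlier_shift k : R := k * u * (1 + t / (t^-1 - k * u)).
Local Notation rho := outlier_shift.
Let pt k : R[i] := 'i%C * (tstar t + rho k)%:C%C.
Let tmu k : t * mu k = 1 - k * (t * u).
Proof. by rewrite /mu mulrBr divff ?gt_eqF//; ring. Qed.
Let mu_gt0 k : k <= 10 -> 0 < mu k.
Proof.
move=> k10; rewrite -(pmulr_rgt0 _ t0) tmu.
have tu0 : 0 < t * u by rewrite mulr_gt0.
by have := ler_wpM2r (ltW tu0) k10; have := tu; lra.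
Qed.

Lemma spectral_point_imag k : k <= 10 -> spectral_point ('i%C * (t^-1 - k * u)%:C%C) = pt k.
Proof.
move=> k10; have m0 := mu_gt0 k10.
apply: complex_eq.
  rewrite cReB cReN complexV_Re /pt !(cReM) !cRe_i !cIm_i !cRe_real !cIm_real; ring.
rewrite spectral_point_Im /pt !(cImM) !cRe_i !cIm_i !cRe_real !cIm_real cabsM cabs_i cabs_real.
rewrite -/(mu k) !mul1r (gtr0_norm m0) !mul0r !add0r /rho /tstar -/(mu k).
have e : k * u = t^-1 - mu k by rewrite /mu; ring.
by rewrite e; field; rewrite !gt_eqF.
Qed.

Lemma outlier_shift_ge k : 0 < k -> k <= 10 -> k * u < rho k.
Proof.
move=> k0 k10; have m0 := mu_gt0 k10; have ku : 0 < k * u by rewrite mulr_gt0.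
by rewrite /rho -[ltLHS]mulr1 ltr_pM2l// ltrDl divr_gt0.
Qed.

(** At [pt k] the law gives $S\approx i(1/t-ku)$, so $|1+itS|\approx ktu$ and $|1-itS|\approx 2$:
    the Blaschke product is about $ktu/2$, proportional to [k]. *)
Lemma blaschke_bound k : 1 <= k -> k <= 10 ->
  cabs (form A v (pt k) - 'i%C * (mu k)%:C%C) <= u / 100 ->
  [/\ forall j, 0 < cabs (pt k - lam j),
     (k - 1 / 100) * (t * u) / (2001 / 1000) <=
       \prod_j (cabs (pt k - lam j) / cabs (pt k - cconj (lam j))) &
     \prod_j (cabs (pt k - lam j) / cabs (pt k - cconj (lam j))) <=
       (k + 1 / 100) * (t * u) / (1989 / 1000)].
Proof.
move=> k1 k10; have k0 : 0 < k by lra.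
have k99 : 0 < k - 1 / 100 by lra.
have c1 : 0 < 1989 / 1000 :> R by lra.
have c2 : 0 < 2001 / 1000 :> R by lra.
have tu0 : 0 < t * u by rewrite mulr_gt0.
have ts0 : 0 < tstar t.
  by rewrite subr_gt0; apply: lt_trans t1; rewrite invf_lt1.
have p0 : 0 < cIm (pt k).
  rewrite /pt cImM cRe_i cIm_i cRe_real cIm_real mul0r add0r mul1r addr_gt0//.
  by apply: lt_trans (outlier_shift_ge k0 k10); rewrite mulr_gt0.
set S := form A v (pt k) => hS.
have bl := blaschke Ah lamE p0; rewrite -/S in bl.
have ii : 'i%C * 'i%C = -1 :> R[i] by rewrite -expr2 sqr_i.
have tn : t%:C%C != 0 :> R[i] by rewrite -cabs_gt0 cabs_real normr_gt0 gt_eqF.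
have sm : 'i%C * (mu k)%:C%C + 'i%C * (k * u)%:C%C = 'i%C / t%:C%C :> R[i].
  by rewrite -mulrDr -rmorphD /mu subrK /= fmorphV.
have n1 : cabs (1 + 'i%C * t%:C%C * S) = t * cabs ((S - 'i%C * (mu k)%:C%C) - 'i%C * (k * u)%:C%C).
  have -> : 1 + 'i%C * t%:C%C * S = 'i%C * t%:C%C * ((S - 'i%C * (mu k)%:C%C) - 'i%C * (k * u)%:C%C).
    rewrite -addrA -opprD sm mulrBr.
    have -> : 'i%C * t%:C%C * ('i%C / t%:C%C) = 'i%C * 'i%C :> R[i] by field.
    by rewrite ii opprK addrC.
  by rewrite !cabsM cabs_i cabs_real gtr0_norm// mul1r.
have n2 : 1 - 'i%C * t%:C%C * S = (1 + t * mu k)%:C%C - 'i%C * t%:C%C * (S - 'i%C * (mu k)%:C%C).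
  rewrite [X in _ = _ - X]mulrBr; have -> : 'i%C * t%:C%C * ('i%C * (mu k)%:C%C) = 'i%C * 'i%C * (t * mu k)%:C%C :> R[i].
    by rewrite rmorphM /=; ring.
  rewrite ii rmorphD rmorph1 /=; ring.
have n1l : (k - 1 / 100) * (t * u) <= cabs (1 + 'i%C * t%:C%C * S).
  have := cabs_lb ('i%C * (k * u)%:C%C) (S - 'i%C * (mu k)%:C%C).
  rewrite n1 [cabs (_ - 'i%C * (k * u)%:C%C)]cabsBC cabsM cabs_i cabs_real gtr0_norm ?mulr_gt0// => h.
  have h2 : (k - 1 / 100) * u <= cabs ('i%C * (k * u)%:C%C - (S - 'i%C * (mu k)%:C%C)).
    by move: h hS; lra.
  by have := ler_wpM2l (ltW t0) h2; lra.
have n1u : cabs (1 + 'i%C * t%:C%C * S) <= (k + 1 / 100) * (t * u).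
  have := cabsB (S - 'i%C * (mu k)%:C%C) ('i%C * (k * u)%:C%C).
  rewrite n1 [cabs ('i%C * (k * u)%:C%C)]cabsM cabs_i cabs_real gtr0_norm ?mulr_gt0// => h.
  have h2 : cabs (S - 'i%C * (mu k)%:C%C - 'i%C * (k * u)%:C%C) <= (k + 1 / 100) * u.
    by move: h hS; lra.
  by have := ler_wpM2l (ltW t0) h2; lra.
have ts' : cabs ('i%C * t%:C%C * (S - 'i%C * (mu k)%:C%C)) <= t * u / 100.
  rewrite !cabsM cabs_i cabs_real gtr0_norm// mul1r.
  by have := ler_wpM2l (ltW t0) hS; lra.
have tu' := tu; have tm := tmu k; have ktu := ler_wpM2r (ltW tu0) k10; have ktu0 := mulr_gt0 k0 tu0.
have tm0 : 0 < 1 + t * mu k by lra.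
have n2l : 1989 / 1000 <= cabs (1 - 'i%C * t%:C%C * S).
  have := cabs_lb ((1 + t * mu k)%:C%C) ('i%C * t%:C%C * (S - 'i%C * (mu k)%:C%C)).
  by rewrite -n2 cabs_real gtr0_norm//; lra.
have n2u : cabs (1 - 'i%C * t%:C%C * S) <= 2001 / 1000.
  have := cabsB ((1 + t * mu k)%:C%C) ('i%C * t%:C%C * (S - 'i%C * (mu k)%:C%C)).
  by rewrite -n2 cabs_real gtr0_norm//; lra.
have d0 j : 0 < cabs (pt k - cconj (lam j)).
  apply: lt_le_trans (cIm_ub _); rewrite cImB cIm_conj opprK.
  exact: ltr_wpDr (root_Im_ge0 Ah t0 lamE j) p0.
move: bl n1l n1u n2l n2u; move: (cabs (1 + _)) (cabs (1 - _)) => X Y bl n1l n1u n2l n2u.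
have Pd : 0 < \prod_j cabs (pt k - cconj (lam j)) by apply: prodr_gt0.
have X0 : 0 < X by apply: lt_le_trans n1l; rewrite mulr_gt0.
have Y0 : 0 < Y := lt_le_trans c1 n2l.
have e : \prod_j (cabs (pt k - lam j) / cabs (pt k - cconj (lam j))) = X / Y.
  rewrite prodf_div; apply: (canLR (mulfK (lt0r_neq0 Pd))).
  apply: (mulIf (lt0r_neq0 Y0)); apply: etrans bl _.
  by rewrite mulrAC divfK ?gt_eqF// mulrC.
split.
- move=> j; rewrite lt_neqAle cabs_ge0 andbT eq_sym; apply/negP => /eqP z.
  have : 0 < X / Y by rewrite divr_gt0.
  by rewrite -e (bigD1 j)//= z mul0r mul0r ltxx.
- have k99' := mulr_ge0 (ltW k99) (ltW tu0).
  rewrite e (ler_pdivlMr _ _ Y0) mulrAC (ler_pdivrMr _ _ c2).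
  exact: (ler_pM k99' (ltW Y0) n1l n2u).
rewrite e (ler_pdivrMr _ _ Y0) mulrAC (ler_pdivlMr _ _ c1).
exact: (ler_pM (ltW X0) (ltW c1) n1u n2l).
Qed.

Let i1 : (1 : R) <= 10. Proof. by lra. Qed.
Let i10 : (0 : R) < 10. Proof. by lra. Qed.

Lemma outlier_shift_ratio : 10 * rho 1 <= rho 10 /\ rho 10 <= 1011 / 100 * rho 1.
Proof.
have m1 := mu_gt0 i1; have m10 := mu_gt0 (lexx 10).
rewrite /rho -/(mu 1) -/(mu 10).
have mm : mu 10 <= mu 1 by rewrite /mu; have := u0; lra.
have mm2 : 99 / 100 * mu 1 <= mu 10.
  by rewrite -(ler_pM2l t0) mulrCA !tmu; have := mulr_gt0 t0 u0; have := tu; lra.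
have h1 : t / mu 1 <= t / mu 10 by rewrite ler_wpM2l ?(ltW t0)// lef_pV2.
have h2 : t / mu 10 <= 1011 / 1000 * (t / mu 1).
  rewrite ler_pdivrMr//.
  have e : t / mu 1 * mu 1 = t by rewrite divfK// gt_eqF.
  have := ler_wpM2l (ltW (divr_gt0 t0 m1)) mm2; have := mulr_gt0 (divr_gt0 t0 m1) m10.
  rewrite [t / mu 1 * (99 / 100 * mu 1)]mulrCA e; lra.
have := ler_wpM2l (ltW u0) h1; have := ler_wpM2l (ltW u0) h2; have := u0.
by move=> ? ? ?; split; lra.
Qed.

Lemma blaschke_ratio : cabs (form A v (pt 1) - 'i%C * (mu 1)%:C%C) <= u / 100 ->
  cabs (form A v (pt 10) - 'i%C * (mu 10)%:C%C) <= u / 100 ->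
  let B k := \prod_j (cabs (pt k - lam j) / cabs (pt k - cconj (lam j))) in
  [/\ forall j, 0 < cabs (pt 1 - lam j), forall j, 0 < cabs (pt 10 - lam j),
    97 / 10 * B 1 <= B 10, B 10 <= 103 / 10 * B 1 & u / 3 <= B 1].
Proof.
move=> S1 S10 B.
have [D1 l1 u1] := blaschke_bound (lexx 1) i1 S1.
have [D10 l10 u10] := blaschke_bound i1 (lexx 10) S10.
have tu0 : 0 < t * u by rewrite mulr_gt0.
have uu : u <= t * u by rewrite ler_peMl ?(ltW u0)// ltW.
rewrite -/(B 1) in l1 u1; rewrite -/(B 10) in l10 u10.
move: (B 1) (B 10) l1 u1 l10 u10 => b1 b10 l1 u1 l10 u10.
split=> //; have := tu0; have := u0; move: l1 u1 l10 u10 uu; move: (t * u) => w; lra.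
Qed.

(** The points with $k=1$ and $k=10$ are compared. By the assumed dichotomy, an eigenvalue that is
    not near $it^*$ has imaginary part below [b], so its factor is of the far kind. *)
Lemma outlier_count : cabs (form A v (pt 1) - 'i%C * (mu 1)%:C%C) <= u / 100 ->
  cabs (form A v (pt 10) - 'i%C * (mu 10)%:C%C) <= u / 100 ->
  (forall j, b <= cIm (lam j) -> cabs (lam j - 'i%C * (tstar t)%:C%C) <= rho 1 / 100) ->
  16 * b <= tstar t -> 1000 * rho 1 <= tstar t -> 40 * rho 1 * M <= tstar t ->
  expR (- M) <= (u / 3) ^+ 2 ->
  exists j0, cabs (lam j0 - 'i%C * (tstar t)%:C%C) <= rho 1 / 100 /\
    forall j, j != j0 -> cIm (lam j) < b.
Proof.
move=> S1 S10 dich b16 r1000 rM eM.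
have [D1 D10 B1 B2 B3] := blaschke_ratio S1 S10; move: eM B1 B2 B3 => eM B1 B2 B3.
have ts0 : 0 < tstar t.
  by rewrite subr_gt0; apply: lt_trans t1; rewrite invf_lt1.
have r0 : 0 < rho 1 by apply: lt_trans (outlier_shift_ge ltr01 i1); rewrite mulr_gt0.
have r10 : 0 < rho 10 by apply: lt_trans (outlier_shift_ge i10 (lexx 10)); rewrite mulr_gt0.
have [rr1 rr2] := outlier_shift_ratio.
have lam0 j := root_Im_ge0 Ah t0 lamE j.
pose y k := tstar t + rho k.
have ptI k : cIm (pt k) = y k.
  by rewrite /pt cImM cRe_i cIm_i cRe_real cIm_real mul0r add0r mul1r.
have ptR k : cRe (pt k) = 0.
  by rewrite /pt cReM cRe_i cIm_i cRe_real cIm_real mul0r mulr0 subr0.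
pose d k j := cabs (pt k - cconj (lam j)); pose D k j := cabs (pt k - lam j).
(* $|z-\lambda|^2=|z-\bar\lambda|^2-4\,\Im z\,\Im\lambda$ gives the squared factors the shape needed
   by [far_factor]. *)
have dD k j : D k j ^+ 2 = d k j ^+ 2 - 4 * y k * cIm (lam j).
  rewrite !cabs_sq !(cReB, cImB) cRe_conj cIm_conj ptR ptI; ring.
have yd k j : y k <= d k j.
  apply: le_trans (cIm_ub _); rewrite cImB cIm_conj ptI opprK lerDl; exact: lam0.
have y1 : 0 < y 1 by rewrite /y; lra.
have y10 : 0 < y 10 by rewrite /y; lra.
have d1 j : 0 < d 1 j by apply: lt_le_trans (yd 1 j).
have d10 j : 0 < d 10 j by apply: lt_le_trans (yd 10 j).
have pd : cabs (pt 10 - pt 1) = y 10 - y 1.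
  rewrite /pt -mulrBr -rmorphB /= cabsM cabs_i cabs_real mul1r ger0_norm.
    by rewrite /y.
  by rewrite opprD addrACA subrr add0r subr_ge0; have := r0; lra.
have dd j : d 10 j <= d 1 j + (y 10 - y 1).
  rewrite -pd; apply: le_trans (cabsD _ _); rewrite le_eqVlt; apply/orP; left; apply/eqP.
  by rewrite /d; congr cabs; ring.
have dd' j : d 1 j <= d 10 j.
  apply: ler_of_sq; first exact: ltW.
  rewrite !cabs_sq !(cReB, cImB) cRe_conj cIm_conj !ptR !ptI lerD2l opprK.
  rewrite lerXn2r ?nnegrE ?lerD2r//; [| |by rewrite /y; lra].
    by have := lam0 j; lra.
  by have := lam0 j; lra.
have ptc k : 0 < rho k -> cabs (pt k - 'i%C * (tstar t)%:C%C) = rho k.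
  move=> rk; rewrite /pt -mulrBr -rmorphB /= cabsM cabs_i cabs_real mul1r.
  by rewrite [tstar t + _]addrC addrK gtr0_norm.
pose near j := cabs (lam j - 'i%C * (tstar t)%:C%C) <= rho 1 / 100.
have farb j : ~~ near j -> cIm (lam j) <= b.
  by move=> nj; rewrite leNgt; apply: contra nj => /ltW; exact: dich.
have := @count_near R N near (fun j => D 10 j / d 10 j) (fun j => D 1 j / d 1 j)
  (fun j => 4 * y 10 * cIm (lam j) / d 10 j ^+ 2) (fun j => 4 * y 1 * cIm (lam j) / d 1 j ^+ 2)
  (10 * rho 1 / tstar t) M.
case.
- by move=> j; exact: divr_gt0 (D10 j) (d10 j).
- move=> j; apply/andP; split; first exact: divr_gt0 (D1 j) (d1 j).
  rewrite (ler_pdivrMr _ _ (d1 j)) mul1r; apply: ler_of_sq; first exact: ltW.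
  rewrite dD gerBl; apply: mulr_ge0; last exact: lam0.
  by apply: mulr_ge0 => //; exact: ltW.
- move=> j nj.
  have h1 : 1000 * rho 1 <= y 1 by rewrite /y; lra.
  have h2 : y 10 <= y 1 + 10 * rho 1 by rewrite /y; lra.
  have h3 : 999 / 100 * rho 1 <= D 10 j.
    have := cabs_lb (pt 10 - 'i%C * (tstar t)%:C%C) (lam j - 'i%C * (tstar t)%:C%C).
    by rewrite opprB addrA subrK ptc// -/(D 10 j); move: nj; rewrite /near; lra.
  have h4 : D 1 j <= 101 / 100 * rho 1.
    have := cabsB (pt 1 - 'i%C * (tstar t)%:C%C) (lam j - 'i%C * (tstar t)%:C%C).
    by rewrite opprB addrA subrK ptc// -/(D 1 j); move: nj; rewrite /near; lra.
  exact: (near_factor r0 y1 h1 h2 (cabs_ge0 _) (D1 j) (d10 j) (d1 j) (yd 1 j) (dd j) h3 h4).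
- move=> j nj.
  have th0 : 0 <= 10 * rho 1 / tstar t by rewrite divr_ge0 ?(ltW ts0)//; lra.
  have yt : y 10 <= y 1 * (1 + 10 * rho 1 / tstar t).
    have e : tstar t * (10 * rho 1 / tstar t) = 10 * rho 1 by rewrite mulrC divfK// gt_eqF.
    have := mulr_ge0 (ltW r0) th0; move: e; rewrite /y; move: (10 * rho 1 / tstar t) => th.
    by move: rr2 r0; move: (tstar t) (rho 1) (rho 10) => x r z; lra.
  have yy : y 1 <= y 10 by rewrite /y; lra.
  have b16' : 16 * b <= y 1 by rewrite /y; lra.
  have [f1 f2] := far_factor y1 yy yt th0 (lam0 j) (farb j nj) b16' (yd 1 j) (dd' j) (dd j).
  have sq k : 0 < d k j -> (D k j / d k j) ^+ 2 = 1 - 4 * y k * cIm (lam j) / d k j ^+ 2.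
    by move=> dk; rewrite exprMn exprVn dD mulrBl divff// gt_eqF// exprn_gt0.
  by split; rewrite ?sq.
- by apply/andP; split; [rewrite divr_ge0 ?(ltW ts0)//; lra|rewrite ler_pdivrMr//; lra].
- have -> : 4 * (10 * rho 1 / tstar t * M) = 40 * rho 1 * M / tstar t by ring.
  by rewrite ler_pdivrMr// mul1r.
- apply: le_trans eM _; rewrite lerXn2r ?nnegrE//.
  + by rewrite divr_ge0// ltW.
  + by apply: prodr_ge0 => j _; rewrite divr_ge0 ?cabs_ge0.
- exact: B1.
- exact: B2.
move=> j0 [n0 nn]; exists j0; split=> // j jj; rewrite ltNge; apply: contra (nn j jj).
exact: dich.
Qed.
End Count.

(** * Locating the eigenvalues *)

Lemma hs2_mul_row (R : realType) n (w : 'rV[R[i]]_n) (A : 'M[R[i]]_n) :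
  hs2 (w *m A) <= hs2 w * hs2 A.
Proof.
rewrite /hs2 !big_ord1 exchange_big mulr_sumr /=; apply: ler_sum => j _.
by rewrite mxE; exact: cauchy_schwarz.
Qed.

(** From $zS(z)=v^{*}AG(z)v-1$. At an eigenvalue $S=i/t$, so this bounds its modulus by a power of
    $N$, as the domain of the law requires. *)
Lemma form_growth (R : realType) N (A : 'M[R[i]]_N) (v : 'cV[R[i]]_N) z : ctr A = A ->
  hs2 v = 1 -> 0 < cIm z ->
  cabs (z * form A v z) ^+ 2 <= 2 * (1 + hs2 A / cIm z ^+ 2).
Proof.
move=> Ah hv z0.
have e : z * form A v z = ((ctr v *m A) *m (green A N z *m v)) 0 0 - 1.
  have h : A *m green A N z = 1%:M + z *: green A N z.
    have := green_full_l Ah z0; rewrite mulmxBl mul_scalar_mx => <-.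
    by rewrite subrK.
  rewrite mulmxA -[ctr v *m A *m _]mulmxA h mulmxDr mulmxDl mulmx1 -scalemxAr -scalemxAl.
  have v1 : (ctr v *m v) 0 0 = 1.
    by have := mxtrace_ctr_mul v; rewrite hv /mxtrace big_ord1.
  have Z m n c (M : 'M[R[i]]_(m, n)) i j : (c *: M) i j = c * M i j by rewrite mxE.
  have D m n (M M' : 'M[R[i]]_(m, n)) i j : (M + M') i j = M i j + M' i j by rewrite mxE.
  by rewrite D Z v1 addrAC subrr add0r.
rewrite e; set x := (_ *m _) 0 0.
have hx : cabs x ^+ 2 <= hs2 A / cIm z ^+ 2.
  apply: le_trans (cauchy_schwarz_row_col _ _) _; apply: ler_pM; rewrite ?hs2_ge0//.
    by have := hs2_mul_row (ctr v) A; rewrite hs2_ctr hv mul1r.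
  rewrite -[leRHS]mul1r ler_pdivlMr ?exprn_gt0// mulrC -hv; exact: hs2_green_le.
have := cabsB x 1; rewrite cabs1 => h.
have x0 := cabs_ge0 x; have := cabs_ge0 (x - 1); have := sqr_ge0 (cabs x - 1).
move: (cabs x) (cabs (x - 1)) x0 h hx => a c x0 h hx s c0.
have : c ^+ 2 <= (a + 1) ^+ 2 by rewrite lerXn2r ?nnegrE// addr_ge0.
lra.
Qed.

(** Write $\lambda$ as the spectral point of some $m$. Below the domain of the law, $\Im
    S(\lambda)=1/t$ would contradict [form_Im_small]. Inside it, $|m-i/t|$ is small, and then
    $\lambda$ is close to the spectral point of $i/t$, which is $it^*$. *)
Lemma root_location (R : realType) N (A : 'M[R[i]]_N) (v : 'cV[R[i]]_N) (lam : 'I_N -> R[i])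
    (t T q b : R) (j : 'I_N) : (0 < N)%N -> ctr A = A -> hs2 v = 1 -> 1 <= q -> local_law A v q ->
  char_poly (Gt A v t) = \prod_(j < N) ('X - (lam j)%:P) -> 1 < t -> t < T -> 0 < b ->
  800 * q ^+ 8 * N%:R^-1 * T < b ->
  7 * q ^+ 4 * Num.sqrt (N%:R^-1 / b) * (1 + 2 * T ^+ 2) <= tstar t / 2 ->
  2 + 4 * T ^+ 2 * (1 + hs2 A * N%:R ^+ 2) <= N%:R ^+ 6 -> 400 * q ^+ 8 <= N%:R ->
  let w := 7 * q ^+ 4 * Num.sqrt (2 * N%:R^-1 / tstar t) in
  w < t^-1 -> b <= cIm (lam j) ->
  cabs (lam j - 'i%C * (tstar t)%:C%C) <= w * (1 + t / (t^-1 - w)).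
Proof.
move=> N0 Ah hv q1 ll lamE t1 tT b0 n2 n3 n4 n5 w wt bl.
have t0 : 0 < t by exact: lt_trans t1.
have NR : 0 < N%:R :> R by rewrite ltr0n.
have nu0 : 0 < N%:R^-1 :> R by rewrite invr_gt0.
have nN : N%:R^-1 * N%:R = 1 :> R by rewrite mulVf// gt_eqF.
have q8 : 1 <= q ^+ 8 by exact: exprn_ege1.
have q4 : 1 <= q ^+ 4 by exact: exprn_ege1.
have z0 : 0 < cIm (lam j) by exact: lt_le_trans bl.
have Sz := root_form Ah t0 lamE z0.
have ts0 : 0 < tstar t.
  by rewrite subr_gt0; apply: (lt_trans _ t1); rewrite invf_lt1.
have zb : cabs (lam j) ^+ 2 <= 2 * T ^+ 2 * (1 + hs2 A * N%:R ^+ 2).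
  have g := form_growth Ah hv z0; rewrite Sz !cabsM cabsV cabs_i cabs_real mul1r gtr0_norm// in g.
  have nb : N%:R^-1 <= cIm (lam j).
    apply: le_trans bl; apply: le_trans (ltW n2).
    have h1 : N%:R^-1 <= 800 * q ^+ 8 * N%:R^-1.
      by move: q8 nu0; move: (q ^+ 8) (N%:R^-1 : R) => a c a1 c0; have := ler_wpM2r (ltW c0) a1; lra.
    have T1 : 1 <= T by apply: ltW; exact: lt_trans tT.
    exact: le_trans h1 (ler_peMr (le_trans (ltW nu0) h1) T1).
  have nb2 : hs2 A / cIm (lam j) ^+ 2 <= hs2 A * N%:R ^+ 2.
    rewrite ler_wpM2l ?hs2_ge0// -exprVn lerXn2r ?nnegrE ?invr_ge0 ?(ltW z0) ?ler0n//.
    by rewrite -[leRHS]invrK lef_pV2.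
  have h2 : cabs (lam j) ^+ 2 <= t ^+ 2 * (2 * (1 + hs2 A * N%:R ^+ 2)).
    rewrite -ler_pdivrMl ?exprn_gt0// mulrC -exprVn -exprMn; apply: le_trans g _.
    by rewrite ler_wpM2l// lerD2l.
  have t2 : t ^+ 2 <= T ^+ 2 by rewrite lerXn2r ?nnegrE ?(ltW t0) ?(ltW tT)//; lra.
  have c0 : 0 <= 2 * (1 + hs2 A * N%:R ^+ 2).
    by rewrite mulr_ge0// addr_ge0// mulr_ge0 ?hs2_ge0 ?sqr_ge0.
  by have := ler_wpM2r c0 t2; move: h2; lra.
have [m [y0 m1 mz]] := spectral_point_surj z0.
have m0 : 0 < cabs m by rewrite cabs_gt0; apply: contraTneq y0 => ->; rewrite cIm0 ltxx.
have [small|large] := leP (cIm m * cIm (spectral_point m)) (200 * q ^+ 8 * N%:R^-1).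
  have EN : 2 * (1 + cRe (spectral_point m) ^+ 2) <= N%:R ^+ 6.
    apply: le_trans n4; rewrite mz.
    have : cRe (lam j) ^+ 2 <= cabs (lam j) ^+ 2 by rewrite cabs_sq lerDl sqr_ge0.
    by move: zb; lra.
  have := form_Im_small N0 Ah hv q1 ll y0 m1 EN small n5; rewrite mz Sz.
  have -> : cIm ('i%C / t%:C%C : R[i]) = t^-1.
    have tV : t%:C%C^-1 = (t^-1)%:C%C :> R[i] by rewrite fmorphV.
    by rewrite tV cImM cRe_i cIm_i cRe_real mul0r add0r mul1r.
  rewrite (ler_pdivrMl _ _ t0) => h.
  have c0 := mulr_gt0 (lt_le_trans ltr01 q8) nu0.
  have c1 : 0 <= 800 * q ^+ 8 * N%:R^-1 by move: c0; move: (q ^+ 8) (N%:R^-1 : R) => x y; lra.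
  have hc := ler_wpM2l c1 (ltW tT).
  by have := lt_le_trans (le_lt_trans hc n2) (le_trans bl h); rewrite mulrC ltxx.
have m3 : N%:R^-1 ^+ 3 <= cabs m.
  have h1 : (cabs m)^-1 <= cabs (lam j) + 1.
    have -> : (cabs m)^-1 = cabs (lam j + m) by rewrite -mz subrK cabsN cabsV.
    by apply: le_trans (cabsD _ _) _; rewrite lerD2l ltW.
  have h2 : cabs (lam j) + 1 <= N%:R ^+ 3.
    apply: ler_of_sq; first by rewrite exprn_ge0// ltW.
    rewrite -exprM; apply: le_trans n4.
    by have := sqr_ge0 (cabs (lam j) - 1); move: zb; lra.
  by rewrite exprVn -[leRHS]invrK lef_pV2 ?posrE ?invr_gt0 ?exprn_gt0// (le_trans h1).
have := ll m y0 m3 (ltW large); rewrite mz Sz => hE.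
have hE2 : cabs ('i%C / t%:C%C - m) <= 7 * q ^+ 4 * Num.sqrt (N%:R^-1 / cIm (lam j)).
  apply: le_trans hE _; rewrite ler_wpM2l//; first by lra.
  rewrite ler_wsqrtr// ler_wpM2r ?invr_ge0 ?(ltW z0)// ler_piMl ?(ltW nu0)//.
  by apply: ltW; apply: le_lt_trans (cIm_ub m) m1.
have tn : t%:C%C != 0 :> R[i] by rewrite -cabs_gt0 cabs_real normr_gt0 gt_eqF.
have mn : m != 0 by rewrite -cabs_gt0.
have dist : cabs (lam j - 'i%C * (tstar t)%:C%C) <= cabs ('i%C / t%:C%C - m) * (1 + t / cabs m).
  have e0 : 'i%C / t%:C%C != 0 :> R[i].
    by rewrite -cabs_gt0 cabsM cabsV cabs_i cabs_real mul1r invr_gt0 gtr0_norm.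
  have -> : 'i%C * (tstar t)%:C%C = spectral_point ('i%C / t%:C%C).
    have i0 : 'i%C != 0 :> R[i] by rewrite -cabs_gt0 cabs_i.
    have iV : 'i%C^-1 = - 'i%C :> R[i].
      by apply: (mulfI i0); rewrite mulfV// mulrN -expr2 sqr_i opprK.
    by rewrite /spectral_point invfM invrK iV /tstar rmorphB fmorphV /=; ring.
  rewrite -mz spectral_point_sub// cabsM [cabs (m - _)]cabsBC ler_wpM2l ?cabs_ge0//.
  apply: le_trans (cabsB _ _) _; rewrite cabs1 addrC lerD2l cabsV !cabsM cabsV cabs_i cabs_real.
  by rewrite gtr0_norm// mul1r invfM invrK mulrC.
have mlow (x : R) : cabs ('i%C / t%:C%C - m) <= x -> t^-1 - x <= cabs m.
  move=> h; have := cabs_lb ('i%C / t%:C%C) ('i%C / t%:C%C - m); rewrite subKr.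
  by rewrite cabsM cabsV cabs_i cabs_real mul1r gtr0_norm//; move: h; lra.
(* A first, crude pass uses only $\Im\lambda\ge b$ and yields $\Im\lambda\ge t^*/2$; with this the
   law gives the sharp error [w]. *)
have half : tstar t / 2 <= cIm (lam j).
  set x := 7 * q ^+ 4 * Num.sqrt (N%:R^-1 / b) in n3.
  have hx : cabs ('i%C / t%:C%C - m) <= x.
    apply: le_trans hE2 _; rewrite ler_wpM2l//; first by lra.
    by rewrite ler_wsqrtr// ler_wpM2l ?(ltW nu0)// lef_pV2.
  have ml := mlow x hx.
  have x0 : 0 <= x by apply: le_trans (cabs_ge0 _) hx.
  have T0 : 0 < T by exact: lt_trans tT.
  have tsT : tstar t <= T by rewrite /tstar; have := invr_gt0 t; rewrite t0; lra.
  have xT : 4 * x * T <= 1.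
    rewrite -(ler_pM2r T0) mul1r; have := sqr_ge0 T; nra.
  have xt : 4 * x * t <= 1.
    by apply: le_trans xT; rewrite ler_wpM2l ?(ltW tT)// mulr_ge0.
  have tm : t / cabs m <= 2 * T ^+ 2.
    rewrite ler_pdivrMr//.
    have h1 : 3 / 4 <= t * cabs m.
      have := ler_wpM2l (ltW t0) ml; rewrite mulrBr mulfV ?gt_eqF//; lra.
    have tt : t ^+ 2 <= T ^+ 2 by rewrite lerXn2r ?nnegrE ?(ltW t0) ?(ltW tT) ?(ltW T0).
    rewrite -(ler_pM2l t0) -expr2 mulrCA; apply: le_trans tt _.
    have T20 : 0 <= T ^+ 2 by exact: sqr_ge0.
    by have := ler_wpM2l T20 h1; lra.
  have d := cIm_lb (lam j - 'i%C * (tstar t)%:C%C).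
  have d2 : cabs (lam j - 'i%C * (tstar t)%:C%C) <= tstar t / 2.
    apply: le_trans dist _; apply: le_trans n3; apply: ler_pM; rewrite ?cabs_ge0// ?lerD2l//.
    by rewrite addr_ge0// divr_ge0// ltW.
  rewrite cImB cImM cRe_i cIm_i cRe_real cIm_real mul0r add0r mul1r in d; lra.
have hw : cabs ('i%C / t%:C%C - m) <= w.
  apply: le_trans hE2 _; rewrite ler_wpM2l//; first by lra.
  rewrite ler_wsqrtr// [2 * _]mulrC -mulrA ler_wpM2l ?(ltW nu0)//.
  by rewrite -[2]invrK -invfM lef_pV2 ?posrE ?mulr_gt0// mulrC.
apply: le_trans dist _; apply: ler_pM => //; rewrite ?cabs_ge0//.
  by rewrite addr_ge0// divr_ge0// ltW.
rewrite lerD2l ler_wpM2l ?(ltW t0)// lef_pV2 ?posrE ?subr_gt0//; exact: mlow.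
Qed.

(** * Assembling the deterministic statement and choosing the scales *)

Lemma char_poly_split (R : realType) N (A : 'M[R[i]]_N) :
  exists lam : 'I_N -> R[i], char_poly A = \prod_(j < N) ('X - (lam j)%:P).
Proof.
have [r e] := closed_field_poly_normal (char_poly A).
rewrite (monicP (char_poly_monic A)) scale1r in e.
have sr : size r = N.
  by apply: succn_inj; rewrite -(size_prod_XsubC r id) -e size_char_poly.
exists (fun j => r`_j); rewrite e (big_nth 0) sr big_mkord //.
Qed.

Lemma cabs_imag (R : realType) (x : R) : 0 < x -> cabs ('i%C * x%:C%C) = x.
Proof. by move=> x0; rewrite cabsM cabs_i cabs_real mul1r gtr0_norm. Qed.

Lemma cIm_imag (R : realType) (x : R) : cIm ('i%C * x%:C%C) = x.
Proof. by rewrite cImM cRe_i cIm_i cRe_real mul0r add0r mul1r. Qed.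

(** The scale [u] is 100 times the error of the law at height $t^*$, so at both comparison points
    $S$ is known up to $u/100$, and every eigenvalue with imaginary part at least [b] lies within a
    hundredth of the first shift from $it^*$. *)
Lemma outlier_config_of_law (R : realType) N (A : 'M[R[i]]_N) (v : 'cV[R[i]]_N)
    (t T q b r M : R) : (0 < N)%N -> ctr A = A -> hs2 v = 1 -> 1 <= q -> local_law A v q ->
  1 < t -> t < T -> 0 < b ->
  800 * q ^+ 8 * N%:R^-1 * T < b ->
  7 * q ^+ 4 * Num.sqrt (N%:R^-1 / b) * (1 + 2 * T ^+ 2) <= tstar t / 2 ->
  2 + 4 * T ^+ 2 * (1 + hs2 A * N%:R ^+ 2) <= N%:R ^+ 6 -> 400 * q ^+ 8 <= N%:R ->
  16 * b <= tstar t -> 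
  let u := 700 * q ^+ 4 * Num.sqrt (2 * N%:R^-1 / tstar t) in
  0 < u -> 1000 * (u * (1 + 2 * T ^+ 2)) <= tstar t ->
  40 * (u * (1 + 2 * T ^+ 2)) * M <= tstar t -> 0 <= M -> expR (- M) <= (u / 3) ^+ 2 ->
  u * (1 + 2 * T ^+ 2) < r ->
  outlier_config (Gt A v t) ('i%C * (tstar t)%:C%C) r b.
Proof.
move=> N0 Ah hv q1 ll t1 tT b0 n2 n3 n4 n5 b16 u u0 r1000 rM M0 eM ur.
have [lam lamE] := char_poly_split (Gt A v t).
have t0 : 0 < t by exact: lt_trans t1.
have T1 : 1 < T by exact: lt_trans tT.
have T0 : 0 < T by exact: lt_trans T1.
have tiV : 0 < t^-1 by rewrite invr_gt0.
have tsT : tstar t <= t by rewrite /tstar gerBl ltW.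
have ts0 : 0 < tstar t by rewrite subr_gt0; apply: (lt_trans _ t1); rewrite invf_lt1.
have tt : t ^+ 2 <= T ^+ 2 by rewrite lerXn2r ?nnegrE ?(ltW t0) ?(ltW tT) ?(ltW T0).
have tu : t * u <= 1 / 1000.
  have l1 : 1000 * (u * (2 * T ^+ 2)) <= T.
    have := mulr_gt0 u0 T0; have := u0.
    by move: r1000 tsT tT; clear; move: (T ^+ 2) => T2; lra.
  have l2 : 1000 * (u * (2 * T)) <= 1.
    by rewrite -(ler_pM2r T0) mul1r; move: l1; clear; lra.
  have l3 := ler_wpM2r (ltW u0) (ltW tT).
  by have := mulr_gt0 u0 T0; move: l2 l3; clear; lra.
have mu_lo k : 0 <= k -> k <= 10 -> 99 / 100 <= t * (t^-1 - k * u).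
  move=> k0 k10; rewrite mulrBr mulfV ?gt_eqF//.
  have := ler_wpM2r (ltW (mulr_gt0 t0 u0)) k10; move: tu; clear; lra.
have mu_gt0 k : 0 <= k -> k <= 10 -> 0 < t^-1 - k * u.
  by move=> k0 k10; rewrite -(pmulr_rgt0 _ t0); apply: lt_le_trans (mu_lo k k0 k10); clear; lra.
(* The factor $1+2T^2$ bounds $1+t/(1/t-u)$ for all $t<T$, since $t(1/t-u)\ge 99/100$. *)
have rho_le : outlier_shift t u 1 <= u * (1 + 2 * T ^+ 2).
  rewrite /outlier_shift mul1r ler_wpM2l ?(ltW u0)// lerD2l.
  have m0 := mu_gt0 1 ler01 (_ : 1 <= 10); have ml := mu_lo 1 ler01 (_ : 1 <= 10).
  rewrite mul1r in m0 ml; have {}m0 := m0 (ltac:(lra)); have {}ml := ml (ltac:(lra)).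
  rewrite ler_pdivrMr// -(ler_pM2l t0) -expr2 mulrCA; apply: le_trans tt _.
  by have := ler_wpM2l (sqr_ge0 T) ml; have := sqr_ge0 T; clear; lra.
have rho0 : 0 <= outlier_shift t u 1.
  rewrite /outlier_shift !mul1r mulr_ge0 ?(ltW u0)// addr_ge0// divr_ge0 ?(ltW t0)//.
  by have := mu_gt0 1 ler01 (ltac:(lra)); rewrite mul1r => /ltW.
have law k : 0 <= k -> k <= 10 ->
    cabs (form A v (spectral_point ('i%C * (t^-1 - k * u)%:C%C)) - 'i%C * (t^-1 - k * u)%:C%C) <= u / 100.
  move=> k0 k10; have m0 := mu_gt0 k k0 k10; have ml := mu_lo k k0 k10.
  set m := t^-1 - k * u in m0 ml *.
  have mt : m <= t^-1 by rewrite /m gerBl mulr_ge0// ltW.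
  have m1 : m <= 1 by apply: le_trans mt _; rewrite invf_le1// ltW.
  have eI : cIm (spectral_point ('i%C * m%:C%C)) = m^-1 - m.
    by rewrite spectral_point_Im cIm_imag cabs_imag//; field; rewrite gt_eqF.
  have eta : tstar t <= m^-1 - m.
    rewrite /tstar; apply: lerB => //; rewrite -[leLHS]invrK lef_pV2 ?posrE//.
  have NR : 0 < N%:R :> R by rewrite ltr0n.
  have nu0 : 0 < N%:R^-1 :> R by rewrite invr_gt0.
  have h1 := ll ('i%C * m%:C%C); rewrite cIm_imag cabs_imag// eI in h1.
  have c1 : N%:R^-1 ^+ 3 <= m.
    have TN : 2 * T <= N%:R ^+ 3.
      apply: ler_of_sq; first by rewrite exprn_ge0// ltW.
      rewrite -exprM; apply: le_trans n4; rewrite exprMn.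
      have hA : 0 <= T ^+ 2 * (hs2 A * N%:R ^+ 2) by exact: mulr_ge0 (sqr_ge0 _) (mulr_ge0 (hs2_ge0 _) (sqr_ge0 _)).
      by move: hA; clear; lra.
    rewrite exprVn -[leRHS]invrK lef_pV2 ?posrE ?invr_gt0 ?exprn_gt0//; apply: le_trans TN.
    rewrite -(ler_pM2r m0) mulVf ?gt_eqF//.
    by have := ler_wpM2r (ltW m0) (ltW tT); move: ml; clear; lra.
  have c2 : 200 * q ^+ 8 * N%:R^-1 <= m * (m^-1 - m).
    have e1 : tstar t / 4 <= m * tstar t * T.
      have := ler_wpM2r (ltW m0) (ltW tT) => h; have := ler_wpM2r (ltW ts0) (le_trans ml h).
      by move: ts0; clear; lra.
    have e2 := ler_wpM2l (ltW m0) eta.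
    rewrite -(ler_pM2r T0); apply: le_trans (_ : tstar t / 4 <= _).
      by move: n2 b16 b0; clear; move: (q ^+ 8 * N%:R^-1 * T) => x; lra.
    by apply: le_trans e1 _; rewrite ler_wpM2r// ltW.
  apply: le_trans (h1 m0 c1 c2) _.
  have -> : u / 100 = 7 * q ^+ 4 * Num.sqrt (2 * N%:R^-1 / tstar t).
    by rewrite /u; move: (Num.sqrt _) (q ^+ 4) => x y; field.
  have q40 : 0 <= 7 * q ^+ 4 by have := exprn_ge0 4 (le_trans ler01 q1); clear; lra.
  apply: (ler_wpM2l q40); apply: ler_wsqrtr; apply: ler_pM; rewrite ?invr_ge0 ?mulr_ge0 ?(ltW m0) ?(ltW nu0)//.
  - by apply: le_trans eta; exact: ltW.
  - by rewrite ler_wpM2r ?(ltW nu0)//; apply: le_trans m1 _; clear; lra.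
  - by rewrite lef_pV2 ?posrE//; apply: lt_le_trans eta.
have i1 : (1 : R) <= 10 by clear; lra.
have S1 := law 1 ler01 i1; have S10 := law 10 (le_trans ler01 i1) (lexx 10).
rewrite !(spectral_point_imag t1 u0 tu) in S1 S10 => //.
have dich j : b <= cIm (lam j) ->
    cabs (lam j - 'i%C * (tstar t)%:C%C) <= outlier_shift t u 1 / 100.
  move=> bj.
  have wE : u = 100 * (7 * q ^+ 4 * Num.sqrt (2 * N%:R^-1 / tstar t)).
    by rewrite /u; move: (Num.sqrt _) (q ^+ 4) => x y; ring.
  set w := 7 * q ^+ 4 * _ in wE.
  have w0 : 0 < w by move: u0; rewrite wE; clear; lra.
  have m0 := mu_gt0 1 ler01 i1; rewrite mul1r in m0.
  have wu : t^-1 - u <= t^-1 - w by rewrite lerD2l lerN2 wE; move: w0; clear; lra.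
  have wt : w < t^-1 by rewrite -subr_gt0; exact: lt_le_trans wu.
  apply: le_trans (root_location N0 Ah hv q1 ll lamE t1 tT b0 n2 n3 n4 n5 wt bj) _.
  rewrite /outlier_shift !mul1r {1}wE.
  have -> : 100 * w * (1 + t / (t^-1 - u)) / 100 = w * (1 + t / (t^-1 - u)).
    by move: (1 + _) => x; field.
  rewrite ler_wpM2l ?(ltW w0)// lerD2l ler_wpM2l ?(ltW t0)// lef_pV2 ?posrE//.
  exact: lt_le_trans wu.
have rr1 : 1000 * outlier_shift t u 1 <= tstar t.
  by move: rho_le r1000; clear; lra.
have rr2 : 40 * outlier_shift t u 1 * M <= tstar t.
  by apply: le_trans rM; have := ler_wpM2r M0 rho_le; clear; lra.
have [j0 [h1 h2]] := outlier_count Ah t1 u0 tu lamE S1 S10 dich b16 rr1 rr2 eM.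
exists lam; split=> //; exists j0; split=> //.
apply: le_lt_trans h1 _; apply: le_lt_trans ur; apply: le_trans rho_le.
by move: rho0; clear; lra.
Qed.

Lemma outlier_config_of_scale (R : realType) N (A : 'M[R[i]]_N) (v : 'cV[R[i]]_N) (t T L : R) :
  (0 < N)%N -> ctr A = A -> hs2 v = 1 -> local_law A v (256 * L ^+ 6) ->
  hs2 A <= N%:R * L ^+ 2 -> 1 < t -> t < T -> 1000 <= L -> 1 + 2 * T ^+ 2 <= L ->
  L ^+ 60 <= N%:R -> L ^+ 600 <= N%:R * tstar t ^+ 3 -> N%:R <= expR L ->
  outlier_config (Gt A v t) ('i%C * (tstar t)%:C%C)
    (L ^+ 50 / Num.sqrt (N%:R * tstar t)) (L ^+ 200 / (N%:R * tstar t ^+ 2)).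
Proof.
move=> N0 Ah hv ll hA t1 tT L1000 TL Ln Lts nL.
have t0 : 0 < t by exact: lt_trans t1.
have T1 : 1 < T by exact: lt_trans tT.
have T0 : 0 < T by exact: lt_trans T1.
have s0 : 0 < tstar t by rewrite subr_gt0; apply: (lt_trans _ t1); rewrite invf_lt1.
have sT : tstar t <= T.
  by apply: le_trans (ltW tT); rewrite /tstar gerBl ltW// invr_gt0.
have L1 : 1 <= L by apply: le_trans L1000; clear; lra.
have L0 : 0 < L by exact: lt_le_trans L1.
have TLL : T <= L.
  by apply: le_trans TL; move: T1; clear => h; have := sqr_ge0 (T - 1); nra.
have pw i j : (i <= j)%N -> L ^+ i <= L ^+ j by move=> ij; exact: ler_weXn2l.
have p0 i : 0 < L ^+ i by exact: exprn_gt0.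
set q := 256 * L ^+ 6 in ll *.
have q0 : 0 < q by rewrite /q; have := p0 6%N; clear; lra.
have q7 : q <= L ^+ 7.
  by rewrite /q [L ^+ 7]exprS ler_wpM2r ?(ltW (p0 6%N))//; apply: le_trans L1000; clear; lra.
have q1 : 1 <= q by rewrite /q; have := exprn_ege1 6 L1; clear; lra.
have q4 : q ^+ 4 <= L ^+ 28 by rewrite (_ : 28 = 7 * 4)%N// exprM lerXn2r ?nnegrE ?(ltW q0) ?(ltW (p0 _)).
have q8 : q ^+ 8 <= L ^+ 56 by rewrite (_ : 56 = 7 * 8)%N// exprM lerXn2r ?nnegrE ?(ltW q0) ?(ltW (p0 _)).
have q81 : 1 <= q ^+ 8 by exact: exprn_ege1.
have q41 : 1 <= q ^+ 4 by exact: exprn_ege1.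
have lin i (c : R) : c <= L -> c * L ^+ i <= L ^+ i.+1.
  by move=> cL; rewrite exprS ler_wpM2r// ltW.
have NR : 0 < N%:R :> R by rewrite ltr0n.
have n1 : 1 <= N%:R :> R by rewrite ler1n.
have T2 : 1 <= 1 + 2 * T ^+ 2 by rewrite lerDl mulr_ge0 ?sqr_ge0.
have s2 : tstar t ^+ 2 <= L ^+ 2.
  by rewrite lerXn2r ?nnegrE ?(ltW s0) ?(ltW L0)//; exact: le_trans TLL.
have b0 : 0 < L ^+ 200 / (N%:R * tstar t ^+ 2) by rewrite divr_gt0// mulr_gt0// exprn_gt0.
have b1 : 800 * q ^+ 8 * N%:R^-1 * T < L ^+ 200 / (N%:R * tstar t ^+ 2).
  rewrite ltr_pdivlMr; last by rewrite mulr_gt0// exprn_gt0.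
  have -> : 800 * q ^+ 8 * N%:R^-1 * T * (N%:R * tstar t ^+ 2) = 800 * (q ^+ 8 * (T * tstar t ^+ 2)).
    by move: (q ^+ 8) (tstar t ^+ 2) => x y; rewrite [LHS](_ : _ = 800 * (x * (T * y)) * (N%:R^-1 * N%:R));
      [rewrite mulVf ?mulr1// gt_eqF|clear; ring].
  have h1 : T * tstar t ^+ 2 <= L * L ^+ 2.
    by apply: ler_pM => //; [exact: ltW|exact: sqr_ge0].
  have h2 : q ^+ 8 * (T * tstar t ^+ 2) <= L ^+ 59.
    have -> : L ^+ 59 = L ^+ 56 * (L * L ^+ 2) by rewrite -exprS -exprD.
    apply: ler_pM => //; first by apply: le_trans q81.
    by rewrite mulr_ge0 ?sqr_ge0// ltW.
  have h3 := lin 59%N 1000 L1000; have h4 := pw 60%N 200%N isT; have h5 := p0 59%N.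
  by move: h2 h3 h4 h5; clear; lra.
have b2 : 7 * q ^+ 4 * Num.sqrt (N%:R^-1 / (L ^+ 200 / (N%:R * tstar t ^+ 2))) * (1 + 2 * T ^+ 2) <=
    tstar t / 2.
  have -> : N%:R^-1 / (L ^+ 200 / (N%:R * tstar t ^+ 2)) = (tstar t / L ^+ 100) ^+ 2.
    rewrite expr_div_n -exprM invf_div mulrA mulKf ?gt_eqF//.
  rewrite sqrtr_sqr ger0_norm; last by rewrite divr_ge0// ltW.
  have h1 : q ^+ 4 * (1 + 2 * T ^+ 2) <= L ^+ 29.
    by rewrite (exprSr L 28); exact: (ler_pM (le_trans ler01 q41) (le_trans ler01 T2) q4 TL).
  have h3 := lin 29%N 1000 L1000; have h4 := pw 30%N 100%N isT; have h5 := p0 29%N.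
  have h6 : 14 * (q ^+ 4 * (1 + 2 * T ^+ 2)) <= L ^+ 100 by move: h1 h3 h4 h5; clear; lra.
  have -> : 7 * q ^+ 4 * (tstar t / L ^+ 100) * (1 + 2 * T ^+ 2) =
      (tstar t * (14 * (q ^+ 4 * (1 + 2 * T ^+ 2))) / L ^+ 100) / 2.
    by move: (q ^+ 4) (1 + _) (L ^+ 100) (p0 100%N) => x y z z0; field; rewrite gt_eqF.
  rewrite ler_pM2r ?invr_gt0// ler_pdivrMr//.
  by rewrite ler_wpM2l// ltW.
have b3 : 2 + 4 * T ^+ 2 * (1 + hs2 A * N%:R ^+ 2) <= N%:R ^+ 6.
  have h1 : hs2 A * N%:R ^+ 2 <= N%:R ^+ 3 * L ^+ 2.
    by have := ler_wpM2r (sqr_ge0 N%:R) hA; move: (N%:R : R) => n; clear; lra.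
  have n3 : 1 <= N%:R ^+ 3 :> R by exact: exprn_ege1.
  have l2 : 1 <= L ^+ 2 by exact: exprn_ege1.
  have h2 : 1 <= N%:R ^+ 3 * L ^+ 2 by apply: le_trans n3 _; rewrite ler_peMr// (le_trans ler01).
  have h3 : 2 * T ^+ 2 <= L by move: TL; clear; lra.
  have h4 : 2 * T ^+ 2 * (1 + hs2 A * N%:R ^+ 2) <= L * (2 * (N%:R ^+ 3 * L ^+ 2)).
    apply: ler_pM => //; first by rewrite mulr_ge0 ?sqr_ge0.
      by rewrite addr_ge0// mulr_ge0 ?hs2_ge0 ?sqr_ge0.
    by move: h1 h2; clear; lra.
  have h5 : L * (2 * (N%:R ^+ 3 * L ^+ 2)) = 2 * L ^+ 3 * N%:R ^+ 3 by clear; ring.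
  have h6 : 6 * L ^+ 3 <= N%:R ^+ 3.
    have l4 := lin 3%N 1000 L1000; have l5 := pw 4%N 60%N isT.
    have n13 : N%:R <= N%:R ^+ 3 :> R by rewrite -[leLHS]expr1; apply: ler_weXn2l.
    by have := p0 3%N; move: l4 l5 n13 Ln; clear; lra.
  have h7 := ler_wpM2r (le_trans ler01 n3) h6; rewrite -exprD in h7.
  have l3 : 1 <= L ^+ 3 * N%:R ^+ 3.
    by apply: le_trans n3 _; rewrite ler_peMl ?(le_trans ler01 n3)//; exact: exprn_ege1.
  by move: h4 h7 l3; rewrite h5; clear; lra.
have b4 : 400 * q ^+ 8 <= N%:R.
  have h3 := lin 56%N 1000 L1000; have h4 := pw 57%N 60%N isT; have h5 := p0 56%N.
  by move: q8 h3 h4 h5 Ln; clear; lra.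
have b5 : 16 * (L ^+ 200 / (N%:R * tstar t ^+ 2)) <= tstar t.
  rewrite mulrA ler_pdivrMr; last by rewrite mulr_gt0// exprn_gt0.
  have -> : tstar t * (N%:R * tstar t ^+ 2) = N%:R * tstar t ^+ 3 by clear; ring.
  have h3 := lin 200%N 1000 L1000; have h4 := pw 201%N 600%N isT; have h5 := p0 200%N.
  by move: h3 h4 h5 Lts; clear; lra.
set u := 700 * q ^+ 4 * Num.sqrt (2 * N%:R^-1 / tstar t).
have ns0 : 0 < N%:R * tstar t by rewrite mulr_gt0.
have q40 : 0 < q ^+ 4 by exact: exprn_gt0.
have u0 : 0 < u.
  by apply: mulr_gt0; [move: q40; clear; lra|rewrite sqrtr_gt0 divr_gt0// mulr_gt0// invr_gt0].
have u2 : u ^+ 2 * (N%:R * tstar t) = 2 * 700 ^+ 2 * q ^+ 8.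
  rewrite /u exprMn sqr_sqrtr; last by rewrite divr_ge0 ?mulr_ge0 ?invr_ge0// ltW.
  have -> : q ^+ 8 = (q ^+ 4) ^+ 2 by rewrite -exprM.
  by move: (q ^+ 4) (tstar t) (N%:R : R) s0 NR => x y z y0 z0; clear -y0 z0; field; rewrite !gt_eqF.
have c106 : 2 * 700 ^+ 2 <= L ^+ 2.
  have k0 : 0 <= 1000 :> R by clear; lra.
  by have := ler_pM k0 k0 L1000 L1000; clear; lra.
have uq k : u ^+ 2 * (N%:R * tstar t) * L ^+ k <= L ^+ (k + 58).
  rewrite u2 addnC exprD; apply: ler_wpM2r; first exact: ltW.
  have -> : L ^+ 58 = L ^+ 2 * L ^+ 56 by rewrite -exprD.
  have k7 : 0 <= 2 * 700 ^+ 2 :> R by clear; lra.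
  exact: (ler_pM k7 (le_trans ler01 q81) c106 q8).
have uL : u * L ^+ 3 <= tstar t.
  apply: ler_of_sq; first exact: ltW.
  rewrite -(ler_pM2r ns0) exprMn -exprM.
  have -> : tstar t ^+ 2 * (N%:R * tstar t) = N%:R * tstar t ^+ 3 by clear; ring.
  apply: le_trans Lts; rewrite mulrAC; apply: le_trans (uq 6%N) _; exact: pw.
have uT : u * (1 + 2 * T ^+ 2) <= u * L by rewrite ler_wpM2l// ltW.
have uL0 : 0 <= u * L by rewrite mulr_ge0// ltW.
have hL3 : u * L ^+ 3 = u * L * L * L by clear; ring.
have uLL : 0 <= u * L * L by rewrite mulr_ge0// ltW.
have b6 : 1000 * (u * (1 + 2 * T ^+ 2)) <= tstar t.
  apply: le_trans uL; have h1 := ler_wpM2l uL0 L1000; have h2 := ler_wpM2l uLL L1.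
  by rewrite hL3; move: uT h1 h2; clear; lra.
have b7 : 40 * (u * (1 + 2 * T ^+ 2)) * L <= tstar t.
  apply: le_trans uL; rewrite hL3; apply: ler_wpM2r; first exact: ltW.
  have h1 := ler_wpM2l uL0 L1000.
  by move: uT h1 uL0; clear; lra.
have b8 : expR (- L) <= (u / 3) ^+ 2.
  apply: (@le_trans _ _ N%:R^-1).
    by rewrite expRN lef_pV2 ?posrE ?expR_gt0.
  rewrite -(ler_pM2r ns0) mulKf ?gt_eqF//.
  have -> : (u / 3) ^+ 2 * (N%:R * tstar t) = u ^+ 2 * (N%:R * tstar t) / 9 by clear; field.
  rewrite u2; have : tstar t <= q ^+ 8.
    apply: le_trans (le_trans sT TLL) _.
    have Lq : L <= q.
      by rewrite /q; have := pw 1%N 6%N isT; rewrite expr1; have := p0 6%N; clear; lra.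
    apply: le_trans Lq _; rewrite -[leLHS]expr1; exact: ler_weXn2l.
  by move: q81; clear; lra.
have b9 : u * (1 + 2 * T ^+ 2) < L ^+ 50 / Num.sqrt (N%:R * tstar t).
  have sn0 : 0 < Num.sqrt (N%:R * tstar t) by rewrite sqrtr_gt0.
  rewrite ltr_pdivlMr//; apply: le_lt_trans (ler_wpM2r (ltW sn0) uT) _.
  rewrite ltNge; apply/negP => h.
  have ss : Num.sqrt (N%:R * tstar t) * Num.sqrt (N%:R * tstar t) = N%:R * tstar t.
    by rewrite -expr2 sqr_sqrtr// ltW.
  have e : u * L * Num.sqrt (N%:R * tstar t) * (u * L * Num.sqrt (N%:R * tstar t)) =
      u ^+ 2 * (N%:R * tstar t) * L ^+ 2.
    rewrite -[X in _ = _ * X * _]ss; clearbody u; move: (Num.sqrt _) => x; clear; ring.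
  have h2 := ler_pM (ltW (p0 50%N)) (ltW (p0 50%N)) h h; rewrite e -exprD in h2.
  have := le_trans h2 (uq 2%N); apply/negP; rewrite -ltNge.
  by rewrite ltr_eXn2l//; apply: lt_le_trans L1000; clear; lra.
exact: (outlier_config_of_law N0 Ah hv q1 ll t1 tT b0 b1 b2 b3 b4 b5 u0 b6 b7 (ltW L0) b8 b9).
Qed.

Lemma outlier_config_le (R : realType) N (A : 'M[R[i]]_N) c (r r' b b' : R) : r <= r' -> b <= b' ->
  outlier_config A c r b -> outlier_config A c r' b'.
Proof.
move=> rr bb [lam [e [j0 [h1 h2]]]]; exists lam; split=> //; exists j0; split.
  exact: lt_le_trans h1 rr.
by move=> j jj; apply: lt_le_trans bb; exact: h2.
Qed.

Lemma exp_pow_le (R : realType) (L : R) k : 0 <= L -> L ^+ k <= k`!%:R * expR L.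
Proof.
move=> L0; case: k => [|k]; first by rewrite expr0 fact0 mul1r -expR0 ler_expR.
rewrite [_ * expR L]mulrC -ler_pdivrMr ?ltr0n ?fact_gt0//.
by have := expR_ge1Dxn k L0; lra.
Qed.

Lemma powR_exprn (R : realType) (n x y : R) k : 0 <= n -> x * k%:R = y ->
  (n `^ x) ^+ k = n `^ y.
Proof. by move=> n0 <-; rewrite -powR_mulrn ?powR_ge0// -powRrM. Qed.

Lemma failure_bound (R : realType) (n L x C : R) (k : nat) : 1 <= n -> 0 < L -> 1 <= x -> 0 <= C ->
  x * n ^+ 40 <= L ^+ k -> 3 * C <= n ->
  C + 401 ^+ 2 * 160 * expR 2 * k`!%:R < n ->
  n * n * (3 * (C / L ^+ k) / n^-1) <= 1 /\
  n * n * (C / L ^+ k) + (401 * n ^+ 12) ^+ 2 * (160 * (n * n * n) * expR (2 - L)) < x^-1.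
Proof.
move=> n1 L0 x1 C0 Lk nC nK.
have n0 : 0 < n by exact: lt_le_trans n1.
have x0 : 0 < x by exact: lt_le_trans x1.
have Lk0 : 0 < L ^+ k by exact: exprn_gt0.
have f0 : 0 < k`!%:R :> R by rewrite ltr0n fact_gt0.
have n40 : 0 < n ^+ 40 by exact: exprn_gt0.
have iL : (L ^+ k)^-1 <= x^-1 / n ^+ 40.
  by rewrite -invfM lef_pV2 ?posrE// mulr_gt0.
have eL : expR (- L) <= k`!%:R * (x^-1 / n ^+ 40).
  apply: le_trans (ler_wpM2l (ltW f0) iL); rewrite expRN.
  rewrite ler_pdivlMr// [_ * L ^+ k]mulrC ler_pdivrMr ?expR_gt0//.
  by apply: exp_pow_le; exact: ltW.
have pwn i : (i <= 40)%N -> n ^+ i / n ^+ 40 = (n ^+ (40 - i))^-1.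
  move=> ij; have -> : n ^+ 40 = n ^+ (40 - i) * n ^+ i by rewrite -exprD subnK.
  by rewrite invfM mulrCA mulfV ?mulr1// gt_eqF// exprn_gt0.
have small i : (i <= 39)%N -> n ^+ i / n ^+ 40 <= n^-1.
  move=> ij; rewrite pwn ?(leq_trans ij)// lef_pV2 ?posrE ?exprn_gt0//.
  by rewrite -{1}[n]expr1; apply: ler_weXn2l => //; rewrite subn_gt0.
have xV1 : x^-1 <= 1 by rewrite invf_le1.
have xV0 : 0 < x^-1 by rewrite invr_gt0.
have CL : C / L ^+ k <= C * (x^-1 / n ^+ 40) by rewrite ler_wpM2l.
have i40 : 0 < (n ^+ 40)^-1 by rewrite invr_gt0.
split.
  rewrite invrK.
  apply: (@le_trans _ _ (3 * C * x^-1 * (n ^+ 3 / n ^+ 40))).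
    have := ler_wpM2l (mulr_ge0 (mulr_ge0 (ltW n0) (ltW n0)) (ltW n0)) CL.
    by rewrite [n ^+ 3]exprS expr2; move: (n ^+ 40)^-1 (C / _) => y z; lra.
  have h1 := small 3%N isT.
  apply: (@le_trans _ _ (3 * C * 1 * n^-1)).
    apply: ler_pM => //; first by rewrite mulr_ge0 ?(ltW xV0)// mulr_ge0.
      by rewrite divr_ge0 ?exprn_ge0// ltW.
    by rewrite ler_wpM2l// mulr_ge0.
  by rewrite mulr1 ler_pdivrMr// mul1r.
have e2L : expR (2 - L) <= expR 2 * (k`!%:R * (x^-1 / n ^+ 40)).
  by rewrite expRD ler_wpM2l// expR_ge0.
set K := 401 ^+ 2 * 160 * expR 2 * k`!%:R in nK.
have t1 : n * n * (C / L ^+ k) <= C * x^-1 * n^-1.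
  apply: (@le_trans _ _ (C * x^-1 * (n ^+ 2 / n ^+ 40))).
    have := ler_wpM2l (mulr_ge0 (ltW n0) (ltW n0)) CL.
    by rewrite expr2; move: (n ^+ 40)^-1 (C / _) => y z; lra.
  by rewrite ler_wpM2l ?small// mulr_ge0 ?(ltW xV0).
have t2 : (401 * n ^+ 12) ^+ 2 * (160 * (n * n * n) * expR (2 - L)) <= K * x^-1 * n^-1.
  apply: (@le_trans _ _ (K * x^-1 * (n ^+ 27 / n ^+ 40))).
    have c0 : 0 <= 401 ^+ 2 * 160 * n ^+ 27.
      by have := exprn_gt0 27 n0; lra.
    have := ler_wpM2l c0 e2L.
    have -> : (401 * n ^+ 12) ^+ 2 * (160 * (n * n * n) * expR (2 - L)) =
        401 ^+ 2 * 160 * n ^+ 27 * expR (2 - L).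
      rewrite exprMn -exprM; have -> : n ^+ 27 = n ^+ 24 * (n * n * n) by clear; ring.
      by move: (n ^+ 24) (expR _) => y z; clear; ring.
    move/le_trans; apply; rewrite /K le_eqVlt; apply/orP; left; apply/eqP.
    by move: (n ^+ 27) (expR 2) (n ^+ 40)^-1 => y z e; clear; ring.
  have K0 : 0 <= K by rewrite /K; have := mulr_gt0 (expR_gt0 (2 : R)) f0; clear; lra.
  by rewrite ler_wpM2l ?small// mulr_ge0// ltW.
apply: le_lt_trans (lerD t1 t2) _.
have -> : C / x / n + K / x / n = (C + K) / n * x^-1 by clear; ring.
by rewrite gtr_pMl// ltr_pdivrMr// mul1r.
Qed.

(** * The event for one matrix size, and the conclusion *)

Section FixedSize.
Context {R : realType} {d : measure_display} {Om : measurableType d}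
  (P : probability Om R) (n0 : nat).
Local Notation N := n0.+1.
Variables (H : Om -> 'M[R[i]]_N) (v : 'cV[R[i]]_N) (p : nat) (C T eps a D : R).
Hypotheses (HW : wigner_at P H) (v1 : unit_vec v)
  (a0 : 0 < a) (ae : a <= eps) (a10 : a <= 1 / 10) (D0 : 0 < D) (C0 : 0 <= C).
(** Chosen so that $L^{50}=N^{a/4}$ and $L^{200}=N^a$ are the losses allowed in the radius and in
    the bound on the other eigenvalues. *)
Let L := N%:R `^ (a / 200) : R.
Hypothesis Hp : forall i j,
  (\int[P]_w ((Num.sqrt N%:R * cabs (H w i j)) ^+ p.+2)%:E <= C%:E)%E.
Hypotheses (pD : (D + 40) * 200 <= p%:R * a) (L1000 : 1000 <= L) (TL : 1 + 2 * T ^+ 2 <= L)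
  (NC : 3 * C <= N%:R) (Np : p`!%:R <= N%:R :> R)
  (NK : C + 401 ^+ 2 * 160 * expR 2 * p`!%:R < N%:R).

Let n1 : 1 <= N%:R :> R. Proof. by rewrite ler1n. Qed.
Let L1 : 2 <= L. Proof. by have := L1000; lra. Qed.
Let L0 : 0 < L. Proof. by have := L1000; lra. Qed.
Let LX k y : a / 200 * k%:R = y -> L ^+ k = N%:R `^ y.
Proof. by move=> e; apply: powR_exprn. Qed.

Let Lp : N%:R `^ D * N%:R ^+ 40 <= L ^+ p.
Proof.
rewrite (LX erefl) -(powR_mulrn 40 (le_trans ler01 n1)) -powRD; last first.
  by rewrite pnatr_eq0 implybT.
by apply: ler_powR => //; have := pD; lra.
Qed.

Let x1 : 1 <= N%:R `^ D :> R.
Proof. by rewrite -[leLHS](powRr0 (N%:R : R)); exact: (ler_powR n1 (ltW D0)). Qed.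

Let NL : N%:R <= expR L.
Proof.
have h := le_trans Lp (exp_pow_le p (ltW L0)).
have f0 : 0 < p`!%:R :> R by rewrite ltr0n fact_gt0.
rewrite -(ler_pM2l f0); apply: le_trans h.
have h2 : N%:R ^+ 40 <= N%:R `^ D * N%:R ^+ 40 by rewrite ler_peMl// exprn_ge0.
apply: le_trans h2; apply: le_trans (ler_wpM2r (ler0n _ _) Np) _.
by rewrite -expr2; apply: ler_weXn2l.
Qed.

Let good w := local_law (H w) v (256 * L ^+ 6) /\ bounded_entries H L w.

Lemma outlier_of_good w t : good w -> 1 + N%:R `^ (- (1 / 3) + eps) < t < T ->
  outlier_config (Gt (H w) v t) ('i%C * (tstar t)%:C%C)
    (N%:R `^ (eps / 4) / Num.sqrt (N%:R * tstar t)) (N%:R `^ eps / (N%:R * tstar t ^+ 2)).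
Proof.
move=> [ll bw] /andP[tl tT].
have Ah : ctr (H w) = H w by apply/matrixP => i j; rewrite ctrE [RHS](HW.1 w j i).
have hv : hs2 v = 1 by rewrite -v1 /hs2; apply: eq_bigr => i _; rewrite big_ord1.
have NR : 0 < N%:R :> R by rewrite ltr0n.
have pw0 x : 0 < N%:R `^ x :> R by exact: powR_gt0.
have t1 : 1 < t by have := pw0 (- (1 / 3) + eps); move: tl; lra.
have ts : N%:R `^ (- (1 / 3) + a) <= tstar t.
  have h1 : N%:R `^ (- (1 / 3) + a) <= N%:R `^ (- (1 / 3) + eps) :> R.
    by apply: ler_powR => //; rewrite lerD2l.
  have h2 : t - 1 <= tstar t by rewrite /tstar lerD2l lerN2 invf_le1 ?ltW// (lt_trans ltr01).
  by move: tl h1 h2; lra.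
have s0 : 0 < tstar t by apply: lt_le_trans ts.
have hA : hs2 (H w) <= N%:R * L ^+ 2.
  apply: (@le_trans _ _ (\sum_(i < N) \sum_(j < N) (L ^+ 2 / N%:R))).
    by apply: ler_sum => i _; apply: ler_sum => j _; exact: bw.
  rewrite !sumr_const !card_ord -[X in X *+ _]mulr_natr -[leLHS]mulr_natr.
  by rewrite mulfVK ?gt_eqF// mulrC.
have L60 : L ^+ 60 <= N%:R.
  rewrite (LX erefl) -{2}(powRr1 (ltW NR)); apply: ler_powR => //.
  by have := a10; lra.
have L600 : L ^+ 600 <= N%:R * tstar t ^+ 3.
  apply: (@le_trans _ _ (N%:R * (N%:R `^ (- (1 / 3) + a)) ^+ 3)); last first.
    by rewrite ler_wpM2l ?(ltW NR)// lerXn2r ?nnegrE ?(ltW (pw0 _)) ?(ltW s0).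
  rewrite (powR_exprn (y := -1 + 3 * a)) ?(ltW NR)//; last by lra.
  have -> : N%:R * N%:R `^ (-1 + 3 * a) = N%:R `^ (3 * a) :> R.
    rewrite -[X in X * _](powRr1 (ltW NR)) -powRD ?pnatr_eq0 ?implybT//.
    by congr (_ `^ _); ring.
  rewrite (@LX 600 (3 * a)) ?lexx//.
  by lra.
have := outlier_config_of_scale (isT : (0 < N)%N) Ah hv ll hA t1 tT L1000 TL L60 L600 NL.
apply: outlier_config_le.
  rewrite ler_wpM2r ?invr_ge0 ?sqrtr_ge0// (@LX 50 (a / 4)); last by lra.
  by apply: ler_powR => //; have := ae; lra.
have i0 : 0 <= (N%:R * tstar t ^+ 2)^-1.
  by rewrite invr_ge0; exact: mulr_ge0 (ltW NR) (sqr_ge0 _).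
apply: ler_wpM2r => //; rewrite (@LX 200 a); last by lra.
exact: ler_powR.
Qed.

Lemma high_probability_fixed : exists E : set Om, measurable E /\
  E `<=` [set w : Om | forall t : R, 1 + N%:R `^ (- (1 / 3) + eps) < t < T ->
      outlier_config (Gt (H w) v t) ('i%C * (tstar t)%:C%C)
        (N%:R `^ (eps / 4) / Num.sqrt (N%:R * tstar t))
        (N%:R `^ eps / (N%:R * tstar t ^+ 2))] /\
  (P (~` E) < (N%:R `^ (- D))%:E)%E.
Proof.
have [CL fb] := failure_bound n1 L0 x1 C0 Lp NC NK.
have CL' : (N * N)%:R * (3 * (C / L ^+ p) / N%:R^-1) <= 1 by rewrite natrM.
have L1' : 1 <= L by have := L1; lra.
have r1 := rare_unbounded_entries HW L1' Hp.
have r2 := rare_not_local_law HW L1 Hp CL' NL v1.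
have [B [mB AB PB]] := rareU r1 r2.
exists (~` B); split; first exact: measurableC.
split.
  move=> w nB t; apply: outlier_of_good; split.
    apply: contrapT => nl; apply: nB; apply: AB.
    case: (pselect (bounded_entries H L w)) => bw; last by left.
    by right.
  by apply: contrapT => nb; apply: nB; apply: AB; left.
rewrite setCK; apply: le_lt_trans PB _; rewrite lte_fin powRN.
have e160 : 0 <= 160 * (N%:R * N%:R * N%:R) * expR (2 - L).
  have n0' : 0 <= N%:R :> R by exact: ler0n.
  by have := mulr_ge0 (mulr_ge0 (mulr_ge0 n0' n0') n0') (expR_ge0 (2 - L)); lra.
have n12 := exprn_ege1 12 n1.
have hY : (((2 * (200 * N ^ 12)).+1 ^ 2)%:R : R) <= (401 * N%:R ^+ 12) ^+ 2.
  rewrite natrX -natr1 natrM natrM natrX.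
  have h : 2 * (200 * N%:R ^+ 12) + 1 <= 401 * N%:R ^+ 12 :> R by lra.
  have h0 : 0 <= 2 * (200 * N%:R ^+ 12) + 1 :> R by lra.
  by rewrite !expr2; exact: (ler_pM h0 h0 h h).
have e3 : (N * N * N)%:R = N%:R * N%:R * N%:R :> R by rewrite !natrM.
apply: le_lt_trans fb; rewrite e3 [(N * N)%:R]natrM lerD2l.
exact: (ler_wpM2r e160 hY).
Qed.
End FixedSize.

Theorem theorem2p4 (R : realType) (d : nat -> measure_display)
  (Om : forall N, measurableType (d N)) (P : forall N, probability (Om N) R)
  (H : forall N, Om N -> 'M[R[i]]_N) (v : forall N, 'cV[R[i]]_N) (T : R) :
  wigner_seq P H ->
  (forall N, (0 < N)%N -> unit_vec (v N)) ->
  2 <= T ->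
  forall eps : R, 0 < eps ->
  with_high_probability P (fun N => [set w : Om N |
    forall t : R, 1 + N%:R `^ (- (1 / 3) + eps) < t < T ->
      outlier_config (Gt (H N w) (v N) t)
        ('i%C * (tstar t)%:C%C)
        (N%:R `^ (eps / 4) / Num.sqrt (N%:R * tstar t))
        (N%:R `^ eps / (N%:R * tstar t ^+ 2))]).
Proof.
move=> [HW [C0 Hp]] v1 T2 eps eps0 D D0.
pose a := Num.min eps (1 / 10).
have a0 : 0 < a by rewrite lt_min eps0; lra.
have ae : a <= eps by rewrite ge_min lexx.
have a10 : a <= 1 / 10 by rewrite ge_min lexx orbT.
(* Enough moments for $L^p\ge N^{D+40}$. *)
pose p := (Num.truncn ((D + 40) * 200 / a)).+1.
have pD : (D + 40) * 200 <= p%:R * a.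
  by rewrite -ler_pdivrMr//; apply: ltW; exact: truncnS_gt.
pose C := `|C0 p.+2|.
have CC : 0 <= C by exact: normr_ge0.
pose B := 1000 + (1 + 2 * T ^+ 2).
have T20 := sqr_ge0 T.
have B0 : 0 <= B by rewrite /B; lra.
pose K := 3 * C + p`!%:R + (C + 401 ^+ 2 * 160 * expR 2 * p`!%:R) + B `^ (200 / a).
(* The threshold is positive, which disposes of $N=0$; the last summand of [K] makes [L] exceed
   [B]. *)
exists (Num.truncn K).+1 => -[//|n0] Nn.
have KN : K < n0.+1%:R by apply: lt_le_trans (truncnS_gt K) _; rewrite ler_nat.
have f0 : 0 <= p`!%:R :> R by exact: ler0n.
have e0 : 0 <= expR 2 * p`!%:R :> R by rewrite mulr_ge0 ?expR_ge0.
have b0 : 0 <= B `^ (200 / a) by exact: powR_ge0.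
have BL : B <= n0.+1%:R `^ (a / 200).
  have -> : B = (B `^ (200 / a)) `^ (a / 200).
    by rewrite -powRrM -[LHS]powRr1//; congr (_ `^ _); field; rewrite gt_eqF.
  apply: ge0_ler_powR; rewrite ?nnegrE ?ler0n//; first by rewrite divr_ge0// ltW.
  by move: KN; rewrite /K; lra.
apply: (@high_probability_fixed _ _ _ (P n0.+1) n0 (H n0.+1) (v n0.+1) p C T eps a D) => //.
- exact: v1.
- move=> i j; apply: le_trans (Hp p.+2 n0.+1 i j) _; rewrite lee_fin; exact: ler_norm.
- by move: BL; rewrite /B; lra.
- by move: BL; rewrite /B; lra.
- by move: KN; rewrite /K; lra.
- by move: KN; rewrite /K; lra.
- by move: KN; rewrite /K; lra.
Qed.
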